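(* Let $(G,E)$ be a connected simple graph with countably infinite vertex set $G$ and bounded degree, let $(T,\pi,\phi)$ be a bi-infinite tree with a reference point, and let $K$ be a minimal partition of $(G,E)$ parametrized by $(T,\pi,\phi)$. Let $d$ be a metric on $G$ with $\mathrm{diam}(G,d)=\infty$ which fits to $(G,E)$ and satisfies the basic framework with respect to $K$, with constant $r\in(0,1)$; let $T_r$ be the associated refined tree and let all energies and dimensions below be computed on $T_r$. Then there is an integer $M_0\ge 0$ (depending only on $d$ and $K$) such that for all integers $N\ge1$, $N_1\ge0$ and $N_2\ge N_1+M_0$, and all $p>0$: (1) $\underline{I}_{\mathcal{E}}(N_1,N_2,N)=\overline{I}_{\mathcal{E}}(N_1,N_2,N)=\dim_{\mathrm{AR}}(G,d)$; (2) if $\underline{R}_p(N_1,N_2,N)<1$, then $\dim_{\mathrm{AR}}(G,d)\le \underline{d}^S_p(N_1,N_2,N)\le \overline{d}^S_p(N_1,N_2,N)<p$; (3) if $\overline{R}_p(N_1,N_2,N)\ge 1$, then $\dim_{\mathrm{AR}}(G,d)\ge \overline{d}^S_p(N_1,N_2,N)\ge \underline{d}^S_p(N_1,N_2,N)\ge p$.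
   Context: Quasisymmetry: for metrics $d,\rho$ on a set $X$ and a homeomorphism $\theta:[0,\infty)\to[0,\infty)$, $d$ is $\theta$-quasisymmetric to $\rho$ if $\rho(x,y)/\rho(x,z)\le\theta(d(x,y)/d(x,z))$ for all $x,y,z$ with $x\ne z$; $d\sim_{QS}\rho$ if this holds for some $\theta$. A Borel measure $\mu$ is $\alpha$-Ahlfors regular w.r.t. $(X,d)$ if there is $C>0$ with $C^{-1}r^\alpha\le\mu(B_d(x,r))\le Cr^\alpha$ for all $x\in X$ and $r_x\le r\le\mathrm{diam}(X,d)$, where $r_x=\inf_{y\ne x}d(x,y)$ and $B_d(x,r)$ is the open ball; $(X,d)$ is $\alpha$-Ahlfors regular if such $\mu$ exists. $\dim_{\mathrm{AR}}(X,d)=\inf\{\alpha:$ there is a metric $\rho$ on $X$, $\alpha$-Ahlfors regular, with $d\sim_{QS}\rho\}$ ($\inf\emptyset=\infty$). Fitting: $d$ fits to $(G,E)$ if (F1) there is $C>0$ with $d(x,y)\le Cd(x,z)$ whenever $x\sim y$ and $x\ne z$; (F2) for every $\epsilon>0$ there exist $r>0$, $n\ge1$ and $x_0,\dots,x_n\in G$ with $x_i\in B_d(x_0,r)$ for $i<n$, $x_n\notin B_d(x_0,r)$, and $x_i\sim x_{i-1}$, $d(x_i,x_{i-1})\le\epsilon r$ for $1\le i\le n$. Bi-infinite tree: $T$ countable, $\pi:T\to T$ with (T1) for all $w,v$ there are $n,m\ge0$ with $\pi^n(w)=\pi^m(v)$; (T2) $\pi^n(w)\ne w$ for all $n\ge1$.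 With reference point $\phi\in T$, the height is $[w]=n-m$ where $\pi^n(w)=\pi^m(\phi)$ (well defined); $(T)_n=\{w:[w]=n\}$; $S(w)=\pi^{-1}(w)$, $S^k(A)=\{v:\pi^k(v)\in A\}$; $T_w=\{v:\pi^n(v)=w$ for some $n\ge0\}$; $\Sigma^*$ is the set of $(\omega_n)_{n\in\mathbb{Z}}$ with $\omega_n\in(T)_n$, $\pi(\omega_{n+1})=\omega_n$. Partition of $(G,E)$: a map $w\mapsto K_w$ from $T$ to finite subsets of $G$ with (PG1) $\bigcup_{v\in S(w)}K_v=K_w$; (PG2) for every $\omega\in\Sigma^*$ there are $n_0$ and an edge $x\sim y$ with $K_{\omega_n}=\{x,y\}$ for all $n\ge n_0$; (PG3) for every edge $(x,y)$ some $w$ has $K_w=\{x,y\}$. Put $\Lambda_e=\{w:\#K_w=2,\ \#K_{\pi(w)}>2\}$, $T_e=\{w:\#K_{\pi(w)}>2\}$. $K$ is minimal if $K_w\ne K_v$ for distinct $w,v\in\Lambda_e$. Scales: $g_d(w)=\max_{x,y\in K_w}d(x,y)$ for $w\in T_e$. For $s>0$: $\Lambda_s=\{w\in T_e: g_d(w)\le s<g_d(\pi(w))\}$; $E_s$ = pairs of distinct $w,v\in\Lambda_s$ with $K_w\cap K_v\ne\emptyset$; $\Lambda_{s,M}(w)=\{v\in\Lambda_s: l_{E_s}(w,v)\le M\}$ ($l$ = graph distance); $\Lambda_{s,M}(x)=\bigcup_{w\in\Lambda_s,x\in K_w}\Lambda_{s,M}(w)$; $U_M(x,s)=\{x\}$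 if $\Lambda_{s,M}(x)=\emptyset$, else $\bigcup_{w\in\Lambda_{s,M}(x)}K_w$. $d$ is uniformly finite if $\sup\{\#\Lambda_{s,1}(w):s>0,w\in\Lambda_s\}<\infty$; thick if there is $\alpha>0$ such that every $w\in T_e$ has $x\in K_w$ with $\Lambda_{\alpha g_d(\pi(w)),1}(x)\subseteq T_w$; $M$-adapted if there are $\alpha_1,\alpha_2>0$ with $B_d(x,\alpha_1 s)\subseteq U_M(x,s)\subseteq B_d(x,\alpha_2 s)$ for all $x\in G$, $s>0$; adapted if $M$-adapted for some $M$. $d$ satisfies the basic framework w.r.t. minimal $K$ if $\sup_{w\in T_e\setminus\Lambda_e}\#S(w)<\infty$, $d$ is uniformly finite, thick and adapted, and there are $r\in(0,1)$, $C\ge1$ with $C^{-1}r^{[w]}\le g_d(w)\le Cr^{[w]}$ for all $w\in T_e$. Refined tree $T_r$: for $w\in\Lambda_e$ write $K_w=\{w^+,w^-\}$; for $m\ge1$ let $n(m)\in\mathbb{N}$ with $2^{-n(m)}\le r^m<2^{1-n(m)}$. $T_r=T_e\sqcup\{u_{w,m,k}: w\in\Lambda_e, m\ge1, 0\le k\le 2^{n(m)}-1\}$ with $\pi_r=\pi$ on $T_e$, $\pi_r(u_{w,1,k})=w$, and $\pi_r(u_{w,m,k})=u_{w,m-1,l}$ where $[k2^{-n(m)},(k+1)2^{-n(m)}]\subseteq[l2^{-n(m-1)},(l+1)2^{-n(m-1)}]$; $[u_{w,m,k}]=[w]+m$ and heights on $T_e$ are unchanged. Cable system $\mathfrak{C}_G$: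 a copy of $[0,1]$ for each edge, parametrized from one endpoint to the other, with endpoints identified with the vertices. For $v\in T_e$, $\mathcal{K}_v$ is the union of the cables of the edges $K_u$, $u\in\Lambda_e\cap T_v$; $\mathcal{K}_{u_{w,m,k}}$ is the set of points of the cable of $\{w^+,w^-\}$ at parameter $t\in[k2^{-n(m)},(k+1)2^{-n(m)}]$ measured from $w^+$. $J^h_m=\{(u,v):u,v\in(T_r)_m,\ u\ne v,\ \mathcal{K}_u\cap\mathcal{K}_v\ne\emptyset\}$. Energies (on $T=T_r$): $J^h_{N,m}=\{(w,v)\in(T)_m^2: 0<l_{J^h_m}(w,v)\le N\}$; $\Gamma_n(w)=\{v\in(T)_{[w]}: l_{J^h_{[w]}}(w,v)\le n\}$. $\mathcal{E}_{p,k,w}(N_1,N_2,N)=\inf\{\frac12\sum_{(x,y)\in J^h_{N,[w]+k}}|f(x)-f(y)|^p : f:(T)_{[w]+k}\to\mathbb{R},\ f=1$ on $S^k(\Gamma_{N_1}(w))$, $f=0$ off $S^k(\Gamma_{N_2}(w))\}$; $\mathcal{E}_{p,k}=\sup_{w\in T}\mathcal{E}_{p,k,w}$; $\overline{\mathcal{E}}_p=\limsup_k\mathcal{E}_{p,k}$, $\underline{\mathcal{E}}_p=\liminf_k\mathcal{E}_{p,k}$; $\overline{I}_{\mathcal{E}}=\inf\{p:\overline{\mathcal{E}}_p=0\}$, $\underline{I}_{\mathcal{E}}=\inf\{p:\underline{\mathcal{E}}_p=0\}$. $\overline{N}_*=\limsup_k\sup_{w}\#(S^k(w))^{1/k}$;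 $\overline{R}_p=\limsup_k\mathcal{E}_{p,k}^{1/k}$, $\underline{R}_p=\liminf_k\mathcal{E}_{p,k}^{1/k}$; $\overline{d}^S_p=p\log\overline{N}_*/(\log\overline{N}_*-\log\overline{R}_p)$, $\underline{d}^S_p=p\log\overline{N}_*/(\log\overline{N}_*-\log\underline{R}_p)$ (all with arguments $(N_1,N_2,N)$). *)

(* Defs.v *)
From Stdlib Require Import Reals Lra Lia ZArith List Classical ClassicalEpsilon Relations.
From Coquelicot Require Import Rcomplements Rbar Lub.
Open Scope R_scope.

Definition rb_sup (S : Rbar -> Prop) : Rbar :=
  if excluded_middle_informative (S p_infty) then p_infty
  else Lub_Rbar (fun x : R => S (Finite x)).

(* inf of a set of extended reals (inf of the empty set is +oo) *)
Definition rb_inf (S : Rbar -> Prop) : Rbar :=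
  if excluded_middle_informative (S m_infty) then m_infty
  else Glb_Rbar (fun x : R => S (Finite x)).

Definition rb_limsup (a : nat -> Rbar) : Rbar :=
  rb_inf (fun y => exists n : nat,
            y = rb_sup (fun z => exists k : nat, (n <= k)%nat /\ z = a k)).
Definition rb_liminf (a : nat -> Rbar) : Rbar :=
  rb_sup (fun y => exists n : nat,
            y = rb_inf (fun z => exists k : nat, (n <= k)%nat /\ z = a k)).

Definition nnsum {A : Type} (P : A -> Prop) (a : A -> R) : Rbar :=
  rb_sup (fun z => exists l : list A, NoDup l /\ (forall x, In x l -> P x) /\
                    z = Finite (fold_right Rplus 0 (map a l))).

Definition card {A : Type} (P : A -> Prop) : Rbar :=
  rb_sup (fun z => exists l : list A, NoDup l /\ (forall x, In x l -> P x) /\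
                    z = Finite (INR (length l))).

Definition card_le {A : Type} (P : A -> Prop) (n : nat) : Prop :=
  forall l : list A, NoDup l -> (forall x, In x l -> P x) -> (length l <= n)%nat.

Definition rpow (a q : R) : R := if Rle_dec a 0 then 0 else Rpower a q.

Definition rb_root (k : nat) (x : Rbar) : Rbar :=
  match x with
  | Finite y => Finite (rpow y (/ INR k))
  | p_infty => p_infty
  | m_infty => Finite 0
  end.

Fixpoint within {A : Type} (Rel : A -> A -> Prop) (n : nat) (w v : A) : Prop :=
  match n with
  | O => w = v
  | S n' => within Rel n' w v \/ exists u, within Rel n' w u /\ Rel u v
  end.

Definition two_elts {A : Type} (P : A -> Prop) : Prop :=
  exists x y, x <> y /\ forall z, P z <-> z = x \/ z = y.
Definition more_than_two {A : Type} (P : A -> Prop) : Prop :=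
  exists x y z, P x /\ P y /\ P z /\ x <> y /\ y <> z /\ x <> z.
Definition same_set {A : Type} (P Q : A -> Prop) : Prop := forall z, P z <-> Q z.

Definition countably_infinite (X : Type) : Prop :=
  exists f : nat -> X, (forall i j, f i = f j -> i = j) /\ (forall x, exists i, f i = x).
Definition countable (X : Type) : Prop :=
  exists f : nat -> X, forall x, exists i, f i = x.

Definition simple_graph {G : Type} (E : G -> G -> Prop) : Prop :=
  (forall x y, E x y -> E y x) /\ (forall x, ~ E x x).
Definition connected {G : Type} (E : G -> G -> Prop) : Prop :=
  forall x y, clos_refl_trans G E x y.
Definition bounded_degree {G : Type} (E : G -> G -> Prop) : Prop :=
  exists D : nat, forall x, card_le (E x) D.

Definition is_metric {X : Type} (d : X -> X -> R) : Prop :=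
  (forall x y, 0 <= d x y) /\ (forall x y, d x y = 0 <-> x = y) /\
  (forall x y, d x y = d y x) /\ (forall x y z, d x z <= d x y + d y z).

Definition ball {X : Type} (d : X -> X -> R) (x : X) (s : R) (y : X) : Prop := d x y < s.

Definition diam {X : Type} (d : X -> X -> R) : Rbar :=
  rb_sup (fun z => exists x y, z = Finite (d x y)).

Definition rx {X : Type} (d : X -> X -> R) (x : X) : Rbar :=
  rb_inf (fun z => exists y, y <> x /\ z = Finite (d x y)).

Definition homeo_halfline (th : R -> R) : Prop :=
  exists thi : R -> R,
    (forall t, 0 <= t -> 0 <= th t) /\ (forall t, 0 <= t -> 0 <= thi t) /\
    (forall t, 0 <= t -> thi (th t) = t) /\ (forall t, 0 <= t -> th (thi t) = t) /\
    (forall t, 0 <= t -> continue_in th (fun u => 0 <= u) t) /\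
    (forall t, 0 <= t -> continue_in thi (fun u => 0 <= u) t).

Definition theta_QS {X : Type} (th : R -> R) (d rho : X -> X -> R) : Prop :=
  forall x y z, x <> z -> rho x y / rho x z <= th (d x y / d x z).
Definition QS {X : Type} (d rho : X -> X -> R) : Prop :=
  exists th, homeo_halfline th /\ theta_QS th d rho.

(* alpha-Ahlfors regular measure.  On a countable metric space every subset is
   Borel (countable union of closed singletons), so a Borel measure is given
   by its point masses mu({x}) via countable additivity; the measure of a ball
   is the (unordered) sum of the masses of its points.  Point masses +oo are
   impossible for a measure satisfying the upper bound, so we take mu : X -> R>=0. *)
Definition AR_measure {X : Type} (rho : X -> X -> R) (alpha : R) (mu : X -> R) : Prop :=
  (forall x, 0 <= mu x) /\
  exists C, 0 < C /\
    forall x s, 0 < s -> Rbar_le (rx rho x) (Finite s) -> Rbar_le (Finite s) (diam rho) ->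
      Rbar_le (Finite (/ C * Rpower s alpha)) (nnsum (ball rho x s) mu) /\
      Rbar_le (nnsum (ball rho x s) mu) (Finite (C * Rpower s alpha)).
Definition Ahlfors_regular {X : Type} (rho : X -> X -> R) (alpha : R) : Prop :=
  exists mu, AR_measure rho alpha mu.

Definition dimAR {X : Type} (d : X -> X -> R) : Rbar :=
  Glb_Rbar (fun alpha => exists rho : X -> X -> R,
     is_metric rho /\ Ahlfors_regular rho alpha /\ QS d rho).

Definition fits {G : Type} (d : G -> G -> R) (E : G -> G -> Prop) : Prop :=
  (exists C, 0 < C /\ forall x y z, E x y -> x <> z -> d x y <= C * d x z) /\
  (forall eps, 0 < eps -> exists s, 0 < s /\ exists (n : nat) (xs : nat -> G),
      (1 <= n)%nat /\
      (forall i, (i < n)%nat -> ball d (xs O) s (xs i)) /\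
      ~ ball d (xs O) s (xs n) /\
      (forall i, (1 <= i <= n)%nat -> E (xs i) (xs (i - 1)%nat) /\
                                      d (xs i) (xs (i - 1)%nat) <= eps * s)).

Section Tree.
Context {T : Type} (pi : T -> T) (phi : T).

Definition bi_infinite_tree : Prop :=
  (forall w v, exists n m : nat, Nat.iter n pi w = Nat.iter m pi v) /\
  (forall w (n : nat), (1 <= n)%nat -> Nat.iter n pi w <> w).

Definition height (w : T) : Z :=
  epsilon (inhabits 0%Z) (fun h => exists n m : nat,
     Nat.iter n pi w = Nat.iter m pi phi /\ h = (Z.of_nat n - Z.of_nat m)%Z).

Definition in_subtree (w v : T) : Prop := exists n : nat, Nat.iter n pi v = w.

Definition in_Sigma_star (om : Z -> T) : Prop :=
  forall n : Z, height (om n) = n /\ pi (om (n + 1)%Z) = om n.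
End Tree.

Section Partition.
Context {G T : Type} (E : G -> G -> Prop) (pi : T -> T) (phi : T) (K : T -> G -> Prop).

Definition is_partition : Prop :=
  (forall w, exists l : list G, forall x, K w x <-> In x l) /\
  (forall w x, K w x <-> exists v, pi v = w /\ K v x) /\
  (forall om, in_Sigma_star pi phi om ->
     exists (n0 : Z) (x y : G), E x y /\
       forall n, (n0 <= n)%Z -> forall z, K (om n) z <-> z = x \/ z = y) /\
  (forall x y, E x y -> exists w, forall z, K w z <-> z = x \/ z = y).

Definition Lambda_e (w : T) : Prop := two_elts (K w) /\ more_than_two (K (pi w)).
Definition T_e (w : T) : Prop := more_than_two (K (pi w)).

Definition minimal : Prop :=
  forall w v, Lambda_e w -> Lambda_e v -> w <> v -> ~ same_set (K w) (K v).
End Partition.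

Section Framework.
Context {G T : Type} (pi : T -> T) (phi : T) (K : T -> G -> Prop) (d : G -> G -> R).

Definition gd (w : T) : R :=
  epsilon (inhabits 0) (fun s => (exists x y, K w x /\ K w y /\ d x y = s) /\
                                 forall x y, K w x -> K w y -> d x y <= s).

Definition Lambda_s (s : R) (w : T) : Prop :=
  T_e pi K w /\ gd w <= s /\ s < gd (pi w).

Definition E_s (s : R) (w v : T) : Prop :=
  Lambda_s s w /\ Lambda_s s v /\ w <> v /\ exists x, K w x /\ K v x.

Definition Lambda_sM (s : R) (M : nat) (w v : T) : Prop :=
  Lambda_s s v /\ within (E_s s) M w v.

Definition Lambda_sM_pt (s : R) (M : nat) (x : G) (v : T) : Prop :=
  exists w, Lambda_s s w /\ K w x /\ Lambda_sM s M w v.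

Definition U_M (M : nat) (x : G) (s : R) (y : G) : Prop :=
  ((~ exists v, Lambda_sM_pt s M x v) /\ y = x) \/
  (exists v, Lambda_sM_pt s M x v /\ K v y).

Definition uniformly_finite : Prop :=
  exists C : nat, forall s w, 0 < s -> Lambda_s s w -> card_le (Lambda_sM s 1 w) C.

Definition thick : Prop :=
  exists alpha, 0 < alpha /\ forall w, T_e pi K w ->
    exists x, K w x /\ forall v, Lambda_sM_pt (alpha * gd (pi w)) 1 x v -> in_subtree pi w v.

Definition M_adapted (M : nat) : Prop :=
  exists a1 a2, 0 < a1 /\ 0 < a2 /\ forall x s, 0 < s ->
    (forall y, ball d x (a1 * s) y -> U_M M x s y) /\
    (forall y, U_M M x s y -> ball d x (a2 * s) y).
Definition adapted : Prop := exists M, M_adapted M.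

Definition basic_framework (r : R) : Prop :=
  (exists B : nat, forall w, T_e pi K w -> ~ Lambda_e pi K w ->
      card_le (fun v => pi v = w) B) /\
  uniformly_finite /\ thick /\ adapted /\
  0 < r < 1 /\
  exists C, 1 <= C /\ forall w, T_e pi K w ->
     / C * powerRZ r (height pi phi w) <= gd w <= C * powerRZ r (height pi phi w).
End Framework.

Definition nexp (r : R) (m : nat) : nat :=
  epsilon (inhabits O) (fun n => / 2 ^ n <= r ^ m < 2 * / 2 ^ n).

(* the index l of the parent dyadic interval *)
Definition lpar (r : R) (m k : nat) : nat :=
  epsilon (inhabits O) (fun l =>
     INR l * / 2 ^ (nexp r (m - 1)) <= INR k * / 2 ^ (nexp r m) /\
     (INR k + 1) * / 2 ^ (nexp r m) <= (INR l + 1) * / 2 ^ (nexp r (m - 1))).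

Inductive RNode (T : Type) : Type :=
| RBase : T -> RNode T
| RSub : T -> nat -> nat -> RNode T.
Arguments RBase {T} _.
Arguments RSub {T} _ _ _.

(* points of the cable system: vertices, and interior points CE x y t of the
   cable of an edge {x,y} at parameter t in (0,1) measured from x;
   CE x y t and CE y x (1-t) denote the same point, and all the sets below
   are closed under this identification. *)
Inductive CPt (G : Type) : Type :=
| CV : G -> CPt G
| CE : G -> G -> R -> CPt G.
Arguments CV {G} _.
Arguments CE {G} _ _ _.

Definition seg {G : Type} (a b : G) (s1 s2 : R) (p : CPt G) : Prop :=
  match p with
  | CV x => (x = a /\ s1 = 0) \/ (x = b /\ s2 = 1)
  | CE x y t => 0 < t < 1 /\
      ((x = a /\ y = b /\ s1 <= t <= s2) \/ (x = b /\ y = a /\ s1 <= 1 - t <= s2))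
  end.

Section Refined.
Context {G T : Type} (pi : T -> T) (phi : T) (K : T -> G -> Prop) (r : R) (wp : T -> G).

Definition wm (w : T) : G := epsilon (inhabits (wp w)) (fun y => K w y /\ y <> wp w).

Definition rvalid (u : RNode T) : Prop :=
  match u with
  | RBase w => T_e pi K w
  | RSub w m k => Lambda_e pi K w /\ (1 <= m)%nat /\ (k < 2 ^ nexp r m)%nat
  end.

Definition rheight (u : RNode T) : Z :=
  match u with
  | RBase w => height pi phi w
  | RSub w m k => (height pi phi w + Z.of_nat m)%Z
  end.

Definition rpi (u : RNode T) : RNode T :=
  match u with
  | RBase w => RBase (pi w)
  | RSub w m k => if Nat.leb m 1 then RBase w else RSub w (m - 1) (lpar r m k)
  end.

Definition Kc (u : RNode T) (p : CPt G) : Prop :=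
  match u with
  | RBase v => exists u', Lambda_e pi K u' /\ in_subtree pi v u' /\ seg (wp u') (wm u') 0 1 p
  | RSub w m k => seg (wp w) (wm w) (INR k * / 2 ^ nexp r m) ((INR k + 1) * / 2 ^ nexp r m) p
  end.

Definition level (m : Z) (u : RNode T) : Prop := rvalid u /\ rheight u = m.

Definition Jh (m : Z) (u v : RNode T) : Prop :=
  level m u /\ level m v /\ u <> v /\ exists p, Kc u p /\ Kc v p.

Definition JhN (N : nat) (m : Z) (uv : RNode T * RNode T) : Prop :=
  level m (fst uv) /\ level m (snd uv) /\ fst uv <> snd uv /\
  within (Jh m) N (fst uv) (snd uv).

Definition Gam (n : nat) (w v : RNode T) : Prop :=
  level (rheight w) v /\ within (Jh (rheight w)) n w v.

Definition Sk (k : nat) (A : RNode T -> Prop) (v : RNode T) : Prop :=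
  rvalid v /\ A (Nat.iter k rpi v).

Definition Epkw (p : R) (k : nat) (w : RNode T) (N1 N2 N : nat) : Rbar :=
  let m := (rheight w + Z.of_nat k)%Z in
  rb_inf (fun z => exists f : RNode T -> R,
     (forall x, level m x -> Sk k (Gam N1 w) x -> f x = 1) /\
     (forall x, level m x -> ~ Sk k (Gam N2 w) x -> f x = 0) /\
     z = Rbar_mult (Finite (/ 2))
           (nnsum (JhN N m) (fun xy => rpow (Rabs (f (fst xy) - f (snd xy))) p))).

Definition Epk (p : R) (k : nat) (N1 N2 N : nat) : Rbar :=
  rb_sup (fun z => exists w, rvalid w /\ z = Epkw p k w N1 N2 N).

Definition Ebar (p : R) (N1 N2 N : nat) : Rbar := rb_limsup (fun k => Epk p k N1 N2 N).
Definition Eund (p : R) (N1 N2 N : nat) : Rbar := rb_liminf (fun k => Epk p k N1 N2 N).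

Definition Ibar (N1 N2 N : nat) : Rbar :=
  Glb_Rbar (fun p => 0 < p /\ Ebar p N1 N2 N = Finite 0).
Definition Iund (N1 N2 N : nat) : Rbar :=
  Glb_Rbar (fun p => 0 < p /\ Eund p N1 N2 N = Finite 0).

Definition Nstar : Rbar :=
  rb_limsup (fun k => rb_sup (fun z => exists w, rvalid w /\
                         z = rb_root k (card (Sk k (fun v => v = w))))).

Definition Rbar_p (p : R) (N1 N2 N : nat) : Rbar :=
  rb_limsup (fun k => rb_root k (Epk p k N1 N2 N)).
Definition Rund_p (p : R) (N1 N2 N : nat) : Rbar :=
  rb_liminf (fun k => rb_root k (Epk p k N1 N2 N)).
End Refined.

(* d^S = p log N / (log N - log R), extended conventions: log 0 = -oo (gives 0);
   a non-positive denominator or R = +oo gives +oo. *)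
Definition dS (p : R) (Ns Rp : Rbar) : Rbar :=
  match Ns, Rp with
  | Finite n, Finite rr =>
      if Rle_dec rr 0 then Finite 0
      else if Rlt_dec 0 (ln n - ln rr) then Finite (p * ln n / (ln n - ln rr))
      else p_infty
  | Finite _, m_infty => Finite 0
  | _, _ => p_infty
  end.

Definition dSbar {G T : Type} (pi : T -> T) (phi : T) (K : T -> G -> Prop) (r : R)
  (wp : T -> G) (p : R) (N1 N2 N : nat) : Rbar :=
  dS p (Nstar pi K r) (Rbar_p pi phi K r wp p N1 N2 N).
Definition dSund {G T : Type} (pi : T -> T) (phi : T) (K : T -> G -> Prop) (r : R)
  (wp : T -> G) (p : R) (N1 N2 N : nat) : Rbar :=
  dS p (Nstar pi K r) (Rund_p pi phi K r wp p N1 N2 N).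

(* Main.v *)
(** Small energies give regular metrics: if the [p]-energies of the cutoffs over [n] generations can be made
    arbitrarily small, group the generations into blocks of length [n] and distribute mass downwards block by block,
    so that the children of a piece share its mass, touching pieces have comparable masses, and the mass of a piece
    dominates the mass of each nearby ancestor times the [p]-th power of the increments of its cutoff. Put
    [sigma = mass^(1/p)]. The largest distance for which every piece [v] has diameter at most [sigma v] is then
    comparable to [sigma] at all scales, because the cutoffs assemble to functions that oscillate by at most [sigma]
    on every piece and still separate distant points; it is a [p]-Ahlfors regular metric quasisymmetric to [d].

    Conversely let [rho] be [alpha]-Ahlfors regular and quasisymmetric to [d]. Condition (F2) forces [alpha >= 1].
    Weigh every piece by its [rho]-diameter: the weights decay geometrically in the generation, and the [alpha]-th
    powers of the weights of the descendants of a piece sum to at most a multiple of the [alpha]-th power of its own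
    weight. Truncating the weighted path distance gives cutoffs whose [p]-energy decays geometrically when [p > alpha].

    Hoelder's inequality between two exponents, together with the growth rate of the tree, turns both statements into
    the comparison with the spectral dimensions. *)

Require Import Defs.
From Stdlib Require FinFun Cantor.
From Stdlib Require Import Reals Lra Lia ZArith List Classical ClassicalEpsilon Relations Arith.
From Coquelicot Require Import Rcomplements Rbar Lub.
Import ListNotations.
Open Scope R_scope.

(** * Sums over lists and chains *)

(** The obstacle in the mass construction is a circle of constants. Smoothing over range [i] makes
    touching masses comparable up to a tail of order [(D/b)^i], which must stay below the floor
    [eps] granted to each child; but a block long enough to absorb range [i] has up to about
    [B^(n1 i)] children per piece, so [eps] is itself that small. Two facts break the circle: a
    chain of [i] pieces seen [n >= i * n1] generations up has length at most [M], whatever [i] is,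
    and [b] is free, so that [b = 2 * D * B^n1] lets the tail win. The tree has no root, so masses
    are built on finite windows of levels, normalised at one piece, and passed to the limit.

    In the converse, a cable splits into [g] pieces of weight [t/g], and
    [g * (t/g)^alpha <= t^alpha] is exactly [alpha >= 1]: this is where (F2) acts on the energies.
    [M0] is [Ma + 4], where [Ma] is the adaptedness constant: close vertices are joined by [Ma + 2]
    touching pieces, and one more step at each end leads along a cable to a vertex. *)

Lemma eq_dec_classic {A : Type} (x y : A) : {x = y} + {x <> y}.
Proof. apply excluded_middle_informative. Qed.

Definition ndup {A : Type} (l : list A) : list A := nodup eq_dec_classic l.

Definition lsum {A : Type} (l : list A) (f : A -> R) : R := fold_right Rplus 0 (map f l).

Lemma lsum_cons {A : Type} (x : A) l f : lsum (x :: l) f = f x + lsum l f.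
Proof. reflexivity. Qed.

Lemma lsum_app {A : Type} (l l' : list A) f : lsum (l ++ l') f = lsum l f + lsum l' f.
Proof. induction l as [|x l IH]; simpl; [unfold lsum; simpl; lra|]. rewrite !lsum_cons, IH. lra. Qed.

Lemma lsum_le {A : Type} (l : list A) f g :
  (forall x, In x l -> f x <= g x) -> lsum l f <= lsum l g.
Proof.
  induction l as [|x l IH]; intros H; [apply Rle_refl|]. rewrite !lsum_cons.
  apply Rplus_le_compat; [apply H; left; reflexivity | apply IH; intros; apply H; right; assumption].
Qed.

Lemma lsum_ext {A : Type} (l : list A) f g :
  (forall x, In x l -> f x = g x) -> lsum l f = lsum l g.
Proof. intros H. apply Rle_antisym; apply lsum_le; intros; rewrite H by assumption; lra. Qed.

Lemma lsum_plus {A : Type} (l : list A) f g :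
  lsum l (fun x => f x + g x) = lsum l f + lsum l g.
Proof. induction l as [|x l IH]; [unfold lsum; simpl; lra|]. rewrite !lsum_cons, IH. lra. Qed.

Lemma lsum_scal {A : Type} (l : list A) c f : lsum l (fun x => c * f x) = c * lsum l f.
Proof. induction l as [|x l IH]; [unfold lsum; simpl; lra|]. rewrite !lsum_cons, IH. lra. Qed.

Lemma lsum_nonneg {A : Type} (l : list A) f :
  (forall x, In x l -> 0 <= f x) -> 0 <= lsum l f.
Proof.
  induction l as [|x l IH]; intros H; [unfold lsum; simpl; lra|]. rewrite lsum_cons.
  apply Rplus_le_le_0_compat; [apply H; left; reflexivity | apply IH; intros; apply H; right; assumption].
Qed.

Lemma lsum_const_le {A : Type} (l : list A) f c :
  (forall x, In x l -> f x <= c) -> lsum l f <= INR (length l) * c.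
Proof.
  induction l as [|x l IH]; intros H; [unfold lsum; simpl; lra|].
  rewrite lsum_cons. change (length (x :: l)) with (S (length l)). rewrite S_INR.
  assert (f x <= c) by (apply H; left; reflexivity).
  assert (lsum l f <= INR (length l) * c) by (apply IH; intros; apply H; right; assumption). lra.
Qed.

Lemma lsum_In_le {A : Type} (l : list A) f x :
  (forall y, In y l -> 0 <= f y) -> In x l -> f x <= lsum l f.
Proof.
  intros H Hx. apply in_split in Hx. destruct Hx as (l1 & l2 & ->).
  rewrite lsum_app, lsum_cons.
  assert (0 <= lsum l1 f) by (apply lsum_nonneg; intros; apply H; apply in_or_app; tauto).
  assert (0 <= lsum l2 f) by (apply lsum_nonneg; intros; apply H; apply in_or_app; simpl; tauto). lra.
Qed.

Lemma lsum_incl {A : Type} (l l' : list A) f :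
  NoDup l -> incl l l' -> (forall y, In y l' -> 0 <= f y) -> lsum l f <= lsum l' f.
Proof.
  revert l'. induction l as [|x l IH]; intros l' Hn Hi Hf; [apply lsum_nonneg; assumption|].
  inversion Hn as [|? ? Hx Hl]; subst.
  assert (Hxl : In x l') by (apply Hi; left; reflexivity).
  apply in_split in Hxl. destruct Hxl as (l1 & l2 & ->).
  rewrite lsum_app, !lsum_cons.
  assert (Hle : lsum l f <= lsum (l1 ++ l2) f).
  { apply IH; [assumption| |intros y Hy; apply Hf; apply in_app_or in Hy; apply in_or_app; simpl; tauto].
    intros y Hy. assert (In y (l1 ++ x :: l2)) as Hy' by (apply Hi; right; assumption).
    apply in_app_or in Hy'. apply in_or_app. destruct Hy' as [|[<-|]]; tauto. }
  rewrite lsum_app in Hle. lra.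
Qed.

Lemma lsum_map {A B : Type} (g : A -> B) (l : list A) f : lsum (map g l) f = lsum l (fun x => f (g x)).
Proof. unfold lsum. rewrite map_map. reflexivity. Qed.

Lemma lsum_flat_map {A B : Type} (g : A -> list B) (l : list A) f :
  lsum (flat_map g l) f = lsum l (fun x => lsum (g x) f).
Proof. induction l as [|x l IH]; [reflexivity|]. simpl. rewrite lsum_app, IH. reflexivity. Qed.

Lemma lsum_swap {A B : Type} (l : list A) (l' : list B) (f : A -> B -> R) :
  lsum l (fun x => lsum l' (f x)) = lsum l' (fun y => lsum l (fun x => f x y)).
Proof.
  induction l as [|x l IH].
  - unfold lsum at 1; simpl. symmetry. induction l'; [reflexivity|]. rewrite lsum_cons, IHl'. unfold lsum; simpl; lra.
  - rewrite lsum_cons, IH, <- lsum_plus. apply lsum_ext. intros; rewrite lsum_cons; reflexivity.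
Qed.

Definition ind (P : Prop) : R := if excluded_middle_informative P then 1 else 0.

Lemma ind_true (P : Prop) : P -> ind P = 1.
Proof. intros H; unfold ind; destruct excluded_middle_informative; tauto. Qed.
Lemma ind_false (P : Prop) : ~ P -> ind P = 0.
Proof. intros H; unfold ind; destruct excluded_middle_informative; tauto. Qed.
Lemma ind_bounds (P : Prop) : 0 <= ind P <= 1.
Proof. unfold ind; destruct excluded_middle_informative; lra. Qed.

Lemma lsum_ind_le {A : Type} (l l' : list A) (P : A -> Prop) :
  NoDup l -> (forall x, In x l -> P x -> In x l') ->
  lsum l (fun x => ind (P x)) <= INR (length l').
Proof.
  revert l'. induction l as [|x l IH]; intros l' Hn Hi.
  - unfold lsum; simpl. apply pos_INR.
  - inversion Hn as [|? ? Hx Hl]; subst. rewrite lsum_cons.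
    destruct (classic (P x)) as [Hp|Hp].
    + rewrite ind_true by assumption.
      assert (Hxl : In x l') by (apply Hi; [left; reflexivity|assumption]).
      apply in_split in Hxl. destruct Hxl as (l1 & l2 & ->).
      assert (lsum l (fun x => ind (P x)) <= INR (length (l1 ++ l2))).
      { apply IH; [assumption|]. intros y Hy HPy.
        assert (In y (l1 ++ x :: l2)) as Hy' by (apply Hi; [right; assumption|assumption]).
        apply in_app_or in Hy'. apply in_or_app. destruct Hy' as [|[<-|]]; tauto. }
      rewrite length_app in *. simpl. replace (length l1 + S (length l2))%nat with (S (length l1 + length l2)) by lia.
      rewrite S_INR. lra.
    + rewrite ind_false by assumption.
      assert (lsum l (fun x => ind (P x)) <= INR (length l')).
      { apply IH; [assumption|]. intros; apply Hi; [right; assumption|assumption]. }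
      lra.
Qed.

(* Each [z] is met by at most [D] of the lists [g y], since [z] in [g y] forces [y] into [gi z]. *)
Lemma lsum_double_count {A B : Type} (Y : list A) (Z : list B) (g : A -> list B) (gi : B -> list A) D F :
  NoDup Y -> (forall y, In y Y -> NoDup (g y)) -> (forall y, In y Y -> incl (g y) Z) ->
  (forall y z, In y Y -> In z (g y) -> In y (gi z)) -> (forall z, In z Z -> (length (gi z) <= D)%nat) ->
  (forall z, In z Z -> 0 <= F z) ->
  lsum Y (fun y => lsum (g y) F) <= INR D * lsum Z F.
Proof.
  intros HY Hg Hi Hs HD HF.
  apply Rle_trans with (lsum Y (fun y => lsum Z (fun z => ind (In z (g y)) * F z))).
  - apply lsum_le; intros y Hy.
    apply Rle_trans with (lsum (g y) (fun z => ind (In z (g y)) * F z)).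
    + right; apply lsum_ext; intros z Hz. rewrite ind_true by assumption; lra.
    + apply lsum_incl; [auto|auto|]. intros z Hz. pose proof (ind_bounds (In z (g y))).
      apply Rmult_le_pos; [lra|auto].
  - rewrite lsum_swap, <- lsum_scal. apply lsum_le. intros z Hz.
    rewrite (lsum_ext _ _ (fun y => F z * ind (In z (g y)))) by (intros; lra).
    rewrite lsum_scal. rewrite (Rmult_comm (INR D)). apply Rmult_le_compat_l; [auto|].
    apply Rle_trans with (INR (length (gi z))).
    + apply lsum_ind_le; [assumption|]. intros; auto.
    + apply le_INR; auto.
Qed.

Lemma NoDup_ndup {A : Type} (l : list A) : NoDup (ndup l).
Proof. apply NoDup_nodup. Qed.
Lemma In_ndup {A : Type} (l : list A) x : In x (ndup l) <-> In x l.
Proof. apply nodup_In. Qed.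

Lemma length_flat_map_le {A B : Type} (g : A -> list B) l D :
  (forall x, In x l -> (length (g x) <= D)%nat) -> (length (flat_map g l) <= length l * D)%nat.
Proof.
  induction l as [|x l IH]; intros H; simpl; [lia|]. rewrite length_app.
  assert (length (g x) <= D)%nat by (apply H; left; reflexivity).
  assert (length (flat_map g l) <= length l * D)%nat by (apply IH; intros; apply H; right; assumption). lia.
Qed.

Lemma list_argmin {A : Type} (l : list A) (f : A -> R) :
  l <> [] -> exists x, In x l /\ forall y, In y l -> f x <= f y.
Proof.
  induction l as [|x l IH]; intros H; [congruence|].
  destruct l as [|y l].
  - exists x. split; [left; reflexivity|]. intros z [<-|[]]; lra.
  - destruct IH as (z & Hz & Hm); [congruence|].
    destruct (Rle_dec (f x) (f z)).
    + exists x; split; [left; reflexivity|]. intros w [<-|Hw]; [lra|]. specialize (Hm w Hw). lra.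
    + exists z; split; [right; assumption|]. intros w [<-|Hw]; [lra|]. apply Hm; assumption.
Qed.

Lemma list_zbound {A : Type} (l : list A) (f : A -> Z) : exists b, forall x, In x l -> (f x <= b)%Z.
Proof.
  induction l as [|x l (b & H)]; [exists 0%Z; intros ? []|].
  exists (Z.max b (f x)). intros y [<-|Hy]; [lia|]. specialize (H y Hy). lia.
Qed.

(** * Chains of bounded length *)

Lemma within_mono {A : Type} (Rel : A -> A -> Prop) n n' a b :
  (n <= n')%nat -> within Rel n a b -> within Rel n' a b.
Proof. induction 1; intros; [assumption|]. left. auto. Qed.

Lemma within_trans {A : Type} (Rel : A -> A -> Prop) n k a b c :
  within Rel n a b -> within Rel k b c -> within Rel (n + k) a c.
Proof.
  intros Hab. revert c. induction k as [|k IH]; simpl; intros c H.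
  - subst. rewrite Nat.add_0_r. assumption.
  - rewrite Nat.add_succ_r. destruct H as [H|(u & H & Hr)]; [left; auto|right; exists u; auto].
Qed.

Lemma within_step {A : Type} (Rel : A -> A -> Prop) a b : Rel a b -> within Rel 1 a b.
Proof. intros H. right. exists a. split; [reflexivity|assumption]. Qed.

Lemma within_refl {A : Type} (Rel : A -> A -> Prop) n a : within Rel n a a.
Proof. apply (within_mono _ 0); [lia|reflexivity]. Qed.

Lemma within_sym {A : Type} (Rel : A -> A -> Prop) n a b :
  (forall x y, Rel x y -> Rel y x) -> within Rel n a b -> within Rel n b a.
Proof.
  intros Hs. revert b. induction n as [|n IH]; simpl; intros b H; [congruence|].
  destruct H as [H|(u & H & Hr)]; [left; auto|].
  assert (within Rel (1 + n) b a) as H1.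
  { apply within_trans with u; [apply within_step; auto|auto]. }
  exact H1.
Qed.

Lemma within_map {A B : Type} (Rel : A -> A -> Prop) (Rel' : B -> B -> Prop) (g : A -> B) n a b :
  (forall x y, Rel x y -> Rel' (g x) (g y)) -> within Rel n a b -> within Rel' n (g a) (g b).
Proof.
  intros Hg. revert b. induction n as [|n IH]; simpl; intros b H; [congruence|].
  destruct H as [H|(u & H & Hr)]; [left; auto|right; exists (g u); auto].
Qed.

Lemma within_impl {A : Type} (Rel Rel' : A -> A -> Prop) n a b :
  (forall x y, Rel x y -> Rel' x y) -> within Rel n a b -> within Rel' n a b.
Proof. intros H. apply (within_map Rel Rel' (fun x => x)). assumption. Qed.

Lemma within_invariant {A : Type} (Rel : A -> A -> Prop) (I : A -> Prop) n a b :
  (forall x y, Rel x y -> I y) -> I a -> within Rel n a b -> I b.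
Proof.
  intros H Ha. revert b. induction n as [|n IH]; simpl; intros b Hb; [congruence|].
  destruct Hb as [Hb|(u & Hu & Hr)]; [auto|eapply H; eassumption].
Qed.

Lemma within_split {A : Type} (Rel : A -> A -> Prop) n k a c :
  within Rel (n + k) a c -> exists b, within Rel n a b /\ within Rel k b c.
Proof.
  revert c. induction k as [|k IH]; intros c H.
  - rewrite Nat.add_0_r in H. exists c. split; [assumption|reflexivity].
  - rewrite Nat.add_succ_r in H. destruct H as [H|(u & H & Hr)].
    + destruct (IH _ H) as (b & Hb & Hc). exists b. split; [assumption|left; assumption].
    + destruct (IH _ H) as (b & Hb & Hc). exists b. split; [assumption|right; exists u; auto].
Qed.

Lemma within_ratio {A : Type} (Rel : A -> A -> Prop) (f : A -> R) (A0 : R) n a b :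
  1 <= A0 -> (forall x y, Rel x y -> f y <= A0 * f x) -> 0 <= f a ->
  within Rel n a b -> f b <= A0 ^ n * f a.
Proof.
  intros HA Hr Ha. revert b. induction n as [|n IH]; simpl; intros b Hb.
  - subst. lra.
  - assert (0 <= A0 ^ n) by (apply pow_le; lra).
    assert (0 <= A0 ^ n * f a) by (apply Rmult_le_pos; assumption).
    destruct Hb as [Hb|(u & Hu & HR)].
    + specialize (IH _ Hb). nra.
    + specialize (IH _ Hu). specialize (Hr _ _ HR). nra.
Qed.

Lemma least_nat (P : nat -> Prop) n : P n -> exists k, (k <= n)%nat /\ P k /\ forall i, (i < k)%nat -> ~ P i.
Proof.
  induction n as [n IH] using lt_wf_ind. intros Hn.
  destruct (classic (exists i, (i < n)%nat /\ P i)) as [(i & Hi & HP)|Hno].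
  - destruct (IH i Hi HP) as (k & Hk & H). exists k. split; [lia|assumption].
  - exists n. split; [lia|]. split; [assumption|]. intros i Hi HP. apply Hno. eauto.
Qed.

Definition keep {A : Type} (P : A -> Prop) (l : list A) : list A :=
  filter (fun x => if excluded_middle_informative (P x) then true else false) l.

Lemma In_keep {A : Type} (P : A -> Prop) l x : In x (keep P l) <-> In x l /\ P x.
Proof. unfold keep. rewrite filter_In. destruct excluded_middle_informative; intuition congruence. Qed.

Lemma NoDup_keep {A : Type} (P : A -> Prop) l : NoDup l -> NoDup (keep P l).
Proof. apply NoDup_filter. Qed.

Lemma length_keep {A : Type} (P : A -> Prop) l : (length (keep P l) <= length l)%nat.
Proof. apply filter_length_le. Qed.

Lemma lsum_keep {A : Type} (P : A -> Prop) (l : list A) F :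
  (forall x, In x l -> ~ P x -> F x = 0) -> lsum l F = lsum (keep P l) F.
Proof.
  induction l as [|x l IH]; intros H; [reflexivity|]. rewrite lsum_cons, IH by (intros; apply H; [right; assumption|assumption]).
  unfold keep. simpl. destruct excluded_middle_informative as [Hx|Hx]; [reflexivity|]. rewrite H by (simpl; auto). apply Rplus_0_l.
Qed.

Lemma lsum_fibers {A B : Type} (g : A -> B) (Y : list A) (U : list B) F :
  NoDup Y -> (forall y, In y Y -> In (g y) U) -> (forall y, 0 <= F y) ->
  lsum Y F <= lsum U (fun u => lsum (keep (fun y => g y = u) Y) F).
Proof.
  intros HY Hg HF. rewrite <- lsum_flat_map. apply lsum_incl; [assumption| |auto]. intros y Hy. apply in_flat_map.
  exists (g y). split; [auto|]. apply In_keep. auto.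
Qed.

(** * Averaging over neighbours *)

(** A sum rather than a mean: the normalisation is left to the powers of [b] in [ker]. On a level,
    [nb v] contains [v] itself. *)
Definition avg {V : Type} (nb : V -> list V) (F : V -> R) (v : V) : R := lsum (nb v) F.

Fixpoint avgn {V : Type} (nb : V -> list V) (l : nat) (F : V -> R) : V -> R :=
  match l with
  | O => F
  | S l' => avgn nb l' (avg nb F)
  end.

(** Repetitions are kept; only membership, which describes the ball of radius [k] ([bl_spec]), and
    the crude length bound [D ^ k] matter. *)
Fixpoint bl {V : Type} (nb : V -> list V) (k : nat) (w : V) : list V :=
  match k with
  | O => [w]
  | S k' => flat_map nb (bl nb k' w)
  end.

(* The kernel [sum_(l <= k) b^-l A^l], [A] the sum over neighbours. *)
Fixpoint ker {V : Type} (nb : V -> list V) (b : R) (k : nat) (F : V -> R) (v : V) : R :=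
  match k with
  | O => F v
  | S k' => ker nb b k' F v + / b ^ S k' * avgn nb (S k') F v
  end.

Section Level.
Context {V : Type} (X : V -> Prop) (tch : V -> V -> Prop) (nb : V -> list V) (D : nat).
Hypothesis tch_refl : forall v, X v -> tch v v.
Hypothesis tch_sym : forall v v', tch v v' -> tch v' v.
Hypothesis nb_spec : forall v, X v -> forall v', In v' (nb v) <-> X v' /\ tch v v'.
Hypothesis nb_NoDup : forall v, X v -> NoDup (nb v).
Hypothesis nb_len : forall v, X v -> (length (nb v) <= D)%nat.

Definition adj (a b : V) : Prop := X a /\ X b /\ tch a b.

Lemma adj_sym a b : adj a b -> adj b a.
Proof. unfold adj; intuition. Qed.

Lemma within_adj_X k v v' : X v -> within adj k v v' -> X v'.
Proof. apply within_invariant. unfold adj; tauto. Qed.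

Lemma bl_spec k w v : X w -> (In v (bl nb k w) <-> within adj k w v).
Proof.
  intros Hw. revert v. induction k as [|k IH]; intros v; simpl; [intuition|].
  rewrite in_flat_map. split.
  - intros (u & Hu & Hv). right. exists u. apply IH in Hu. split; [assumption|].
    assert (X u) by (eapply within_adj_X; eassumption).
    apply nb_spec in Hv; [|assumption]. unfold adj; tauto.
  - intros [H|(u & Hu & Ha)].
    + exists v. split; [apply IH; assumption|].
      assert (X v) by (eapply within_adj_X; eassumption). apply nb_spec; auto.
    + exists u. split; [apply IH; assumption|]. destruct Ha as (? & ? & ?). apply nb_spec; auto.
Qed.

Lemma bl_length k w : X w -> (length (bl nb k w) <= D ^ k)%nat.
Proof.
  intros Hw. induction k as [|k IH]; simpl; [lia|].
  eapply Nat.le_trans; [apply (length_flat_map_le _ _ D)|nia].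
  intros u Hu. apply nb_len. apply bl_spec in Hu; [|assumption]. eapply within_adj_X; eassumption.
Qed.

Lemma avg_nonneg F : (forall v, X v -> 0 <= F v) -> forall v, X v -> 0 <= avg nb F v.
Proof. intros HF v Hv. apply lsum_nonneg. intros u Hu. apply HF. apply nb_spec in Hu; tauto. Qed.

Lemma avgn_nonneg l F : (forall v, X v -> 0 <= F v) -> forall v, X v -> 0 <= avgn nb l F v.
Proof. revert F. induction l; intros F HF v Hv; simpl; [auto|]. apply IHl; [|assumption]. apply avg_nonneg; assumption. Qed.

Lemma avgn_local l F F' v : X v -> (forall v', within adj l v v' -> F v' = F' v') -> avgn nb l F v = avgn nb l F' v.
Proof.
  revert F F'. induction l as [|l IH]; intros F F' Hv H; simpl.
  - apply H. reflexivity.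
  - apply IH; [assumption|]. intros u Hu. apply lsum_ext. intros z Hz.
    assert (X u) by (eapply within_adj_X; eassumption).
    apply nb_spec in Hz; [|assumption]. apply H. right. exists u. unfold adj. tauto.
Qed.

Lemma avgn_plus l F F' v : X v -> avgn nb l (fun x => F x + F' x) v = avgn nb l F v + avgn nb l F' v.
Proof.
  revert F F' v. induction l as [|l IH]; intros F F' v Hv; simpl; [reflexivity|].
  rewrite <- IH by assumption. apply avgn_local; [assumption|]. intros. unfold avg. rewrite lsum_plus. reflexivity.
Qed.

Lemma avgn_scal l c F v : X v -> avgn nb l (fun x => c * F x) v = c * avgn nb l F v.
Proof.
  revert F v. induction l as [|l IH]; intros F v Hv; simpl; [reflexivity|].
  rewrite <- IH by assumption. apply avgn_local; [assumption|]. intros. unfold avg. rewrite lsum_scal. reflexivity.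
Qed.

Lemma avgn_comm l F v : X v -> avgn nb (S l) F v = avg nb (avgn nb l F) v.
Proof.
  revert F v. induction l as [|l IH]; intros F v Hv; [reflexivity|].
  change (avgn nb (S (S l)) F v) with (avgn nb (S l) (avg nb F) v). rewrite IH by assumption. reflexivity.
Qed.

Lemma avgn_neighbour l F v v' : (forall v, X v -> 0 <= F v) -> X v -> X v' -> tch v v' ->
  avgn nb l F v <= avgn nb (S l) F v'.
Proof.
  intros HF Hv Hv' Ht. rewrite avgn_comm by assumption. unfold avg.
  apply lsum_In_le; [|apply nb_spec; auto].
  intros y Hy. apply nb_spec in Hy; [|assumption]. apply avgn_nonneg; tauto.
Qed.

(** Contact is symmetric, so each value [F z] is counted by at most [D] neighbours: one averaging
    step has [l^1] norm at most [D]. [Z] is any list that swallows the [l]-neighbourhood of [Y]. *)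
Lemma avgn_l1 l F Y Z : (forall v, X v -> 0 <= F v) ->
  NoDup Y -> (forall y, In y Y -> X y) -> (forall z, In z Z -> X z) ->
  (forall y z, In y Y -> within adj l y z -> In z Z) ->
  lsum Y (avgn nb l F) <= INR D ^ l * lsum Z F.
Proof.
  revert F Z. induction l as [|l IH]; intros F Z HF HY HYX HZX HYZ.
  - simpl. rewrite Rmult_1_l. apply lsum_incl; [assumption| |intros; auto].
    intros y Hy. eapply HYZ; [eassumption|reflexivity].
  - set (Z1 := ndup (flat_map (bl nb l) Y)).
    assert (HZ1 : forall z, In z Z1 <-> exists y, In y Y /\ within adj l y z).
    { intros z. unfold Z1. rewrite In_ndup, in_flat_map. split; intros (y & Hy & H); exists y; split; auto.
      - apply bl_spec in H; auto. - apply bl_spec; auto. }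
    assert (HZ1X : forall z, In z Z1 -> X z).
    { intros z Hz. apply HZ1 in Hz. destruct Hz as (y & Hy & H). eapply within_adj_X; [|eassumption]. auto. }
    simpl. eapply Rle_trans.
    + apply (IH _ Z1); [apply avg_nonneg; assumption|assumption|assumption|assumption|].
      intros y z Hy Hz. apply HZ1. eauto.
    + rewrite (Rmult_comm (INR D)), Rmult_assoc. apply Rmult_le_compat_l; [apply pow_le, pos_INR|].
      unfold avg. apply (lsum_double_count Z1 Z nb nb D F).
      * apply NoDup_ndup.
      * intros; apply nb_NoDup; auto.
      * intros y Hy z Hz. pose proof (HZ1X _ Hy). apply HZ1 in Hy. destruct Hy as (y0 & Hy0 & Hw).
        apply nb_spec in Hz; [|assumption]. eapply HYZ; [eassumption|]. right. exists y. unfold adj. tauto.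
      * intros y z Hy Hz. pose proof (HZ1X _ Hy). apply nb_spec in Hz; [|assumption]. apply nb_spec; intuition.
      * intros; apply nb_len; auto.
      * intros; auto.
Qed.

Lemma ker_nonneg b k F : 0 < b -> (forall v, X v -> 0 <= F v) -> forall v, X v -> 0 <= ker nb b k F v.
Proof.
  intros Hb HF v Hv. induction k; simpl; [auto|].
  assert (0 < / (b * b ^ k)) by (apply Rinv_0_lt_compat; change (0 < b ^ S k); apply pow_lt; assumption).
  assert (0 <= avgn nb (S k) F v) by (apply avgn_nonneg; auto). simpl in *. nra.
Qed.

Lemma ker_ge b k F : 0 < b -> (forall v, X v -> 0 <= F v) -> forall v, X v -> F v <= ker nb b k F v.
Proof.
  intros Hb HF v Hv. induction k; simpl; [lra|].
  assert (0 < / (b * b ^ k)) by (apply Rinv_0_lt_compat; change (0 < b ^ S k); apply pow_lt; assumption).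
  assert (0 <= avgn nb (S k) F v) by (apply avgn_nonneg; auto). simpl in *. nra.
Qed.

Lemma ker_plus b k F F' v : X v -> ker nb b k (fun x => F x + F' x) v = ker nb b k F v + ker nb b k F' v.
Proof. intros Hv. induction k; [reflexivity|]. cbn [ker]. rewrite IHk, avgn_plus by assumption. ring. Qed.

Lemma ker_scal b k c F v : X v -> ker nb b k (fun x => c * F x) v = c * ker nb b k F v.
Proof. intros Hv. induction k; [reflexivity|]. cbn [ker]. rewrite IHk, avgn_scal by assumption. ring. Qed.

Lemma ker_local b k F F' v : X v -> (forall v', within adj k v v' -> F v' = F' v') -> ker nb b k F v = ker nb b k F' v.
Proof.
  intros Hv. induction k; intros H; [apply H; reflexivity|]. cbn [ker]. rewrite IHk.
  - f_equal. f_equal. apply avgn_local; assumption.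
  - intros. apply H. left. assumption.
Qed.

(** Passing from [v'] to its neighbour [v] costs one step, so term [l] of the series at [v] is at
    most [b] times term [l + 1] at [v']. Truncation leaves one uncompensated term, which is the one
    added on the right. *)
Lemma ker_slow b k F v v' : 0 < b -> (forall v, X v -> 0 <= F v) -> X v -> X v' -> tch v v' ->
  ker nb b k F v <= b * (ker nb b k F v' + / b ^ S k * avgn nb (S k) F v').
Proof.
  intros Hb HF Hv Hv' Ht. change (ker nb b k F v <= b * ker nb b (S k) F v').
  (* The zeroth term at [v'] never serves the comparison; keeping it on the left makes the induction
     close, and it is dropped at the end. *)
  assert (Hk : ker nb b k F v + b * F v' <= b * ker nb b (S k) F v').
  2:{ pose proof (HF _ Hv'). pose proof (Rmult_le_pos b (F v') (Rlt_le _ _ Hb) H). lra. }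
  induction k as [|k IH].
  - cbn [ker]. pose proof (avgn_neighbour 0 F v v' HF Hv Hv' Ht).
    cbn [avgn] in *. rewrite pow_1. replace (b * (F v' + / b * avg nb F v')) with (b * F v' + avg nb F v') by (field; lra). lra.
  - change (ker nb b (S (S k)) F v') with (ker nb b (S k) F v' + / b ^ S (S k) * avgn nb (S (S k)) F v').
    change (ker nb b (S k) F v) with (ker nb b k F v + / b ^ S k * avgn nb (S k) F v).
    pose proof (avgn_neighbour (S k) F v v' HF Hv Hv' Ht).
    assert (Hp : 0 < / b ^ S k) by (apply Rinv_0_lt_compat, pow_lt; assumption).
    replace (b * (ker nb b (S k) F v' + / b ^ S (S k) * avgn nb (S (S k)) F v'))
      with (b * ker nb b (S k) F v' + / b ^ S k * avgn nb (S (S k)) F v').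
    + nra.
    + cbn [ker]. simpl pow. assert (b ^ k <> 0) by (apply pow_nonzero; lra). field. split; lra.
Qed.
End Level.

Lemma iter_P_L {V : Type} (L : Z -> V -> Prop) (P : V -> V) :
  (forall j v, L (j + 1)%Z v -> L j (P v)) ->
  forall j v k, L j v -> L (j - Z.of_nat k)%Z (Nat.iter k P v).
Proof.
  intros P_L j v k Hv. induction k as [|k IH]; simpl.
  - replace (j - 0)%Z with j by lia. assumption.
  - apply P_L. replace (j - Z.pos (Pos.of_succ_nat k) + 1)%Z with (j - Z.of_nat k)%Z by lia. assumption.
Qed.

Section Iterate.
Context {G V : Type} (L : Z -> V -> Prop) (P : V -> V) (tch : V -> V -> Prop) (inc : V -> G -> Prop).
Hypothesis P_L : forall j v, L (j + 1)%Z v -> L j (P v).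
Hypothesis tch_P : forall j v v', adj (L (j + 1)%Z) tch v v' -> tch (P v) (P v').
Hypothesis inc_P : forall j v x, L (j + 1)%Z v -> inc v x -> inc (P v) x.

Lemma iter_lev j k v : L (j + Z.of_nat k)%Z v -> L j (Nat.iter k P v).
Proof.
  intros H. apply (iter_P_L L P P_L _ _ k) in H. replace (j + Z.of_nat k - Z.of_nat k)%Z with j in H by lia. assumption.
Qed.

Lemma iter_touch j k v v' : adj (L (j + Z.of_nat k)%Z) tch v v' -> adj (L j) tch (Nat.iter k P v) (Nat.iter k P v').
Proof.
  revert j. induction k as [|k IH]; intros j H; simpl.
  - rewrite Z.add_0_r in H. assumption.
  - replace (j + Z.of_nat (S k))%Z with (j + 1 + Z.of_nat k)%Z in H by lia. apply IH in H.
    pose proof H as (H1 & H2 & _). split; [auto|]. split; [auto|]. eapply tch_P; eassumption.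
Qed.

Lemma iter_vertex j k v x : L (j + Z.of_nat k)%Z v -> inc v x -> inc (Nat.iter k P v) x.
Proof.
  revert j. induction k as [|k IH]; intros j H Hx; simpl; [assumption|].
  replace (j + Z.of_nat (S k))%Z with (j + 1 + Z.of_nat k)%Z in H by lia.
  eapply inc_P; [apply iter_lev; eassumption|]. eapply IH; eassumption.
Qed.
End Iterate.

(** * Distributing mass to the next level *)

Section Step.
Context {V : Type} (X0 X1 : V -> Prop) (tch : V -> V -> Prop) (nb ch : V -> list V) (P : V -> V).
Context (D Bn M i Q : nat).
Hypothesis tch_sym : forall v v', tch v v' -> tch v' v.
Hypothesis tch_refl1 : forall v, X1 v -> tch v v.
Hypothesis nb_spec0 : forall v, X0 v -> forall v', In v' (nb v) <-> X0 v' /\ tch v v'.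
Hypothesis nb_len0 : forall v, X0 v -> (length (nb v) <= D)%nat.
Hypothesis tch_refl0 : forall v, X0 v -> tch v v.
Hypothesis nb_spec1 : forall v, X1 v -> forall v', In v' (nb v) <-> X1 v' /\ tch v v'.
Hypothesis nb_NoDup1 : forall v, X1 v -> NoDup (nb v).
Hypothesis nb_len1 : forall v, X1 v -> (length (nb v) <= D)%nat.
Hypothesis P_X : forall v, X1 v -> X0 (P v).
Hypothesis ch_spec : forall w, X0 w -> forall v, In v (ch w) <-> X1 v /\ P v = w.
Hypothesis ch_NoDup : forall w, X0 w -> NoDup (ch w).
Hypothesis ch_len : forall w, X0 w -> (2 <= length (ch w) <= Bn)%nat.
(** The kernel reaches [i] steps among children but only [M] steps among parents; [M] stays fixed
    while [i] is taken large. *)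
Hypothesis contract : forall v v', X1 v -> within (adj X1 tch) i v v' -> within (adj X0 tch) M (P v) (P v').
Hypothesis interior : forall w, X0 w -> exists c, X1 c /\ P c = w /\
  forall v', within (adj X1 tch) i c v' -> P v' = w.
Context (Phi : V -> V -> R) (m : V -> R) (a b eps delta tau : R).
Hypothesis Phi_pos : forall u v, 0 <= Phi u v.
Hypothesis Phi_sum : forall u w, X0 u -> X0 w -> lsum (ch w) (Phi u) <= delta.
Hypothesis m_pos : forall w, X0 w -> 0 < m w.
Hypothesis m_slow : forall w w', adj X0 tch w w' -> m w' <= a * m w.
Hypothesis D_pos : (1 <= D)%nat.
Hypothesis i_pos : (1 <= i)%nat.
Hypothesis b_large : 2 * INR D <= b.
Hypothesis a_def : a = 2 * b.
(** With this value the smoothed demand below [w] is at most [2 * D^M * a^M * tau * m w = m w / 2]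
    by [S_ker_le], so half of the mass remains free. Half of [tau] is reserved for the floor [eps],
    the other half for the cutoffs. *)
Hypothesis tau_def : tau = / (4 * INR D ^ M * a ^ M).
Hypothesis eps_pos : 0 < eps.
Hypothesis eps_small : eps * INR Bn <= tau / 2.
Hypothesis delta_small : INR D ^ Q * a ^ Q * delta <= tau / 2.
(** The left side bounds, relative to the parent, the term of order [i] that truncation leaves over
    in [ker_slow]; the factor [2] is the bound for the total of the smoothed function below one
    parent. *)
Hypothesis tail_small : / b ^ i * (INR D ^ i * INR D ^ M * (2 * a ^ M)) <= eps.

Let S (F : V -> R) (w : V) : R := lsum (ch w) F.

Lemma step_D1 : 1 <= INR D. Proof. apply (le_INR 1). assumption. Qed.
Lemma step_a1 : 1 <= a. Proof. pose proof step_D1. lra. Qed.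

(** In [l <= i] steps the children of [w] only see children of parents within [M] of [w]. There are
    at most [D^M] of these, each of mass at most [a^M * m w]. *)
Lemma S_avgn_le l F t w : (l <= i)%nat -> X0 w -> (forall v, X1 v -> 0 <= F v) -> 0 <= t ->
  (forall w', X0 w' -> S F w' <= t * m w') ->
  S (avgn nb l F) w <= INR D ^ l * (INR D ^ M * (a ^ M * (t * m w))).
Proof.
  intros Hl Hw HF Ht HS. pose proof step_D1 as HD1. pose proof step_a1 as Ha1.
  assert (Hbl : forall w', In w' (bl nb M w) -> X0 w' /\ within (adj X0 tch) M w w').
  { intros w' H'. pose proof (proj1 (bl_spec X0 tch nb tch_refl0 nb_spec0 M w w' Hw) H').
    split; [eapply within_adj_X; eassumption|assumption]. }
  unfold S at 1. eapply Rle_trans.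
  - apply (avgn_l1 X1 tch nb D tch_refl1 tch_sym nb_spec1 nb_NoDup1 nb_len1 l F (ch w) (flat_map ch (bl nb M w))).
    + assumption.
    + apply ch_NoDup; assumption.
    + intros y Hy. apply ch_spec in Hy; tauto.
    + intros z Hz. apply in_flat_map in Hz. destruct Hz as (w' & Hw' & Hz).
      apply ch_spec in Hz; [tauto|]. apply Hbl; assumption.
    + intros y z Hy Hz. apply ch_spec in Hy; [|assumption]. destruct Hy as (Hy & <-).
      assert (X1 z) by (eapply within_adj_X; eassumption).
      apply in_flat_map. exists (P z). split; [|apply ch_spec; auto].
      apply (bl_spec X0 tch nb tch_refl0 nb_spec0); [assumption|].
      apply contract; [assumption|]. eapply within_mono; eassumption.
  - apply Rmult_le_compat_l; [apply pow_le; lra|]. rewrite lsum_flat_map.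
    eapply Rle_trans.
    + apply (lsum_const_le _ _ (a ^ M * (t * m w))). intros w' Hw'. apply Hbl in Hw'. destruct Hw' as (HX & Hwi).
      eapply Rle_trans; [apply HS; assumption|].
      replace (a ^ M * (t * m w)) with (t * (a ^ M * m w)) by ring.
      apply Rmult_le_compat_l; [assumption|].
      apply (within_ratio (adj X0 tch) m a M w w'); [assumption|assumption| |assumption].
      apply Rlt_le, m_pos; assumption.
    + apply Rmult_le_compat_r.
      * apply Rmult_le_pos; [apply pow_le; lra|]. apply Rmult_le_pos; [assumption|apply Rlt_le, m_pos; assumption].
      * rewrite <- pow_INR. apply le_INR. apply (bl_length X0 tch nb D tch_refl0 nb_spec0 nb_len0). assumption.
Qed.

(** Because [b >= 2 * D], term [l] of the kernel contributes at most [2^-l] times the bound for the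
    zeroth one; [2 - / 2 ^ k] is the partial sum of that geometric series. *)
Lemma S_ker_le k F t w : (k <= i)%nat -> X0 w -> (forall v, X1 v -> 0 <= F v) -> 0 <= t ->
  (forall w', X0 w' -> S F w' <= t * m w') ->
  S (ker nb b k F) w <= (2 - / 2 ^ k) * (INR D ^ M * (a ^ M * (t * m w))).
Proof.
  intros Hk Hw HF Ht HS. pose proof step_D1 as HD1.
  set (c := INR D ^ M * (a ^ M * (t * m w))).
  assert (Hc : 0 <= c).
  { pose proof step_a1. pose proof (m_pos w Hw). unfold c. repeat apply Rmult_le_pos; try apply pow_le; lra. }
  induction k as [|k IH].
  - change (S F w <= (2 - / 2 ^ 0) * c).
    pose proof (S_avgn_le 0 F t w ltac:(lia) Hw HF Ht HS) as H. fold c in H. cbn [avgn] in H. rewrite pow_O in *. lra.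
  - assert (IH' := IH ltac:(lia)).
    replace (S (ker nb b (Datatypes.S k) F) w)
      with (S (ker nb b k F) w + / b ^ Datatypes.S k * S (avgn nb (Datatypes.S k) F) w).
    2:{ unfold S. rewrite <- lsum_scal, <- lsum_plus. apply lsum_ext; intros; reflexivity. }
    pose proof (S_avgn_le (Datatypes.S k) F t w Hk Hw HF Ht HS) as H. fold c in H.
    assert (Hb : 0 < b) by lra.
    assert (Hi : / b ^ Datatypes.S k * INR D ^ Datatypes.S k <= / 2 ^ Datatypes.S k).
    { apply Rmult_le_reg_l with (b ^ Datatypes.S k); [apply pow_lt; assumption|].
      rewrite <- Rmult_assoc, Rinv_r, Rmult_1_l by (apply pow_nonzero; lra).
      apply Rmult_le_reg_r with (2 ^ Datatypes.S k); [apply pow_lt; lra|].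
      rewrite Rmult_assoc, Rinv_l, Rmult_1_r by (apply pow_nonzero; lra).
      rewrite <- Rpow_mult_distr. apply pow_incr. lra. }
    assert (H1 : / b ^ Datatypes.S k * S (avgn nb (Datatypes.S k) F) w <= / 2 ^ Datatypes.S k * c).
    { eapply Rle_trans.
      - apply Rmult_le_compat_l; [apply Rlt_le, Rinv_0_lt_compat, pow_lt; assumption|apply H].
      - rewrite <- Rmult_assoc. apply Rmult_le_compat_r; assumption. }
    assert (H2 : / 2 ^ k = 2 * / 2 ^ Datatypes.S k) by (simpl; field; apply pow_nonzero; lra).
    rewrite H2 in IH'. nra.
Qed.

(* [F] prescribes the mass required by the cutoffs; the kernel makes it comparable at neighbours, and the mass left
   over goes to an interior child, where the kernel does not reach other pieces. *)
Lemma mass_step : exists m' : V -> R,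
  (forall v, X1 v -> eps * m (P v) <= m' v <= (1 - eps) * m (P v)) /\
  (forall v v', adj X1 tch v v' -> m' v' <= a * m' v) /\
  (forall w, X0 w -> lsum (ch w) m' = m w) /\
  (forall u v, X1 v -> within (adj X0 tch) Q u (P v) -> m u * Phi u v <= m' v).
Proof.
  pose proof step_D1 as HD1. pose proof step_a1 as Ha1. assert (Hb : 0 < b) by lra.
  destruct (choice (fun w c => X0 w -> X1 c /\ P c = w /\ forall v', within (adj X1 tch) i c v' -> P v' = w)) as (vc & Hvc).
  { intros w. destruct (classic (X0 w)) as [Hw|Hw].
    - destruct (interior w Hw) as (c & Hc). exists c. auto.
    - exists w. tauto. }
  (* The floor gives every child a definite share; the sum collects the demands of all cutoffs
     centred within [Q] of the parent. *)
  set (F := fun v => eps * m (P v) + lsum (bl nb Q (P v)) (fun u => m u * Phi u v)).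
  assert (HFX : forall w, X0 w -> 0 <= lsum (bl nb Q w) m /\ forall u, In u (bl nb Q w) -> X0 u).
  { intros w Hw. assert (H : forall u, In u (bl nb Q w) -> X0 u).
    { intros u Hu. eapply within_adj_X; [exact Hw|]. apply (bl_spec X0 tch nb tch_refl0 nb_spec0); eassumption. }
    split; [|assumption]. apply lsum_nonneg. intros; apply Rlt_le, m_pos; auto. }
  assert (Hsum0 : forall v, X1 v -> 0 <= lsum (bl nb Q (P v)) (fun u => m u * Phi u v)).
  { intros v Hv. apply lsum_nonneg. intros u Hu. apply Rmult_le_pos; [|auto]. apply Rlt_le, m_pos.
    apply (HFX (P v)); auto. }
  assert (HFe : forall v, X1 v -> eps * m (P v) <= F v).
  { intros v Hv. unfold F. pose proof (Hsum0 v Hv). lra. }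
  assert (HF0 : forall v, X1 v -> 0 <= F v).
  { intros v Hv. pose proof (HFe v Hv). pose proof (m_pos _ (P_X v Hv)). nra. }
  assert (Hd0 : forall w, X0 w -> 0 <= delta).
  { intros w Hw. eapply Rle_trans; [|apply (Phi_sum w w); assumption]. apply lsum_nonneg. auto. }
  assert (HSF : forall w, X0 w -> S F w <= tau * m w).
  { intros w Hw. unfold S.
    rewrite (lsum_ext _ _ (fun v => eps * m w + lsum (bl nb Q w) (fun u => m u * Phi u v))).
    2:{ intros v Hv. apply ch_spec in Hv; [|assumption]. destruct Hv as (_ & <-). reflexivity. }
    rewrite lsum_plus, lsum_swap. pose proof (m_pos w Hw) as Hmw. pose proof (Hd0 w Hw).
    assert (H1 : lsum (ch w) (fun _ => eps * m w) <= tau / 2 * m w).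
    { eapply Rle_trans; [apply (lsum_const_le _ _ (eps * m w)); intros; lra|].
      assert (INR (length (ch w)) <= INR Bn) by (apply le_INR, ch_len; assumption).
      rewrite <- Rmult_assoc. apply Rmult_le_compat_r; [lra|].
      eapply Rle_trans; [|apply eps_small]. rewrite Rmult_comm. apply Rmult_le_compat_l; lra. }
    assert (H2 : lsum (bl nb Q w) (fun u => lsum (ch w) (fun v => m u * Phi u v)) <= tau / 2 * m w).
    { eapply Rle_trans.
      - apply (lsum_const_le _ _ (a ^ Q * m w * delta)). intros u Hu. rewrite lsum_scal.
        assert (HuX : X0 u) by (apply (HFX w); assumption).
        apply Rmult_le_compat; [apply Rlt_le, m_pos; assumption| |
          |apply Phi_sum; assumption].
        + apply lsum_nonneg; auto.
        + apply (within_ratio (adj X0 tch) m a Q w u); [assumption|assumption|lra|].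
          apply (bl_spec X0 tch nb tch_refl0 nb_spec0); assumption.
      - assert (INR (length (bl nb Q w)) <= INR D ^ Q).
        { rewrite <- pow_INR. apply le_INR. apply (bl_length X0 tch nb D tch_refl0 nb_spec0 nb_len0). assumption. }
        assert (0 <= a ^ Q) by (apply pow_le; lra).
        assert (0 <= a ^ Q * m w * delta) by (repeat apply Rmult_le_pos; lra).
        eapply Rle_trans; [apply Rmult_le_compat_r; eassumption|].
        replace (INR D ^ Q * (a ^ Q * m w * delta)) with (INR D ^ Q * a ^ Q * delta * m w) by ring.
        apply Rmult_le_compat_r; lra. }
    lra. }
  assert (Htau : 0 < tau /\ INR D ^ M * (a ^ M * tau) = 1 / 4).
  { assert (0 < INR D ^ M) by (apply pow_lt; lra). assert (0 < a ^ M) by (apply pow_lt; lra).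
    rewrite tau_def. split; [apply Rinv_0_lt_compat; nra|field; lra]. }
  destruct Htau as (Htau0 & Htau).
  (* Truncating at [i - 1] makes the uncompensated term of [ker_slow] the one of order [i], which
     [tail_small] controls. *)
  set (k0 := (i - 1)%nat). assert (HRi : i = Datatypes.S k0) by (unfold k0; lia).
  set (one := fun w v => if eq_dec_classic v (vc w) then 1 else 0).
  set (s := fun w => S (ker nb b k0 (one w)) w).
  (* Among the children of [w] only the source at [vc w] is felt, so conservation of mass is one
     linear equation for [c w]. Its solution lies in [[0, m w]] because [s w >= 1] and the smoothed
     demand is at most [m w / 2]. *)
  set (c := fun w => (m w - S (ker nb b k0 F) w) / s w).
  set (Gf := fun v => if eq_dec_classic v (vc (P v)) then c (P v) else 0).
  assert (Hone : forall w v, 0 <= one w v) by (intros; unfold one; destruct eq_dec_classic; lra).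
  assert (Hs : forall w, X0 w -> 1 <= s w).
  { intros w Hw. destruct (Hvc w Hw) as (Hc1 & Hc2 & _). unfold s, S.
    assert (Hin : In (vc w) (ch w)) by (apply ch_spec; auto).
    assert (Hk : forall v, X1 v -> 0 <= ker nb b k0 (one w) v).
    { apply (ker_nonneg X1 tch nb nb_spec1); auto. }
    eapply Rle_trans; [|apply (lsum_In_le _ _ (vc w))]; [| |assumption].
    - eapply Rle_trans; [|apply (ker_ge X1 tch nb nb_spec1); auto].
      unfold one. destruct eq_dec_classic; [lra|congruence].
    - intros y Hy. apply ch_spec in Hy; [|assumption]. apply Hk; tauto. }
  assert (HSk : forall w, X0 w -> 0 <= S (ker nb b k0 F) w <= m w / 2).
  { intros w Hw. split.
    - apply lsum_nonneg. intros v Hv. apply ch_spec in Hv; [|assumption]. apply (ker_nonneg X1 tch nb nb_spec1); tauto.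
    - eapply Rle_trans; [apply (S_ker_le k0 F tau w); [unfold k0; lia|assumption|assumption|lra|assumption]|].
      replace (INR D ^ M * (a ^ M * (tau * m w))) with (1 / 4 * m w) by (rewrite <- Htau; ring).
      assert (0 < / 2 ^ k0) by (apply Rinv_0_lt_compat, pow_lt; lra). pose proof (m_pos w Hw). nra. }
  assert (Hc : forall w, X0 w -> 0 <= c w <= m w).
  { intros w Hw. pose proof (Hs w Hw). pose proof (HSk w Hw). pose proof (m_pos w Hw). unfold c. split.
    - apply Rdiv_le_0_compat; lra.
    - apply Rle_div_l; [lra|]. nra. }
  assert (HG0 : forall v, X1 v -> 0 <= Gf v).
  { intros v Hv. unfold Gf. destruct eq_dec_classic; [|lra]. apply Hc; auto. }
  assert (HSG : forall w, X0 w -> S Gf w <= m w).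
  { intros w Hw. unfold S. destruct (Hvc w Hw) as (Hc1 & Hc2 & _).
    rewrite (lsum_ext _ _ (fun v => c w * ind (v = vc w))).
    - rewrite lsum_scal. pose proof (Hc w Hw).
      assert (lsum (ch w) (fun v => ind (v = vc w)) <= INR (length [vc w])).
      { apply lsum_ind_le; [auto|]. intros x _ ->. left; reflexivity. }
      simpl in H0. nra.
    - intros v Hv. apply ch_spec in Hv; [|assumption]. destruct Hv as (_ & <-). unfold Gf, ind.
      destruct eq_dec_classic; destruct excluded_middle_informative; try contradiction; lra. }
  set (H := fun v => F v + Gf v).
  assert (HH0 : forall v, X1 v -> 0 <= H v).
  { intros v Hv. unfold H. pose proof (HF0 v Hv). pose proof (HG0 v Hv). lra. }
  assert (HHF : forall v, X1 v -> F v <= H v).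
  { intros v Hv. unfold H. pose proof (HG0 v Hv). lra. }
  assert (Htau1 : tau <= 1).
  { assert (1 <= INR D ^ M) by (apply pow_R1_Rle; lra). assert (1 <= a ^ M) by (apply pow_R1_Rle; lra).
    assert (1 <= INR D ^ M * a ^ M) by nra. nra. }
  assert (HSH : forall w, X0 w -> S H w <= 2 * m w).
  { intros w Hw. unfold S, H. rewrite lsum_plus. pose proof (HSF w Hw). pose proof (HSG w Hw). pose proof (m_pos w Hw).
    unfold S in *. nra. }
  set (m' := ker nb b k0 H).
  assert (HmF : forall v, X1 v -> F v <= m' v).
  { intros v Hv. eapply Rle_trans; [apply HHF; assumption|]. unfold m'. apply (ker_ge X1 tch nb nb_spec1); auto. }
  assert (Hsum : forall w, X0 w -> lsum (ch w) m' = m w).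
  { intros w Hw.
    rewrite (lsum_ext _ _ (fun v => ker nb b k0 F v + c w * ker nb b k0 (one w) v)).
    - rewrite lsum_plus, lsum_scal. change (S (ker nb b k0 F) w + c w * s w = m w).
      pose proof (Hs w Hw). unfold c. field. lra.
    - intros v Hv. apply ch_spec in Hv; [|assumption]. destruct Hv as (Hv & Hpv). unfold m', H.
      rewrite (ker_plus X1 tch nb nb_spec1) by assumption. f_equal.
      rewrite <- (ker_scal X1 tch nb nb_spec1) by assumption.
      apply (ker_local X1 tch nb nb_spec1); [assumption|]. intros v' Hv'.
      assert (HX' : X1 v') by (eapply within_adj_X; eassumption).
      (* A source within [i - 1] steps of a child of [w] belongs to [w], since the [i]-neighbourhood
         of an interior child stays below a single parent. *)
      assert (Hloc : v' = vc (P v') -> P v' = w).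
      { intros He. destruct (Hvc (P v') (P_X _ HX')) as (_ & _ & Hi). rewrite <- Hpv. symmetry. apply Hi.
        rewrite <- He. apply within_sym; [apply adj_sym; assumption|]. eapply within_mono; [|eassumption]. lia. }
      unfold Gf, one. destruct eq_dec_classic as [He|He].
      + pose proof (Hloc He) as Hp. rewrite Hp in He |- *. destruct eq_dec_classic; [lra|contradiction].
      + destruct eq_dec_classic as [He'|]; [|lra]. exfalso. apply He.
        destruct (Hvc w Hw) as (_ & Hpc & _). congruence. }
  assert (Hlow : forall v, X1 v -> eps * m (P v) <= m' v).
  { intros v Hv. pose proof (HFe v Hv). pose proof (HmF v Hv). lra. }
  exists m'. split; [|split; [|split]].
  - intros v Hv. split; [apply Hlow; assumption|].
    pose proof (P_X v Hv) as Hw. pose proof (Hsum _ Hw) as HS. pose proof (ch_len _ Hw) as Hl.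
    pose proof (ch_NoDup _ Hw) as Hn.
    assert (Hin : In v (ch (P v))) by (apply ch_spec; auto).
    (* The floor at a second child keeps the mass of [v] away from the whole mass of its parent. *)
    assert (exists v2, In v2 (ch (P v)) /\ v2 <> v) as (v2 & Hin2 & Hne).
    { destruct (ch (P v)) as [|x [|y l]]; simpl in Hl; try lia.
      destruct (classic (x = v)) as [->|]; [|exists x; simpl; auto].
      exists y. split; [simpl; auto|]. intros ->. inversion Hn as [|? ? Hx _]. apply Hx. left. reflexivity. }
    assert (lsum [v; v2] m' <= lsum (ch (P v)) m').
    { apply lsum_incl.
      - constructor; [simpl; intuition|constructor; [simpl; tauto|constructor]].
      - intros z [<-|[<-|[]]]; assumption.
      - intros y Hy. apply ch_spec in Hy; [|assumption]. unfold m'. apply (ker_nonneg X1 tch nb nb_spec1); tauto. }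
    unfold lsum in H0 at 1; simpl in H0. apply ch_spec in Hin2; [|assumption]. destruct Hin2 as (HX2 & HP2).
    pose proof (Hlow v2 HX2) as Hl2. rewrite HP2 in Hl2. lra.
  - intros v' v (Hv' & Hv & Ht). unfold m' at 1.
    eapply Rle_trans; [apply (ker_slow X1 tch nb tch_sym nb_spec1 b k0 H v v'); auto|].
    assert (/ b ^ Datatypes.S k0 * avgn nb (Datatypes.S k0) H v' <= m' v').
    { rewrite <- HRi. eapply Rle_trans; [|apply Hlow; assumption].
      assert (avgn nb i H v' <= S (avgn nb i H) (P v')).
      { apply lsum_In_le; [|apply ch_spec; auto]. intros y Hy. apply ch_spec in Hy; [|auto].
        apply (avgn_nonneg X1 tch nb nb_spec1); tauto. }
      assert (S (avgn nb i H) (P v') <= INR D ^ i * (INR D ^ M * (a ^ M * (2 * m (P v'))))).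
      { apply S_avgn_le; auto; lra. }
      assert (0 < / b ^ i) by (apply Rinv_0_lt_compat, pow_lt; assumption).
      apply Rle_trans with (/ b ^ i * (INR D ^ i * (INR D ^ M * (a ^ M * (2 * m (P v')))))).
      - apply Rmult_le_compat_l; lra.
      - replace (/ b ^ i * (INR D ^ i * (INR D ^ M * (a ^ M * (2 * m (P v'))))))
          with (/ b ^ i * (INR D ^ i * INR D ^ M * (2 * a ^ M)) * m (P v')) by ring.
        apply Rmult_le_compat_r; [apply Rlt_le, m_pos; auto|assumption]. }
    fold m'. rewrite a_def. nra.
  - assumption.
  - intros u v Hv Hu. eapply Rle_trans; [|apply HmF; assumption]. unfold F.
    pose proof (m_pos _ (P_X v Hv)).
    assert (m u * Phi u v <= lsum (bl nb Q (P v)) (fun u => m u * Phi u v)).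
    { apply (lsum_In_le _ (fun u => m u * Phi u v)).
      - intros y Hy. apply Rmult_le_pos; [|auto]. apply Rlt_le, m_pos. apply (HFX (P v)); auto.
      - apply (bl_spec X0 tch nb tch_refl0 nb_spec0); [auto|]. apply within_sym; [apply adj_sym; assumption|assumption]. }
    nra.
Qed.
End Step.

(** * Masses on all levels *)

(* One coordinate of the diagonal argument. *)
Lemma cluster_step (Good : R -> nat -> Prop) (F : nat -> R) (lo hi : R) (N : nat) :
  (forall eta eta' J, eta <= eta' -> Good eta J -> Good eta' J) ->
  (forall eta n0, 0 < eta -> exists J, (n0 <= J)%nat /\ Good eta J) ->
  (forall J, (N <= J)%nat -> lo <= F J <= hi) ->
  exists x, forall eta n0, 0 < eta -> exists J, (n0 <= J)%nat /\ Good eta J /\ Rabs (F J - x) < eta.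
Proof.
  intros Hmono Hg Hb.
  destruct (choice (fun k J => (k <= J)%nat /\ (N <= J)%nat /\ Good (/ INR (S k)) J)) as (J & HJ).
  { intros k. destruct (Hg (/ INR (S k)) (k + N)%nat) as (J & HJ & HG).
    - apply Rinv_0_lt_compat. apply lt_0_INR. lia.
    - exists J. split; [lia|split; [lia|assumption]]. }
  destruct (Bolzano_Weierstrass (fun k => F (J k)) (fun x => lo <= x <= hi)) as (x & Hx).
  - apply compact_P3.
  - intros k. apply Hb. apply HJ.
  - exists x. intros eta n0 He.
    destruct (archimed_cor1 eta He) as (k0 & Hk0 & Hk0').
    destruct (Hx (fun y => Rabs (y - x) < eta) (n0 + k0)%nat) as (k & Hk & HF).
    { exists (mkposreal eta He). intros y Hy. exact Hy. }
    exists (J k). destruct (HJ k) as (H1 & H2 & H3). split; [lia|]. split; [|exact HF].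
    eapply Hmono; [|exact H3]. apply Rle_trans with (/ INR k0); [|lra].
    apply Rinv_le_contravar; [apply lt_0_INR; lia|apply le_INR; lia].
Qed.

(** No subsequence is extracted. The limits are chosen one coordinate at a time so that, for every
    tolerance, arbitrarily large [J] stay close to all limits chosen so far; [pre n] lists the first
    [n] of them. *)
Lemma diagonal_limit {V : Type} (en : nat -> V) (F : nat -> V -> R) :
  (forall v, exists k, en k = v) ->
  (forall v, exists lo hi N, forall J, (N <= J)%nat -> lo <= F J v <= hi) ->
  exists m : V -> R, forall (l : list V) eta n0, 0 < eta ->
    exists J, (n0 <= J)%nat /\ forall v, In v l -> Rabs (F J v - m v) < eta.
Proof.
  intros Hen Hb.
  set (good := fun (s : list R) eta J => forall k, (k < length s)%nat -> Rabs (F J (en k) - nth k s 0) < eta).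
  set (ok := fun s => forall eta n0, 0 < eta -> exists J, (n0 <= J)%nat /\ good s eta J).
  assert (Hstep : forall s, exists x, ok s -> ok (s ++ [x])).
  { intros s. destruct (classic (ok s)) as [Hs|Hs]; [|exists 0; tauto].
    destruct (Hb (en (length s))) as (lo & hi & N & HN).
    destruct (cluster_step (good s) (fun J => F J (en (length s))) lo hi N) as (x & Hx).
    - intros eta eta' J Hle Hg k Hk. specialize (Hg k Hk). lra.
    - exact Hs.
    - exact HN.
    - exists x. intros _ eta n0 He. destruct (Hx eta n0 He) as (J & HJ & Hg & HF).
      exists J. split; [assumption|]. intros k Hk. rewrite length_app in Hk; simpl in Hk.
      destruct (Nat.eq_dec k (length s)) as [->|Hne].
      + rewrite nth_middle. assumption.
      + rewrite app_nth1 by lia. apply Hg. lia. }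
  destruct (choice _ Hstep) as (nx & Hnx).
  set (pre := fun n => Nat.iter n (fun s => s ++ [nx s]) []).
  assert (Hpre : forall n, ok (pre n)).
  { induction n as [|n IH].
    - intros eta n0 He. exists n0. split; [lia|]. intros k Hk. simpl in Hk. lia.
    - apply Hnx. exact IH. }
  assert (Hlen : forall n, length (pre n) = n).
  { induction n as [|n IH]; [reflexivity|]. change (pre (S n)) with (pre n ++ [nx (pre n)]).
    rewrite length_app, IH. simpl. lia. }
  assert (Hnth : forall n k, (k < n)%nat -> nth k (pre n) 0 = nx (pre k)).
  { induction n as [|n IH]; intros k Hk; [lia|]. change (pre (S n)) with (pre n ++ [nx (pre n)]).
    destruct (Nat.eq_dec k n) as [->|Hne].
    - rewrite <- (Hlen n) at 1. apply nth_middle.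
    - rewrite app_nth1 by (rewrite Hlen; lia). apply IH. lia. }
  destruct (choice (fun v k => en k = v) Hen) as (idx & Hidx).
  exists (fun v => nx (pre (idx v))). intros l eta n0 He.
  assert (exists n, forall v, In v l -> (idx v < n)%nat) as (n & Hn).
  { clear - l. induction l as [|x l (n & IH)]; [exists 0%nat; intros ? []|].
    exists (S (n + idx x)). intros v [<-|Hv]; [lia|]. specialize (IH v Hv). lia. }
  destruct (Hpre n eta n0 He) as (J & HJ & Hg). exists J. split; [assumption|]. intros v Hv.
  specialize (Hn v Hv). specialize (Hg (idx v)). rewrite Hlen, Hnth, Hidx in Hg by assumption. auto.
Qed.

(** Comparability of touching pieces, the bounds by the parent and the demand of the cutoffs are
    inequalities of this shape between two masses, hence survive the limit. *)
Lemma le_by_limit (c x y : R) : 0 <= c ->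
  (forall eta, 0 < eta -> exists x' y', Rabs (x' - x) < eta /\ Rabs (y' - y) < eta /\ x' <= c * y') -> x <= c * y.
Proof.
  intros Hc H. apply Rnot_lt_le. intros Hlt.
  set (e := (x - c * y) / (2 * (1 + c))).
  assert (He : 0 < e) by (apply Rdiv_lt_0_compat; lra).
  destruct (H e He) as (x' & y' & H1 & H2 & H3).
  apply Rabs_def2 in H1. apply Rabs_def2 in H2.
  assert (e * (2 * (1 + c)) = x - c * y) by (unfold e; field; lra). nra.
Qed.

Section Mass.
Context {V : Type} (L : Z -> V -> Prop) (tch : V -> V -> Prop) (nb ch : V -> list V) (P : V -> V).
Context (D Bn M i Q : nat).
Hypothesis L_inj : forall j j' v, L j v -> L j' v -> j = j'.
Hypothesis tch_sym : forall v v', tch v v' -> tch v' v.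
Hypothesis tch_refl : forall j v, L j v -> tch v v.
Hypothesis nb_spec : forall j v, L j v -> forall v', In v' (nb v) <-> L j v' /\ tch v v'.
Hypothesis nb_NoDup : forall v, NoDup (nb v).
Hypothesis nb_len : forall j v, L j v -> (length (nb v) <= D)%nat.
Hypothesis P_L : forall j v, L (j + 1)%Z v -> L j (P v).
Hypothesis ch_spec : forall j w, L j w -> forall v, In v (ch w) <-> L (j + 1)%Z v /\ P v = w.
Hypothesis ch_NoDup : forall w, NoDup (ch w).
Hypothesis ch_len : forall j w, L j w -> (2 <= length (ch w) <= Bn)%nat.
Hypothesis contract : forall j v v', L (j + 1)%Z v ->
  within (adj (L (j + 1)%Z) tch) i v v' -> within (adj (L j) tch) M (P v) (P v').
Hypothesis interior : forall j w, L j w -> exists c, L (j + 1)%Z c /\ P c = w /\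
  forall v', within (adj (L (j + 1)%Z) tch) i c v' -> P v' = w.
Context (Phi : V -> V -> R) (a b eps delta tau : R).
Hypothesis Phi_pos : forall u v, 0 <= Phi u v.
Hypothesis Phi_sum : forall j u w, L j u -> L j w -> lsum (ch w) (Phi u) <= delta.
Hypothesis D_pos : (1 <= D)%nat.
Hypothesis i_pos : (1 <= i)%nat.
Hypothesis b_large : 2 * INR D <= b.
Hypothesis a_def : a = 2 * b.
Hypothesis tau_def : tau = / (4 * INR D ^ M * a ^ M).
Hypothesis eps_pos : 0 < eps.
Hypothesis eps_small : eps * INR Bn <= tau / 2.
Hypothesis delta_small : INR D ^ Q * a ^ Q * delta <= tau / 2.
Hypothesis tail_small : / b ^ i * (INR D ^ i * INR D ^ M * (2 * a ^ M)) <= eps.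
Context (en : nat -> V) (ref : V).
Hypothesis en_surj : forall v, exists k, en k = v.
Hypothesis ref_L : L 0%Z ref.
Hypothesis common : forall j v, L j v -> exists k k', Nat.iter k P v = Nat.iter k' P ref.

Definition good (g : V -> R) (j0 : Z) (k : nat) : Prop :=
  (forall j v, (j0 <= j <= j0 + Z.of_nat k)%Z -> L j v -> 0 < g v) /\
  (forall j v v', (j0 <= j <= j0 + Z.of_nat k)%Z -> adj (L j) tch v v' -> g v' <= a * g v) /\
  (forall j v, (j0 <= j < j0 + Z.of_nat k)%Z -> L (j + 1)%Z v -> eps * g (P v) <= g v <= (1 - eps) * g (P v)) /\
  (forall j w, (j0 <= j < j0 + Z.of_nat k)%Z -> L j w -> lsum (ch w) g = g w) /\
  (forall j u v, (j0 <= j < j0 + Z.of_nat k)%Z -> L (j + 1)%Z v ->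
      within (adj (L j) tch) Q u (P v) -> g u * Phi u v <= g v).

(** Constant mass on the top level [j0], then one application of [mass_step] per level. *)
Lemma good_exists j0 k : exists g, good g j0 k.
Proof.
  assert (HD : 1 <= INR D) by (apply (le_INR 1); assumption).
  induction k as [|k (g & H1 & H2 & H3 & H4 & H5)].
  - exists (fun _ => 1). unfold good. repeat split; intros; try lra; lia.
  - set (jk := (j0 + Z.of_nat k)%Z).
    assert (E : (j0 + Z.of_nat (S k) = jk + 1)%Z) by (unfold jk; lia).
    destruct (mass_step (L jk) (L (jk + 1)%Z) tch nb ch P D Bn M i Q) with (Phi := Phi) (m := g) (a := a) (b := b)
      (eps := eps) (delta := delta) (tau := tau) as (m' & G1 & G2 & G3 & G4); eauto.
    { intros w Hw. apply (H1 jk); [lia|assumption]. }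
    { intros w w' Hw. apply (H2 jk); [lia|assumption]. }
    set (g' := fun v => if excluded_middle_informative (L (jk + 1)%Z v) then m' v else g v).
    assert (E1 : forall v, L (jk + 1)%Z v -> g' v = m' v).
    { intros v Hv. unfold g'. destruct excluded_middle_informative; tauto. }
    assert (E2 : forall j v, L j v -> j <> (jk + 1)%Z -> g' v = g v).
    { intros j v Hv Hj. unfold g'. destruct excluded_middle_informative as [Hl|]; [|reflexivity].
      exfalso. apply Hj. eapply L_inj; eassumption. }
    exists g'. unfold good. rewrite E. split; [|split; [|split; [|split]]].
    + intros j v Hj Hv. destruct (Z.eq_dec j (jk + 1)) as [->|Hne].
      * rewrite E1 by assumption. pose proof (G1 v Hv). pose proof (H1 jk (P v) ltac:(lia) (P_L _ _ Hv)). nra.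
      * rewrite (E2 j) by assumption. apply (H1 j); [lia|assumption].
    + intros j v v' Hj Ha. destruct Ha as (Hv & Hv' & Ht). destruct (Z.eq_dec j (jk + 1)) as [->|Hne].
      * rewrite !E1 by assumption. apply G2. repeat split; assumption.
      * rewrite !(E2 j) by assumption. apply (H2 j); [lia|]. repeat split; assumption.
    + intros j v Hj Hv. pose proof (P_L _ _ Hv) as HPv. destruct (Z.eq_dec j jk) as [->|Hne].
      * rewrite (E1 v) by assumption. rewrite (E2 jk (P v)) by (assumption || lia). apply G1. assumption.
      * rewrite (E2 (j + 1)%Z v), (E2 j (P v)) by (assumption || lia). apply (H3 j); [lia|assumption].
    + intros j w Hj Hw. destruct (Z.eq_dec j jk) as [->|Hne].
      * rewrite (E2 jk) by (assumption || lia). rewrite <- G3 by assumption. apply lsum_ext.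
        intros v Hv. apply (ch_spec jk) in Hv; [|assumption]. apply E1; tauto.
      * rewrite (E2 j) by (assumption || lia). rewrite <- (H4 j) by (lia || assumption). apply lsum_ext.
        intros v Hv. apply (ch_spec j) in Hv; [|assumption]. apply (E2 (j + 1)%Z); [tauto|lia].
    + intros j u v Hj Hv Hu.
      assert (HuL : L j u).
      { apply (within_adj_X (L j) tch Q (P v)); [apply P_L; assumption|].
        apply within_sym; [apply adj_sym; assumption|assumption]. }
      destruct (Z.eq_dec j jk) as [->|Hne].
      * rewrite (E1 v) by assumption. rewrite (E2 jk u) by (assumption || lia). apply G4; assumption.
      * rewrite (E2 (j + 1)%Z v), (E2 j u) by (assumption || lia). apply (H5 j); [lia|assumption|assumption].
Qed.

Lemma good_iter g j0 k j v n : good g j0 k -> (j <= j0 + Z.of_nat k)%Z -> (j0 <= j - Z.of_nat n)%Z -> L j v ->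
  eps ^ n * g (Nat.iter n P v) <= g v <= g (Nat.iter n P v).
Proof.
  intros (H1 & _ & H3 & _) Hj Hn Hv. induction n as [|n IH]; simpl; [lra|].
  assert (IH' := IH ltac:(lia)).
  pose proof (iter_P_L L P P_L j v n Hv) as Hw. set (w := Nat.iter n P v) in *.
  assert (Hw' : L (j - Z.of_nat (S n) + 1)%Z w) by (replace (j - Z.of_nat (S n) + 1)%Z with (j - Z.of_nat n)%Z by lia; assumption).
  pose proof (H3 (j - Z.of_nat (S n))%Z w ltac:(lia) Hw') as H.
  assert (0 < g (P w)) by (apply (H1 (j - Z.of_nat (S n))%Z); [lia|apply P_L; assumption]).
  assert (0 < eps ^ n) by (apply pow_lt; assumption). split; [|nra].
  apply Rle_trans with (eps ^ n * (eps * g (P w))); [lra|]. nra.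
Qed.

(** The windows [[-J, J]] exhaust the levels. Dividing by the mass of [ref] keeps every value
    between two positive constants: [v] and [ref] have a common ancestor, and each generation
    multiplies the mass by a factor between [eps] and [1]. *)
Lemma mass_exists : exists m : V -> R,
  (forall j v, L j v -> 0 < m v) /\
  (forall j v v', adj (L j) tch v v' -> m v' <= a * m v) /\
  (forall j v, L (j + 1)%Z v -> eps * m (P v) <= m v <= (1 - eps) * m (P v)) /\
  (forall j w, L j w -> lsum (ch w) m = m w) /\
  (forall j u v, L (j + 1)%Z v -> within (adj (L j) tch) Q u (P v) -> m u * Phi u v <= m v).
Proof.
  assert (HD : 1 <= INR D) by (apply (le_INR 1); assumption).
  destruct (choice (fun J g => good g (- Z.of_nat J) (2 * J)) (fun J => good_exists _ _)) as (g & Hg).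
  set (F := fun J v => if excluded_middle_informative (exists j, L j v) then g J v / g J ref else 0).
  assert (HF : forall J j v, L j v -> F J v = g J v / g J ref).
  { intros J j v Hv. unfold F. destruct excluded_middle_informative as [|Hn]; [reflexivity|]. exfalso; eauto. }
  assert (Href : forall J, 0 < g J ref).
  { intros J. destruct (Hg J) as (H1 & _). apply (H1 0%Z); [lia|assumption]. }
  assert (Hbd : forall v, exists lo hi N, (forall j, L j v -> 0 < lo) /\ forall J, (N <= J)%nat -> lo <= F J v <= hi).
  { intros v. destruct (classic (exists j, L j v)) as [(j & Hv)|Hn].
    2:{ exists 0, 0, 0%nat. split; [intros j Hj; exfalso; eauto|]. intros J _. unfold F.
        destruct excluded_middle_informative; [tauto|lra]. }
    destruct (common j v Hv) as (k & k' & Hkk).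
    exists (eps ^ k), (/ eps ^ k'), (Z.to_nat (Z.abs j) + k + k')%nat. split; [intros; apply pow_lt; assumption|].
    intros J HJ. rewrite (HF J j v Hv). pose proof (Href J) as Hr.
    pose proof (good_iter _ _ _ j v k (Hg J) ltac:(lia) ltac:(lia) Hv) as A1.
    pose proof (good_iter _ _ _ 0%Z ref k' (Hg J) ltac:(lia) ltac:(lia) ref_L) as A2.
    rewrite Hkk in A1. set (c := g J (Nat.iter k' P ref)) in *.
    assert (0 < eps ^ k) by (apply pow_lt; assumption). assert (0 < eps ^ k') by (apply pow_lt; assumption).
    split.
    - apply Rle_div_r; [assumption|]. apply Rle_trans with (eps ^ k * c); [|lra]. apply Rmult_le_compat_l; lra.
    - apply Rle_div_l; [assumption|]. apply Rle_trans with c; [lra|].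
      apply Rmult_le_reg_l with (eps ^ k'); [assumption|]. rewrite <- Rmult_assoc, Rinv_r by lra. lra. }
  destruct (diagonal_limit en F en_surj) as (m & Hm).
  { intros v. destruct (Hbd v) as (lo & hi & N & _ & H). eauto. }
  assert (Hle : forall c x y jx jy n0, 0 <= c -> L jx x -> L jy y ->
    (forall J, (n0 <= J)%nat -> g J x <= c * g J y) -> m x <= c * m y).
  { intros c x y jx jy n0 Hc Hx Hy H. apply le_by_limit; [assumption|]. intros eta He.
    destruct (Hm [x; y] eta n0 He) as (J & HJ & HJv). exists (F J x), (F J y).
    split; [apply HJv; simpl; auto|]. split; [apply HJv; simpl; auto|].
    rewrite (HF J jx x Hx), (HF J jy y Hy). specialize (H J HJ). pose proof (Href J).
    unfold Rdiv. rewrite <- Rmult_assoc. apply Rmult_le_compat_r; [apply Rlt_le, Rinv_0_lt_compat; assumption|assumption]. }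
  assert (Hpos : forall j v, L j v -> 0 < m v).
  { intros j v Hv. destruct (Hbd v) as (lo & hi & N & Hlo & H). specialize (Hlo j Hv).
    destruct (Hm [v] (lo / 2) N) as (J & HJ & HJv); [lra|]. specialize (HJv v (or_introl eq_refl)).
    specialize (H J HJ). apply Rabs_def2 in HJv. lra. }
  exists m. split; [assumption|]. split; [|split; [|split]].
  - intros j v v' Ha. pose proof Ha as (Hv & Hv' & _).
    apply (Hle a v' v j j (Z.to_nat (Z.abs j))); [lra|assumption|assumption|].
    intros J HJ. destruct (Hg J) as (_ & H2 & _). apply (H2 j); [lia|assumption].
  - intros j v Hv. pose proof (P_L _ _ Hv) as HPv. split.
    + apply Rmult_le_reg_l with (/ eps); [apply Rinv_0_lt_compat; assumption|].
      rewrite <- Rmult_assoc, Rinv_l, Rmult_1_l by lra.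
      apply (Hle (/ eps) (P v) v j (j + 1)%Z (Z.to_nat (Z.abs j) + 1)%nat); try assumption.
      { apply Rlt_le, Rinv_0_lt_compat; assumption. }
      intros J HJ. destruct (Hg J) as (_ & _ & H3 & _). pose proof (H3 j v ltac:(lia) Hv) as H.
      apply Rmult_le_reg_l with eps; [assumption|]. rewrite <- Rmult_assoc, Rinv_r, Rmult_1_l by lra. lra.
    + assert (He : 0 <= 1 - eps).
      { destruct (Hg (Z.to_nat (Z.abs j) + 1)%nat) as (H1 & _ & H3 & _).
        pose proof (H3 j v ltac:(lia) Hv). pose proof (H1 j (P v) ltac:(lia) HPv). nra. }
      apply (Hle (1 - eps) v (P v) (j + 1)%Z j (Z.to_nat (Z.abs j) + 1)%nat); try assumption.
      intros J HJ. destruct (Hg J) as (_ & _ & H3 & _). apply (H3 j); [lia|assumption].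
  (* At an index [J] where [w] and all its children are within [e] of their limits the equation
     holds exactly, so the limits violate it by at most [e] times the number of these pieces; the
     defect was defined to exceed this. *)
  - intros j w Hw. apply Rminus_diag_uniq. apply NNPP. intros Hne.
    set (e := Rabs (lsum (ch w) m - m w) / (INR (length (ch w)) + 2)).
    pose proof (pos_INR (length (ch w))) as Hl.
    assert (He : 0 < e) by (apply Rdiv_lt_0_compat; [apply Rabs_pos_lt; assumption|lra]).
    destruct (Hm (w :: ch w) e (Z.to_nat (Z.abs j) + 1)%nat He) as (J & HJ & HJv).
    destruct (Hg J) as (_ & _ & _ & H4 & _).
    assert (HS : lsum (ch w) (F J) = F J w).
    { rewrite (HF J j w Hw), <- (H4 j w) by (lia || assumption). unfold Rdiv. rewrite Rmult_comm, <- lsum_scal.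
      apply lsum_ext. intros v Hv. apply (ch_spec j) in Hv; [|assumption]. rewrite (HF J (j + 1)%Z) by tauto. unfold Rdiv; ring. }
    assert (Hd : lsum (ch w) (F J) - lsum (ch w) m <= INR (length (ch w)) * e /\
                 lsum (ch w) m - lsum (ch w) (F J) <= INR (length (ch w)) * e).
    { assert (forall f h : V -> R, (forall v, In v (ch w) -> f v - h v <= e) ->
        lsum (ch w) f - lsum (ch w) h <= INR (length (ch w)) * e) as Hgen.
      { intros f h Hfh. replace (lsum (ch w) f - lsum (ch w) h) with (lsum (ch w) (fun v => f v + -1 * h v)).
        - apply lsum_const_le. intros v Hv. specialize (Hfh v Hv). lra.
        - rewrite lsum_plus, lsum_scal. ring. }
      split; apply Hgen; intros v Hv; specialize (HJv v (or_intror Hv)); apply Rabs_def2 in HJv; lra. }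
    assert (Hw' := HJv w (or_introl eq_refl)). apply Rabs_def2 in Hw'.
    assert (Rabs (lsum (ch w) m - m w) <= (INR (length (ch w)) + 1) * e).
    { apply Rabs_le. split; lra. }
    assert (e * (INR (length (ch w)) + 2) = Rabs (lsum (ch w) m - m w)) by (unfold e; field; lra). lra.
  - intros j u v Hv Hu.
    assert (HuL : L j u).
    { apply (within_adj_X (L j) tch Q (P v)); [apply P_L; assumption|].
        apply within_sym; [apply adj_sym; assumption|assumption]. }
    destruct (Req_dec (Phi u v) 0) as [->|Hne]; [pose proof (Hpos _ _ Hv); lra|].
    assert (Hp : 0 < Phi u v) by (pose proof (Phi_pos u v); lra).
    apply Rmult_le_reg_r with (/ Phi u v); [apply Rinv_0_lt_compat; assumption|].
    rewrite Rmult_assoc, Rinv_r, Rmult_1_r by lra. rewrite Rmult_comm.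
    apply (Hle (/ Phi u v) u v j (j + 1)%Z (Z.to_nat (Z.abs j) + 1)%nat); try assumption.
    { apply Rlt_le, Rinv_0_lt_compat; assumption. }
    intros J HJ. destruct (Hg J) as (_ & _ & _ & _ & H5). pose proof (H5 j u v ltac:(lia) Hv Hu).
    apply Rmult_le_reg_l with (Phi u v); [assumption|]. rewrite <- Rmult_assoc, Rinv_r, Rmult_1_l by lra. lra.
Qed.
End Mass.

(** * The metric attached to a mass *)

Definition lmin {A : Type} (l : list A) (g : A -> R) : R :=
  epsilon (inhabits 0) (fun t => exists u, In u l /\ t = g u /\ forall u', In u' l -> g u <= g u').

Lemma lmin_spec {A : Type} (l : list A) (g : A -> R) : l <> [] ->
  exists u, In u l /\ lmin l g = g u /\ forall u', In u' l -> g u <= g u'.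
Proof.
  intros Hl. unfold lmin. apply epsilon_spec. destruct (list_argmin l g Hl) as (u & Hu & Hm). exists (g u), u. auto.
Qed.

Section Metric.
Context {G V : Type} (L : Z -> V -> Prop) (tch : V -> V -> Prop) (nb : V -> list V) (P : V -> V)
  (inc : V -> G -> Prop).
Context (M N2 Q T : nat).
Hypothesis tch_sym : forall v v', tch v v' -> tch v' v.
Hypothesis tch_refl : forall j v, L j v -> tch v v.
Hypothesis nb_spec : forall j v, L j v -> forall v', In v' (nb v) <-> L j v' /\ tch v v'.
Hypothesis P_L : forall j v, L (j + 1)%Z v -> L j (P v).
Hypothesis tch_P : forall j v v', adj (L (j + 1)%Z) tch v v' -> tch (P v) (P v').
Hypothesis contract : forall j v v', L (j + 1)%Z v ->
  within (adj (L (j + 1)%Z) tch) T v v' -> within (adj (L j) tch) M (P v) (P v').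
Hypothesis inc_P : forall j v x, L (j + 1)%Z v -> inc v x -> inc (P v) x.
Hypothesis inc_tch : forall j v v' x, L j v -> L j v' -> inc v x -> inc v' x -> tch v v'.
Hypothesis Q_def : Q = S N2.
Hypothesis T_large : (Q + M <= T)%nat.
Context (sg : V -> R) (A eps th C0 : R) (f : V -> V -> R).
Hypothesis A1 : 1 <= A.
Hypothesis th_bd : 0 < th < 1.
Hypothesis eps_pos : 0 < eps.
(** The factor that [lip_within] yields for [Q + 1] steps: a full penalty [C0 * B * sg u] pays for
    the way from a candidate [u] to a parent one step out of its reach. *)
Hypothesis C0_def : C0 = INR (S Q) * A ^ S Q.
Hypothesis sg_pos : forall j v, L j v -> 0 < sg v.
Hypothesis sg_slow : forall j v v', adj (L j) tch v v' -> sg v' <= A * sg v.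
Hypothesis sg_P : forall j v, L (j + 1)%Z v -> eps * sg (P v) <= sg v <= th * sg (P v).
Hypothesis f_le1 : forall u v, f u v <= 1.
Hypothesis f_1 : forall v, f (P v) v = 1.
Hypothesis f_0 : forall j u v, L (j + 1)%Z v -> ~ within (adj (L j) tch) N2 u (P v) -> f u v = 0.
Hypothesis f_sg : forall j u v v', adj (L (j + 1)%Z) tch v v' -> within (adj (L j) tch) Q u (P v) ->
  C0 * sg u * Rabs (f u v - f u v') <= sg v.

Lemma adj_P j v v' : adj (L (j + 1)%Z) tch v v' -> adj (L j) tch (P v) (P v').
Proof. intros H. pose proof H as (H1 & H2 & _). split; [|split]; [apply P_L; assumption|apply P_L; assumption|]. eapply tch_P; eassumption. Qed.

Lemma iter_L j v k : L (j + Z.of_nat k)%Z v -> L j (Nat.iter k P v).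
Proof. apply iter_lev. assumption. Qed.

Lemma iter_adj j v v' k : adj (L (j + Z.of_nat k)%Z) tch v v' -> adj (L j) tch (Nat.iter k P v) (Nat.iter k P v').
Proof. apply iter_touch; assumption. Qed.

Lemma iter_inc j v x k : L (j + Z.of_nat k)%Z v -> inc v x -> inc (Nat.iter k P v) x.
Proof. apply (iter_vertex L); assumption. Qed.

Lemma sg_iter j v k : L (j + Z.of_nat k)%Z v ->
  eps ^ k * sg (Nat.iter k P v) <= sg v <= th ^ k * sg (Nat.iter k P v).
Proof.
  revert j. induction k as [|k IH]; intros j H; simpl; [lra|].
  replace (j + Z.of_nat (S k))%Z with (j + 1 + Z.of_nat k)%Z in H by lia.
  pose proof (IH _ H) as (I1 & I2). pose proof (sg_P _ _ (iter_L _ _ _ H)) as (J1 & J2).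
  assert (0 < eps ^ k) by (apply pow_lt; assumption). assert (0 < th ^ k) by (apply pow_lt; lra).
  split.
  - eapply Rle_trans; [|exact I1]. replace (eps * eps ^ k * sg (P (Nat.iter k P v))) with (eps ^ k * (eps * sg (P (Nat.iter k P v)))) by ring.
    apply Rmult_le_compat_l; lra.
  - eapply Rle_trans; [exact I2|]. replace (th * th ^ k * sg (P (Nat.iter k P v))) with (th ^ k * (th * sg (P (Nat.iter k P v)))) by ring.
    apply Rmult_le_compat_l; lra.
Qed.

Lemma sg_within j v v' k : L j v -> within (adj (L j) tch) k v v' -> sg v' <= A ^ k * sg v.
Proof.
  intros Hv H. apply (within_ratio (adj (L j) tch) sg A); [assumption| |apply Rlt_le; eapply sg_pos; eassumption|assumption].
  intros x y Hxy. eapply sg_slow; eassumption.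
Qed.

Lemma lip_within j (h : V -> R) B k v v' : 0 <= B ->
  (forall w w', adj (L j) tch w w' -> Rabs (h w' - h w) <= B * sg w) ->
  L j v -> within (adj (L j) tch) k v v' -> Rabs (h v' - h v) <= B * (INR k * A ^ k) * sg v.
Proof.
  intros HB Hh Hv. revert v'. induction k as [|k IH]; intros v' H.
  - simpl in H. subst. rewrite Rminus_diag, Rabs_R0. simpl. lra.
  - assert (HA : 1 <= A ^ k) by (apply pow_R1_Rle; assumption).
    assert (Hs : 0 < sg v) by (eapply sg_pos; eassumption).
    assert (Hmono : B * (INR k * A ^ k) * sg v + B * (A ^ k * sg v) <= B * (INR (S k) * A ^ S k) * sg v).
    { rewrite S_INR. simpl. replace (B * (INR k * A ^ k) * sg v + B * (A ^ k * sg v)) with (B * sg v * ((INR k + 1) * A ^ k)) by ring.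
      replace (B * ((INR k + 1) * (A * A ^ k)) * sg v) with (B * sg v * ((INR k + 1) * A ^ k * A)) by ring.
      pose proof (pos_INR k). apply Rmult_le_compat_l; [apply Rmult_le_pos; lra|].
      rewrite <- (Rmult_1_r ((INR k + 1) * A ^ k)) at 1. apply Rmult_le_compat_l; [|assumption].
      apply Rmult_le_pos; lra. }
    assert (0 <= B * (A ^ k * sg v)) by (apply Rmult_le_pos; [assumption|]; apply Rmult_le_pos; lra).
    destruct H as [H|(u & Hu & Ha)].
    + specialize (IH _ H). lra.
    + specialize (IH _ Hu). specialize (Hh _ _ Ha). pose proof (sg_within j v u k Hv Hu).
      assert (B * sg u <= B * (A ^ k * sg v)) by (apply Rmult_le_compat_l; assumption).
      pose proof (Rabs_triang (h v' - h u) (h u - h v)) as Ht.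
      replace (h v' - h u + (h u - h v)) with (h v' - h v) in Ht by ring. lra.
Qed.

(* A test function is carried one level down: it follows the values of the nearby ancestors [u], penalised where
   the cutoff [f u] has dropped below [1]. *)
Definition ext (B : R) (h : V -> R) (v : V) : R :=
  lmin (bl nb Q (P v)) (fun u => h u + C0 * B * sg u * (1 - f u v)).

Section Ext.
Context (j : Z) (h : V -> R) (B : R).
Hypothesis B_pos : 0 <= B.
Hypothesis h_lip : forall w w', adj (L j) tch w w' -> Rabs (h w' - h w) <= B * sg w.

Lemma bl_L k w v : L j w -> (In v (bl nb k w) <-> within (adj (L j) tch) k w v).
Proof. apply (bl_spec (L j) tch nb); [intros; eapply tch_refl; eassumption|apply nb_spec]. Qed.

Lemma C0_pos : 0 < C0.
Proof. rewrite C0_def. apply Rmult_lt_0_compat; [apply lt_0_INR; lia|apply pow_lt; lra]. Qed.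

Lemma ext_spec v : L (j + 1)%Z v -> exists u, within (adj (L j) tch) Q (P v) u /\
  ext B h v = h u + C0 * B * sg u * (1 - f u v) /\
  forall u', within (adj (L j) tch) Q (P v) u' -> ext B h v <= h u' + C0 * B * sg u' * (1 - f u' v).
Proof.
  intros Hv. pose proof (P_L _ _ Hv) as Hp.
  destruct (lmin_spec (bl nb Q (P v)) (fun u => h u + C0 * B * sg u * (1 - f u v))) as (u & Hu & He & Hm).
  - intros E. assert (In (P v) (bl nb Q (P v))) as Hi by (apply bl_L; [assumption|apply within_refl]).
    rewrite E in Hi. destruct Hi.
  - exists u. split; [apply bl_L; assumption|]. split; [exact He|]. intros u' Hu'. unfold ext. rewrite He.
    apply Hm. apply bl_L; assumption.
Qed.

Lemma ext_pen u v : L j u -> 0 <= C0 * B * sg u * (1 - f u v).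
Proof.
  intros Hu. pose proof C0_pos. pose proof (sg_pos _ _ Hu). pose proof (f_le1 u v).
  repeat apply Rmult_le_pos; lra.
Qed.

(** The parent is itself a candidate and carries no penalty. *)
Lemma ext_le v : L (j + 1)%Z v -> ext B h v <= h (P v).
Proof.
  intros Hv. destruct (ext_spec v Hv) as (u & _ & _ & H).
  specialize (H (P v) (within_refl _ _ _)). rewrite f_1 in H. lra.
Qed.

Lemma ext_ge_near v : L (j + 1)%Z v -> exists u, within (adj (L j) tch) Q (P v) u /\ h u <= ext B h v.
Proof.
  intros Hv. destruct (ext_spec v Hv) as (u & Hu & He & _). exists u. split; [assumption|].
  assert (L j u) by (eapply within_adj_X; [apply P_L; exact Hv|eassumption]).
  pose proof (ext_pen u v H). lra.
Qed.

Lemma ext_ge v : L (j + 1)%Z v -> h (P v) - B * (INR Q * A ^ Q) * sg (P v) <= ext B h v.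
Proof.
  intros Hv. destruct (ext_ge_near v Hv) as (u & Hu & He).
  pose proof (lip_within j h B Q (P v) u B_pos h_lip (P_L _ _ Hv) Hu) as H. apply Rcomplements.Rabs_le_between in H. lra.
Qed.

(* A minimiser for [v] that is no candidate for [v'] sits at distance exactly [Q], where [f] vanishes,
   so its penalty already pays for the way to [P v']. *)
Lemma ext_lip v v' : adj (L (j + 1)%Z) tch v v' -> Rabs (ext B h v' - ext B h v) <= B * sg v.
Proof.
  assert (Hone : forall v v', adj (L (j + 1)%Z) tch v v' -> ext B h v' <= ext B h v + B * sg v /\ ext B h v' <= ext B h v + B * sg v').
  { clear v v'. intros v v' Ha. pose proof Ha as (Hv & Hv' & Ht).
    pose proof (sg_pos _ _ Hv) as Hsv. pose proof (sg_pos _ _ Hv') as Hsv'. pose proof C0_pos as HC.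
    destruct (ext_spec v Hv) as (u & Hu & He & _). destruct (ext_spec v' Hv') as (_ & _ & _ & Hm).
    assert (HuL : L j u) by (eapply within_adj_X; [apply P_L; exact Hv|eassumption]).
    pose proof (sg_pos _ _ HuL) as Hsu.
    destruct (classic (within (adj (L j) tch) Q (P v') u)) as [Hu'|Hu'].
    - specialize (Hm u Hu').
      assert (HB : forall s, C0 * sg u * Rabs (f u v - f u v') <= s -> ext B h v' <= ext B h v + B * s).
      { intros s Hs. rewrite He. eapply Rle_trans; [exact Hm|].
        assert (C0 * sg u * (f u v - f u v') <= s).
        { eapply Rle_trans; [|exact Hs]. apply Rmult_le_compat_l; [nra|apply Rle_abs]. }
        assert (B * (C0 * sg u * (f u v - f u v')) <= B * s) by (apply Rmult_le_compat_l; assumption). lra. }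
      split; apply HB.
      + apply (f_sg j); [assumption|]. apply within_sym; [apply adj_sym; assumption|assumption].
      + rewrite Rabs_minus_sym. apply (f_sg j); [apply adj_sym; assumption|]. apply within_sym; [apply adj_sym; assumption|assumption].
    - assert (Hf : f u v = 0).
      { apply (f_0 j); [assumption|]. intros Hw. apply Hu'. rewrite Q_def.
        apply (within_trans (adj (L j) tch) 1 N2 _ (P v)); [apply within_step; apply adj_P; apply adj_sym; assumption|].
        apply within_sym; [apply adj_sym; assumption|assumption]. }
      assert (Hw : within (adj (L j) tch) (S Q) u (P v')).
      { right. exists (P v). split; [apply within_sym; [apply adj_sym; assumption|assumption]|apply adj_P; assumption]. }
      pose proof (lip_within j h B (S Q) u (P v') B_pos h_lip HuL Hw) as H.
      rewrite <- C0_def in H. apply Rcomplements.Rabs_le_between in H.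
      pose proof (ext_le v' Hv'). rewrite Hf in He.
      assert (0 <= B * sg v) by (apply Rmult_le_pos; lra). assert (0 <= B * sg v') by (apply Rmult_le_pos; lra).
      assert (C0 * B * sg u * (1 - 0) = B * C0 * sg u) by ring. lra. }
  intros Ha. apply Rabs_le. pose proof (Hone _ _ Ha) as (H1 & _).
  pose proof (Hone _ _ (adj_sym _ _ tch_sym _ _ Ha)) as (_ & H2). lra.
Qed.
End Ext.

Section Extend.
Context (j0 : Z) (h0 : V -> R) (B s : R).
Hypothesis B_pos : 0 <= B.
Hypothesis h0_lip : forall w w', adj (L j0) tch w w' -> Rabs (h0 w' - h0 w) <= B * sg w.
Hypothesis h0_bd : forall w, L j0 w -> 0 <= h0 w <= s.

Definition hk (k : nat) : V -> R := Nat.iter k (ext B) h0.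

Lemma hk_lip k w w' : adj (L (j0 + Z.of_nat k)%Z) tch w w' -> Rabs (hk k w' - hk k w) <= B * sg w.
Proof.
  revert w w'. induction k as [|k IH]; intros w w' Ha.
  - simpl in Ha. rewrite Z.add_0_r in Ha. apply h0_lip. assumption.
  - simpl. apply (ext_lip (j0 + Z.of_nat k)%Z); [assumption|exact IH|].
    replace (j0 + Z.of_nat k + 1)%Z with (j0 + Z.of_nat (S k))%Z by lia. assumption.
Qed.

Lemma hk_bd k w : L (j0 + Z.of_nat k)%Z w -> 0 <= hk k w <= s.
Proof.
  revert w. induction k as [|k IH]; intros w Hw.
  - simpl in Hw. rewrite Z.add_0_r in Hw. apply h0_bd. assumption.
  - replace (j0 + Z.of_nat (S k))%Z with (j0 + Z.of_nat k + 1)%Z in Hw by lia. simpl. split.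
    + destruct (ext_ge_near _ (hk k) B B_pos w Hw) as (u & Hu & He). eapply Rle_trans; [|exact He].
      apply IH. eapply within_adj_X; [apply P_L; exact Hw|exact Hu].
    + eapply Rle_trans; [apply (ext_le (j0 + Z.of_nat k)%Z); assumption|]. apply IH. apply P_L. assumption.
Qed.

(** A plateau is not eroded: the [T]-neighbourhood of [w] projects to within [M] of the parent,
    minimisers lie within [Q] of that, and [M + Q <= T] reproduces the radius at every
    generation. *)
Lemma hk_const k w : L (j0 + Z.of_nat k)%Z w ->
  (forall w', within (adj (L j0) tch) T (Nat.iter k P w) w' -> h0 w' = s) ->
  forall w', within (adj (L (j0 + Z.of_nat k)%Z) tch) T w w' -> hk k w' = s.
Proof.
  revert w. induction k as [|k IH]; intros w Hw Hs w' Hw'.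
  - simpl in *. rewrite Z.add_0_r in *. apply Hs. assumption.
  - assert (HwL : L (j0 + Z.of_nat (S k))%Z w') by (eapply within_adj_X; eassumption).
    apply Rle_antisym; [apply hk_bd; assumption|].
    replace (j0 + Z.of_nat (S k))%Z with (j0 + Z.of_nat k + 1)%Z in * by lia. simpl.
    destruct (ext_ge_near _ (hk k) B B_pos w' HwL) as (u & Hu & He). eapply Rle_trans; [|exact He]. right. symmetry.
    apply (IH (P w)).
    + apply P_L. assumption.
    + rewrite <- Nat.iter_succ_r. assumption.
    + apply (within_mono _ (M + Q)); [lia|]. apply within_trans with (P w'); [|assumption]. apply contract; assumption.
Qed.

(** Each generation moves the function by at most a fixed multiple of [sg], and [sg] shrinks by
    [th]; the geometric series is dominated by its coarsest term. *)
Lemma hk_drift k n v : L (j0 + Z.of_nat (k + n))%Z v ->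
  Rabs (hk (k + n) v - hk k (Nat.iter n P v)) <=
  B * (INR Q * A ^ Q) * sg (Nat.iter n P v) * ((1 - th ^ n) / (1 - th)).
Proof.
  intros Hv. revert k Hv. induction n as [|n IH]; intros k Hv.
  - rewrite Nat.add_0_r. simpl. rewrite Rminus_diag, Rabs_R0. unfold Rdiv. rewrite Rminus_diag. lra.
  - replace (k + S n)%nat with (S k + n)%nat in * by lia.
    pose proof (IH (S k) Hv) as H. set (w := Nat.iter n P v) in *.
    assert (HwL : L (j0 + Z.of_nat k + 1)%Z w).
    { apply iter_L. replace (j0 + Z.of_nat k + 1 + Z.of_nat n)%Z with (j0 + Z.of_nat (S k + n))%Z by lia. assumption. }
    change (hk k (Nat.iter (S n) P v)) with (hk k (P w)). change (sg (Nat.iter (S n) P v)) with (sg (P w)).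
    pose proof (ext_le (j0 + Z.of_nat k)%Z (hk k) B w HwL) as H1.
    pose proof (ext_ge (j0 + Z.of_nat k)%Z (hk k) B B_pos (hk_lip k) w HwL) as H2.
    change (ext B (hk k) w) with (hk (S k) w) in *.
    pose proof (sg_P _ _ HwL) as (_ & H3). pose proof (sg_pos _ _ (P_L _ _ HwL)) as H4.
    set (c := B * (INR Q * A ^ Q)) in *.
    assert (Hc : 0 <= c) by (unfold c; apply Rmult_le_pos; [assumption|]; apply Rmult_le_pos; [apply pos_INR|apply pow_le; lra]).
    assert (Hg : 0 <= (1 - th ^ n) / (1 - th)).
    { apply Rdiv_le_0_compat; [|lra]. assert (th ^ n <= 1) by (rewrite <- (pow1 n); apply pow_incr; lra). lra. }
    assert (H5 : c * sg w * ((1 - th ^ n) / (1 - th)) <= c * (th * sg (P w)) * ((1 - th ^ n) / (1 - th))).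
    { apply Rmult_le_compat_r; [assumption|]. apply Rmult_le_compat_l; assumption. }
    replace (c * sg (P w) * ((1 - th ^ S n) / (1 - th)))
      with (c * (th * sg (P w)) * ((1 - th ^ n) / (1 - th)) + c * sg (P w)) by (simpl; field; lra).
    apply Rabs_le. apply Rcomplements.Rabs_le_between in H. lra.
Qed.
End Extend.

(** * The distance and its two-sided bounds *)

Context (I : G -> Z).
Hypothesis cover : forall j x, exists v, L j v /\ inc v x.
(** Beyond level [I x] the vertex [x] is alone on its pieces. *)
Hypothesis resolve : forall j v x y, L j v -> inc v x -> inc v y -> x <> y -> (j <= I x)%Z.
Hypothesis common_pt : forall x y, exists j v, L j v /\ inc v x /\ inc v y.
Hypothesis separate : forall x y, x <> y -> exists j v v', L j v /\ L j v' /\ inc v x /\ inc v' y /\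
  ~ within (adj (L j) tch) (T + 2) v v'.

(* [rho] is the largest distance giving every piece [u] diameter at most [sg u]. *)
Definition lip (h : G -> R) : Prop :=
  forall j u x y, L j u -> inc u x -> inc u y -> Rabs (h x - h y) <= sg u.

Definition rho (x y : G) : R :=
  real (Lub_Rbar (fun t => exists h, lip h /\ t = Rabs (h x - h y))).

(** Some piece contains both points and bounds all the differences, so the supremum is finite and
    [real] loses nothing. *)
Lemma rho_lub x y : is_lub_Rbar (fun t => exists h, lip h /\ t = Rabs (h x - h y)) (Finite (rho x y)).
Proof.
  unfold rho. set (E := fun t => exists h, lip h /\ t = Rabs (h x - h y)).
  assert (H := Lub_Rbar_correct E). destruct (common_pt x y) as (j & v & Hv & Hx & Hy).
  assert (H0 : E 0).
  { exists (fun _ => 0). split; [|rewrite Rminus_diag, Rabs_R0; reflexivity].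
    intros j' u x' y' Hu _ _. rewrite Rminus_diag, Rabs_R0. apply Rlt_le. eapply sg_pos; eassumption. }
  destruct (Lub_Rbar E) as [l| |] eqn:El; [exact H| |].
  - exfalso. destruct H as (_ & H). specialize (H (Finite (sg v))). apply H.
    intros t (h & Hh & ->). simpl. apply (Hh j); assumption.
  - exfalso. destruct H as (H & _). apply (H 0 H0).
Qed.

Lemma rho_ge h x y : lip h -> Rabs (h x - h y) <= rho x y.
Proof. intros Hh. destruct (rho_lub x y) as (H & _). apply (H (Rabs (h x - h y))). eauto. Qed.

Lemma rho_le c x y : (forall h, lip h -> Rabs (h x - h y) <= c) -> rho x y <= c.
Proof. intros Hh. destruct (rho_lub x y) as (_ & H). apply (H (Finite c)). intros t (h & Hl & ->). simpl. auto. Qed.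

Lemma rho_piece j v x y : L j v -> inc v x -> inc v y -> rho x y <= sg v.
Proof. intros Hv Hx Hy. apply rho_le. intros h Hh. apply (Hh j); assumption. Qed.

Lemma rho_pseudo : (forall x y, 0 <= rho x y) /\ (forall x, rho x x = 0) /\ (forall x y, rho x y = rho y x) /\
  (forall x y z, rho x z <= rho x y + rho y z).
Proof.
  assert (Hl : lip (fun _ => 0)).
  { intros j' u x' y' Hu _ _. rewrite Rminus_diag, Rabs_R0. apply Rlt_le. eapply sg_pos; eassumption. }
  assert (H0 : forall x y, 0 <= rho x y).
  { intros x y. eapply Rle_trans; [|apply (rho_ge _ x y Hl)]. apply Rabs_pos. }
  split; [assumption|]. split; [|split].
  - intros x. apply Rle_antisym; [|apply H0]. apply rho_le. intros. rewrite Rminus_diag, Rabs_R0. lra.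
  - assert (forall x y, rho x y <= rho y x) as H.
    { intros x y. apply rho_le. intros h Hh. rewrite Rabs_minus_sym. apply rho_ge. assumption. }
    intros; apply Rle_antisym; apply H.
  - intros x y z. apply rho_le. intros h Hh. pose proof (rho_ge h x y Hh). pose proof (rho_ge h y z Hh).
    pose proof (Rabs_triang (h x - h y) (h y - h z)) as Ht.
    replace (h x - h y + (h y - h z)) with (h x - h z) in Ht by ring. lra.
Qed.

Definition pc (j : Z) (x : G) : V := proj1_sig (constructive_indefinite_description _ (cover j x)).
Lemma pc_spec j x : L j (pc j x) /\ inc (pc j x) x.
Proof. unfold pc. destruct constructive_indefinite_description; assumption. Qed.

(** What the test function of [rho_lower] can vary on a piece [u], in units of [sg u]: twice the
    drift and Lipschitz cost on fine pieces, and [A ^ S T] on coarse ones. *)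
Definition osc : R := 2 * (A * (INR Q * A ^ Q) / (1 - th) * A + A * A) + A ^ S T.

Lemma osc_pos : 0 < osc.
Proof.
  assert (0 < A ^ S T) by (apply pow_lt; lra). assert (0 <= A ^ Q) by (apply pow_le; lra). pose proof (pos_INR Q).
  assert (0 <= A * (INR Q * A ^ Q) / (1 - th) * A).
  { apply Rmult_le_pos; [|lra]. apply Rdiv_le_0_compat; [|lra]. apply Rmult_le_pos; [lra|]. apply Rmult_le_pos; assumption. }
  unfold osc. nra.
Qed.

(** The function that vanishes on one level-[j] piece through [x] and equals [s], the value of [sg]
    there, on all others is carried down by [ext]. It varies by at most [osc * sg u] on each piece
    [u], vanishes at [x] and equals [s] at [y]; divided by [osc] it competes in the supremum that
    defines [rho]. *)
Lemma rho_lower j v v' x y : L j v -> L j v' -> inc v x -> inc v' y ->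
  ~ within (adj (L j) tch) (T + 2) v v' -> / (osc * A) * sg v <= rho x y.
Proof.
  intros Hv Hv' Hx Hy Hfar.
  (* A vertex [z] is read at level [max (I z) j]. Below [I z] no piece holds [z] and another vertex,
     so a piece with two vertices is never finer than the levels at which they are read. *)
  set (kk := fun x => Z.to_nat (Z.max (I x) j - j)).
  set (vx := fun x => pc (j + Z.of_nat (kk x))%Z x).
  assert (HvxL : forall x, L (j + Z.of_nat (kk x))%Z (vx x)) by (intros; apply pc_spec).
  assert (Hvxi : forall x, inc (vx x) x) by (intros; apply pc_spec).
  set (an := fun x => Nat.iter (kk x) P (vx x)).
  assert (HanL : forall x, L j (an x)) by (intros; apply iter_L; apply HvxL).
  assert (Hani : forall x, inc (an x) x) by (intros; eapply iter_inc; [apply HvxL|apply Hvxi]).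
  set (w0 := an x). set (s := sg w0).
  assert (Hw0 : L j w0) by apply HanL. assert (Hs : 0 < s) by (eapply sg_pos; eassumption).
  set (h0 := fun w => if eq_dec_classic w w0 then 0 else s).
  assert (Hlip0 : forall w w', adj (L j) tch w w' -> Rabs (h0 w' - h0 w) <= A * sg w).
  { intros w w' Ha. pose proof Ha as (Hw & Hw' & _). pose proof (sg_pos _ _ Hw).
    assert (s <= A * s) by nra. unfold h0.
    destruct (eq_dec_classic w' w0) as [E1|]; destruct (eq_dec_classic w w0) as [E2|].
    - rewrite Rminus_diag, Rabs_R0. nra.
    - rewrite Rminus_0_l, Rabs_Ropp, Rabs_pos_eq by lra. unfold s. rewrite <- E1. eapply sg_slow; eassumption.
    - rewrite Rminus_0_r, Rabs_pos_eq by lra. rewrite E2. assumption.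
    - rewrite Rminus_diag, Rabs_R0. nra. }
  assert (Hbd0 : forall w, L j w -> 0 <= h0 w <= s).
  { intros w _. unfold h0. destruct eq_dec_classic; lra. }
  assert (HA0 : 0 <= A) by lra.
  set (H := fun z => hk h0 A (kk z) (vx z)).
  assert (HHbd : forall z, 0 <= H z <= s) by (intros z; apply (hk_bd j h0 A s HA0 Hbd0); apply HvxL).
  assert (Hconst : forall z, ~ within (adj (L j) tch) T (an z) w0 -> H z = s).
  { intros z Hz. apply (hk_const j h0 A s HA0 Hbd0 (kk z) (vx z)); [apply HvxL| |apply within_refl].
    intros w' Hw'. unfold h0. destruct eq_dec_classic as [->|]; [contradiction|reflexivity]. }
  assert (Hdrift : forall z k u, (k <= kk z)%nat -> L (j + Z.of_nat k)%Z u -> inc u z ->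
    Rabs (H z - hk h0 A k u) <= (A * (INR Q * A ^ Q) / (1 - th) * A + A * A) * sg u).
  { intros z k u Hk Hu Hiu. set (n := (kk z - k)%nat). assert (En : (kk z = k + n)%nat) by (unfold n; lia).
    pose proof (HvxL z) as HL. rewrite En in HL.
    pose proof (hk_drift j h0 A HA0 Hlip0 k n (vx z) HL) as Hd. rewrite <- En in Hd. fold (H z) in Hd.
    set (a := Nat.iter n P (vx z)) in *.
    assert (HaL : L (j + Z.of_nat k)%Z a).
    { apply iter_L. replace (j + Z.of_nat k + Z.of_nat n)%Z with (j + Z.of_nat (k + n))%Z by lia. assumption. }
    assert (Hai : inc a z).
    { eapply iter_inc; [|apply Hvxi]. replace (j + Z.of_nat (k + n))%Z with (j + Z.of_nat k + Z.of_nat n)%Z in HL by lia. exact HL. }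
    assert (Hadj : adj (L (j + Z.of_nat k)%Z) tch u a) by (repeat split; try assumption; eapply inc_tch; eassumption).
    pose proof (sg_slow _ _ _ Hadj) as Hsl. pose proof (hk_lip j h0 A HA0 Hlip0 k u a Hadj) as Hl.
    pose proof (sg_pos _ _ HaL). pose proof (sg_pos _ _ Hu).
    assert (0 <= A ^ Q) by (apply pow_le; lra). pose proof (pos_INR Q).
    assert (Hc : 0 <= A * (INR Q * A ^ Q)) by (apply Rmult_le_pos; [lra|apply Rmult_le_pos; assumption]).
    assert (Hth : 0 <= th ^ n) by (apply pow_le; lra).
    assert (Hfin : A * (INR Q * A ^ Q) * sg a * ((1 - th ^ n) / (1 - th)) <= A * (INR Q * A ^ Q) / (1 - th) * (A * sg u)).
    { unfold Rdiv. set (e := / (1 - th)). assert (0 < e) by (apply Rinv_0_lt_compat; lra).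
      replace (A * (INR Q * A ^ Q) * sg a * ((1 - th ^ n) * e)) with (A * (INR Q * A ^ Q) * e * (sg a * (1 - th ^ n))) by ring.
      apply Rmult_le_compat_l; [apply Rmult_le_pos; lra|]. nra. }
    pose proof (Rabs_triang (H z - hk h0 A k a) (hk h0 A k a - hk h0 A k u)) as Ht.
    replace (H z - hk h0 A k a + (hk h0 A k a - hk h0 A k u)) with (H z - hk h0 A k u) in Ht by ring.
    assert (A * sg u <= A * A * sg u) by nra. lra. }
  assert (Hosc : forall j' u x' y', L j' u -> inc u x' -> inc u y' -> Rabs (H x' - H y') <= osc * sg u).
  { intros j' u x' y' Hu Hx' Hy'. pose proof (sg_pos _ _ Hu) as Hsu.
    destruct (classic (x' = y')) as [->|Hne].
    { rewrite Rminus_diag, Rabs_R0. pose proof osc_pos. nra. }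
    assert (HAT : 0 < A ^ S T) by (apply pow_lt; lra).
    set (c1 := A * (INR Q * A ^ Q) / (1 - th) * A + A * A) in *.
    assert (Hc1 : 0 <= c1).
    { unfold c1. assert (0 <= A ^ Q) by (apply pow_le; lra). pose proof (pos_INR Q).
      assert (0 <= A * (INR Q * A ^ Q) / (1 - th) * A).
      { apply Rmult_le_pos; [|lra]. apply Rdiv_le_0_compat; [|lra]. apply Rmult_le_pos; [lra|]. apply Rmult_le_pos; assumption. }
      nra. }
    destruct (Z_le_dec j j') as [Hj|Hj].
    (* Pieces at level [j] or finer: both values are compared, through the drift, with the extended
       function at [u] itself. *)
    - set (k := Z.to_nat (j' - j)). assert (Ek : j' = (j + Z.of_nat k)%Z) by (unfold k; lia). rewrite Ek in Hu.
      assert (Hkx : (k <= kk x')%nat).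
      { pose proof (resolve _ u x' y' Hu Hx' Hy' Hne). unfold kk. lia. }
      assert (Hky : (k <= kk y')%nat).
      { pose proof (resolve _ u y' x' Hu Hy' Hx' (not_eq_sym Hne)). unfold kk. lia. }
      pose proof (Hdrift x' k u Hkx Hu Hx') as D1. pose proof (Hdrift y' k u Hky Hu Hy') as D2.
      unfold osc. fold c1. apply Rcomplements.Rabs_le_between in D1. apply Rcomplements.Rabs_le_between in D2.
      assert (0 < A ^ S T * sg u) by (apply Rmult_lt_0_compat; assumption). apply Rabs_le. lra.
    - set (k := Z.to_nat (j - j')). assert (Ek : j = (j' + Z.of_nat k)%Z) by (unfold k; lia).
      (* Pieces coarser than level [j]: a value other than [s] puts the ancestor of [z] within [T]
         of [w0], so [u] is within [T + 1] of an ancestor of [w0], whose [sg] is at least [s]. *)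
      assert (Hcoarse : forall z, inc u z -> H z <> s -> s <= A ^ S T * sg u).
      { intros z Hz Hzs. assert (Hwi : within (adj (L j) tch) T (an z) w0) by (apply NNPP; intro; apply Hzs; apply Hconst; assumption).
        pose proof (HanL z) as HaL. rewrite Ek in HaL, Hwi. assert (Hw0' := Hw0). rewrite Ek in Hw0'.
        assert (Hwi' : within (adj (L j') tch) T (Nat.iter k P (an z)) (Nat.iter k P w0)).
        { revert Hwi. apply within_map. intros a b. apply iter_adj. }
        assert (Hstep : within (adj (L j') tch) (1 + T) u (Nat.iter k P w0)).
        { apply within_trans with (Nat.iter k P (an z)); [|assumption]. apply within_step.
          split; [|split]; [assumption|apply iter_L; assumption|]. eapply inc_tch; [exact Hu|apply iter_L; exact HaL|exact Hz|].
          eapply iter_inc; [exact HaL|apply Hani]. }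
        pose proof (sg_within _ _ _ _ Hu Hstep) as Hr. pose proof (sg_iter _ _ _ Hw0') as (_ & Hi).
        assert (th ^ k <= 1) by (rewrite <- (pow1 k); apply pow_incr; lra).
        assert (0 < sg (Nat.iter k P w0)) by (eapply sg_pos; apply iter_L; exact Hw0').
        unfold s. change (1 + T)%nat with (S T) in Hr. nra. }
      assert (Hd : Rabs (H x' - H y') <= s) by (pose proof (HHbd x'); pose proof (HHbd y'); apply Rabs_le; lra).
      assert (Hsm : A ^ S T * sg u <= osc * sg u) by (apply Rmult_le_compat_r; [lra|]; unfold osc; fold c1; lra).
      destruct (Req_dec (H x') s) as [E1|E1].
      + destruct (Req_dec (H y') s) as [E2|E2].
        * rewrite E1, E2, Rminus_diag, Rabs_R0. pose proof osc_pos. nra.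
        * pose proof (Hcoarse y' Hy' E2). lra.
      + pose proof (Hcoarse x' Hx' E1). lra. }
  assert (Hl : lip (fun z => / osc * H z)).
  { intros j' u x' y' Hu Hx' Hy'. pose proof (Hosc j' u x' y' Hu Hx' Hy') as Ho. pose proof osc_pos as Hp.
    rewrite <- Rmult_minus_distr_l, Rabs_mult, (Rabs_pos_eq (/ osc)) by (apply Rlt_le, Rinv_0_lt_compat; assumption).
    apply Rmult_le_reg_l with osc; [assumption|]. rewrite <- Rmult_assoc, Rinv_r, Rmult_1_l by lra. assumption. }
  pose proof (rho_ge _ x y Hl) as Hr. cbv beta in Hr.
  assert (HHx : H x = 0).
  { apply Rle_antisym; [|apply HHbd].
    assert (Hle : forall k v, L (j + Z.of_nat k)%Z v -> hk h0 A k v <= h0 (Nat.iter k P v)).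
    { induction k as [|k IH]; intros u Hu; [simpl; lra|].
      replace (j + Z.of_nat (S k))%Z with (j + Z.of_nat k + 1)%Z in Hu by lia.
      eapply Rle_trans; [apply (ext_le (j + Z.of_nat k)%Z (hk h0 A k) A); exact Hu|]. rewrite Nat.iter_succ_r. apply IH. apply P_L. assumption. }
    eapply Rle_trans; [apply Hle; apply HvxL|]. fold (an x). fold w0. unfold h0. destruct eq_dec_classic; [lra|congruence]. }
  (* Of the [T + 2] steps, one is spent from [v] to the piece [an x] and one from [v'] to [an y];
     the remaining [T] are the radius of [hk_const]. *)
  assert (HHy : H y = s).
  { apply Hconst. intros Hw. apply Hfar. apply within_sym; [apply adj_sym; assumption|].
    replace (T + 2)%nat with (1 + (T + 1))%nat by lia.
    apply within_trans with (an y).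
    - apply within_step. repeat split; try assumption; [apply HanL|]. eapply inc_tch; [exact Hv'|apply HanL|exact Hy|apply Hani].
    - apply within_trans with w0; [assumption|]. apply within_step. repeat split; try assumption.
      eapply inc_tch; [exact Hw0|exact Hv|apply Hani|exact Hx]. }
  rewrite HHx, HHy, Rmult_0_r, Rminus_0_l, Rabs_Ropp, Rabs_pos_eq in Hr.
  2:{ apply Rmult_le_pos; [apply Rlt_le, Rinv_0_lt_compat, osc_pos|lra]. }
  eapply Rle_trans; [|exact Hr]. rewrite Rinv_mult. rewrite Rmult_assoc.
  apply Rmult_le_compat_l; [apply Rlt_le, Rinv_0_lt_compat, osc_pos|].
  apply Rmult_le_reg_l with A; [lra|]. rewrite <- Rmult_assoc, Rinv_r, Rmult_1_l by lra.
  apply (sg_slow j w0 v). repeat split; try assumption. eapply inc_tch; [exact Hw0|exact Hv|apply Hani|exact Hx].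
Qed.

Lemma rho_metric : is_metric rho.
Proof.
  destruct rho_pseudo as (H0 & Hr & Hs & Ht). split; [assumption|]. split; [|split; assumption].
  intros x y. split; [|intros ->; apply Hr]. intros E. apply NNPP. intros Hne.
  destruct (separate x y Hne) as (j & v & v' & Hv & Hv' & Hx & Hy & Hf).
  pose proof (rho_lower j v v' x y Hv Hv' Hx Hy Hf) as H. pose proof (sg_pos _ _ Hv). pose proof osc_pos.
  assert (0 < / (osc * A)) by (apply Rinv_0_lt_compat; nra). nra.
Qed.

(** Consecutive pieces share a vertex and not merely a point inside a cable, so [rho_piece] and the
    triangle inequality add up along the chain. *)
Lemma rho_upper j k v v' x y : L j v -> inc v x -> inc v' y ->
  within (fun a b => adj (L j) tch a b /\ exists z, inc a z /\ inc b z) k v v' ->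
  rho x y <= INR (S k) * A ^ k * sg v.
Proof.
  intros Hv Hx Hy Hw. revert v' y Hy Hw. induction k as [|k IH]; intros v' y Hy Hw.
  - simpl in Hw. subst. simpl. pose proof (rho_piece j v' x y Hv Hx Hy). lra.
  - pose proof (sg_pos _ _ Hv) as Hs. assert (HA : 1 <= A ^ k) by (apply pow_R1_Rle; assumption).
    assert (HI : 0 <= INR (S k)) by apply pos_INR.
    assert (Hmono : INR (S k) * A ^ k * sg v + A ^ S k * sg v <= INR (S (S k)) * A ^ S k * sg v).
    { rewrite (S_INR (S k)). simpl pow. assert (A ^ k <= A * A ^ k) by nra.
      assert (INR (S k) * A ^ k <= INR (S k) * (A * A ^ k)) by (apply Rmult_le_compat_l; assumption). nra. }
    assert (0 <= A ^ S k * sg v) by (apply Rmult_le_pos; [apply pow_le|]; lra).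
    destruct Hw as [Hw|(u & Hu & Ha & z & Hz & Hz')].
    + pose proof (IH v' y Hy Hw). lra.
    + pose proof (IH u z Hz Hu) as H1. pose proof Ha as (_ & Hv' & _).
      pose proof (rho_piece j v' z y Hv' Hz' Hy) as H2.
      assert (Hww : within (adj (L j) tch) (S k) v v').
      { right. exists u. split; [|assumption]. revert Hu. apply within_impl. tauto. }
      pose proof (sg_within _ _ _ _ Hv Hww). destruct rho_pseudo as (_ & _ & _ & Ht). pose proof (Ht x z y). lra.
Qed.
End Metric.

(** * Real powers *)

Lemma pow_le1 t k : 0 <= t <= 1 -> t ^ k <= 1.
Proof. intros H. rewrite <- (pow1 k). apply pow_incr. assumption. Qed.

Lemma rpow_pos_eq t q : 0 < t -> rpow t q = Rpower t q.
Proof. intros H. unfold rpow. destruct Rle_dec; [lra|reflexivity]. Qed.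

Lemma rpow_0 t q : t <= 0 -> rpow t q = 0.
Proof. intros H. unfold rpow. destruct Rle_dec; [reflexivity|lra]. Qed.

Lemma Rpower_pos t q : 0 < Rpower t q.
Proof. apply exp_pos. Qed.

Lemma rpow_nonneg t q : 0 <= rpow t q.
Proof. unfold rpow. destruct Rle_dec; [lra|apply Rlt_le, Rpower_pos]. Qed.

Lemma rpow_le t u q : 0 <= q -> t <= u -> rpow t q <= rpow u q.
Proof.
  intros Hq H. destruct (Rle_dec t 0); [rewrite (rpow_0 t) by assumption; apply rpow_nonneg|].
  rewrite !rpow_pos_eq by lra. apply Rle_Rpower_l; lra.
Qed.

Lemma rpow_rpow t q q' : rpow (rpow t q) q' = rpow t (q * q').
Proof.
  destruct (Rle_dec t 0).
  - rewrite !(rpow_0 t) by assumption. apply rpow_0; lra.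
  - rewrite !(rpow_pos_eq t) by lra. rewrite rpow_pos_eq by apply Rpower_pos. apply Rpower_mult.
Qed.

Lemma rpow_1 t : 0 <= t -> rpow t 1 = t.
Proof.
  intros H. destruct (Req_dec t 0) as [->|]; [apply rpow_0; lra|]. rewrite rpow_pos_eq by lra. apply Rpower_1; lra.
Qed.

Lemma rpow_mult t u q : 0 <= t -> 0 <= u -> rpow (t * u) q = rpow t q * rpow u q.
Proof.
  intros Ht Hu. destruct (Req_dec t 0) as [->|]; [rewrite Rmult_0_l, !(rpow_0 0) by lra; lra|].
  destruct (Req_dec u 0) as [->|]; [rewrite Rmult_0_r, !(rpow_0 0) by lra; lra|].
  assert (0 < t * u) by (apply Rmult_lt_0_compat; lra).
  rewrite !rpow_pos_eq by lra. symmetry. apply Rpower_mult_distr; lra.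
Qed.

Lemma rpow_le_inv t u q : 0 < q -> 0 <= t -> 0 <= u -> rpow t q <= u -> t <= rpow u (/ q).
Proof.
  intros Hq Ht Hu H. rewrite <- (rpow_1 t Ht). rewrite <- (Rinv_r q) by lra. rewrite <- rpow_rpow.
  apply rpow_le; [|assumption]. apply Rlt_le, Rinv_0_lt_compat; assumption.
Qed.

Lemma rpow_continuity q t : 0 < q -> continuity_pt (fun u => rpow u q) t.
Proof.
  intros Hq. destruct (Rtotal_order t 0) as [Ht|[->|Ht]].
  - intros e He. exists (- t). split; [lra|]. intros u (_ & Hu). simpl in *. unfold R_dist in *.
    apply Rabs_def2 in Hu. rewrite !rpow_0 by lra. rewrite Rminus_diag, Rabs_R0. assumption.
  - intros e He. exists (Rpower e (/ q)). split; [apply Rpower_pos|]. intros u (_ & Hu). simpl in *. unfold R_dist in *.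
    rewrite (rpow_0 0) by lra. rewrite Rminus_0_r in *. rewrite Rabs_pos_eq by apply rpow_nonneg.
    destruct (Rle_dec u 0); [rewrite rpow_0; lra|]. rewrite Rabs_pos_eq in Hu by lra. rewrite rpow_pos_eq by lra.
    replace e with (Rpower (Rpower e (/ q)) q).
    + apply Rlt_Rpower_l; lra.
    + rewrite Rpower_mult, Rinv_l, Rpower_1 by lra. reflexivity.
  - assert (Hc : continuity_pt (fun u => Rpower u q) t).
    { apply derivable_continuous_pt. exists (q * Rpower t (q - 1)). apply derivable_pt_lim_power. assumption. }
    intros e He. destruct (Hc e He) as (a & Ha & Hb). exists (Rmin a t). split; [apply Rmin_glb_lt; lra|].
    intros u (HD & Hu). simpl in *. unfold R_dist in *. pose proof (Rmin_l a t). pose proof (Rmin_r a t).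
    specialize (Hb u (conj HD (Rlt_le_trans _ _ _ Hu (Rmin_l a t)))).
    apply Rabs_def2 in Hu. rewrite !rpow_pos_eq by lra. exact Hb.
Qed.

Lemma continuity_continue_in f D t : continuity_pt f t -> continue_in f D t.
Proof.
  intros H e He. destruct (H e He) as (a & Ha & Hb). exists a. split; [assumption|].
  intros u ((_ & Hne) & Hu). apply Hb. split; [split; [exact Logic.I|assumption]|assumption].
Qed.

(** The maximum is [t^a] up to [1] and [t^b] beyond; the inverse is the corresponding minimum of
    inverse powers. This is the gauge used in [rho_QS]. *)
Lemma power_homeo (C a b : R) : 0 < C -> 0 < a <= b ->
  homeo_halfline (fun t => C * Rmax (rpow t a) (rpow t b)).
Proof.
  intros HC Hab.
  assert (Hc : forall q k, 0 < q -> forall t, continuity_pt (fun u => rpow (k * u) q) t).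
  { intros q k Hq t. apply (continuity_pt_comp (fun u => k * u) (fun u => rpow u q)); [|apply rpow_continuity; assumption].
    apply continuity_pt_mult; [apply continuity_pt_const; intros ? ?; reflexivity|apply derivable_continuous_pt, derivable_pt_id]. }
  assert (Hlow : forall t q q', 0 <= t <= 1 -> 0 < q <= q' -> rpow t q' <= rpow t q).
  { intros t q q' Ht Hq. destruct (Req_dec t 0) as [->|]; [rewrite !rpow_0; lra|]. rewrite !rpow_pos_eq by lra.
    unfold Rpower. destruct (Req_dec t 1) as [->|]; [rewrite ln_1, !Rmult_0_r; lra|].
    assert (ln t < 0) by (rewrite <- ln_1; apply ln_increasing; lra).
    destruct (Req_dec q q') as [->|]; [lra|]. apply Rlt_le, exp_increasing. nra. }
  assert (Hhigh : forall t q q', 1 <= t -> 0 < q <= q' -> rpow t q <= rpow t q').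
  { intros t q q' Ht Hq. rewrite !rpow_pos_eq by lra. apply Rle_Rpower; lra. }
  assert (Hinv : forall q, 0 < q -> forall t, 0 <= t -> rpow (rpow t q) (/ q) = t).
  { intros q Hq t Ht. rewrite rpow_rpow, Rinv_r, rpow_1 by lra. reflexivity. }
  assert (Hinv' : forall q, 0 < q -> forall t, 0 <= t -> rpow (rpow t (/ q)) q = t).
  { intros q Hq t Ht. rewrite rpow_rpow, Rinv_l, rpow_1 by lra. reflexivity. }
  assert (Hia : 0 < / b <= / a) by (split; [apply Rinv_0_lt_compat; lra|apply Rinv_le_contravar; lra]).
  assert (H1 : forall q, rpow 1 q = 1) by (intros; rewrite rpow_pos_eq by lra; unfold Rpower; rewrite ln_1, Rmult_0_r; apply exp_0).
  exists (fun u => Rmin (rpow (/ C * u) (/ a)) (rpow (/ C * u) (/ b))).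
  split; [|split; [|split; [|split; [|split]]]].
  - intros t _. apply Rmult_le_pos; [lra|]. eapply Rle_trans; [apply rpow_nonneg|apply Rmax_l].
  - intros t _. apply Rmin_glb; apply rpow_nonneg.
  - intros t Ht. rewrite <- Rmult_assoc, Rinv_l, Rmult_1_l by lra. destruct (Rle_dec t 1).
    + rewrite Rmax_left by (apply Hlow; lra). rewrite Hinv by lra. apply Rmin_left.
      rewrite rpow_rpow. rewrite <- (rpow_1 t) at 1 by assumption. apply Hlow; [lra|]. split; [apply Rmult_lt_0_compat; lra|].
      apply Rle_div_l; lra.
    + rewrite Rmax_right by (apply Hhigh; lra). rewrite Hinv by lra. apply Rmin_right.
      rewrite rpow_rpow. rewrite <- (rpow_1 t) at 1 by assumption. apply Hhigh; [lra|]. split; [lra|].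
      apply Rle_div_r; lra.
  - intros t Ht. assert (Ht' : 0 <= / C * t) by (apply Rmult_le_pos; [apply Rlt_le, Rinv_0_lt_compat|]; lra).
    set (u := / C * t) in *. replace t with (C * u) at 1 by (unfold u; field; lra). destruct (Rle_dec u 1).
    + rewrite Rmin_left by (apply Hlow; lra). rewrite Rmax_left.
      * rewrite Hinv' by lra. unfold u. field; lra.
      * apply Hlow; [|lra]. split; [apply rpow_nonneg|]. rewrite <- (H1 (/ a)). apply rpow_le; lra.
    + rewrite Rmin_right by (apply Hhigh; lra). rewrite Rmax_right.
      * rewrite Hinv' by lra. unfold u. field; lra.
      * apply Hhigh; [|lra]. rewrite <- (H1 (/ b)). apply rpow_le; lra.
  - intros t _. apply continuity_continue_in. apply continuity_pt_mult; [apply continuity_pt_const; intros ? ?; reflexivity|].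
    (* Writing the maximum with an absolute value reduces its continuity to that of [Rabs]. *)
    apply (continuity_pt_locally_ext (fun t => (rpow t a + rpow t b + Rabs (rpow t a - rpow t b)) * / 2) _ 1); [lra| |].
    + intros u _. unfold Rabs, Rmax. destruct Rcase_abs; destruct Rle_dec; lra.
    + apply continuity_pt_mult; [|apply continuity_pt_const; intros ? ?; reflexivity].
      apply continuity_pt_plus; [apply continuity_pt_plus; apply rpow_continuity; lra|].
      apply (continuity_pt_comp (fun t => rpow t a - rpow t b) Rabs); [apply continuity_pt_minus; apply rpow_continuity; lra|].
      apply Rcontinuity_abs.
  - intros t _. apply continuity_continue_in.
    apply (continuity_pt_locally_ext (fun t => (rpow (/ C * t) (/ a) + rpow (/ C * t) (/ b) - Rabs (rpow (/ C * t) (/ a) - rpow (/ C * t) (/ b))) * / 2) _ 1); [lra| |].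
    + intros u _. unfold Rabs, Rmin. destruct Rcase_abs; destruct Rle_dec; lra.
    + apply continuity_pt_mult; [|apply continuity_pt_const; intros ? ?; reflexivity].
      apply continuity_pt_minus; [apply continuity_pt_plus; apply Hc; lra|].
      apply (continuity_pt_comp (fun t => rpow (/ C * t) (/ a) - rpow (/ C * t) (/ b)) Rabs); [apply continuity_pt_minus; apply Hc; lra|].
      apply Rcontinuity_abs.
Qed.

Lemma powerRZ_pos t j : 0 < t -> 0 < powerRZ t j.
Proof. intros H. apply powerRZ_lt. assumption. Qed.

Lemma powerRZ_S t j : 0 < t -> powerRZ t (j + 1) = t * powerRZ t j.
Proof. intros H. rewrite powerRZ_add by lra. simpl. ring. Qed.

Lemma powerRZ_nat t j k : 0 < t -> powerRZ t (j + Z.of_nat k) = t ^ k * powerRZ t j.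
Proof. intros H. rewrite powerRZ_add by lra. rewrite <- pow_powerRZ. ring. Qed.

Lemma powerRZ_anti t j j' : 0 < t < 1 -> (j <= j')%Z -> powerRZ t j' <= powerRZ t j.
Proof.
  intros Ht H. replace j' with (j + Z.of_nat (Z.to_nat (j' - j)))%Z by lia. rewrite powerRZ_nat by lra.
  pose proof (powerRZ_pos t j ltac:(lra)). assert (t ^ Z.to_nat (j' - j) <= 1) by (apply pow_le1; lra).
  nra.
Qed.

Lemma powerRZ_lt_inv t j j' : 0 < t < 1 -> powerRZ t j' < powerRZ t j -> (j < j')%Z.
Proof. intros Ht H. apply Z.nle_gt. intros Hle. pose proof (powerRZ_anti t j' j Ht Hle). lra. Qed.

Lemma small_pow t e : 0 < t < 1 -> 0 < e -> exists k, t ^ k < e.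
Proof.
  intros Ht He. destruct (pow_lt_1_zero t ltac:(rewrite Rabs_pos_eq; lra) e He) as (k & Hk). exists k.
  specialize (Hk k (Nat.le_refl _)). rewrite Rabs_pos_eq in Hk; [assumption|]. apply pow_le; lra.
Qed.

Lemma zmax_exists (S : Z -> Prop) a b : S a -> (forall j, S j -> (j <= b)%Z) -> exists j, S j /\ ~ S (j + 1)%Z.
Proof.
  intros Ha Hb. apply NNPP. intros Hn.
  assert (forall k : nat, S (a + Z.of_nat k)%Z) as H.
  { induction k as [|k IH]; [replace (a + Z.of_nat 0)%Z with a by lia; assumption|].
    apply NNPP. intros Hk. apply Hn. exists (a + Z.of_nat k)%Z. split; [assumption|].
    replace (a + Z.of_nat k + 1)%Z with (a + Z.of_nat (Datatypes.S k))%Z by lia. assumption. }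
  specialize (H (Z.to_nat (b - a + 1))). apply Hb in H. pose proof (Hb a Ha). lia.
Qed.

Lemma scale_exists t s : 0 < t < 1 -> 0 < s -> exists j, powerRZ t (j + 1) <= s < powerRZ t j.
Proof.
  intros Ht Hs. destruct (zmax_exists (fun j => s < powerRZ t j) (- Z.of_nat (proj1_sig (constructive_indefinite_description _ (small_pow t (/ s) Ht (Rinv_0_lt_compat _ Hs)))))
    (Z.of_nat (proj1_sig (constructive_indefinite_description _ (small_pow t s Ht Hs))))) as (j & H1 & H2).
  - destruct constructive_indefinite_description as (k & Hk). simpl. rewrite powerRZ_neg', <- pow_powerRZ.
    apply Rinv_lt_contravar in Hk; [rewrite Rinv_inv in Hk; assumption|].
    apply Rmult_lt_0_compat; [apply pow_lt; lra|apply Rinv_0_lt_compat; assumption].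
  - intros j Hj. destruct constructive_indefinite_description as (k & Hk). simpl.
    apply Z.lt_le_incl. apply (powerRZ_lt_inv t); [assumption|]. rewrite <- pow_powerRZ. lra.
  - exists j. split; [lra|assumption].
Qed.

Lemma Rpower_lt1 t q : 0 < t < 1 -> 0 < q -> 0 < Rpower t q < 1.
Proof.
  intros Ht Hq. split; [apply Rpower_pos|]. unfold Rpower. rewrite <- exp_0. apply exp_increasing.
  assert (ln t < 0) by (rewrite <- ln_1; apply ln_increasing; lra). nra.
Qed.

Lemma Rpower_pow_swap t k q : 0 < t -> Rpower (t ^ k) q = Rpower t q ^ k.
Proof.
  intros Ht. rewrite <- Rpower_pow by assumption. rewrite <- Rpower_pow by apply Rpower_pos.
  rewrite !Rpower_mult. f_equal. ring.
Qed.

Lemma Rpower_inv t q : 0 < t -> Rpower (/ t) q = / Rpower t q.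
Proof. intros Ht. unfold Rpower. rewrite ln_Rinv, <- exp_Ropp by assumption. f_equal. ring. Qed.

Lemma powerRZ_pow t n j : 0 < t -> powerRZ t (j * Z.of_nat n) = powerRZ (t ^ n) j.
Proof.
  intros Ht. rewrite !powerRZ_Rpower by (try apply pow_lt; assumption).
  rewrite <- Rpower_pow, Rpower_mult by assumption. f_equal. rewrite mult_IZR, INR_IZR_INZ. ring.
Qed.

(** * Quasisymmetry and Ahlfors regularity *)

Lemma rb_sup_ub (S : Rbar -> Prop) z : S z -> Rbar_le z (rb_sup S).
Proof.
  intros Hz. unfold rb_sup. destruct excluded_middle_informative as [|Hn]; [destruct z; simpl; exact Logic.I|].
  destruct z as [z| |]; [|contradiction|simpl; exact Logic.I]. apply (Lub_Rbar_correct (fun x => S (Finite x))). assumption.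
Qed.

Lemma rb_sup_lub (S : Rbar -> Prop) b : (forall z, S z -> Rbar_le z b) -> Rbar_le (rb_sup S) b.
Proof.
  intros H. unfold rb_sup. destruct excluded_middle_informative as [Hi|Hn]; [apply H; assumption|].
  apply (Lub_Rbar_correct (fun x => S (Finite x))). intros x Hx. apply H. assumption.
Qed.

Lemma rb_inf_lb (S : Rbar -> Prop) z : S z -> Rbar_le (rb_inf S) z.
Proof.
  intros Hz. unfold rb_inf. destruct excluded_middle_informative as [|Hn]; [destruct z; simpl; exact Logic.I|].
  destruct z as [z| |]; [|apply Rbar_le_trans with p_infty; [destruct Glb_Rbar; exact Logic.I|simpl; exact Logic.I]|contradiction].
  apply (Glb_Rbar_correct (fun x => S (Finite x))). assumption.
Qed.

Lemma rb_inf_glb (S : Rbar -> Prop) b : (forall z, S z -> Rbar_le b z) -> Rbar_le b (rb_inf S).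
Proof.
  intros H. unfold rb_inf. destruct excluded_middle_informative as [Hi|Hn]; [apply H; assumption|].
  apply (Glb_Rbar_correct (fun x => S (Finite x))). intros x Hx. apply H. assumption.
Qed.

Lemma nnsum_ge {A : Type} (S : A -> Prop) a l : NoDup l -> (forall x, In x l -> S x) ->
  Rbar_le (Finite (lsum l a)) (nnsum S a).
Proof. intros H1 H2. apply rb_sup_ub. exists l. auto. Qed.

Lemma nnsum_le {A : Type} (S : A -> Prop) a b : (forall l, NoDup l -> (forall x, In x l -> S x) -> lsum l a <= b) ->
  Rbar_le (nnsum S a) (Finite b).
Proof. intros H. apply rb_sup_lub. intros z (l & H1 & H2 & ->). apply H; assumption. Qed.

Section Conformal.
Context {G V : Type} (L : Z -> V -> Prop) (tch : V -> V -> Prop) (nb ch : V -> list V) (P : V -> V)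
  (inc : V -> G -> Prop) (incl_of : V -> list G).
Context (D T2 : nat).
Hypothesis D_pos : (1 <= D)%nat.
Hypothesis L_inj : forall j j' v, L j v -> L j' v -> j = j'.
Hypothesis tch_sym : forall v v', tch v v' -> tch v' v.
Hypothesis tch_refl : forall j v, L j v -> tch v v.
Hypothesis nb_spec : forall j v, L j v -> forall v', In v' (nb v) <-> L j v' /\ tch v v'.
Hypothesis nb_len : forall j v, L j v -> (length (nb v) <= D)%nat.
Hypothesis P_L : forall j v, L (j + 1)%Z v -> L j (P v).
Hypothesis tch_P : forall j v v', adj (L (j + 1)%Z) tch v v' -> tch (P v) (P v').
Hypothesis ch_spec : forall j w, L j w -> forall v, In v (ch w) <-> L (j + 1)%Z v /\ P v = w.
Hypothesis ch_NoDup : forall w, NoDup (ch w).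
Hypothesis inc_P : forall j v x, L (j + 1)%Z v -> inc v x -> inc (P v) x.
Hypothesis inc_tch : forall j v v' x, L j v -> L j v' -> inc v x -> inc v' x -> tch v v'.
Hypothesis incl_spec : forall j v x, L j v -> (In x (incl_of v) <-> inc v x).
Hypothesis incl_NoDup : forall v, NoDup (incl_of v).
Hypothesis cover : forall j x, exists v, L j v /\ inc v x.
Context (d rho : G -> G -> R) (nd : G -> R) (rr C7 c8 c9 C2 c1 : R).
Hypothesis d_metric : is_metric d.
Hypothesis rr_bd : 0 < rr < 1.
Hypothesis nd_pos : forall x, 0 < nd x.
Hypothesis nd_le : forall x y, x <> y -> nd x <= d x y.
Hypothesis C7_pos : 0 < C7.
Hypothesis c8_pos : 0 < c8.
Hypothesis c9_pos : 0 < c9.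
Hypothesis C2_pos : 0 < C2.
Hypothesis c1_pos : 0 < c1.
Hypothesis far : forall j v v' x y, L j v -> L j v' -> inc v x -> inc v' y ->
  within (adj (L j) tch) T2 v v' -> d x y <= C7 * powerRZ rr j.
(** Pieces inside cables may carry no vertex. As long as a piece is large compared with the gaps
    [nd] at its vertices this does not happen to its children, so no mass escapes from [G]. *)
Hypothesis coarse_ch : forall j u c x, L j u -> inc u x -> (forall y, inc u y -> nd y < c9 * powerRZ rr j) ->
  In c (ch u) -> exists y, inc c y.
Context (m : V -> R) (a eps p : R).
Hypothesis a1 : 1 <= a.
Hypothesis p_pos : 0 < p.
Hypothesis eps_bd : 0 < eps < 1 / 2.
Hypothesis m_pos : forall j v, L j v -> 0 < m v.
Hypothesis m_slow : forall j v v', adj (L j) tch v v' -> m v' <= a * m v.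
Hypothesis m_P : forall j v, L (j + 1)%Z v -> eps * m (P v) <= m v <= (1 - eps) * m (P v).
Hypothesis m_sum : forall j w, L j w -> lsum (ch w) m = m w.

Let sg (v : V) : R := Rpower (m v) (/ p).

Hypothesis rho_metric : is_metric rho.
Hypothesis rho_piece : forall j v x y, L j v -> inc v x -> inc v y -> rho x y <= sg v.
Hypothesis rho_lower : forall j v v' x y, L j v -> L j v' -> inc v x -> inc v' y ->
  ~ within (adj (L j) tch) T2 v v' -> c1 * sg v <= rho x y.
Hypothesis rho_upper : forall j v x y, L j v -> inc v x -> d x y < c8 * powerRZ rr j -> rho x y <= C2 * sg v.

Let pc (j : Z) (x : G) : V := proj1_sig (constructive_indefinite_description _ (cover j x)).

Lemma pc_L j x : L j (pc j x).
Proof. exact (proj1 (proj2_sig (constructive_indefinite_description _ (cover j x)))). Qed.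
Lemma pc_inc j x : inc (pc j x) x.
Proof. exact (proj2 (proj2_sig (constructive_indefinite_description _ (cover j x)))). Qed.

Lemma level_iter j v k : L (j + Z.of_nat k)%Z v -> L j (Nat.iter k P v).
Proof. apply iter_lev. assumption. Qed.

Lemma vertex_iter j v x k : L (j + Z.of_nat k)%Z v -> inc v x -> inc (Nat.iter k P v) x.
Proof. apply (iter_vertex L); assumption. Qed.

Lemma touch_iter j v v' k : adj (L (j + Z.of_nat k)%Z) tch v v' -> adj (L j) tch (Nat.iter k P v) (Nat.iter k P v').
Proof. apply iter_touch; assumption. Qed.

Lemma mass_iter j v k : L (j + Z.of_nat k)%Z v ->
  eps ^ k * m (Nat.iter k P v) <= m v <= (1 - eps) ^ k * m (Nat.iter k P v).
Proof.
  revert j. induction k as [|k IH]; intros j H; simpl; [lra|].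
  replace (j + Z.of_nat (S k))%Z with (j + 1 + Z.of_nat k)%Z in H by lia.
  pose proof (IH _ H) as (I1 & I2). pose proof (m_P _ _ (level_iter _ _ _ H)) as (J1 & J2).
  assert (0 < eps ^ k) by (apply pow_lt; lra). assert (0 < (1 - eps) ^ k) by (apply pow_lt; lra).
  split.
  - eapply Rle_trans; [|exact I1]. replace (eps * eps ^ k * m (P (Nat.iter k P v))) with (eps ^ k * (eps * m (P (Nat.iter k P v)))) by ring.
    apply Rmult_le_compat_l; lra.
  - eapply Rle_trans; [exact I2|]. replace ((1 - eps) * (1 - eps) ^ k * m (P (Nat.iter k P v))) with ((1 - eps) ^ k * ((1 - eps) * m (P (Nat.iter k P v)))) by ring.
    apply Rmult_le_compat_l; lra.
Qed.

(** The ancestor of [v'] at level [j] also contains [x], hence touches [v]. *)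
Lemma m_point j k v v' x : L j v -> L (j + Z.of_nat k)%Z v' -> inc v x -> inc v' x ->
  m v <= a * / eps ^ k * m v' /\ m v' <= a * (1 - eps) ^ k * m v.
Proof.
  intros Hv Hv' Hx Hx'. set (u := Nat.iter k P v').
  assert (Hu : L j u) by (apply level_iter; assumption).
  assert (Ha : adj (L j) tch u v).
  { split; [|split]; [assumption|assumption|]. eapply inc_tch; [exact Hu|exact Hv|eapply vertex_iter; eassumption|exact Hx]. }
  pose proof (m_slow _ _ _ Ha) as S1. pose proof (m_slow _ _ _ (adj_sym _ _ tch_sym _ _ Ha)) as S2.
  destruct (mass_iter j v' k Hv') as (I1 & I2). fold u in I1, I2.
  assert (0 < eps ^ k) by (apply pow_lt; lra). assert (0 < (1 - eps) ^ k) by (apply pow_lt; lra).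
  split.
  - eapply Rle_trans; [exact S1|]. rewrite Rmult_assoc. apply Rmult_le_compat_l; [lra|].
    apply Rmult_le_reg_l with (eps ^ k); [assumption|]. rewrite <- Rmult_assoc, Rinv_r by lra. lra.
  - eapply Rle_trans; [exact I2|]. replace (a * (1 - eps) ^ k * m v) with ((1 - eps) ^ k * (a * m v)) by ring.
    apply Rmult_le_compat_l; lra.
Qed.

Lemma sg_rpow v : Rpower (sg v) p = Rpower (m v) 1.
Proof. unfold sg. rewrite Rpower_mult, Rinv_l by lra. reflexivity. Qed.

Lemma sg_pow j v : L j v -> Rpower (sg v) p = m v.
Proof. intros Hv. rewrite sg_rpow. apply Rpower_1. eapply m_pos; eassumption. Qed.

Lemma sg_positive v : 0 < sg v.
Proof. apply Rpower_pos. Qed.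

Lemma sg_le_of_m c v v' : 0 < c -> 0 < m v -> 0 < m v' -> m v <= c * m v' -> sg v <= Rpower c (/ p) * sg v'.
Proof.
  intros Hc Hv Hv' H. unfold sg. rewrite Rpower_mult_distr by assumption.
  apply Rle_Rpower_l; [apply Rlt_le, Rinv_0_lt_compat; assumption|lra].
Qed.

Let A : R := Rpower a (/ p).
Let ep : R := Rpower eps (/ p).
Let th : R := Rpower (1 - eps) (/ p).

Lemma A_ge1 : 1 <= A.
Proof.
  unfold A. rewrite <- (Rpower_O a) by lra. apply Rle_Rpower; [lra|]. apply Rlt_le, Rinv_0_lt_compat; assumption.
Qed.

Lemma ip_pos : 0 < / p. Proof. apply Rinv_0_lt_compat; assumption. Qed.

Lemma ep_bd : 0 < ep < 1.
Proof. apply Rpower_lt1; [lra|apply ip_pos]. Qed.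

Lemma th_bd : 0 < th < 1.
Proof. apply Rpower_lt1; [lra|apply ip_pos]. Qed.

Lemma ep_le_th : ep <= th.
Proof. apply Rle_Rpower_l; [apply Rlt_le, ip_pos|lra]. Qed.

Lemma sg_point j k v v' x : L j v -> L (j + Z.of_nat k)%Z v' -> inc v x -> inc v' x ->
  sg v <= A * / ep ^ k * sg v' /\ sg v' <= A * th ^ k * sg v.
Proof.
  intros Hv Hv' Hx Hx'. destruct (m_point j k v v' x Hv Hv' Hx Hx') as (H1 & H2).
  pose proof (m_pos _ _ Hv). pose proof (m_pos _ _ Hv').
  assert (0 < eps ^ k) by (apply pow_lt; lra). assert (0 < (1 - eps) ^ k) by (apply pow_lt; lra).
  assert (0 < / eps ^ k) by (apply Rinv_0_lt_compat; assumption).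
  split.
  - apply sg_le_of_m in H1; try assumption; [|apply Rmult_lt_0_compat; lra].
    rewrite <- Rpower_mult_distr in H1 by lra. rewrite Rpower_inv, Rpower_pow_swap in H1 by lra. assumption.
  - apply sg_le_of_m in H2; try assumption; [|apply Rmult_lt_0_compat; lra].
    rewrite <- Rpower_mult_distr in H2 by lra. rewrite Rpower_pow_swap in H2 by lra. assumption.
Qed.
Lemma not_near j x y : C7 * powerRZ rr j < d x y -> ~ within (adj (L j) tch) T2 (pc j x) (pc j y).
Proof.
  intros H Hw. pose proof (far j _ _ x y (pc_L j x) (pc_L j y) (pc_inc j x) (pc_inc j y) Hw). lra.
Qed.

Lemma rho_far j x y : C7 * powerRZ rr j < d x y -> c1 * sg (pc j x) <= rho x y.
Proof.
  intros H. eapply rho_lower; [apply pc_L|apply pc_L|apply pc_inc|apply pc_inc|apply not_near; assumption].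
Qed.

Lemma d_pos x y : x <> y -> 0 < d x y.
Proof. intros H. eapply Rlt_le_trans; [apply nd_pos|apply nd_le; exact H]. Qed.

(** Along the pieces of a fixed point [sg] falls by a factor between [ep] and [th] per level, up to
    constants, while the scale of [d] falls by [rr]. With [th = rr^aa] and [ep = rr^bb], ratios of
    [d] become powers [aa] or [bb] of themselves. *)
Lemma rho_QS : QS d rho.
Proof.
  set (aa := ln th / ln rr). set (bb := ln ep / ln rr).
  assert (Hlr : ln rr < 0) by (rewrite <- ln_1; apply ln_increasing; lra).
  pose proof th_bd as Hth. pose proof ep_bd as Hep. pose proof ep_le_th as Het. pose proof A_ge1 as HA.
  assert (Hlt : ln th < 0) by (rewrite <- ln_1; apply ln_increasing; lra).
  assert (Hle : ln ep <= ln th).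
  { destruct Het as [Het|Het]; [apply Rlt_le, ln_increasing; lra|rewrite Het; lra]. }
  assert (Hab : 0 < aa <= bb).
  { unfold aa, bb. split.
    - replace (ln th / ln rr) with ((- ln th) / (- ln rr)) by (field; lra). apply Rdiv_lt_0_compat; lra.
    - replace (ln th / ln rr) with ((- ln th) / (- ln rr)) by (field; lra).
      replace (ln ep / ln rr) with ((- ln ep) / (- ln rr)) by (field; lra).
      apply Rmult_le_compat_r; [apply Rlt_le, Rinv_0_lt_compat|]; lra. }
  assert (Eth : th = Rpower rr aa).
  { unfold aa, Rpower. replace (ln th / ln rr * ln rr) with (ln th) by (field; lra). symmetry. apply exp_ln; lra. }
  assert (Eep : ep = Rpower rr bb).
  { unfold bb, Rpower. replace (ln ep / ln rr * ln rr) with (ln ep) by (field; lra). symmetry. apply exp_ln; lra. }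
  destruct (small_pow rr c8 rr_bd c8_pos) as (s8 & Hs8).
  destruct (small_pow rr (/ C7) rr_bd (Rinv_0_lt_compat _ C7_pos)) as (s7 & Hs7).
  set (s := (s8 + 1 + s7)%nat). set (q := / rr ^ S s).
  assert (Hrs : 0 < rr ^ S s) by (apply pow_lt; lra).
  assert (Hq : 1 <= q).
  { unfold q. rewrite <- Rinv_1. apply Rinv_le_contravar; [assumption|]. apply pow_le1; lra. }
  set (C := C2 / c1 * A * Rpower q bb).
  assert (HC0 : 0 < C2 / c1) by (apply Rdiv_lt_0_compat; assumption).
  assert (HC : 0 < C) by (apply Rmult_lt_0_compat; [apply Rmult_lt_0_compat; [exact HC0|lra]|apply Rpower_pos]).
  exists (fun t => C * Rmax (rpow t aa) (rpow t bb)). split; [apply power_homeo; assumption|].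
  intros x y z Hxz. destruct rho_metric as (R0 & R1 & R2 & R3).
  assert (Hdxz : 0 < d x z) by (apply d_pos; assumption).
  destruct (classic (x = y)) as [<-|Hxy].
  { replace (rho x x) with 0 by (symmetry; apply R1; reflexivity). unfold Rdiv at 1. rewrite Rmult_0_l.
    apply Rmult_le_pos; [lra|]. eapply Rle_trans; [apply rpow_nonneg|apply Rmax_l]. }
  assert (Hdxy : 0 < d x y) by (apply d_pos; assumption).
  destruct (scale_exists rr (d x y) rr_bd Hdxy) as (j1 & Hj1).
  destruct (scale_exists rr (d x z) rr_bd Hdxz) as (j2 & Hj2).
  (* Level [i1] is coarse enough for [rho_upper] to apply to [x, y]; level [i2] is fine enough that
     [x] and [z] lie far apart on it, as [rho_lower] asks. *)
  set (i1 := (j1 - Z.of_nat s8)%Z). set (i2 := (j2 + 1 + Z.of_nat s7)%Z).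
  assert (Hup : rho x y <= C2 * sg (pc i1 x)).
  { eapply rho_upper; [apply pc_L|apply pc_inc|]. eapply Rlt_trans; [apply Hj1|].
    replace j1 with (i1 + Z.of_nat s8)%Z at 1 by (unfold i1; lia). rewrite powerRZ_nat by lra.
    apply Rmult_lt_compat_r; [apply powerRZ_pos; lra|assumption]. }
  assert (Hlo : c1 * sg (pc i2 x) <= rho x z).
  { apply rho_far. eapply Rlt_le_trans; [|apply Hj2]. unfold i2. rewrite powerRZ_nat by lra.
    pose proof (powerRZ_pos rr (j2 + 1) ltac:(lra)) as Hp. rewrite <- Rmult_assoc.
    rewrite <- (Rmult_1_l (powerRZ rr (j2 + 1))) at 2. apply Rmult_lt_compat_r; [assumption|].
    apply Rmult_lt_reg_l with (/ C7); [apply Rinv_0_lt_compat; assumption|].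
    rewrite <- Rmult_assoc, Rinv_l, Rmult_1_l by lra. lra. }
  set (t := d x y / d x z).
  assert (Ht : 0 < t) by (apply Rdiv_lt_0_compat; assumption).
  assert (Hk : powerRZ rr (i1 - i2) <= t * q).
  { unfold t, q. assert (E : powerRZ rr (j1 + 1) = powerRZ rr (i1 - i2) * rr ^ S s * powerRZ rr j2).
    { replace (j1 + 1)%Z with (i1 - i2 + Z.of_nat (S s) + j2)%Z by (unfold i1, i2, s; lia).
      rewrite !powerRZ_add by lra. rewrite <- pow_powerRZ. reflexivity. }
    pose proof (powerRZ_pos rr j2 ltac:(lra)) as Hp2. pose proof (powerRZ_pos rr (i1 - i2) ltac:(lra)) as Hp3.
    apply (proj1 (Rle_div_r _ _ _ Hrs)). apply (proj1 (Rle_div_r _ _ _ Hdxz)).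
    apply Rle_trans with (powerRZ rr (i1 - i2) * rr ^ S s * powerRZ rr j2).
    - apply Rmult_le_compat_l; [apply Rmult_le_pos; lra|lra].
    - rewrite <- E. lra. }
  assert (Hratio : forall e, e = aa \/ e = bb -> sg (pc i1 x) <= A * Rpower (powerRZ rr (i1 - i2)) e * sg (pc i2 x) ->
    rho x y / rho x z <= C * Rmax (rpow t aa) (rpow t bb)).
  { intros e He Hs. assert (He0 : 0 < e) by (destruct He as [-> | ->]; lra).
    pose proof (sg_positive (pc i2 x)) as Hsp.
    assert (Hpe : Rpower (powerRZ rr (i1 - i2)) e <= Rpower q bb * Rmax (rpow t aa) (rpow t bb)).
    { eapply Rle_trans; [apply Rle_Rpower_l; [lra|split; [apply powerRZ_pos; lra|exact Hk]]|].
      rewrite Rmult_comm, <- Rpower_mult_distr by lra.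
      apply Rmult_le_compat; [apply Rlt_le, Rpower_pos|apply Rlt_le, Rpower_pos| |].
      - apply Rle_Rpower; [assumption|destruct He as [-> | ->]; lra].
      - rewrite <- rpow_pos_eq by assumption. destruct He as [-> | ->]; [apply Rmax_l|apply Rmax_r]. }
    assert (Hrz : 0 < rho x z) by (eapply Rlt_le_trans; [|exact Hlo]; apply Rmult_lt_0_compat; assumption).
    apply Rle_div_l; [assumption|].
    set (X := Rmax (rpow t aa) (rpow t bb)) in *. set (Y := Rpower (powerRZ rr (i1 - i2)) e) in *.
    assert (HY : 0 < Y) by apply Rpower_pos.
    assert (HqX : 0 <= C * X) by (apply Rmult_le_pos; [lra|]; unfold X; eapply Rle_trans; [apply rpow_nonneg|apply Rmax_l]).
    apply Rle_trans with (C * X * (c1 * sg (pc i2 x))); [|apply Rmult_le_compat_l; assumption].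
    apply Rle_trans with (C2 * (A * Y * sg (pc i2 x))); [eapply Rle_trans; [exact Hup|apply Rmult_le_compat_l; lra]|].
    apply Rle_trans with (C2 * (A * (Rpower q bb * X) * sg (pc i2 x))).
    - apply Rmult_le_compat_l; [lra|]. apply Rmult_le_compat_r; [lra|]. apply Rmult_le_compat_l; lra.
    - right. unfold C. field. lra. }
  assert (Hpk : forall k : nat, Rpower rr aa ^ k = Rpower (powerRZ rr (Z.of_nat k)) aa).
  { intros k. rewrite <- pow_powerRZ, Rpower_pow_swap by lra. reflexivity. }
  (* From [i2] down to [i1] the guaranteed decay [th] is used; in the other direction the growth is
     at most a power of [/ ep]. *)
  destruct (Z_le_dec i2 i1) as [Hi|Hi].
  - apply (Hratio aa); [left; reflexivity|].
    set (k := Z.to_nat (i1 - i2)). assert (Ek : i1 = (i2 + Z.of_nat k)%Z) by (unfold k; lia).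
    assert (HL1 : L (i2 + Z.of_nat k)%Z (pc i1 x)) by (rewrite <- Ek; apply pc_L).
    destruct (sg_point i2 k (pc i2 x) (pc i1 x) x (pc_L _ _) HL1 (pc_inc _ _) (pc_inc _ _)) as (_ & H).
    rewrite Eth, Hpk in H. replace (i1 - i2)%Z with (Z.of_nat k) by lia. exact H.
  - apply (Hratio bb); [right; reflexivity|].
    set (k := Z.to_nat (i2 - i1)). assert (Ek : i2 = (i1 + Z.of_nat k)%Z) by (unfold k; lia).
    assert (HL2 : L (i1 + Z.of_nat k)%Z (pc i2 x)) by (rewrite <- Ek; apply pc_L).
    destruct (sg_point i1 k (pc i1 x) (pc i2 x) x (pc_L _ _) HL2 (pc_inc _ _) (pc_inc _ _)) as (H & _).
    rewrite Eep in H. rewrite <- Rpower_pow_swap, <- Rpower_inv in H by (try apply pow_lt; lra).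
    replace (i1 - i2)%Z with (- Z.of_nat k)%Z by lia. rewrite powerRZ_neg', <- pow_powerRZ. exact H.
Qed.
Context (Jn : G -> Z) (t0 t1 s7 tb : nat).
Hypothesis Jn_spec : forall y, powerRZ rr (Jn y + 1) <= nd y < powerRZ rr (Jn y).
Hypothesis t0_spec : C7 * rr ^ t0 < rr.
Hypothesis t1_spec : rr ^ t1 <= c9.
Hypothesis s7_spec : C7 * rr ^ s7 < 1.
Hypothesis tb_spec : A * th ^ tb < c1.

(** At this level a piece is smaller than the gap at [y], so it belongs to [y] alone and its mass
    can serve as the point mass at [y]. *)
Let wy (y : G) : V := pc (Jn y + Z.of_nat t0) y.
Let mu (y : G) : R := m (wy y).

Lemma mu_pos y : 0 < mu y.
Proof. eapply m_pos. apply pc_L. Qed.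

Lemma wy_single y z : inc (wy y) z -> z = y.
Proof.
  intros Hz. apply NNPP. intros Hne.
  pose proof (far _ _ _ y z (pc_L _ y) (pc_L _ y) (pc_inc _ y) Hz (within_refl _ _ _)) as H.
  pose proof (nd_le y z (not_eq_sym Hne)). destruct (Jn_spec y) as (Hy & _).
  rewrite powerRZ_nat in H by lra. rewrite powerRZ_S in Hy by lra.
  pose proof (powerRZ_pos rr (Jn y) ltac:(lra)). nra.
Qed.

(** Each [wy y] holds a single vertex, so these pieces are not nested in one another; mass is
    conserved from a piece to its children, so those below [u] cannot outweigh [u]. If [u] is itself
    one of them, nothing else is in the list. *)
Lemma antichain k : forall j u l, L j u -> NoDup l ->
  (forall y, In y l -> exists i, (i <= k)%nat /\ L (j + Z.of_nat i)%Z (wy y) /\ Nat.iter i P (wy y) = u) ->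
  lsum l mu <= m u.
Proof.
  induction k as [|k IH]; intros j u l Hu Hl Hd.
  all: assert (Hroot : (exists y, In y l /\ wy y = u) -> lsum l mu <= m u).
  1, 3: intros (y & Hy & E); apply Rle_trans with (lsum [y] mu);
    [apply lsum_incl; [assumption| |intros; apply Rlt_le, mu_pos]
    |unfold lsum, mu; simpl; rewrite E; lra];
    intros y' Hy'; left; symmetry; apply wy_single; rewrite E;
    destruct (Hd y' Hy') as (i & _ & HL & <-); eapply vertex_iter; [exact HL|apply pc_inc].
  - destruct l as [|y l]; [unfold lsum; simpl; apply Rlt_le; eapply m_pos; eassumption|].
    apply Hroot. exists y. split; [left; reflexivity|].
    destruct (Hd y (or_introl eq_refl)) as (i & Hi & _ & E). replace i with 0%nat in E by lia. exact E.
  - destruct (classic (exists y, In y l /\ wy y = u)) as [H|H]; [auto|].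
    set (below := fun c y => exists i, (i <= k)%nat /\ L (j + 1 + Z.of_nat i)%Z (wy y) /\ Nat.iter i P (wy y) = c).
    set (lc := fun c => keep (below c) l).
    assert (Hlc : forall c y, In y (lc c) <-> In y l /\ below c y) by (intros; exact (In_keep _ _ _)).
    apply Rle_trans with (lsum (flat_map lc (ch u)) mu).
    + apply lsum_incl; [assumption| |intros; apply Rlt_le, mu_pos]. intros y Hy.
      destruct (Hd y Hy) as (i & Hi & HL & E). destruct i as [|i]; [exfalso; apply H; eauto|].
      replace (j + Z.of_nat (S i))%Z with (j + 1 + Z.of_nat i)%Z in HL by lia. simpl in E.
      apply in_flat_map. exists (Nat.iter i P (wy y)). split.
      * apply (ch_spec j); [assumption|]. split; [apply level_iter; assumption|exact E].
      * apply Hlc. split; [assumption|]. exists i. split; [lia|]. auto.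
    + rewrite lsum_flat_map. rewrite <- (m_sum j u Hu). apply lsum_le. intros c Hc.
      apply (ch_spec j) in Hc; [|assumption]. apply (IH (j + 1)%Z); [tauto| |].
      * apply NoDup_keep. assumption.
      * intros y Hy. apply Hlc in Hy. apply Hy.
Qed.

Let E (y : G) : list V := nb (pc (Jn y - Z.of_nat t1) y).

(** The mass of [u] is followed down to its children, all of which contain vertices, until a piece
    lies at the stopping level [Jn y - t1] of one of its vertices [y]. Such a piece touches the
    chosen piece of [y] and is listed in [E y]; the indicator retains the listed pieces below
    [u]. *)
Lemma coarse_mass k : forall j u x, L j u -> inc u x ->
  (forall y, inc u y -> (j <= Jn y - Z.of_nat t1 <= j + Z.of_nat k)%Z) ->
  m u <= lsum (incl_of u) (fun y => lsum (E y) (fun e =>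
     ind (exists i, L (j + Z.of_nat i)%Z e /\ Nat.iter i P e = u) * m e)).
Proof.
  assert (HEL : forall y e, In e (E y) -> L (Jn y - Z.of_nat t1)%Z e).
  { intros y e He. apply (nb_spec _ _ (pc_L _ y)) in He. tauto. }
  assert (HE0 : forall y e Q, In e (E y) -> 0 <= ind Q * m e).
  { intros y e Q He. pose proof (ind_bounds Q). pose proof (m_pos _ _ (HEL y e He)). apply Rmult_le_pos; lra. }
  induction k as [|k IH]; intros j u x Hu Hx Hk.
  all: assert (Hroot : (exists y, inc u y /\ (Jn y - Z.of_nat t1)%Z = j) ->
    m u <= lsum (incl_of u) (fun y => lsum (E y) (fun e =>
     ind (exists i, L (j + Z.of_nat i)%Z e /\ Nat.iter i P e = u) * m e))).
  1, 3: intros (y & Hy & Ey);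
    apply Rle_trans with (lsum (E y) (fun e => ind (exists i, L (j + Z.of_nat i)%Z e /\ Nat.iter i P e = u) * m e));
    [|apply (lsum_In_le (incl_of u) (fun y => lsum (E y) (fun e =>
        ind (exists i, L (j + Z.of_nat i)%Z e /\ Nat.iter i P e = u) * m e)));
      [intros; apply lsum_nonneg; intros; eapply HE0; eassumption|apply (incl_spec j); assumption]];
    apply Rle_trans with (ind (exists i, L (j + Z.of_nat i)%Z u /\ Nat.iter i P u = u) * m u);
    [rewrite ind_true; [lra|exists 0%nat; rewrite Z.add_0_r; auto]
    |apply (lsum_In_le (E y) (fun e => ind (exists i, L (j + Z.of_nat i)%Z e /\ Nat.iter i P e = u) * m e));
      [intros; eapply HE0; eassumption
      |unfold E; apply (nb_spec _ _ (pc_L _ y)); rewrite Ey; split; [assumption|];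
       eapply inc_tch; [apply pc_L|exact Hu|apply pc_inc|exact Hy]]].
  - apply Hroot. exists x. split; [assumption|]. specialize (Hk x Hx). lia.
  - destruct (classic (exists y, inc u y /\ (Jn y - Z.of_nat t1)%Z = j)) as [H|H]; [auto|].
    assert (Hk' : forall y, inc u y -> (j + 1 <= Jn y - Z.of_nat t1 <= j + 1 + Z.of_nat k)%Z).
    { intros y Hy. specialize (Hk y Hy). assert ((Jn y - Z.of_nat t1)%Z <> j) by (intros Ey; apply H; eauto). lia. }
    assert (Hfine : forall y, inc u y -> nd y < c9 * powerRZ rr j).
    { intros y Hy. specialize (Hk' y Hy). destruct (Jn_spec y) as (_ & Hn). eapply Rlt_le_trans; [exact Hn|].
      apply Rle_trans with (powerRZ rr (j + Z.of_nat t1)); [apply powerRZ_anti; [lra|lia]|].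
      rewrite powerRZ_nat by lra. apply Rmult_le_compat_r; [apply Rlt_le, powerRZ_pos; lra|assumption]. }
    rewrite <- (m_sum j u Hu) at 1.
    apply Rle_trans with (lsum (ch u) (fun c => lsum (incl_of u) (fun y => lsum (E y) (fun e =>
      ind (exists i, L (j + 1 + Z.of_nat i)%Z e /\ Nat.iter i P e = c) * m e)))).
    + apply lsum_le. intros c Hc. destruct (coarse_ch j u c x Hu Hx Hfine Hc) as (x' & Hx').
      apply (ch_spec j) in Hc; [|assumption]. destruct Hc as (Hc & Hpc).
      assert (Hcu : forall y, inc c y -> inc u y) by (intros y Hy; rewrite <- Hpc; eapply inc_P; eassumption).
      eapply Rle_trans; [apply (IH (j + 1)%Z c x' Hc Hx'); auto|].
      apply lsum_incl; [apply incl_NoDup| |].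
      * intros y Hy. apply (incl_spec _ _ _ Hc) in Hy. apply (incl_spec _ _ _ Hu). auto.
      * intros; apply lsum_nonneg; intros; eapply HE0; eassumption.
    + rewrite lsum_swap. apply lsum_le. intros y Hy. rewrite lsum_swap. apply lsum_le. intros e He.
      rewrite (lsum_ext _ _ (fun c => m e * ind (exists i, L (j + 1 + Z.of_nat i)%Z e /\ Nat.iter i P e = c))) by (intros; ring).
      rewrite lsum_scal, Rmult_comm. apply Rmult_le_compat_r; [apply Rlt_le; eapply m_pos; apply (HEL y); assumption|].
      destruct (classic (exists c, In c (ch u) /\ exists i, L (j + 1 + Z.of_nat i)%Z e /\ Nat.iter i P e = c)) as [(c & Hc & i & Hi & Ei)|Hno].
      * rewrite (ind_true (exists i, L (j + Z.of_nat i)%Z e /\ _)).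
        -- apply Rle_trans with (INR (length [c])); [|simpl; lra]. apply lsum_ind_le; [apply ch_NoDup|].
           intros c' _ (i' & Hi' & Ei'). left. rewrite <- Ei, <- Ei'. f_equal.
           pose proof (L_inj _ _ _ Hi Hi'). lia.
        -- exists (S i). replace (j + Z.of_nat (S i))%Z with (j + 1 + Z.of_nat i)%Z by lia. split; [assumption|].
           simpl. rewrite Ei. apply (ch_spec j) in Hc; tauto.
      * rewrite (lsum_ext _ _ (fun _ => 0 * 0)).
        -- rewrite lsum_scal, Rmult_0_l. apply ind_bounds.
        -- intros c Hc. rewrite ind_false; [lra|]. intros Hi. apply Hno. eauto.
Qed.

Definition Cmass : R := INR D * (a * (a * / eps ^ (t0 + t1))).

Lemma Cmass_bound : a * / eps ^ (t0 + t1) <= a * (a * / eps ^ (t0 + t1)) /\ a * (a * / eps ^ (t0 + t1)) <= Cmass /\ 1 <= / eps ^ (t0 + t1).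
Proof.
  assert (H : 1 <= / eps ^ (t0 + t1)).
  { rewrite <- Rinv_1. apply Rinv_le_contravar; [apply pow_lt; lra|]. apply pow_le1; lra. }
  assert (1 <= INR D) by (apply (le_INR 1); assumption).
  assert (a <= a * (a * / eps ^ (t0 + t1))) by nra. unfold Cmass. split; [nra|]. split; [nra|assumption].
Qed.

(** If every vertex of [u] stops at level [j] or finer, [coarse_mass] applies, and [Cmass] pays for
    the at most [D] pieces of [E y] and for [t0 + t1] levels. Otherwise some vertex [y] stops above
    [u], and [mu y] alone dominates [m u] up to the constant. *)
Lemma mass_lower j u x : L j u -> inc u x -> m u <= Cmass * lsum (incl_of u) mu.
Proof.
  intros Hu Hx. destruct Cmass_bound as (B1 & B2 & B3).
  assert (Hone : forall y, inc u y -> mu y <= lsum (incl_of u) mu).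
  { intros y Hy. apply lsum_In_le; [intros; apply Rlt_le, mu_pos|]. apply (incl_spec j); assumption. }
  destruct (classic (forall y, inc u y -> (j <= Jn y - Z.of_nat t1)%Z)) as [Hc|Hc].
  - destruct (list_zbound (incl_of u) Jn) as (b & Hb).
    assert (Hbx : (j <= b - Z.of_nat t1)%Z).
    { specialize (Hc x Hx). specialize (Hb x (proj2 (incl_spec _ _ _ Hu) Hx)). lia. }
    eapply Rle_trans; [apply (coarse_mass (Z.to_nat (b - Z.of_nat t1 - j)) j u x Hu Hx)|].
    { intros y Hy. specialize (Hc y Hy). specialize (Hb y (proj2 (incl_spec _ _ _ Hu) Hy)). lia. }
    rewrite <- lsum_scal. apply lsum_le. intros y Hy.
    eapply Rle_trans; [apply (lsum_const_le _ _ (a * (a * / eps ^ (t0 + t1)) * mu y))|].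
    + intros e He. apply (nb_spec _ _ (pc_L _ y)) in He. destruct He as (He & Ht).
      pose proof (m_slow _ _ _ (conj (pc_L _ y) (conj He Ht))) as M1.
      assert (HL : L (Jn y - Z.of_nat t1 + Z.of_nat (t0 + t1))%Z (wy y)).
      { replace (Jn y - Z.of_nat t1 + Z.of_nat (t0 + t1))%Z with (Jn y + Z.of_nat t0)%Z by lia. apply pc_L. }
      destruct (m_point _ _ _ _ y (pc_L (Jn y - Z.of_nat t1) y) HL (pc_inc _ y) (pc_inc _ y)) as (M2 & _).
      fold (mu y) in M2. pose proof (m_pos _ _ He).
      pose proof (ind_bounds (exists i, L (j + Z.of_nat i)%Z e /\ Nat.iter i P e = u)). nra.
    + assert (INR (length (E y)) <= INR D) by (apply le_INR; eapply nb_len; apply pc_L).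
      unfold Cmass. rewrite <- Rmult_assoc. apply Rmult_le_compat_r; [apply Rlt_le, mu_pos|].
      apply Rmult_le_compat_r; [|assumption]. nra.
  - apply not_all_ex_not in Hc. destruct Hc as (y & Hc). apply imply_to_and in Hc. destruct Hc as (Hy & Hj).
    apply Rle_trans with (a * (a * / eps ^ (t0 + t1)) * mu y).
    2:{ pose proof (Hone y Hy). pose proof (mu_pos y). apply Rmult_le_compat; try lra. nra. }
    destruct (Z_le_dec j (Jn y + Z.of_nat t0)) as [Hj2|Hj2].
    + set (k := Z.to_nat (Jn y + Z.of_nat t0 - j)).
      assert (HL : L (j + Z.of_nat k)%Z (wy y)).
      { replace (j + Z.of_nat k)%Z with (Jn y + Z.of_nat t0)%Z by lia. apply pc_L. }
      destruct (m_point j k u (wy y) y Hu HL Hy (pc_inc _ _)) as (M & _). fold (mu y) in M.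
      eapply Rle_trans; [exact M|]. pose proof (mu_pos y). apply Rmult_le_compat_r; [lra|].
      eapply Rle_trans; [|exact B1]. apply Rmult_le_compat_l; [lra|]. apply Rinv_le_contravar; [apply pow_lt; lra|].
      replace (t0 + t1)%nat with (k + (t0 + t1 - k))%nat by lia. rewrite pow_add.
      assert (eps ^ (t0 + t1 - k) <= 1) by (apply pow_le1; lra).
      assert (0 < eps ^ k) by (apply pow_lt; lra). nra.
    + set (k := Z.to_nat (j - (Jn y + Z.of_nat t0))).
      assert (HL : L (Jn y + Z.of_nat t0 + Z.of_nat k)%Z u).
      { replace (Jn y + Z.of_nat t0 + Z.of_nat k)%Z with j by lia. assumption. }
      destruct (m_point _ k (wy y) u y (pc_L _ _) HL (pc_inc _ _) Hy) as (_ & M). fold (mu y) in M.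
      eapply Rle_trans; [exact M|]. pose proof (mu_pos y). apply Rmult_le_compat_r; [lra|].
      assert ((1 - eps) ^ k <= 1) by (apply pow_le1; lra).
      assert (0 < (1 - eps) ^ k) by (apply pow_lt; lra). nra.
Qed.

(** Along the pieces of [x], [sg] tends to [0] downwards and to infinity upwards, at least at the
    rate [th]. *)
Lemma radius_level x s : 0 < s -> exists j, s <= sg (pc j x) /\ sg (pc (j + 1) x) < s.
Proof.
  intros Hs. pose proof th_bd as Hth. pose proof A_ge1 as HA. pose proof (sg_positive (pc 0 x)) as H0.
  destruct (small_pow th (sg (pc 0 x) / (A * s)) Hth) as (k1 & Hk1); [apply Rdiv_lt_0_compat; [assumption|nra]|].
  destruct (small_pow th (s / (A * sg (pc 0 x))) Hth) as (k2 & Hk2); [apply Rdiv_lt_0_compat; [assumption|nra]|].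
  destruct (zmax_exists (fun j => s <= sg (pc j x)) (- Z.of_nat k1) (Z.of_nat k2)) as (j & H1 & H2).
  - assert (HL : L (- Z.of_nat k1 + Z.of_nat k1)%Z (pc 0 x)).
    { replace (- Z.of_nat k1 + Z.of_nat k1)%Z with 0%Z by lia. apply pc_L. }
    destruct (sg_point (- Z.of_nat k1) k1 (pc (- Z.of_nat k1) x) (pc 0 x) x (pc_L _ _) HL (pc_inc _ _) (pc_inc _ _)) as (_ & H).
    assert (0 < A * s) by nra. apply (proj2 (Rlt_div_r _ _ _ H1)) in Hk1.
    assert (0 < th ^ k1) by (apply pow_lt; lra).
    apply Rmult_le_reg_l with (A * th ^ k1); [nra|]. lra.
  - intros j Hj. apply Z.nlt_ge. intros Hlt. set (k := Z.to_nat j).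
    assert (HL : L (0 + Z.of_nat k)%Z (pc j x)) by (replace (0 + Z.of_nat k)%Z with j by lia; apply pc_L).
    destruct (sg_point 0 k (pc 0 x) (pc j x) x (pc_L _ _) HL (pc_inc _ _) (pc_inc _ _)) as (_ & H).
    assert (0 < A * sg (pc 0 x)) by nra. apply (proj2 (Rlt_div_r _ _ _ H1)) in Hk2.
    replace k with (k2 + (k - k2))%nat in H by lia. rewrite pow_add in H.
    assert (th ^ (k - k2) <= 1) by (apply pow_le1; lra).
    assert (0 < th ^ (k - k2)) by (apply pow_lt; lra). assert (0 < th ^ k2) by (apply pow_lt; lra).
    assert (th ^ k2 * th ^ (k - k2) <= th ^ k2) by nra.
    assert (A * (th ^ k2 * th ^ (k - k2)) * sg (pc 0 x) <= A * th ^ k2 * sg (pc 0 x)) by (apply Rmult_le_compat_r; [lra|apply Rmult_le_compat_l; lra]).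
    lra.
  - exists j. split; [assumption|lra].
Qed.

(** Going up [tb] levels makes the lower bound of [rho_lower] exceed [s], so the points of the ball
    lie on pieces near that of [x]; [s7] further levels bring every [wy y] below level [jc]. Then
    [antichain] bounds the mass below each of at most [D^(T2+2)] pieces. *)
Lemma ball_upper x s j l : c1 * sg (pc (Jn x + Z.of_nat t0) x) <= s -> s <= sg (pc j x) ->
  NoDup l -> (forall y, In y l -> ball rho x s y) ->
  lsum l mu <= INR D ^ (T2 + 2) * (a ^ (T2 + 2) * (a * / eps ^ (1 + tb + s7))) * m (pc (j + 1) x).
Proof.
  intros Hr Hs Hl Hb. pose proof th_bd as Hth. pose proof A_ge1 as HA.
  set (jb := (j - Z.of_nat tb)%Z). set (jc := (jb - Z.of_nat s7)%Z).
  assert (Hlev : forall y, In y l -> (jc <= Jn y + Z.of_nat t0)%Z /\ within (adj (L jc) tch) (T2 + 2) (pc jc x)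
      (Nat.iter (Z.to_nat (Jn y + Z.of_nat t0 - jc)) P (wy y))).
  { intros y Hy. specialize (Hb y Hy). unfold ball in Hb.
    assert (Hw : within (adj (L jb) tch) T2 (pc jb x) (pc jb y)).
    { apply NNPP. intros Hn. pose proof (rho_lower jb _ _ x y (pc_L _ _) (pc_L _ _) (pc_inc _ _) (pc_inc _ _) Hn) as H.
      assert (HL : L (jb + Z.of_nat tb)%Z (pc j x)) by (replace (jb + Z.of_nat tb)%Z with j by lia; apply pc_L).
      destruct (sg_point jb tb (pc jb x) (pc j x) x (pc_L _ _) HL (pc_inc _ _) (pc_inc _ _)) as (_ & H2).
      pose proof (sg_positive (pc jb x)). nra. }
    assert (Hjc : (jc <= Jn y + Z.of_nat t0)%Z).
    (* For another point, [nd y <= d x y] bounds the scale of [wy y]; for the centre itself the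
       lower bound on the radius is what prevents [wy x] from lying above [jc]. *)
    { destruct (classic (x = y)) as [<-|Hne].
      - apply Z.nlt_ge. intros Hlt. set (k := Z.to_nat (j - (Jn x + Z.of_nat t0))).
        assert (HL : L (Jn x + Z.of_nat t0 + Z.of_nat k)%Z (pc j x)).
        { replace (Jn x + Z.of_nat t0 + Z.of_nat k)%Z with j by lia. apply pc_L. }
        destruct (sg_point _ k (pc (Jn x + Z.of_nat t0) x) (pc j x) x (pc_L _ _) HL (pc_inc _ _) (pc_inc _ _)) as (_ & H).
        replace k with (tb + (k - tb))%nat in H by lia. rewrite pow_add in H.
        assert (th ^ (k - tb) <= 1) by (apply pow_le1; lra).
        assert (0 < th ^ (k - tb)) by (apply pow_lt; lra). assert (0 < th ^ tb) by (apply pow_lt; lra).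
        assert (A * (th ^ tb * th ^ (k - tb)) <= A * th ^ tb) by (apply Rmult_le_compat_l; nra).
        pose proof (sg_positive (pc (Jn x + Z.of_nat t0) x)). nra.
      - pose proof (far jb _ _ x y (pc_L _ _) (pc_L _ _) (pc_inc _ _) (pc_inc _ _) Hw) as Hd.
        destruct d_metric as (_ & _ & Hsym & _). pose proof (nd_le y x (not_eq_sym Hne)) as Hn. rewrite Hsym in Hn.
        destruct (Jn_spec y) as (Hj & _).
        assert (powerRZ rr (Jn y + 1) < powerRZ rr jc).
        { replace jb with (jc + Z.of_nat s7)%Z in Hd by lia. rewrite powerRZ_nat in Hd by lra.
          pose proof (powerRZ_pos rr jc ltac:(lra)). nra. }
        apply powerRZ_lt_inv in H; [lia|assumption]. }
    split; [assumption|]. set (k := Z.to_nat (Jn y + Z.of_nat t0 - jc)).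
    assert (HLw : L (jc + Z.of_nat k)%Z (wy y)) by (replace (jc + Z.of_nat k)%Z with (Jn y + Z.of_nat t0)%Z by lia; apply pc_L).
    assert (HLb : forall z, L (jc + Z.of_nat s7)%Z (pc jb z)) by (intros; replace (jc + Z.of_nat s7)%Z with jb by lia; apply pc_L).
    replace (T2 + 2)%nat with (1 + (T2 + 1))%nat by lia.
    apply within_trans with (Nat.iter s7 P (pc jb x)); [apply within_step|apply within_trans with (Nat.iter s7 P (pc jb y)); [|apply within_step]].
    - split; [apply pc_L|split; [apply level_iter; apply HLb|]]. eapply inc_tch; [apply pc_L|apply level_iter, HLb|apply pc_inc|eapply vertex_iter; [apply HLb|apply pc_inc]].
    - revert Hw. apply within_map. intros v v'. replace jb with (jc + Z.of_nat s7)%Z by lia. apply touch_iter.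
    - split; [apply level_iter; apply HLb|split; [apply level_iter; assumption|]].
      eapply inc_tch; [apply level_iter, HLb|apply level_iter; exact HLw|eapply vertex_iter; [apply HLb|apply pc_inc]|eapply vertex_iter; [exact HLw|apply pc_inc]]. }
  set (BL := bl nb (T2 + 2) (pc jc x)).
  assert (HBL : forall u, In u BL <-> within (adj (L jc) tch) (T2 + 2) (pc jc x) u).
  { intros u. apply (bl_spec (L jc) tch nb); [intros; eapply tch_refl; eassumption|apply nb_spec|apply pc_L]. }
  set (anc := fun y => Nat.iter (Z.to_nat (Jn y + Z.of_nat t0 - jc)) P (wy y)).
  eapply Rle_trans; [apply (lsum_fibers anc l BL); [assumption|intros; apply HBL, Hlev; assumption|intros; apply Rlt_le, mu_pos]|].
  assert (HD1 : 1 <= INR D) by (apply (le_INR 1); assumption).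
  pose proof (m_pos _ _ (pc_L jc x)) as Hmc.
  assert (Hac : 0 <= a ^ (T2 + 2) * m (pc jc x)) by (apply Rmult_le_pos; [apply pow_le; lra|lra]).
  apply Rle_trans with (INR D ^ (T2 + 2) * (a ^ (T2 + 2) * m (pc jc x))).
  - eapply Rle_trans; [apply (lsum_const_le _ _ (a ^ (T2 + 2) * m (pc jc x)))|].
    + intros u Hu. apply HBL in Hu. assert (HuL : L jc u) by (eapply within_adj_X; [apply pc_L|exact Hu]).
      apply Rle_trans with (m u).
      * destruct (list_zbound l (fun y => (Jn y + Z.of_nat t0 - jc)%Z)) as (b & Hbz).
        apply (antichain (Z.to_nat b) jc); [assumption|apply NoDup_keep; assumption|].
        intros y Hy. apply In_keep in Hy. destruct Hy as (Hy & Ey). destruct (Hlev y Hy) as (Hj & _).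
        exists (Z.to_nat (Jn y + Z.of_nat t0 - jc)). specialize (Hbz y Hy). cbv beta in Hbz. split; [lia|]. split; [|exact Ey].
        replace (jc + Z.of_nat (Z.to_nat (Jn y + Z.of_nat t0 - jc)))%Z with (Jn y + Z.of_nat t0)%Z by lia. apply pc_L.
      * apply (within_ratio (adj (L jc) tch) m a); [assumption|intros; eapply m_slow; eassumption|lra|assumption].
    + apply Rmult_le_compat_r; [assumption|]. rewrite <- pow_INR. apply le_INR.
      apply (bl_length (L jc) tch nb D); [intros; eapply tch_refl; eassumption|apply nb_spec|apply nb_len|apply pc_L].
  - assert (HL : L (jc + Z.of_nat (1 + tb + s7))%Z (pc (j + 1) x)).
    { replace (jc + Z.of_nat (1 + tb + s7))%Z with (j + 1)%Z by lia. apply pc_L. }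
    destruct (m_point jc (1 + tb + s7) (pc jc x) (pc (j + 1) x) x (pc_L _ _) HL (pc_inc _ _) (pc_inc _ _)) as (M & _).
    replace (INR D ^ (T2 + 2) * (a ^ (T2 + 2) * (a * / eps ^ (1 + tb + s7))) * m (pc (j + 1) x))
      with (INR D ^ (T2 + 2) * (a ^ (T2 + 2) * (a * / eps ^ (1 + tb + s7) * m (pc (j + 1) x)))) by ring.
    apply Rmult_le_compat_l; [apply pow_le; lra|]. apply Rmult_le_compat_l; [apply pow_le; lra|exact M].
Qed.

Lemma rho_AR_measure : AR_measure rho p mu.
Proof.
  split; [intros; apply Rlt_le, mu_pos|].
  set (Cu := INR D ^ (T2 + 2) * (a ^ (T2 + 2) * (a * / eps ^ (1 + tb + s7)))).
  set (Cl := Cmass * (a * / eps)).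
  assert (HD1 : 1 <= INR D) by (apply (le_INR 1); assumption).
  assert (HCu : 0 < Cu).
  { unfold Cu. repeat apply Rmult_lt_0_compat; try (apply pow_lt; lra); try lra. apply Rinv_0_lt_compat, pow_lt; lra. }
  destruct Cmass_bound as (B1 & B2 & B3).
  assert (HCm : 0 < Cmass) by nra.
  assert (HCl : 0 < Cl) by (unfold Cl; repeat apply Rmult_lt_0_compat; try lra; apply Rinv_0_lt_compat; lra).
  exists (Cu + Cl). split; [lra|]. intros x s Hs Hrx _.
  destruct (radius_level x s Hs) as (j & Hj1 & Hj2).
  (* Any other vertex is far from [x] at the level of [wy x], so [rx] is at least [c1 * sg (wy x)]:
     admissible radii are not below the size of the point mass. *)
  assert (Hr : c1 * sg (pc (Jn x + Z.of_nat t0) x) <= s).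
  { assert (Rbar_le (Finite (c1 * sg (pc (Jn x + Z.of_nat t0) x))) (Finite s)); [|assumption].
    eapply Rbar_le_trans; [|exact Hrx]. apply rb_inf_glb. intros z (y & Hy & ->). simpl. apply rho_far.
    destruct (Jn_spec x) as (Hn & _). pose proof (nd_le x y (not_eq_sym Hy)).
    rewrite powerRZ_nat by lra. rewrite powerRZ_S in Hn by lra. pose proof (powerRZ_pos rr (Jn x) ltac:(lra)). nra. }
  assert (Hsp : 0 < Rpower s p) by apply Rpower_pos.
  assert (Hm1 : m (pc (j + 1) x) <= Rpower s p).
  { rewrite <- (sg_pow _ _ (pc_L (j + 1) x)). apply Rle_Rpower_l; [lra|]. split; [apply sg_positive|lra]. }
  assert (Hm0 : Rpower s p <= m (pc j x)).
  { rewrite <- (sg_pow _ _ (pc_L j x)). apply Rle_Rpower_l; lra. }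
  split.
  (* The piece of [x] at level [j + 1] has diameter less than [s] and therefore lies in the ball. *)
  - set (u := pc (j + 1) x). eapply Rbar_le_trans; [|apply (nnsum_ge _ mu (incl_of u)); [apply incl_NoDup|]].
    + simpl. pose proof (mass_lower (j + 1) u x (pc_L _ _) (pc_inc _ _)) as H1.
      destruct (m_point j 1 (pc j x) u x (pc_L _ _) (pc_L _ _) (pc_inc _ _) (pc_inc _ _)) as (H2 & _).
      rewrite pow_1 in H2. assert (0 < / eps) by (apply Rinv_0_lt_compat; lra).
      assert (0 <= lsum (incl_of u) mu) by (apply lsum_nonneg; intros; apply Rlt_le, mu_pos).
      assert (Rpower s p <= Cl * lsum (incl_of u) mu).
      { eapply Rle_trans; [exact Hm0|]. eapply Rle_trans; [exact H2|]. unfold Cl.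
        replace (Cmass * (a * / eps) * lsum (incl_of u) mu) with (a * / eps * (Cmass * lsum (incl_of u) mu)) by ring.
        apply Rmult_le_compat_l; [apply Rmult_le_pos; lra|assumption]. }
      apply Rmult_le_reg_l with (Cu + Cl); [lra|]. rewrite <- Rmult_assoc, Rinv_r, Rmult_1_l by lra. nra.
    + intros y Hy. apply (incl_spec (j + 1)) in Hy; [|apply pc_L]. unfold ball.
      eapply Rle_lt_trans; [|exact Hj2]. eapply rho_piece; [apply pc_L|apply pc_inc|exact Hy].
  - apply nnsum_le. intros l Hl Hb. eapply Rle_trans; [apply (ball_upper x s j); assumption|]. fold Cu. nra.
Qed.
End Conformal.

(** * Regular metrics from small energies *)

Lemma NoDup_pairs {A B : Type} (l : list A) (g : A -> list B) :
  NoDup l -> (forall x, In x l -> NoDup (g x)) -> NoDup (flat_map (fun x => map (pair x) (g x)) l).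
Proof.
  induction l as [|x l IH]; intros Hl Hg; [constructor|]. inversion Hl as [|? ? Hx Hl']; subst. simpl.
  apply NoDup_app.
  - apply FinFun.Injective_map_NoDup; [intros ? ? E; congruence|apply Hg; left; reflexivity].
  - apply IH; [assumption|intros; apply Hg; right; assumption].
  - intros (x1, y1) H1 H2. apply in_map_iff in H1. destruct H1 as (y & E & _). inversion E; subst.
    apply in_flat_map in H2. destruct H2 as (x2 & Hx2 & H2). apply in_map_iff in H2. destruct H2 as (y2 & E2 & _).
    inversion E2; subst. contradiction.
Qed.

Section Filling.
Context {G V : Type} (lev : Z -> V -> Prop) (par : V -> V) (tch : V -> V -> Prop) (inc : V -> G -> Prop)
  (d : G -> G -> R) (r : R) (nb : V -> list V) (D B M n1 : nat) (C7 c8 : R) (nd : G -> R).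

(* [inc v x]: the vertex [x] lies on the piece [v]; [nd x] is of the order of the distance from [x] to the other vertices. *)
Record filling : Prop := {
  fl_inj : forall j j' v, lev j v -> lev j' v -> j = j';
  fl_sym : forall v v', tch v v' -> tch v' v;
  fl_refl : forall j v, lev j v -> tch v v;
  fl_par : forall j v, lev (j + 1)%Z v -> lev j (par v);
  fl_tch_par : forall j v v', adj (lev (j + 1)%Z) tch v v' -> tch (par v) (par v');
  fl_nb : forall j v, lev j v -> forall v', In v' (nb v) <-> lev j v' /\ tch v v';
  fl_nb_NoDup : forall v, NoDup (nb v);
  fl_nb_len : forall j v, lev j v -> (length (nb v) <= D)%nat;
  fl_ch : forall j w, lev j w -> exists l, (length l <= B)%nat /\ forall v, lev (j + 1)%Z v -> par v = w -> In v l;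
  fl_inc_par : forall j v x, lev (j + 1)%Z v -> inc v x -> inc (par v) x;
  fl_inc_tch : forall j v v' x, lev j v -> lev j v' -> inc v x -> inc v' x -> tch v v';
  fl_inc_fin : forall j v, lev j v -> exists l, forall x, inc v x -> In x l;
  fl_cover : forall j x, exists v, lev j v /\ inc v x;
  fl_contract : forall i n j v v', (i * n1 <= n)%nat -> lev (j + Z.of_nat n)%Z v ->
    within (adj (lev (j + Z.of_nat n)%Z) tch) i v v' ->
    within (adj (lev j) tch) M (Nat.iter n par v) (Nat.iter n par v');
  fl_interior : forall j w, lev j w -> exists c, lev (j + Z.of_nat n1)%Z c /\ Nat.iter n1 par c = w /\
    forall v', adj (lev (j + Z.of_nat n1)%Z) tch c v' -> Nat.iter n1 par v' = w;
  fl_neighbour : forall j v, lev j v -> exists v', adj (lev j) tch v v' /\ v <> v';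
  fl_far : forall j k v v' x y, lev j v -> lev j v' -> inc v x -> inc v' y ->
    within (adj (lev j) tch) k v v' -> d x y <= C7 * INR (S k) * powerRZ r j;
  fl_near : forall j v v' x y, lev j v -> lev j v' -> inc v x -> inc v' y -> d x y < c8 * powerRZ r j ->
    within (fun a b => adj (lev j) tch a b /\ exists z, inc a z /\ inc b z) M v v';
  fl_nd : forall x, 0 < nd x;
  fl_nd_le : forall x y, x <> y -> nd x <= d x y;
  fl_common : forall j j' v v', lev j v -> lev j' v' -> exists k k', Nat.iter k par v = Nat.iter k' par v';
  fl_coarse : forall n, exists c9, 0 < c9 /\ forall j u c x, lev j u -> inc u x ->
    (forall y, inc u y -> nd y < c9 * powerRZ r j) ->
    lev (j + Z.of_nat n)%Z c -> Nat.iter n par c = u -> exists y, inc c y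
}.

Hypothesis Fl : filling.
Hypothesis D_pos : (1 <= D)%nat.
Hypothesis B_pos : (1 <= B)%nat.
Hypothesis n1_pos : (1 <= n1)%nat.
Hypothesis C7_pos : 0 < C7.
Hypothesis c8_pos : 0 < c8.
Hypothesis r_bd : 0 < r < 1.
Hypothesis d_metric : is_metric d.

Lemma lev_iter j n v : lev (j + Z.of_nat n)%Z v -> lev j (Nat.iter n par v).
Proof. apply iter_lev. exact (fl_par Fl). Qed.

Lemma adj_iter j n v v' : adj (lev (j + Z.of_nat n)%Z) tch v v' -> adj (lev j) tch (Nat.iter n par v) (Nat.iter n par v').
Proof. apply iter_touch; [exact (fl_par Fl)|exact (fl_tch_par Fl)]. Qed.

Lemma inc_iter j n v x : lev (j + Z.of_nat n)%Z v -> inc v x -> inc (Nat.iter n par v) x.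
Proof. apply (iter_vertex lev); [exact (fl_par Fl)|exact (fl_inc_par Fl)]. Qed.

Lemma iter_add_par a b v : Nat.iter (a + b) par v = Nat.iter a par (Nat.iter b par v).
Proof. apply Nat.iter_add. Qed.

Lemma children_list n : forall j w, lev j w -> exists l, (length l <= B ^ n)%nat /\
  forall v, lev (j + Z.of_nat n)%Z v -> Nat.iter n par v = w -> In v l.
Proof.
  induction n as [|n IH]; intros j w Hw.
  - exists [w]. split; [simpl; lia|]. simpl. intros v _ ->. left; reflexivity.
  - destruct (fl_ch Fl j w Hw) as (l & Hl & Hin).
    destruct (choice (fun c lc => lev (j + 1)%Z c -> (length lc <= B ^ n)%nat /\
      forall v, lev (j + 1 + Z.of_nat n)%Z v -> Nat.iter n par v = c -> In v lc)) as (g & Hg).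
    { intros c. destruct (classic (lev (j + 1)%Z c)) as [Hc|Hc]; [|exists []; tauto].
      destruct (IH _ _ Hc) as (lc & H). exists lc. auto. }
    set (l' := keep (lev (j + 1)%Z) l).
    assert (Hl' : forall c, In c l' <-> In c l /\ lev (j + 1)%Z c) by (intros; exact (In_keep _ _ _)).
    assert (Hll : (length l' <= length l)%nat) by apply length_keep.
    exists (flat_map g l'). split.
    + eapply Nat.le_trans; [apply (length_flat_map_le _ _ (B ^ n))|simpl; apply Nat.mul_le_mono_r; lia].
      intros c Hc. apply Hl' in Hc. apply Hg; tauto.
    + intros v Hv E. replace (j + Z.of_nat (S n))%Z with (j + 1 + Z.of_nat n)%Z in Hv by lia. simpl in E.
      apply in_flat_map. exists (Nat.iter n par v). pose proof (lev_iter _ _ _ Hv) as Hc. split.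
      * apply Hl'. split; [apply Hin; assumption|assumption].
      * apply Hg; auto.
Qed.

(** Each round of [n1] generations protects one more step: the first step of a chain from [c] stays
    below [c'], and the remaining [i] steps project to a chain from [c']. *)
Lemma interior_iter i : forall j w, lev j w -> exists c, lev (j + Z.of_nat (i * n1))%Z c /\ Nat.iter (i * n1) par c = w /\
  forall v', within (adj (lev (j + Z.of_nat (i * n1))%Z) tch) i c v' -> Nat.iter (i * n1) par v' = w.
Proof.
  induction i as [|i IH]; intros j w Hw.
  - exists w. simpl. rewrite Z.add_0_r. split; [assumption|]. split; [reflexivity|]. congruence.
  - destruct (IH j w Hw) as (c' & Hc' & Ec' & Hi').
    destruct (fl_interior Fl _ c' Hc') as (c & Hc & Ec & Hi).
    assert (El : (j + Z.of_nat (i * n1) + Z.of_nat n1)%Z = (j + Z.of_nat (S i * n1))%Z) by (simpl; lia).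
    assert (En : (S i * n1 = i * n1 + n1)%nat) by (simpl; lia).
    rewrite El in *. exists c. split; [assumption|]. rewrite En. split; [rewrite iter_add_par, Ec; assumption|].
    intros v' Hv'. rewrite iter_add_par. apply Hi'.
    rewrite <- En in Hv'. apply (within_split _ 1 i) in Hv'. destruct Hv' as (u & Hu & Hv').
    assert (Eu : Nat.iter n1 par u = c').
    { destruct Hu as [Hu|(z & Hz & Ha)]; [simpl in Hu; congruence|]. simpl in Hz. subst z. apply Hi. assumption. }
    rewrite <- Eu. revert Hv'. apply within_map. intros x y. rewrite <- El. apply adj_iter.
Qed.

Lemma descendant n : forall j w, lev j w -> exists v, lev (j + Z.of_nat n)%Z v /\ Nat.iter n par v = w.
Proof.
  intros j w Hw. destruct (interior_iter n j w Hw) as (c & Hc & E & _).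
  assert (Hn : (n * n1 = n + (n * n1 - n))%nat) by nia.
  exists (Nat.iter (n * n1 - n) par c). split.
  - apply lev_iter. replace (j + Z.of_nat n + Z.of_nat (n * n1 - n))%Z with (j + Z.of_nat (n * n1))%Z by lia. assumption.
  - rewrite <- iter_add_par. rewrite <- Hn. assumption.
Qed.

Lemma interior_deep i n j w : (i * n1 <= n)%nat -> lev j w -> exists c, lev (j + Z.of_nat n)%Z c /\ Nat.iter n par c = w /\
  forall v', within (adj (lev (j + Z.of_nat n)%Z) tch) i c v' -> Nat.iter n par v' = w.
Proof.
  intros Hn Hw. destruct (interior_iter i j w Hw) as (c' & Hc' & Ec' & Hi').
  destruct (descendant (n - i * n1) _ c' Hc') as (c & Hc & Ec).
  assert (En : forall v, Nat.iter n par v = Nat.iter (i * n1) par (Nat.iter (n - i * n1) par v)).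
  { intros v. rewrite <- iter_add_par. f_equal. lia. }
  assert (El : (j + Z.of_nat (i * n1) + Z.of_nat (n - i * n1))%Z = (j + Z.of_nat n)%Z) by lia.
  exists c. split; [rewrite <- El; assumption|]. split; [rewrite En, Ec; assumption|].
  intros v' Hv'. rewrite En. apply Hi'. rewrite <- Ec. rewrite <- El in Hv'. revert Hv'.
  apply within_map. intros x y. apply adj_iter.
Qed.

(** An interior descendant and a neighbour of it are distinct and both lie below [w]. *)
Lemma two_descendants n j w : (n1 <= n)%nat -> lev j w -> exists c c', c <> c' /\
  lev (j + Z.of_nat n)%Z c /\ Nat.iter n par c = w /\ lev (j + Z.of_nat n)%Z c' /\ Nat.iter n par c' = w.
Proof.
  intros Hn Hw. destruct (fl_interior Fl _ w Hw) as (a & Ha & Ea & Hi).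
  destruct (fl_neighbour Fl _ a Ha) as (b & Hab & Hne).
  pose proof (Hi b Hab) as Eb. pose proof Hab as (_ & Hb & _).
  destruct (descendant (n - n1) _ a Ha) as (c & Hc & Ec). destruct (descendant (n - n1) _ b Hb) as (c' & Hc' & Ec').
  assert (El : (j + Z.of_nat n1 + Z.of_nat (n - n1))%Z = (j + Z.of_nat n)%Z) by lia. rewrite El in *.
  assert (En : forall v, Nat.iter n par v = Nat.iter n1 par (Nat.iter (n - n1) par v)).
  { intros v. rewrite <- iter_add_par. f_equal. lia. }
  exists c, c'. split; [intros ->; congruence|].
  rewrite !En, Ec, Ec'. auto.
Qed.

Section Block.
Context (p : R) (N2 : nat).
Hypothesis p_pos : 0 < p.
Hypothesis V_count : exists en : nat -> V, forall v, exists k, en k = v.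
Hypothesis V_ref : exists v, lev 0%Z v.
Hypothesis energy : forall delta n0, 0 < delta -> exists n, (n0 <= n)%nat /\ forall j u, lev j u ->
  exists f : V -> R, (forall v, lev (j + Z.of_nat n)%Z v -> Nat.iter n par v = u -> f v = 1) /\
    (forall v, lev (j + Z.of_nat n)%Z v -> ~ within (adj (lev j) tch) N2 u (Nat.iter n par v) -> f v = 0) /\
    forall l, NoDup l -> (forall vv, In vv l -> adj (lev (j + Z.of_nat n)%Z) tch (fst vv) (snd vv) /\ fst vv <> snd vv) ->
      lsum l (fun vv => rpow (Rabs (f (fst vv) - f (snd vv))) p) <= delta.

Theorem filling_dimension : exists rho, is_metric rho /\ Ahlfors_regular rho p /\ QS d rho.
Proof.
  pose proof (fl_inj Fl) as F_inj.
  pose proof (fl_sym Fl) as F_sym.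
  pose proof (fl_refl Fl) as F_refl.
  pose proof (fl_nb Fl) as F_nb.
  pose proof (fl_nb_NoDup Fl) as F_nbN.
  pose proof (fl_nb_len Fl) as F_nbl.
  set (Q := S N2). set (T := (Q + M)%nat).
  assert (HD : 1 <= INR D) by (apply (le_INR 1); assumption).
  assert (HB : 1 <= INR B) by (apply (le_INR 1); assumption).
  (* The factor [B^n1] offsets the number of children: the tail has order [2^-i * B^(-n1 i)], while
     [eps] has order [B^-n] with [n < (i + 1) * n1]. *)
  set (b := 2 * INR D * INR B ^ n1).
  assert (HBn : 1 <= INR B ^ n1) by (apply pow_R1_Rle; assumption).
  assert (Hb : 2 * INR D <= b) by (unfold b; nra).
  set (a := 2 * b). assert (Ha1 : 1 <= a) by (unfold a; lra).
  set (tau := / (4 * INR D ^ M * a ^ M)).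
  assert (HDM : 1 <= INR D ^ M) by (apply pow_R1_Rle; assumption). assert (HaM : 1 <= a ^ M) by (apply pow_R1_Rle; assumption).
  assert (H4 : 4 <= 4 * INR D ^ M * a ^ M) by nra.
  assert (Htau : 0 < tau <= 1 / 4).
  { unfold tau. split; [apply Rinv_0_lt_compat; lra|]. replace (1 / 4) with (/ 4) by lra. apply Rinv_le_contravar; lra. }
  set (A := Rpower a (/ p)).
  assert (Hip : 0 < / p) by (apply Rinv_0_lt_compat; assumption).
  assert (HA1 : 1 <= A).
  { unfold A. rewrite <- (Rpower_O a) by lra. apply Rle_Rpower; lra. }
  set (C0 := INR (S Q) * A ^ S Q).
  assert (HC0 : 0 < C0) by (unfold C0; apply Rmult_lt_0_compat; [apply lt_0_INR; lia|apply pow_lt; lra]).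
  set (C0p := Rpower C0 p). assert (HC0p : 0 < C0p) by apply Rpower_pos.
  set (delta := tau / (2 * INR D ^ Q * a ^ Q)).
  assert (HDQ : 0 < INR D ^ Q) by (apply pow_lt; lra). assert (HaQ : 0 < a ^ Q) by (apply pow_lt; lra).
  assert (Hdel : 0 < delta) by (apply Rdiv_lt_0_compat; [lra|nra]).
  set (KK := 16 * (INR D ^ M * INR D ^ M) * (a ^ M * a ^ M) * INR B ^ n1).
  destruct (small_pow (/ 2) (/ KK)) as (i0 & Hi0); [lra|apply Rinv_0_lt_compat; unfold KK; repeat apply Rmult_lt_0_compat; lra|].
  (* The block length makes [i] at least [i0], for the tail, and at least [T], for contraction at
     the range required by [hk_const]. Dividing [delta] by [C0p] anticipates the factor in [Phi]. *)
  destruct (energy (delta / C0p) ((i0 + T + 1) * n1)%nat) as (n & Hn & Hen); [apply Rdiv_lt_0_compat; assumption|].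
  set (i := (n / n1)%nat).
  assert (Hin : (i * n1 <= n < (i + 1) * n1)%nat).
  { unfold i. pose proof (Nat.div_mod_eq n n1). pose proof (Nat.mod_upper_bound n n1 ltac:(lia)). nia. }
  assert (Hii : (i0 + T + 1 <= i)%nat) by nia.
  set (Bn := (B ^ n)%nat). assert (HBn' : 1 <= INR Bn) by (unfold Bn; rewrite pow_INR; apply pow_R1_Rle; assumption).
  set (eps := tau / (2 * INR Bn)).
  assert (Heps : 0 < eps < 1 / 2).
  { unfold eps. split; [apply Rdiv_lt_0_compat; lra|]. apply Rlt_div_l; nra. }
  assert (Hepsm : eps * INR Bn <= tau / 2) by (unfold eps; right; field; lra).
  assert (Hdelm : INR D ^ Q * a ^ Q * delta <= tau / 2) by (unfold delta; right; field; lra).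
  assert (Htail : / b ^ i * (INR D ^ i * INR D ^ M * (2 * a ^ M)) <= eps).
  { assert (E1 : / b ^ i * INR D ^ i = (/ 2) ^ i * / (INR B ^ n1) ^ i).
    { rewrite <- (pow_inv b), <- (pow_inv (INR B ^ n1)), <- !Rpow_mult_distr. f_equal. unfold b. field. lra. }
    assert (E2 : (/ 2) ^ i <= / KK).
    { replace i with (i0 + (i - i0))%nat by lia. rewrite pow_add.
      assert ((/ 2) ^ (i - i0) <= 1) by (apply pow_le1; lra). assert (0 < (/ 2) ^ i0) by (apply pow_lt; lra). nra. }
    assert (E3 : INR Bn <= (INR B ^ n1) ^ i * INR B ^ n1).
    { unfold Bn. rewrite pow_INR, <- pow_mult, <- pow_add. apply Rle_pow; [assumption|nia]. }
    assert (HX : 0 < (INR B ^ n1) ^ i) by (apply pow_lt; lra).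
    replace (/ b ^ i * (INR D ^ i * INR D ^ M * (2 * a ^ M))) with (/ b ^ i * INR D ^ i * (INR D ^ M * (2 * a ^ M))) by ring.
    rewrite E1. unfold eps, tau. apply (proj1 (Rle_div_r _ _ (2 * INR Bn) ltac:(lra))).
    apply Rle_trans with (/ KK * / (INR B ^ n1) ^ i * (INR D ^ M * (2 * a ^ M)) * (2 * ((INR B ^ n1) ^ i * INR B ^ n1))).
    - apply Rmult_le_compat; [|lra| |lra].
      + repeat apply Rmult_le_pos; try lra; [apply pow_le; lra|apply Rlt_le, Rinv_0_lt_compat; assumption].
      + apply Rmult_le_compat_r; [nra|]. apply Rmult_le_compat_r; [apply Rlt_le, Rinv_0_lt_compat; assumption|assumption].
    - right. unfold KK. field. repeat split; try lra. }
  set (L := fun (j : Z) v => lev (j * Z.of_nat n)%Z v).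
  set (P := fun v => Nat.iter n par v).
  assert (EL : forall j, ((j + 1) * Z.of_nat n = j * Z.of_nat n + Z.of_nat n)%Z) by (intros; ring).
  assert (HLS : forall j v, L (j + 1)%Z v <-> lev (j * Z.of_nat n + Z.of_nat n)%Z v) by (intros; unfold L; rewrite EL; tauto).
  assert (HPL : forall j v, L (j + 1)%Z v -> L j (P v)) by (intros j v Hv; apply lev_iter; apply HLS; assumption).
  assert (Hnpos : (1 <= n)%nat) by nia.
  assert (HL_inj : forall j j' v, L j v -> L j' v -> j = j').
  { intros j j' v H1 H2. pose proof (F_inj _ _ _ H1 H2). nia. }
  assert (HtP : forall j v v', adj (L (j + 1)%Z) tch v v' -> tch (P v) (P v')).
  { intros j v v' (H1 & H2 & H3). apply (adj_iter (j * Z.of_nat n)%Z n v v'). split; [apply HLS; assumption|split; [apply HLS; assumption|assumption]]. }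
  assert (HwL : forall j k v v', within (adj (L (j + 1)%Z) tch) k v v' -> within (adj (lev (j * Z.of_nat n + Z.of_nat n)%Z) tch) k v v').
  { intros j k v v'. apply within_impl. unfold L, adj. rewrite EL. tauto. }
  assert (Hcontr : forall k j v v', (k <= i)%nat -> L (j + 1)%Z v -> within (adj (L (j + 1)%Z) tch) k v v' -> within (adj (L j) tch) M (P v) (P v')).
  { intros k j v v' Hk Hv Hw. apply HLS in Hv. apply HwL in Hw.
    apply (fl_contract Fl k n (j * Z.of_nat n)%Z); [nia|assumption|assumption]. }
  destruct (choice (fun w l => NoDup l /\ (length l <= Bn)%nat /\ forall j, L j w -> forall v, In v l <-> L (j + 1)%Z v /\ P v = w)) as (ch & Hch).
  { intros w. destruct (classic (exists j, L j w)) as [(j & Hw)|Hno].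
    2:{ exists []. split; [constructor|]. split; [simpl; lia|]. intros j Hw. exfalso; eauto. }
    destruct (children_list n _ w Hw) as (l & Hl & Hin').
    set (l' := ndup (keep (fun v => L (j + 1)%Z v /\ P v = w) l)).
    exists l'. split; [apply NoDup_ndup|]. split.
    - apply Nat.le_trans with (length l); [|exact Hl]. apply NoDup_incl_length; [apply NoDup_ndup|].
      intros v Hv. unfold l' in Hv. apply In_ndup, In_keep in Hv. tauto.
    - intros j' Hj' v. rewrite <- (HL_inj _ _ _ Hw Hj'). unfold l'. rewrite In_ndup, In_keep.
      split; [tauto|]. intros H. split; [|assumption]. apply Hin'; [apply HLS; tauto|tauto]. }
  destruct (choice (fun u f => forall j, L j u -> (forall v, L (j + 1)%Z v -> P v = u -> f v = 1) /\
     (forall v, L (j + 1)%Z v -> ~ within (adj (L j) tch) N2 u (P v) -> f v = 0) /\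
     forall l, NoDup l -> (forall vv, In vv l -> adj (L (j + 1)%Z) tch (fst vv) (snd vv) /\ fst vv <> snd vv) ->
       lsum l (fun vv => rpow (Rabs (f (fst vv) - f (snd vv))) p) <= delta / C0p)) as (f0 & Hf0).
  { intros u. destruct (classic (exists j, L j u)) as [(j & Hu)|Hno].
    - destruct (Hen _ u Hu) as (f & E1 & E2 & E3). exists f. intros j' Hj'. rewrite <- (HL_inj _ _ _ Hu Hj').
      split; [intros v Hv; apply E1; apply HLS; assumption|]. split; [intros v Hv; apply E2; apply HLS; assumption|].
      intros l Hl Hll. apply E3; [assumption|]. intros vv Hvv. unfold L in Hll. rewrite EL in Hll. apply Hll. assumption.
    - exists (fun _ => 0). intros j Hj. exfalso; eauto. }
  (* After taking [p]-th roots, [m u * Phi u v <= m v] bounds [C0 * sg u] times each increment of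
     the cutoff at [v] by [sg v]; this is the form in which [ext_lip] uses it. *)
  set (Phi := fun u v => C0p * lsum (nb v) (fun v' => rpow (Rabs (f0 u v - f0 u v')) p)).
  assert (HPhi0 : forall u v, 0 <= Phi u v).
  { intros u v. unfold Phi. apply Rmult_le_pos; [lra|]. apply lsum_nonneg. intros. apply rpow_nonneg. }
  assert (HPhis : forall j u w, L j u -> L j w -> lsum (ch w) (Phi u) <= delta).
  { intros j u w Hu Hw. destruct (Hch w) as (Hc1 & _ & Hc2). unfold Phi. rewrite lsum_scal.
    set (nb' := fun v => keep (fun v' => v <> v') (nb v)).
    assert (Hnb' : forall v v', In v' (nb' v) <-> In v' (nb v) /\ v <> v') by (intros; exact (In_keep _ _ _)).
    assert (H : lsum (ch w) (fun v => lsum (nb v) (fun v' => rpow (Rabs (f0 u v - f0 u v')) p)) <= delta / C0p).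
    { apply Rle_trans with (lsum (flat_map (fun v => map (pair v) (nb' v)) (ch w)) (fun vv => rpow (Rabs (f0 u (fst vv) - f0 u (snd vv))) p)).
      - rewrite lsum_flat_map. apply lsum_le. intros v _. rewrite lsum_map. simpl.
        right. apply lsum_keep. intros v' _ Hvv. apply NNPP in Hvv. subst v'. rewrite Rminus_diag, Rabs_R0. apply rpow_0. lra.
      - destruct (Hf0 u j Hu) as (_ & _ & H3). apply H3.
        + apply NoDup_pairs; [assumption|]. intros. apply NoDup_keep. apply F_nbN.
        + intros vv Hvv. apply in_flat_map in Hvv. destruct Hvv as (v & Hv & Hvv). apply in_map_iff in Hvv.
          destruct Hvv as (v' & <- & Hv'). simpl. apply Hnb' in Hv'. apply (Hc2 j Hw) in Hv. destruct Hv as (Hv & _).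
          destruct Hv' as (Hv' & Hne). apply (F_nb _ _ Hv) in Hv'. split; [|assumption]. split; [assumption|tauto]. }
    apply Rmult_le_compat_l with (r := C0p) in H; [|lra]. replace (C0p * (delta / C0p)) with delta in H by (field; lra). exact H. }
  destruct V_count as (en & Hen'). destruct V_ref as (ref & Href).
  destruct (mass_exists L tch nb ch P D Bn M i Q HL_inj F_sym (fun j v => F_refl _ v) (fun j v => F_nb _ v) F_nbN (fun j v => F_nbl _ v) HPL)
    with (Phi := Phi) (a := a) (b := b) (eps := eps) (delta := delta) (tau := tau) (en := en) (ref := ref)
    as (m & m_pos & m_slow & m_P & m_sum & m_Phi); try assumption; try reflexivity; try lia; try tauto.
  { intros j w Hw. apply Hch; assumption. }
  { intros w. apply Hch. }
  { intros j w Hw. destruct (Hch w) as (Hc1 & Hc2 & Hc3). split; [|assumption].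
    destruct (two_descendants n _ w ltac:(nia) Hw) as (c & c' & Hne & H1 & H2 & H3 & H5).
    assert (incl [c; c'] (ch w)).
    { intros z [<-|[<-|[]]]; apply (Hc3 j Hw); (split; [apply HLS; assumption|assumption]). }
    change 2%nat with (length [c; c']). apply NoDup_incl_length; [|assumption].
    constructor; [simpl; intuition|constructor; [simpl; tauto|constructor]]. }
  { intros j v v' Hv Hw. apply (Hcontr i); [lia|assumption|assumption]. }
  { intros j w Hw. destruct (interior_deep i n _ w ltac:(lia) Hw) as (c & H1 & H2 & H3). exists c.
    split; [apply HLS; assumption|]. split; [assumption|]. intros v' Hv'. apply H3. apply HwL. assumption. }
  { intros j v Hv. destruct (fl_common Fl _ _ v ref Hv Href) as (k & k' & Ek).
    (* A common ancestor exists some generations up; [s] rounds that number to a whole number of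
       blocks. *)
    set (s := Z.to_nat ((- (Z.of_nat k)) mod Z.of_nat n)).
    assert (Hs : (Z.of_nat (k + s) mod Z.of_nat n = 0)%Z).
    { unfold s. rewrite Nat2Z.inj_add, Z2Nat.id by (apply Z.mod_pos_bound; lia).
      rewrite Zplus_mod_idemp_r. replace (Z.of_nat k + - Z.of_nat k)%Z with 0%Z by lia. apply Z.mod_0_l. lia. }
    assert (E : Nat.iter (k + s) par v = Nat.iter (k' + s) par ref).
    { rewrite (Nat.add_comm k), (Nat.add_comm k'), !iter_add_par, Ek. reflexivity. }
    assert (L1 : lev (j * Z.of_nat n - Z.of_nat (k + s))%Z (Nat.iter (k + s) par v)).
    { apply lev_iter. replace (j * Z.of_nat n - Z.of_nat (k + s) + Z.of_nat (k + s))%Z with (j * Z.of_nat n)%Z by lia. assumption. }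
    assert (L2 : lev (0 - Z.of_nat (k' + s))%Z (Nat.iter (k' + s) par ref)).
    { apply lev_iter. replace (0 - Z.of_nat (k' + s) + Z.of_nat (k' + s))%Z with 0%Z by lia. assumption. }
    rewrite E in L1. pose proof (F_inj _ _ _ L1 L2) as El.
    apply Z.mod_divide in Hs; [|lia]. destruct Hs as (q & Hq).
    assert (Hq' : Z.of_nat (k' + s) = ((q - j) * Z.of_nat n)%Z) by lia.
    assert (Hqn : (0 <= q)%Z) by nia. assert (Hqn' : (0 <= q - j)%Z) by nia.
    assert (Hit : forall t v, Nat.iter t P v = Nat.iter (t * n) par v).
    { induction t as [|t IH]; intros u; [reflexivity|]. change (P (Nat.iter t P u) = Nat.iter (S t * n) par u).
      rewrite IH. unfold P. rewrite <- iter_add_par. reflexivity. }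
    exists (Z.to_nat q), (Z.to_nat (q - j)). rewrite !Hit.
    replace (Z.to_nat q * n)%nat with (k + s)%nat by nia. replace (Z.to_nat (q - j) * n)%nat with (k' + s)%nat by nia. assumption. }
  assert (HLrefl : forall j v, L j v -> tch v v) by (intros j v; apply F_refl).
  assert (HLnb : forall j v, L j v -> forall v', In v' (nb v) <-> L j v' /\ tch v v') by (intros j v; apply F_nb).
  assert (HLlen : forall j v, L j v -> (length (nb v) <= D)%nat) by (intros j v; apply F_nbl).
  set (sg := fun v => Rpower (m v) (/ p)). set (ep := Rpower eps (/ p)). set (th := Rpower (1 - eps) (/ p)).
  assert (Hsgm : forall v j, L j v -> Rpower (sg v) p = m v).
  { intros v j Hv. unfold sg. rewrite Rpower_mult, Rinv_l, Rpower_1 by (try lra; eapply m_pos; eassumption). reflexivity. }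
  (* Truncation at [1] makes the penalty nonnegative without enlarging increments. The values [1]
     and [0] are imposed by hand because the metric construction asks for them without fixing the
     level of [u]. *)
  set (f := fun u v => if eq_dec_classic (P v) u then 1 else
     if excluded_middle_informative (exists j, L (j + 1)%Z v /\ ~ within (adj (L j) tch) N2 u (P v)) then 0 else Rmin 1 (f0 u v)).
  assert (Hff : forall j u v, L j u -> L (j + 1)%Z v -> f u v = Rmin 1 (f0 u v)).
  { intros j u v Hu Hv. destruct (Hf0 u j Hu) as (E1 & E2 & _). unfold f. destruct eq_dec_classic as [E|E].
    - rewrite E1 by assumption. rewrite Rmin_left; lra.
    - destruct excluded_middle_informative as [(j' & Hj' & Hn')|]; [|reflexivity].
      assert (j' = j) by (pose proof (HL_inj _ _ _ Hj' Hv); lia). subst j'. rewrite (E2 v Hv Hn'). rewrite Rmin_right; lra. }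
  assert (Hfle : forall u v, f u v <= 1).
  { intros u v. unfold f. destruct eq_dec_classic; [lra|]. destruct excluded_middle_informative; [lra|apply Rmin_l]. }
  assert (Hf1 : forall v, f (P v) v = 1) by (intros v; unfold f; destruct eq_dec_classic; [reflexivity|congruence]).
  assert (Hfz : forall j u v, L (j + 1)%Z v -> ~ within (adj (L j) tch) N2 u (P v) -> f u v = 0).
  { intros j u v Hv Hn'. unfold f. destruct eq_dec_classic as [E|E].
    - exfalso. apply Hn'. rewrite E. apply within_refl.
    - destruct excluded_middle_informative as [|Hno]; [reflexivity|]. exfalso. apply Hno. eauto. }
  assert (Hfs : forall j u v v', adj (L (j + 1)%Z) tch v v' -> within (adj (L j) tch) Q u (P v) ->
    C0 * sg u * Rabs (f u v - f u v') <= sg v).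
  { intros j u v v' (Hv & Hv' & Ht) Hw.
    assert (Hu : L j u).
    { apply (within_adj_X (L j) tch Q (P v)); [apply HPL; assumption|]. apply within_sym; [apply adj_sym; assumption|assumption]. }
    rewrite (Hff j u v Hu Hv), (Hff j u v' Hu Hv').
    assert (Hmin : Rabs (Rmin 1 (f0 u v) - Rmin 1 (f0 u v')) <= Rabs (f0 u v - f0 u v')).
    { unfold Rmin, Rabs. repeat (destruct Rle_dec || destruct Rcase_abs); lra. }
    pose proof (m_Phi j u v Hv Hw) as Hm. set (g := Rabs (f0 u v - f0 u v')) in *.
    assert (Hg0 : 0 <= g) by apply Rabs_pos. pose proof (m_pos _ _ Hu) as Hmu. pose proof (m_pos _ _ Hv) as Hmv.
    assert (Hg : m u * (C0p * rpow g p) <= m v).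
    { eapply Rle_trans; [|exact Hm]. apply Rmult_le_compat_l; [lra|]. unfold Phi. apply Rmult_le_compat_l; [lra|].
      apply (lsum_In_le (nb v) (fun v' => rpow (Rabs (f0 u v - f0 u v')) p) v'); [intros; apply rpow_nonneg|].
      apply (F_nb _ _ Hv). split; assumption. }
    assert (Hsu : 0 < sg u) by apply Rpower_pos.
    apply Rle_trans with (C0 * sg u * g); [apply Rmult_le_compat_l; [nra|assumption]|].
    assert (H0 : 0 <= C0 * sg u * g) by (apply Rmult_le_pos; nra).
    unfold sg at 2. rewrite <- rpow_pos_eq by assumption. apply rpow_le_inv; [assumption|assumption|lra|].
    rewrite rpow_mult, rpow_mult by nra. rewrite (rpow_pos_eq C0), (rpow_pos_eq (sg u)) by assumption. rewrite (Hsgm u j Hu).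
    fold C0p. lra. }
  assert (HT : (Q + M <= T)%nat) by (unfold T; lia).
  assert (Hth : 0 < th < 1) by (apply Rpower_lt1; lra).
  assert (Hep0 : 0 < ep) by apply Rpower_pos.
  assert (Hsgpos : forall j v, L j v -> 0 < sg v) by (intros; apply Rpower_pos).
  assert (Hle_m : forall c v v', 0 < c -> 0 < m v -> 0 < m v' -> m v <= c * m v' -> sg v <= Rpower c (/ p) * sg v').
  { intros c v v' Hc Hv Hv' H. unfold sg. rewrite Rpower_mult_distr by assumption. apply Rle_Rpower_l; lra. }
  assert (Hsgslow : forall j v v', adj (L j) tch v v' -> sg v' <= A * sg v).
  { intros j v v' Ha. pose proof Ha as (Hv & Hv' & _). apply Hle_m; [lra|eauto|eauto|]. eapply m_slow; eassumption. }
  assert (HsgP : forall j v, L (j + 1)%Z v -> ep * sg (P v) <= sg v <= th * sg (P v)).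
  { intros j v Hv. pose proof (HPL _ _ Hv) as HPv. pose proof (m_pos _ _ Hv). pose proof (m_pos _ _ HPv). destruct (m_P _ _ Hv) as (M1 & M2). split.
    - unfold ep, sg. rewrite Rpower_mult_distr by lra. apply Rle_Rpower_l; [lra|]. split; [nra|assumption].
    - apply Hle_m; [lra|assumption|assumption|assumption]. }
  assert (HcT : forall j v v', L (j + 1)%Z v -> within (adj (L (j + 1)%Z) tch) T v v' -> within (adj (L j) tch) M (P v) (P v')).
  { intros j v v'. apply (Hcontr T). lia. }
  assert (HincP : forall j v x, L (j + 1)%Z v -> inc v x -> inc (P v) x).
  { intros j v x Hv. apply (inc_iter (j * Z.of_nat n)%Z). apply HLS. assumption. }
  assert (Hinct : forall j v v' x, L j v -> L j v' -> inc v x -> inc v' x -> tch v v').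
  { intros j v v' x. apply (fl_inc_tch Fl). }
  assert (Hcov : forall j x, exists v, L j v /\ inc v x) by (intros; apply (fl_cover Fl)).
  set (rr := r ^ n).
  assert (Hrr : 0 < rr < 1).
  { unfold rr. split; [apply pow_lt; lra|]. destruct n; [lia|]. simpl. assert (r ^ n <= 1) by (apply pow_le1; lra).
    assert (0 < r ^ n) by (apply pow_lt; lra). nra. }
  assert (Hrj : forall j, powerRZ r (j * Z.of_nat n) = powerRZ rr j).
  { intros j. apply powerRZ_pow. lra. }
  set (C7' := C7 * INR (S (T + 2))).
  assert (HC7' : 0 < C7') by (apply Rmult_lt_0_compat; [assumption|apply lt_0_INR; lia]).
  assert (Hfar : forall j v v' x y, L j v -> L j v' -> inc v x -> inc v' y ->
    within (adj (L j) tch) (T + 2) v v' -> d x y <= C7' * powerRZ rr j).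
  { intros j v v' x y Hv Hv' Hx Hy Hw. rewrite <- Hrj.
    exact (fl_far Fl (j * Z.of_nat n)%Z (T + 2)%nat v v' x y Hv Hv' Hx Hy Hw). }
  pose proof (fl_nd Fl) as Hnd. pose proof (fl_nd_le Fl) as Hndle.
  destruct (choice (fun y j => powerRZ rr (j + 1) <= nd y < powerRZ rr j) (fun y => scale_exists rr (nd y) Hrr (Hnd y))) as (Jn & HJn).
  destruct (small_pow rr (rr / C7') Hrr) as (t0 & Ht0); [apply Rdiv_lt_0_compat; lra|].
  apply (proj2 (Rlt_div_r _ _ _ HC7')) in Ht0.
  assert (Hres : forall j v x y, L j v -> inc v x -> inc v y -> x <> y -> (j <= Jn x + Z.of_nat t0)%Z).
  { intros j v x y Hv Hx Hy Hne. pose proof (Hfar j v v x y Hv Hv Hx Hy (within_refl _ _ _)) as H. pose proof (Hndle x y Hne).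
    destruct (HJn x) as (H1 & _). apply Z.nlt_ge. intros Hlt.
    pose proof (powerRZ_anti rr (Jn x + Z.of_nat t0) j Hrr ltac:(lia)) as Hpa. rewrite powerRZ_nat in Hpa by lra.
    rewrite powerRZ_S in H1 by lra. pose proof (powerRZ_pos rr (Jn x) ltac:(lra)). nra. }
  assert (Hcommon : forall x y, exists j v, L j v /\ inc v x /\ inc v y).
  { intros x y. destruct (Hcov 0%Z x) as (v & Hv & Hx). destruct (Hcov 0%Z y) as (v' & Hv' & Hy).
    destruct (fl_common Fl _ _ v v' Hv Hv') as (k & k' & Ek).
    assert (Hit : forall t v, Nat.iter t P v = Nat.iter (t * n) par v).
    { induction t as [|t IH]; intros u; [reflexivity|]. change (P (Nat.iter t P u) = Nat.iter (S t * n) par u).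
      rewrite IH. unfold P. rewrite <- iter_add_par. reflexivity. }
    assert (k = k').
    { assert (L1 : lev (0 * Z.of_nat n - Z.of_nat k)%Z (Nat.iter k par v)).
      { apply lev_iter. replace (0 * Z.of_nat n - Z.of_nat k + Z.of_nat k)%Z with (0 * Z.of_nat n)%Z by lia. assumption. }
      assert (L2 : lev (0 * Z.of_nat n - Z.of_nat k')%Z (Nat.iter k' par v')).
      { apply lev_iter. replace (0 * Z.of_nat n - Z.of_nat k' + Z.of_nat k')%Z with (0 * Z.of_nat n)%Z by lia. assumption. }
      rewrite Ek in L1. pose proof (F_inj _ _ _ L1 L2). lia. }
    subst k'. assert (E : Nat.iter k P v = Nat.iter k P v').
    { rewrite !Hit. replace (k * n)%nat with (k * n - k + k)%nat by nia. rewrite !iter_add_par, Ek. reflexivity. }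
    assert (Hlv : forall u x, L 0%Z u -> inc u x -> L (- Z.of_nat k)%Z (Nat.iter k P u) /\ inc (Nat.iter k P u) x).
    { intros u z Hu Hz. split.
      - pose proof (iter_P_L L P HPL 0%Z u k Hu) as H. exact H.
      - rewrite Hit. apply (inc_iter (- Z.of_nat (k * n))%Z); [|assumption].
        replace (- Z.of_nat (k * n) + Z.of_nat (k * n))%Z with 0%Z by lia. exact Hu. }
    exists (- Z.of_nat k)%Z, (Nat.iter k P v). destruct (Hlv v x Hv Hx) as (H1 & H2). split; [assumption|]. split; [assumption|].
    rewrite E. apply (Hlv v' y Hv' Hy). }
  assert (Hsep : forall x y, x <> y -> exists j v v', L j v /\ L j v' /\ inc v x /\ inc v' y /\ ~ within (adj (L j) tch) (T + 2) v v').
  { intros x y Hne. destruct (Hcov (Jn x + Z.of_nat t0)%Z x) as (v & Hv & Hx). destruct (Hcov (Jn x + Z.of_nat t0)%Z y) as (v' & Hv' & Hy).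
    exists (Jn x + Z.of_nat t0)%Z, v, v'. repeat split; try assumption. intros Hw.
    pose proof (Hfar _ v v' x y Hv Hv' Hx Hy Hw) as H. pose proof (Hndle x y Hne). destruct (HJn x) as (H1 & _).
    rewrite powerRZ_nat in H by lra. rewrite powerRZ_S in H1 by lra. pose proof (powerRZ_pos rr (Jn x) ltac:(lra)). nra. }
  set (rh := rho L inc sg).
  assert (Hosc : 0 < osc Q T A th * A).
  { apply Rmult_lt_0_compat; [|lra]. eapply (osc_pos Q T A th); eassumption. }
  assert (Hmet : is_metric rh).
  { eapply (rho_metric L tch nb P inc M N2 Q T) with (A := A) (eps := ep) (th := th) (C0 := C0) (f := f)
      (I := fun x => (Jn x + Z.of_nat t0)%Z); try eassumption; try reflexivity. }
  assert (Hlow : forall j v v' x y, L j v -> L j v' -> inc v x -> inc v' y ->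
    ~ within (adj (L j) tch) (T + 2) v v' -> / (osc Q T A th * A) * sg v <= rh x y).
  { eapply (rho_lower L tch nb P inc M N2 Q T) with (A := A) (eps := ep) (th := th) (C0 := C0) (f := f)
      (I := fun x => (Jn x + Z.of_nat t0)%Z); try eassumption; try reflexivity. }
  assert (Hpie : forall j v x y, L j v -> inc v x -> inc v y -> rh x y <= sg v).
  { intros j v x y. eapply (rho_piece L inc sg); eassumption. }
  assert (Hupp : forall j v x y, L j v -> inc v x -> d x y < c8 * powerRZ rr j -> rh x y <= INR (S M) * A ^ M * sg v).
  { intros j v x y Hv Hx Hd. destruct (Hcov j y) as (v' & Hv' & Hy).
    eapply (rho_upper L tch P inc M N2 Q T) with (A := A) (th := th) (C0 := C0) (f := f); try eassumption; try reflexivity.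
    eapply (fl_near Fl); try eassumption. rewrite Hrj. assumption. }
  destruct (fl_coarse Fl n) as (c9 & Hc9 & Hcoarse).
  destruct (choice (fun v l => NoDup l /\ forall j, L j v -> forall x, In x l <-> inc v x)) as (incl_of & Hincl).
  { intros v. destruct (classic (exists j, L j v)) as [(j & Hv)|Hno].
    2:{ exists []. split; [constructor|]. intros j Hj. exfalso; eauto. }
    destruct (fl_inc_fin Fl _ v Hv) as (l & Hl).
    exists (ndup (keep (inc v) l)). split; [apply NoDup_ndup|]. intros _ _ x. rewrite In_ndup, In_keep.
    split; [tauto|]. intros H. split; [auto|assumption]. }
  assert (Hcc : forall j u c x, L j u -> inc u x -> (forall y, inc u y -> nd y < c9 * powerRZ rr j) -> In c (ch u) -> exists y, inc c y).
  { intros j u c x Hu Hx Hf Hc. apply (Hch u) with (j := j) in Hc; [|assumption]. destruct Hc as (Hc & Ec).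
    eapply (Hcoarse (j * Z.of_nat n)%Z u c x); try eassumption; [|apply HLS; assumption].
    intros y Hy. rewrite Hrj. apply Hf. assumption. }
  assert (HC2 : 0 < INR (S M) * A ^ M) by (apply Rmult_lt_0_compat; [apply lt_0_INR; lia|apply pow_lt; lra]).
  assert (Hc1 : 0 < / (osc Q T A th * A)) by (apply Rinv_0_lt_compat; assumption).
  exists rh. split; [assumption|]. split.
  - destruct (small_pow rr c9 Hrr Hc9) as (t1 & Ht1).
    destruct (small_pow rr (/ C7') Hrr (Rinv_0_lt_compat _ HC7')) as (s7 & Hs7).
    destruct (small_pow th (/ (osc Q T A th * A) / A) Hth) as (tb & Htb); [apply Rdiv_lt_0_compat; lra|].
    assert (HApos : 0 < A) by lra. apply (proj2 (Rlt_div_r _ _ _ HApos)) in Htb.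
    assert (Hs7' : C7' * rr ^ s7 < 1).
    { apply Rmult_lt_compat_l with (r := C7') in Hs7; [|assumption]. rewrite Rinv_r in Hs7 by lra. assumption. }
    eexists. eapply (rho_AR_measure L tch nb ch P inc incl_of D (T + 2)) with (c1 := / (osc Q T A th * A)) (d := d) (nd := nd) (rr := rr)
      (C7 := C7') (c9 := c9) (a := a) (eps := eps) (m := m) (Jn := Jn) (t0 := t0) (t1 := t1) (s7 := s7) (tb := tb) (cover := Hcov);
      try eassumption; try lra; try (intros; apply Hch || apply Hincl || apply F_nbN; assumption).
    + intros j v x Hv. apply (Hincl v) with (j := j). assumption.
    + fold A th. lra.
  - eapply (rho_QS L tch P inc D (T + 2)) with (c1 := / (osc Q T A th * A)) (nd := nd) (rr := rr)
      (C7 := C7') (a := a) (eps := eps) (m := m) (c8 := c8) (p := p) (C2 := INR (S M) * A ^ M);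
      try eassumption; try lra; try (intros; apply Hch || apply Hincl || apply F_nbN; assumption).
Qed.
End Block.
End Filling.

(** * Ahlfors regular spaces *)

(** [homeo_halfline] does not mention monotonicity; smallness near [0] is derived from continuity
    and [th 0 = 0], and the latter from injectivity. *)
Lemma homeo_bounds th : homeo_halfline th ->
  (forall t, 0 <= t -> 0 <= th t) /\
  (forall T, 0 <= T -> exists C, 0 < C /\ forall t, 0 <= t <= T -> th t <= C) /\
  (forall e, 0 < e -> exists a, 0 < a /\ forall t, 0 <= t <= a -> th t <= e).
Proof.
  intros (thi & H1 & H2 & H3 & H4 & H5 & _). split; [assumption|].
  set (f := fun t => th (Rmax 0 t)).
  assert (Hf : forall t, 0 <= t -> f t = th t) by (intros t Ht; unfold f; rewrite Rmax_right by assumption; reflexivity).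
  assert (Hc : continuity f).
  { intros t e He. assert (Ht : 0 <= Rmax 0 t) by apply Rmax_l. destruct (H5 _ Ht e He) as (a & Ha & Hb).
    exists a. split; [assumption|]. intros u (_ & Hu). simpl in *. unfold R_dist in *. unfold f.
    destruct (Req_dec (Rmax 0 u) (Rmax 0 t)) as [->|Hne]; [rewrite Rminus_diag, Rabs_R0; assumption|].
    apply Hb. split; [split; [apply Rmax_l|congruence]|]. eapply Rle_lt_trans; [|exact Hu].
    unfold Rmax, Rabs. repeat (destruct Rle_dec || destruct Rcase_abs); lra. }
  assert (Hinj : forall s t, 0 <= s -> 0 <= t -> th s = th t -> s = t).
  { intros s t Hs Ht E. rewrite <- (H3 s Hs), <- (H3 t Ht), E. reflexivity. }
  assert (Hroot : forall x y v, 0 <= x <= y -> (f x - v) * (f y - v) <= 0 -> exists z, x <= z <= y /\ th z = v).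
  { intros x y v Hxy Hv. assert (Hcv : continuity (fun t => f t - v)).
    { apply continuity_minus; [assumption|apply continuity_const; intros ? ?; reflexivity]. }
    destruct (IVT_cor _ x y Hcv ltac:(lra) Hv) as (z & Hz & Ez). exists z. split; [assumption|]. rewrite <- (Hf z) by lra. lra. }
  (* If [th 0 > 0], then [th] vanishes at some [t0 > 0], and a small positive value is taken on both
     sides of [t0], against injectivity. *)
  assert (H0 : th 0 = 0).
  { apply NNPP. intros Hne. assert (Hp : 0 < th 0) by (pose proof (H1 0 (Rle_refl _)); lra).
    set (t0 := thi 0). assert (Ht0 : 0 <= t0) by (apply H2; lra). assert (E0 : th t0 = 0) by (apply H4; lra).
    assert (H1t : 0 < th (t0 + 1)).
    { destruct (H1 (t0 + 1) ltac:(lra)) as [|E]; [assumption|]. exfalso. rewrite <- E0 in E. apply Hinj in E; lra. }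
    set (v := Rmin (th 0) (th (t0 + 1)) / 2).
    assert (Hv : 0 < v /\ v < th 0 /\ v < th (t0 + 1)).
    { pose proof (Rmin_l (th 0) (th (t0 + 1))). pose proof (Rmin_r (th 0) (th (t0 + 1))).
      assert (0 < Rmin (th 0) (th (t0 + 1))) by (apply Rmin_glb_lt; assumption). unfold v. lra. }
    destruct (Hroot 0 t0 v) as (z1 & Hz1 & E1); [lra|rewrite !Hf, E0 by lra; nra|].
    destruct (Hroot t0 (t0 + 1) v) as (z2 & Hz2 & E2); [lra|rewrite !Hf, E0 by lra; nra|].
    assert (E3 : z1 = z2) by (apply Hinj; lra). destruct Hz1 as (_ & Hz1). destruct Hz2 as (Hz2 & _). assert (E4 : z1 = t0) by lra. rewrite E4, E0 in E1. lra. }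
  split.
  - intros T HT. destruct (continuity_ab_maj f 0 T HT ltac:(intros; apply Hc)) as (M & HM & _).
    exists (Rmax 1 (f M)). split; [pose proof (Rmax_l 1 (f M)); lra|]. intros t Ht. rewrite <- Hf by lra.
    eapply Rle_trans; [apply HM; assumption|apply Rmax_r].
  - intros e He. destruct (Hc 0 e He) as (a & Ha & Hb). exists (a / 2). split; [lra|]. intros t Ht.
    destruct (Req_dec t 0) as [->|Hne]; [lra|].
    specialize (Hb t). simpl in Hb. unfold R_dist in Hb. rewrite (Hf t), (Hf 0), H0 in Hb by lra.
    assert (Rabs (th t - 0) < e).
    { apply Hb. split; [split; [exact Logic.I|congruence]|]. rewrite Rminus_0_r, Rabs_pos_eq; lra. }
    rewrite Rminus_0_r, Rabs_pos_eq in H by (apply H1; lra). lra.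
Qed.

Section AhlforsRegular.
Context {X : Type} (rho : X -> X -> R) (alpha Ca : R) (mu : X -> R).
Hypothesis rho_met : is_metric rho.
Hypothesis Ca_pos : 0 < Ca.
Hypothesis mu_nonneg : forall x, 0 <= mu x.
Hypothesis unbounded : diam rho = p_infty.
Hypothesis AR : forall x s, 0 < s -> Rbar_le (rx rho x) (Finite s) -> Rbar_le (Finite s) (diam rho) ->
      Rbar_le (Finite (/ Ca * Rpower s alpha)) (nnsum (ball rho x s) mu) /\
      Rbar_le (nnsum (ball rho x s) mu) (Finite (Ca * Rpower s alpha)).

Lemma AR_at x s : 0 < s -> (exists y, y <> x /\ rho x y <= s) ->
  Rbar_le (Finite (/ Ca * Rpower s alpha)) (nnsum (ball rho x s) mu) /\
      Rbar_le (nnsum (ball rho x s) mu) (Finite (Ca * Rpower s alpha)).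
Proof.
  intros Hs (y & Hy & Hle). apply AR; [assumption| |rewrite unbounded; simpl; exact Logic.I].
  eapply Rbar_le_trans; [apply rb_inf_lb; exists y; split; [exact Hy|reflexivity]|exact Hle].
Qed.

Lemma AR_upper x s l : 0 < s -> (exists y, y <> x /\ rho x y <= s) -> NoDup l -> (forall y, In y l -> rho x y < s) ->
  lsum l mu <= Ca * Rpower s alpha.
Proof.
  intros Hs Hy Hl Hb. destruct (AR_at x s Hs Hy) as (_ & H).
  assert (Rbar_le (Finite (lsum l mu)) (Finite (Ca * Rpower s alpha))); [|assumption].
  eapply Rbar_le_trans; [|exact H]. apply nnsum_ge; assumption.
Qed.

(** [nnsum] is a supremum of finite sums, so a finite list captures half of the guaranteed mass. *)
Lemma AR_lower x s : 0 < s -> (exists y, y <> x /\ rho x y <= s) -> exists l, NoDup l /\ (forall y, In y l -> rho x y < s) /\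
  Rpower s alpha <= 2 * Ca * lsum l mu.
Proof.
  intros Hs Hy. destruct (AR_at x s Hs Hy) as (H & _). apply NNPP. intros Hno.
  pose proof (Rpower_pos s alpha) as Hp. assert (HCi : 0 < / Ca) by (apply Rinv_0_lt_compat; assumption).
  assert (Rbar_le (Finite (/ Ca * Rpower s alpha)) (Finite (/ 2 * (/ Ca * Rpower s alpha)))) as Hc.
  { eapply Rbar_le_trans; [exact H|]. apply nnsum_le. intros l Hl Hb. apply Rnot_lt_le. intros Hlt. apply Hno.
    exists l. split; [assumption|]. split; [exact Hb|]. apply Rmult_lt_compat_l with (r := 2 * Ca) in Hlt; [|lra].
    replace (2 * Ca * (/ 2 * (/ Ca * Rpower s alpha))) with (Rpower s alpha) in Hlt by (field; lra). lra. }
  simpl in Hc. assert (0 < / Ca * Rpower s alpha) by (apply Rmult_lt_0_compat; assumption). lra.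
Qed.

(* The ball around [x] whose radius is the distance to the other points contains [x] only. *)
Lemma AR_point x c : 0 < c -> (forall y, y <> x -> c <= rho x y) -> (exists y : X, y <> x) ->
  0 <= alpha -> Rpower c alpha <= Ca * mu x.
Proof.
  intros Hc Hfar (y0 & Hy0) Hal.
  assert (Hr : exists s, rx rho x = Finite s /\ c <= s).
  { assert (H1 : Rbar_le (Finite c) (rx rho x)).
    { apply rb_inf_glb. intros z (y & Hy & ->). apply Hfar. assumption. }
    assert (H2 : Rbar_le (rx rho x) (Finite (rho x y0))) by (apply rb_inf_lb; exists y0; auto).
    destruct (rx rho x) as [s| |]; simpl in *; [eauto|contradiction|contradiction]. }
  destruct Hr as (s & Es & Hs).
  destruct (AR x s ltac:(lra)) as (H & _); [rewrite Es; apply Rbar_le_refl|rewrite unbounded; simpl; exact Logic.I|].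
  assert (Hb : Rbar_le (Finite (/ Ca * Rpower s alpha)) (Finite (mu x))).
  { eapply Rbar_le_trans; [exact H|]. apply nnsum_le. intros l Hl Hin. apply Rle_trans with (lsum [x] mu).
    - apply lsum_incl; [assumption| |auto]. intros y Hy. left. apply NNPP. intros Hne. specialize (Hin y Hy). unfold ball in Hin.
      assert (Rbar_le (rx rho x) (Finite (rho x y))) as Hle by (apply rb_inf_lb; exists y; split; [congruence|reflexivity]).
      rewrite Es in Hle. simpl in Hle. lra.
    - unfold lsum; simpl; lra. }
  simpl in Hb. apply Rmult_le_compat_l with (r := Ca) in Hb; [|lra].
  rewrite <- Rmult_assoc, Rinv_r, Rmult_1_l in Hb by lra. eapply Rle_trans; [|exact Hb]. apply Rle_Rpower_l; lra.
Qed.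

(* A chain of small steps across a ball carries many disjoint small balls. *)
Lemma AR_exponent_ge1 :
  (forall e, 0 < e -> exists (n : nat) (xs : nat -> X), (1 <= n)%nat /\ 0 < rho (xs 0%nat) (xs n) /\
     forall i, (1 <= i <= n)%nat -> xs i <> xs (i - 1)%nat /\ rho (xs i) (xs (i - 1)%nat) <= e * rho (xs 0%nat) (xs n)) ->
  1 <= alpha.
Proof.
  intros Hchain. apply Rnot_lt_le. intros Hal.
  (* The packing estimate will read [J <= 2 * Ca^2 * (8 J)^alpha], which fails for large [J] when
     [alpha < 1]. The maximum with [0] covers negative [alpha]. *)
  assert (Hbig : exists J : nat, (1 <= J)%nat /\ 2 * Ca * Ca * Rpower 8 (Rmax 0 alpha) < Rpower (INR J) (1 - alpha)).
  { set (Y := 2 * Ca * Ca * Rpower 8 (Rmax 0 alpha)).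
    assert (HY : 0 < Y) by (unfold Y; pose proof (Rpower_pos 8 (Rmax 0 alpha)); repeat apply Rmult_lt_0_compat; lra).
    destruct (INR_unbounded (Rpower (Y + 1) (/ (1 - alpha)))) as (J & HJ).
    pose proof (Rpower_pos (Y + 1) (/ (1 - alpha))) as Hp.
    exists J. split; [destruct J; [simpl in HJ; lra|lia]|].
    apply Rlt_le_trans with (Y + 1); [lra|].
    replace (Y + 1) with (Rpower (Rpower (Y + 1) (/ (1 - alpha))) (1 - alpha)).
    - apply Rle_Rpower_l; lra.
    - rewrite Rpower_mult, Rinv_l, Rpower_1 by lra. reflexivity. }
  destruct Hbig as (J & HJ & Hbig). assert (HJR : 1 <= INR J) by (apply (le_INR 1); assumption).
  set (e := / (4 * INR J)). assert (He : 0 < e) by (apply Rinv_0_lt_compat; lra).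
  assert (He4 : 4 * INR J * e = 1) by (unfold e; field; lra).
  destruct (Hchain e He) as (n & xs & Hn & HR & Hst). set (Rr := rho (xs 0%nat) (xs n)) in *.
  destruct rho_met as (M0 & M1 & M2 & M3).
  set (h := fun i => rho (xs 0%nat) (xs i)).
  assert (Hh0 : h 0%nat = 0) by (apply M1; reflexivity).
  (* Steps have length at most [e * Rr], so the distance from the start cannot jump over the values
     [4 * j * e * Rr] by more than that; the spacing makes balls of radius [e * Rr] at these points
     disjoint. *)
  assert (Hpt : forall j, (j < J)%nat -> exists i, (i <= n)%nat /\ 4 * INR j * e * Rr <= h i <= 4 * INR j * e * Rr + e * Rr).
  { intros j Hj. assert (Hjr : INR j + 1 <= INR J) by (rewrite <- S_INR; apply le_INR; lia). pose proof (pos_INR j).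
    assert (HeR : 0 < e * Rr) by (apply Rmult_lt_0_compat; assumption).
    destruct (least_nat (fun i => 4 * INR j * e * Rr <= h i) n) as (i & Hi & Hi1 & Hi2).
    { unfold h. fold Rr. replace (4 * INR j * e * Rr) with (4 * INR j * (e * Rr)) by ring.
      replace Rr with (4 * INR J * (e * Rr)) at 2 by (rewrite <- Rmult_assoc, He4; ring). nra. }
    exists i. split; [assumption|]. split; [assumption|]. destruct i as [|i].
    - rewrite Hh0. assert (0 <= INR j * (e * Rr)) by nra. lra.
    - specialize (Hi2 i ltac:(lia)). apply Rnot_le_lt in Hi2. destruct (Hst (S i) ltac:(lia)) as (_ & Hs).
      replace (S i - 1)%nat with i in Hs by lia. pose proof (M3 (xs 0%nat) (xs i) (xs (S i))) as Ht. rewrite (M2 (xs i)) in Ht. unfold h in *. lra. }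
  destruct (choice (fun j i => (j < J)%nat -> (i <= n)%nat /\ 4 * INR j * e * Rr <= h i <= 4 * INR j * e * Rr + e * Rr)) as (ix & Hix).
  { intros j. destruct (Nat.lt_ge_cases j J) as [Hj|Hj]; [destruct (Hpt j Hj) as (i & H); exists i; auto|exists 0%nat; lia]. }
  set (s := e * Rr). assert (Hs : 0 < s) by (apply Rmult_lt_0_compat; assumption).
  (* Regularity only concerns radii that reach another point; the adjacent point of the chain is
     within [s]. *)
  assert (Hnear : forall i, (i <= n)%nat -> exists y, y <> xs i /\ rho (xs i) y <= s).
  { intros i Hi. destruct (Nat.eq_dec i 0) as [->|Hne].
    - exists (xs 1%nat). destruct (Hst 1%nat ltac:(lia)) as (A1 & A2). simpl in A1, A2. split; [assumption|]. rewrite M2. assumption.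
    - exists (xs (i - 1)%nat). destruct (Hst i ltac:(lia)) as (A1 & A2). split; [congruence|assumption]. }
  destruct (choice (fun j l => (j < J)%nat -> NoDup l /\ (forall y, In y l -> rho (xs (ix j)) y < s) /\ Rpower s alpha <= 2 * Ca * lsum l mu)) as (lj & Hlj).
  { intros j. destruct (Nat.lt_ge_cases j J) as [Hj|Hj]; [|exists []; lia].
    destruct (Hix j Hj) as (Hi & _). destruct (AR_lower (xs (ix j)) s Hs (Hnear _ Hi)) as (l & H). exists l. auto. }
  assert (Hdisj : forall j j' y, (j < J)%nat -> (j' < J)%nat -> In y (lj j) -> In y (lj j') -> j = j').
  { assert (Hd : forall j j' y, (j < j')%nat -> (j' < J)%nat -> In y (lj j) -> In y (lj j') -> False).
    { intros j j' y Hjj Hj' Hy Hy'. destruct (Hix j ltac:(lia)) as (_ & A1 & A2). destruct (Hix j' Hj') as (_ & B1 & B2).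
      destruct (Hlj j ltac:(lia)) as (_ & L1 & _). destruct (Hlj j' Hj') as (_ & L2 & _). specialize (L1 y Hy). specialize (L2 y Hy').
      pose proof (M3 (xs 0%nat) (xs (ix j)) (xs (ix j'))) as T1. pose proof (M3 (xs (ix j)) y (xs (ix j'))) as T2. rewrite (M2 y) in T2.
      apply (le_INR (S j) j') in Hjj. rewrite S_INR in Hjj. unfold h in *.
      replace (4 * INR j * e * Rr) with (4 * INR j * s) in * by (unfold s; ring). replace (4 * INR j' * e * Rr) with (4 * INR j' * s) in * by (unfold s; ring).
      fold s in A2, B2. assert (INR j * s + s <= INR j' * s) by nra. lra. }
    intros j j' y Hj Hj' Hy Hy'. destruct (Nat.lt_trichotomy j j') as [H|[H|H]]; [exfalso|assumption|exfalso]; eauto. }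
  set (U := ndup (flat_map lj (seq 0 J))).
  assert (HU : lsum (seq 0 J) (fun j => lsum (lj j) mu) <= INR 1 * lsum U mu).
  { apply (lsum_double_count (seq 0 J) U lj (fun z => keep (fun j => In z (lj j)) (seq 0 J))).
    - apply seq_NoDup.
    - intros j Hj. apply in_seq in Hj. apply Hlj. lia.
    - intros j Hj z Hz. apply In_ndup. apply in_flat_map. eauto.
    - intros j z Hj Hz. apply In_keep. auto.
    - intros z _. set (lf := keep _ _).
      assert (Hlf : forall j, In j lf -> (j < J)%nat /\ In z (lj j)).
      { intros j Hj. apply In_keep in Hj. destruct Hj as (Hj & Hz). apply in_seq in Hj. split; [lia|assumption]. }
      assert (Hnd : NoDup lf) by (apply NoDup_keep, seq_NoDup).
      destruct lf as [|j0 [|j1 lf]]; simpl; try lia. exfalso. inversion Hnd as [|? ? Hx _]. apply Hx. left.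
      destruct (Hlf j0 (or_introl eq_refl)). destruct (Hlf j1 (or_intror (or_introl eq_refl))). eapply Hdisj; eassumption.
    - intros; apply mu_nonneg. }
  assert (HUb : lsum U mu <= Ca * Rpower (2 * Rr) alpha).
  { apply (AR_upper (xs 0%nat)); [lra| |apply NoDup_ndup|].
    - destruct (Hnear 0%nat ltac:(lia)) as (y & Hy & Hle). exists y. split; [assumption|]. assert (e <= 1) by nra. assert (s <= Rr) by (unfold s; nra). lra.
    - intros y Hy. apply In_ndup, in_flat_map in Hy. destruct Hy as (j & Hj & Hy). apply in_seq in Hj.
      destruct (Hix j ltac:(lia)) as (_ & _ & A2). destruct (Hlj j ltac:(lia)) as (_ & L1 & _). specialize (L1 y Hy).
      pose proof (M3 (xs 0%nat) (xs (ix j)) y). unfold h in A2.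
      assert (Hjr : INR j + 1 <= INR J) by (rewrite <- S_INR; apply le_INR; lia).
      assert (4 * INR j * e * Rr + e * Rr + s < 2 * Rr); [|lra].
      replace (4 * INR j * e * Rr + e * Rr + s) with ((4 * INR j + 2) * s) by (unfold s; ring).
      replace Rr with (4 * INR J * s) by (unfold s; rewrite <- Rmult_assoc, He4; ring). nra. }
  assert (HL : INR J * Rpower s alpha <= 2 * Ca * lsum U mu).
  { apply Rle_trans with (2 * Ca * lsum (seq 0 J) (fun j => lsum (lj j) mu)); [|apply Rmult_le_compat_l; simpl INR in HU; lra].
    rewrite <- lsum_scal. apply Rle_trans with (lsum (seq 0 J) (fun _ => Rpower s alpha)).
    - right. assert (forall (l : list nat) c, lsum l (fun _ => c) = INR (length l) * c) as Hc.
      { intros l c. induction l as [|a l IH]; [unfold lsum; simpl; ring|]. rewrite lsum_cons, IH. simpl length. rewrite S_INR. ring. }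
      rewrite Hc, length_seq. reflexivity.
    - apply lsum_le. intros j Hj. apply in_seq in Hj. apply Hlj. lia. }
  assert (Hfin : INR J * Rpower s alpha <= 2 * Ca * Ca * Rpower (2 * Rr) alpha).
  { eapply Rle_trans; [exact HL|]. replace (2 * Ca * Ca * Rpower (2 * Rr) alpha) with (2 * Ca * (Ca * Rpower (2 * Rr) alpha)) by ring.
    apply Rmult_le_compat_l; lra. }
  assert (E2 : Rpower (2 * Rr) alpha = Rpower (8 * INR J) alpha * Rpower s alpha).
  { rewrite Rpower_mult_distr by lra. f_equal. replace (8 * INR J * s) with (2 * (4 * INR J * e) * Rr) by (unfold s; ring). rewrite He4. ring. }
  rewrite E2 in Hfin. pose proof (Rpower_pos s alpha) as Hsp.
  assert (Hfin2 : INR J <= 2 * Ca * Ca * Rpower (8 * INR J) alpha).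
  { apply Rmult_le_reg_r with (Rpower s alpha); [assumption|]. lra. }
  assert (E3 : Rpower (INR J) (1 - alpha) <= 2 * Ca * Ca * Rpower 8 (Rmax 0 alpha)); [|lra].
  rewrite <- Rpower_mult_distr in Hfin2 by lra.
  replace (Rpower (INR J) (1 - alpha)) with (INR J * / Rpower (INR J) alpha).
  2:{ unfold Rminus. rewrite Rpower_plus, Rpower_1, Rpower_Ropp by lra. reflexivity. }
  pose proof (Rpower_pos (INR J) alpha) as HpJ.
  apply Rmult_le_reg_r with (Rpower (INR J) alpha); [assumption|]. rewrite Rmult_assoc, Rinv_l, Rmult_1_r by lra.
  eapply Rle_trans; [exact Hfin2|]. rewrite <- Rmult_assoc. apply Rmult_le_compat_r; [lra|]. apply Rmult_le_compat_l; [nra|].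
  apply Rle_Rpower; [lra|apply Rmax_r].
Qed.
End AhlforsRegular.

(** * Upper and lower limits, and the spectral dimension *)

Lemma limsup_lt a b : Rbar_lt (rb_limsup a) b -> exists n, forall k, (n <= k)%nat -> Rbar_lt (a k) b.
Proof.
  intros H. apply NNPP. intros Hno. apply Rbar_lt_not_le in H. apply H. apply rb_inf_glb. intros y (n & ->).
  apply NNPP. intros Hlt. apply Hno. exists n. intros k Hk. apply Rbar_not_le_lt. intros Hle. apply Hlt.
  eapply Rbar_le_trans; [exact Hle|]. apply rb_sup_ub. eauto.
Qed.

Lemma limsup_le a b n : (forall k, (n <= k)%nat -> Rbar_le (a k) b) -> Rbar_le (rb_limsup a) b.
Proof.
  intros H. eapply Rbar_le_trans; [apply rb_inf_lb; exists n; reflexivity|]. apply rb_sup_lub. intros z (k & Hk & ->). auto.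
Qed.

Lemma limsup_ge a b : (forall n, exists k, (n <= k)%nat /\ Rbar_le b (a k)) -> Rbar_le b (rb_limsup a).
Proof.
  intros H. apply rb_inf_glb. intros y (n & ->). destruct (H n) as (k & Hk & Hb). eapply Rbar_le_trans; [exact Hb|]. apply rb_sup_ub. eauto.
Qed.

Lemma liminf_ge a b n : (forall k, (n <= k)%nat -> Rbar_le b (a k)) -> Rbar_le b (rb_liminf a).
Proof.
  intros H. eapply Rbar_le_trans; [|apply rb_sup_ub; exists n; reflexivity]. apply rb_inf_glb. intros z (k & Hk & ->). auto.
Qed.

Lemma liminf_lt a b : Rbar_lt (rb_liminf a) b -> forall n, exists k, (n <= k)%nat /\ Rbar_lt (a k) b.
Proof.
  intros H n. apply NNPP. intros Hno. apply Rbar_lt_not_le in H. apply H. apply (liminf_ge a b n). intros k Hk.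
  apply Rbar_not_lt_le. intros Hlt. apply Hno. eauto.
Qed.

Lemma liminf_le_limsup a : Rbar_le (rb_liminf a) (rb_limsup a).
Proof.
  apply rb_sup_lub. intros y (n & ->). apply rb_inf_glb. intros y' (n' & ->).
  apply Rbar_le_trans with (a (n + n')%nat); [apply rb_inf_lb|apply rb_sup_ub]; exists (n + n')%nat; split; auto; lia.
Qed.

Lemma pow_lt_mono a b k : 0 <= a < b -> (1 <= k)%nat -> a ^ k < b ^ k.
Proof.
  intros Hab Hk. destruct k as [|k]; [lia|]. simpl. assert (0 < b ^ k) by (apply pow_lt; lra).
  assert (a ^ k <= b ^ k) by (apply pow_incr; lra). assert (0 <= a ^ k) by (apply pow_le; lra). nra.
Qed.

Lemma Rpower_root y k : 0 < y -> (1 <= k)%nat -> Rpower y (/ INR k) ^ k = y.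
Proof.
  intros Hy Hk. assert (1 <= INR k) by (apply (le_INR 1); assumption).
  rewrite <- Rpower_pow by apply Rpower_pos. rewrite Rpower_mult, Rinv_l, Rpower_1 by lra. reflexivity.
Qed.

Lemma root_lt k x s : (1 <= k)%nat -> 0 < s -> Rbar_lt (rb_root k x) (Finite s) -> Rbar_lt x (Finite (s ^ k)).
Proof.
  intros Hk Hs. assert (0 < s ^ k) by (apply pow_lt; assumption). destruct x as [y| |]; simpl; [|tauto|tauto]. intros H1.
  destruct (Rle_dec y 0) as [Hy|Hy]; [lra|]. rewrite rpow_pos_eq in H1 by lra. rewrite <- (Rpower_root y k) by (assumption || lra).
  pose proof (Rpower_pos y (/ INR k)). apply pow_lt_mono; [lra|assumption].
Qed.

Lemma root_le k x s : (1 <= k)%nat -> 0 <= s -> Rbar_le x (Finite (s ^ k)) -> Rbar_le (rb_root k x) (Finite s).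
Proof.
  intros Hk Hs. destruct x as [y| |]; simpl; [|tauto|tauto]. intros H1. destruct (Rle_dec y 0) as [Hy|Hy]; [rewrite rpow_0; assumption|].
  rewrite rpow_pos_eq by lra. apply Rnot_lt_le. intros Hlt. rewrite <- (Rpower_root y k) in H1 by (assumption || lra).
  apply (Rlt_irrefl (s ^ k)). eapply Rlt_le_trans; [|exact H1]. apply pow_lt_mono; [lra|assumption].
Qed.

Lemma root_ge k x s : (1 <= k)%nat -> 0 < s -> Rbar_le (Finite (s ^ k)) x -> Rbar_le (Finite s) (rb_root k x).
Proof.
  intros Hk Hs. assert (Hsk : 0 < s ^ k) by (apply pow_lt; assumption). destruct x as [y| |]; simpl; [|tauto|tauto]. intros H1.
  rewrite rpow_pos_eq by lra. apply Rnot_lt_le. intros Hlt. rewrite <- (Rpower_root y k) in H1 by (assumption || lra).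
  apply (Rlt_irrefl (s ^ k)). eapply Rle_lt_trans; [exact H1|]. pose proof (Rpower_pos y (/ INR k)). apply pow_lt_mono; [lra|assumption].
Qed.

Lemma pow_absorb C s s' : 0 < C -> 0 < s < s' -> exists k0, forall k, (k0 <= k)%nat -> C * s ^ k <= s' ^ k.
Proof.
  intros HC Hs. assert (Hq : 0 < s / s' < 1) by (split; [apply Rdiv_lt_0_compat; lra|apply Rlt_div_l; lra]).
  destruct (small_pow (s / s') (/ C) Hq) as (k0 & Hk0); [apply Rinv_0_lt_compat; assumption|].
  exists k0. intros k Hk. replace k with (k0 + (k - k0))%nat by lia. set (j := (k - k0)%nat).
  replace s with (s / s' * s') by (field; lra). rewrite Rpow_mult_distr.
  assert (0 < s' ^ (k0 + j)) by (apply pow_lt; lra). rewrite <- Rmult_assoc. rewrite <- (Rmult_1_l (s' ^ (k0 + j))) at 2.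
  apply Rmult_le_compat_r; [lra|]. rewrite pow_add. assert ((s / s') ^ j <= 1) by (apply pow_le1; lra).
  assert (0 < (s / s') ^ j) by (apply pow_lt; lra). assert (0 < (s / s') ^ k0) by (apply pow_lt; lra).
  apply Rmult_lt_compat_l with (r := C) in Hk0; [|assumption]. rewrite Rinv_r in Hk0 by lra. nra.
Qed.

Lemma ln_le_sub u : 0 < u -> ln u <= u - 1.
Proof. intros Hu. pose proof (exp_ineq1_le (ln u)). rewrite exp_ln in H by assumption. lra. Qed.

(** The weighted inequality between geometric and arithmetic mean of [y] and [1]: [ln u <= u - 1] is
    applied at [y / m] and [1 / m]. *)
Lemma Rpower_bernoulli y b : 0 < y -> 0 < b < 1 -> Rpower y b <= b * y + (1 - b).
Proof.
  intros Hy Hb. set (m := b * y + (1 - b)). assert (Hm : 0 < m) by (unfold m; nra).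
  assert (Hl : b * ln y <= ln m).
  { assert (Hym : 0 < y / m) by (apply Rdiv_lt_0_compat; assumption). assert (H1m : 0 < 1 / m) by (apply Rdiv_lt_0_compat; lra).
    pose proof (ln_le_sub _ Hym) as H1. pose proof (ln_le_sub _ H1m) as H2.
    rewrite ln_div in H1 by assumption. rewrite ln_div, ln_1 in H2 by lra.
    assert (b * (y / m - 1) + (1 - b) * (1 / m - 1) = 0) by (unfold m; field; unfold m in Hm; lra). nra. }
  unfold Rpower. rewrite <- (exp_ln m Hm). destruct Hl as [Hl | ->]; [apply Rlt_le, exp_increasing; assumption|lra].
Qed.

Lemma rpow_tangent x t b : 0 <= x -> 0 < t -> 0 < b < 1 -> rpow x b <= b * x * Rpower t (b - 1) + (1 - b) * Rpower t b.
Proof.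
  intros Hx Ht Hb. pose proof (Rpower_pos t (b - 1)). pose proof (Rpower_pos t b).
  assert (H1 : 0 <= b * x * Rpower t (b - 1)) by (apply Rmult_le_pos; [nra|lra]). assert (H2 : 0 <= (1 - b) * Rpower t b) by nra.
  destruct Hx as [Hx|<-]; [|rewrite rpow_0; lra]. rewrite rpow_pos_eq by assumption.
  assert (Hxt : 0 < x / t) by (apply Rdiv_lt_0_compat; assumption). pose proof (Rpower_bernoulli _ b Hxt Hb) as H3.
  replace x with (t * (x / t)) at 1 by (field; lra). rewrite <- Rpower_mult_distr by assumption.
  replace (b * x * Rpower t (b - 1)) with (Rpower t b * (b * (x / t))).
  - replace (Rpower t b * (b * (x / t)) + (1 - b) * Rpower t b) with (Rpower t b * (b * (x / t) + (1 - b))) by ring.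
    apply Rmult_le_compat_l; lra.
  - unfold Rminus. rewrite Rpower_plus, Rpower_Ropp, Rpower_1 by assumption. field. lra.
Qed.

(** Hoelder's inequality by tangent lines: the concave power is bounded by its tangent at the mean
    value [s / t], where the two terms add up to the product on the right. *)
Lemma power_sum {A : Type} (l : list A) a b s t : 0 < b < 1 -> 0 < s -> 0 < t -> INR (length l) <= t ->
  (forall x, In x l -> 0 <= a x) -> lsum l a <= s -> lsum l (fun x => rpow (a x) b) <= Rpower s b * Rpower t (1 - b).
Proof.
  intros Hb Hs Ht Hlen Ha Hsum. set (u := s / t). assert (Hu : 0 < u) by (apply Rdiv_lt_0_compat; assumption).
  pose proof (Rpower_pos u (b - 1)). pose proof (Rpower_pos u b).
  apply Rle_trans with (lsum l (fun x => (b * Rpower u (b - 1)) * a x + (1 - b) * Rpower u b)).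
  { apply lsum_le. intros x Hx. eapply Rle_trans; [apply (rpow_tangent _ u); auto|]. lra. }
  rewrite lsum_plus, lsum_scal.
  assert (H1 : lsum l (fun _ => (1 - b) * Rpower u b) <= t * ((1 - b) * Rpower u b)).
  { eapply Rle_trans; [apply lsum_const_le; intros; apply Rle_refl|]. apply Rmult_le_compat_r; [nra|assumption]. }
  assert (H2 : b * Rpower u (b - 1) * lsum l a <= b * Rpower u (b - 1) * s) by (apply Rmult_le_compat_l; [nra|assumption]).
  assert (E1 : Rpower u (b - 1) = Rpower u b * (t / s)).
  { unfold Rminus. rewrite Rpower_plus, Rpower_Ropp, Rpower_1 by assumption. unfold u. field. lra. }
  assert (E2 : t * Rpower u b = Rpower s b * Rpower t (1 - b)).
  { unfold u, Rdiv. rewrite <- Rpower_mult_distr, Rpower_inv by (try apply Rinv_0_lt_compat; assumption).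
    unfold Rminus. rewrite Rpower_plus, Rpower_Ropp, Rpower_1 by assumption. ring. }
  rewrite <- E2. rewrite E1 in H2. replace (b * (Rpower u b * (t / s)) * s) with (b * (t * Rpower u b)) in H2 by (field; lra).
  rewrite E1. lra.
Qed.

(** * The formula for the spectral dimension *)

Section SpectralDimension.
Context (p n : R).
Hypothesis p_pos : 0 < p.
Hypothesis n_gt1 : 1 < n.

Lemma ln_n_pos : 0 < ln n.
Proof. rewrite <- ln_1. apply ln_increasing; lra. Qed.

Lemma dS_mono x y : Rbar_le x y -> Rbar_le (dS p (Finite n) x) (dS p (Finite n) y).
Proof.
  pose proof ln_n_pos as Hn. assert (Hpn : 0 < p * ln n) by (apply Rmult_lt_0_compat; assumption).
  destruct x as [x| |], y as [y| |]; simpl; try tauto; try lra.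
  - intros Hxy. destruct (Rle_dec y 0), (Rle_dec x 0); try lra; simpl; try lra.
    + destruct Rlt_dec as [Hy|Hy]; simpl; [|exact Logic.I]. apply Rdiv_le_0_compat; lra.
    + assert (Hl : ln x <= ln y) by (apply ln_le; lra).
      destruct (Rlt_dec 0 (ln n - ln x)) as [Hx|Hx], (Rlt_dec 0 (ln n - ln y)) as [Hy|Hy]; simpl; try exact Logic.I; try lra.
      apply Rmult_le_compat_l; [lra|]. apply Rinv_le_contravar; lra.
  - intros _. destruct (Rle_dec x 0); simpl; [exact Logic.I|]. destruct Rlt_dec; simpl; exact Logic.I.
  - intros _. destruct (Rle_dec y 0); simpl; [lra|]. destruct Rlt_dec as [Hy|Hy]; simpl; [|exact Logic.I]. apply Rdiv_le_0_compat; lra.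
Qed.

Lemma dS_lt x : Rbar_lt x (Finite 1) -> Rbar_lt (dS p (Finite n) x) (Finite p).
Proof.
  pose proof ln_n_pos as Hn. destruct x as [x| |]; simpl; try tauto; try (intros; assumption). intros Hx.
  destruct (Rle_dec x 0); simpl; [assumption|]. assert (Hl : ln x < 0) by (rewrite <- ln_1; apply ln_increasing; lra).
  destruct Rlt_dec; simpl; [|lra]. apply Rlt_div_l; [lra|]. apply Rmult_lt_compat_l; lra.
Qed.

Lemma dS_ge x : Rbar_le (Finite 1) x -> Rbar_le (Finite p) (dS p (Finite n) x).
Proof.
  pose proof ln_n_pos as Hn. destruct x as [x| |]; simpl; try tauto. intros Hx.
  destruct (Rle_dec x 0); simpl; [lra|]. assert (Hl : 0 <= ln x) by (rewrite <- ln_1; apply ln_le; lra).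
  destruct Rlt_dec; simpl; [|exact Logic.I]. apply Rle_div_r; [lra|]. apply Rmult_le_compat_l; lra.
Qed.

(** [Rpower n (1 - p / q)] is the rate at which the formula takes the value [q]. *)
Lemma dS_le_power q x : p < q -> Rbar_le x (Finite (Rpower n (1 - p / q))) -> Rbar_le (dS p (Finite n) x) (Finite q).
Proof.
  pose proof ln_n_pos as Hn. intros Hq. destruct x as [x| |]; simpl; try tauto; try (intros; lra). intros Hx.
  destruct (Rle_dec x 0); simpl; [lra|]. assert (Hl : ln x <= (1 - p / q) * ln n) by (rewrite <- ln_Rpower; apply ln_le; lra).
  assert (Hpq : 0 < p / q * ln n) by (apply Rmult_lt_0_compat; [apply Rdiv_lt_0_compat; lra|assumption]).
  destruct Rlt_dec as [H|H]; simpl; [|lra]. apply Rle_div_l; [lra|].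
  replace (p * ln n) with (q * (p / q * ln n)) by (field; lra). apply Rmult_le_compat_l; lra.
Qed.

(** For positive [x], [dS < q] says that [x^(q/p) * n^(1 - q/p) < 1], the decay rate of the
    [q]-energy predicted by Hoelder's inequality. Strictness leaves room to enlarge both [x] and
    [n]. *)
Lemma dS_interpolate q x : 0 < q < p -> Rbar_lt x (Finite 1) -> Rbar_lt (dS p (Finite n) x) (Finite q) ->
  exists s n', n < n' /\ 0 < s /\ Rbar_lt x (Finite s) /\ Rpower s (q / p) * Rpower n' (1 - q / p) < 1.
Proof.
  pose proof ln_n_pos as Hn. intros Hq Hx1 Hd. set (b := q / p).
  assert (Hb : 0 < b < 1) by (unfold b; split; [apply Rdiv_lt_0_compat; lra|apply Rlt_div_l; lra]).
  assert (Hcrit : forall s n', b * ln s + (1 - b) * ln n' < 0 -> Rpower s b * Rpower n' (1 - b) < 1).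
  { intros s n' H. unfold Rpower. rewrite <- exp_plus. apply Rlt_le_trans with (exp 0); [apply exp_increasing; assumption|rewrite exp_0; lra]. }
  (* A rate [x <= 0] stands for [ln x = -oo]; any sufficiently small positive [s] serves. *)
  assert (Hsmall : Rbar_le x (Finite 0) -> exists s n', n < n' /\ 0 < s /\ Rbar_lt x (Finite s) /\ Rpower s b * Rpower n' (1 - b) < 1).
  { intros Hx0. set (s := exp (- (((1 - b) * ln (n + 1) + 1) / b))). exists s, (n + 1). pose proof (exp_pos (- (((1 - b) * ln (n + 1) + 1) / b))) as Hs. fold s in Hs.
    split; [lra|]. split; [assumption|]. split; [eapply Rbar_le_lt_trans; [exact Hx0|exact Hs]|]. apply Hcrit. unfold s. rewrite ln_exp.
    replace (b * - (((1 - b) * ln (n + 1) + 1) / b)) with (- ((1 - b) * ln (n + 1) + 1)) by (field; lra). lra. }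
  destruct x as [x| |]; [|simpl in Hx1; tauto|apply Hsmall; simpl; exact Logic.I].
  simpl in Hd, Hx1. destruct (Rle_dec x 0) as [H0|H0]; [apply Hsmall; exact H0|].
  assert (Hl : ln x < 0) by (rewrite <- ln_1; apply ln_increasing; lra).
  destruct Rlt_dec as [Hpos|Hpos]; [|lra]. simpl in Hd. apply (Rlt_div_l _ _ _ Hpos) in Hd.
  set (e := - (b * ln x + (1 - b) * ln n)).
  assert (He : 0 < e).
  { assert (ln n < b * (ln n - ln x)); [|unfold e; lra]. apply Rmult_lt_reg_l with p; [assumption|]. unfold b.
    replace (p * (q / p * (ln n - ln x))) with (q * (ln n - ln x)) by (field; lra). assumption. }
  assert (Hexp : 1 < exp (e / 2)) by (rewrite <- exp_0; apply exp_increasing; lra).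
  exists (x * exp (e / 2)), (n * exp (e / 2)). split; [nra|]. split; [nra|]. split; [simpl; nra|]. apply Hcrit.
  rewrite !ln_mult, ln_exp by lra. unfold e in *. lra.
Qed.
End SpectralDimension.

(** * Critical exponents *)

Lemma Rbar_le_above x t u : t < u -> (forall s, t < s < u -> Rbar_le x (Finite s)) -> Rbar_le x (Finite t).
Proof.
  intros Hu H. apply Rbar_not_lt_le. intros Hlt. destruct x as [y| |]; simpl in Hlt; [|exact (H ((t + u) / 2) ltac:(lra))|tauto].
  pose proof (Rmin_l y u). pose proof (Rmin_r y u). assert (t < Rmin y u) by (apply Rmin_glb_lt; assumption).
  specialize (H ((t + Rmin y u) / 2) ltac:(lra)). simpl in H. lra.
Qed.

Section CriticalExponents.
Context (Ep : R -> nat -> Rbar) (A : R -> Prop) (n : R).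
Hypothesis Ep_nonneg : forall p k, Rbar_le (Finite 0) (Ep p k).
(** [A] stands for the exponents of regular metrics quasisymmetric to [d]. Entering [A] takes small
    energies along a subsequence only, while membership yields exponential decay along all
    generations for larger exponents: this asymmetry makes upper and lower quantities agree. *)
Hypothesis A_witness : forall p, 0 < p -> (forall e k0, 0 < e -> exists k, (k0 <= k)%nat /\ Rbar_lt (Ep p k) (Finite e)) -> A p.
Hypothesis A_decay : forall a p, A a -> a < p -> exists C lam, 0 < C /\ 0 < lam < 1 /\ forall k, Rbar_le (Ep p k) (Finite (C * lam ^ k)).
Hypothesis A_pos : forall a, A a -> 0 < a.
Hypothesis n_gt1 : 1 < n.
Hypothesis interpolate : forall p q n', 0 < p < q -> n < n' -> exists C k0, 0 < C /\ forall k e, (k0 <= k)%nat -> 0 < e ->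
  Rbar_lt (Ep q k) (Finite e) -> Rbar_le (Ep p k) (Finite (C * (Rpower e (p / q) * Rpower (n' ^ k) (1 - p / q)))).

Notation root_sup p := (rb_limsup (fun k => rb_root k (Ep p k))).
Notation root_inf p := (rb_liminf (fun k => rb_root k (Ep p k))).

Lemma decay_limsup a p : A a -> a < p -> rb_limsup (Ep p) = Finite 0.
Proof.
  intros Ha Hp. destruct (A_decay a p Ha Hp) as (C & lam & HC & Hlam & H). apply Rbar_le_antisym.
  - apply (Rbar_le_above _ 0 1); [lra|]. intros s Hs. destruct (small_pow lam (s / C) Hlam) as (k0 & Hk0); [apply Rdiv_lt_0_compat; lra|].
    apply (limsup_le _ _ k0). intros k Hk. eapply Rbar_le_trans; [apply H|]. simpl. replace k with (k0 + (k - k0))%nat by lia. rewrite pow_add.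
    assert (lam ^ (k - k0) <= 1) by (apply pow_le1; lra). assert (0 < lam ^ k0) by (apply pow_lt; lra).
    apply (Rlt_div_r _ _ _ HC) in Hk0.
    apply Rle_trans with (C * lam ^ k0); [|lra]. apply Rmult_le_compat_l; [lra|nra].
  - apply limsup_ge. intros j. exists j. split; [lia|apply Ep_nonneg].
Qed.

Lemma decay_root a p : A a -> a < p -> Rbar_lt (root_sup p) (Finite 1).
Proof.
  intros Ha Hp. destruct (A_decay a p Ha Hp) as (C & lam & HC & Hlam & H).
  destruct (pow_absorb C lam ((1 + lam) / 2) HC ltac:(lra)) as (k0 & Hk0).
  apply Rbar_le_lt_trans with (Finite ((1 + lam) / 2)); [|simpl; lra]. apply (limsup_le _ _ (S k0)). intros k Hk.
  apply root_le; [lia|lra|]. eapply Rbar_le_trans; [apply H|]. apply Hk0. lia.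
Qed.

Lemma glb_le a : A a -> Rbar_le (Glb_Rbar A) (Finite a).
Proof. intros Ha. apply (Glb_Rbar_correct A). assumption. Qed.

Lemma critical_infimum : Glb_Rbar (fun p => 0 < p /\ rb_liminf (Ep p) = Finite 0) = Glb_Rbar A /\
  Glb_Rbar (fun p => 0 < p /\ rb_limsup (Ep p) = Finite 0) = Glb_Rbar A.
Proof.
  set (Iu := Glb_Rbar (fun p => 0 < p /\ rb_liminf (Ep p) = Finite 0)). set (Ib := Glb_Rbar (fun p => 0 < p /\ rb_limsup (Ep p) = Finite 0)).
  assert (H1 : Rbar_le (Glb_Rbar A) Iu).
  { apply (Glb_Rbar_correct (fun p => 0 < p /\ rb_liminf (Ep p) = Finite 0)). intros p (Hp & E). apply glb_le. apply A_witness; [assumption|].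
    intros e k0 He. apply liminf_lt. rewrite E. exact He. }
  assert (H2 : Rbar_le Iu Ib).
  { apply (Glb_Rbar_correct (fun p => 0 < p /\ rb_limsup (Ep p) = Finite 0)). intros p (Hp & E).
    apply (Glb_Rbar_correct (fun p => 0 < p /\ rb_liminf (Ep p) = Finite 0)). split; [assumption|]. apply Rbar_le_antisym.
    - rewrite <- E. apply liminf_le_limsup.
    - apply (liminf_ge _ _ 0). intros k _. apply Ep_nonneg. }
  assert (H3 : Rbar_le Ib (Glb_Rbar A)).
  { apply (Glb_Rbar_correct A). intros a Ha. apply (Rbar_le_above _ a (a + 1)); [lra|]. intros s Hs.
    apply (Glb_Rbar_correct (fun p => 0 < p /\ rb_limsup (Ep p) = Finite 0)). split; [pose proof (A_pos a Ha); lra|].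
    apply (decay_limsup a); [assumption|lra]. }
  split; apply Rbar_le_antisym; try assumption; eapply Rbar_le_trans; eassumption.
Qed.

(** At generations where the [p]-energy is below [s^k], interpolation bounds the [q]-energy by a
    multiple of [g^k] with [g < 1]. A lower limit provides arbitrarily late such generations, which
    is all that [A_witness] asks. *)
Lemma low_energy_exponent p q : 0 < q < p -> Rbar_lt (root_inf p) (Finite 1) -> Rbar_lt (dS p (Finite n) (root_inf p)) (Finite q) -> A q.
Proof.
  intros Hq Hr Hd. destruct (dS_interpolate p n ltac:(lra) n_gt1 q (root_inf p) Hq Hr Hd) as (s & n' & Hn' & Hs & Hrs & Hprod).
  destruct (interpolate q p n' Hq Hn') as (C & k0 & HC & Hint). set (g := Rpower s (q / p) * Rpower n' (1 - q / p)) in *.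
  assert (Hg : 0 < g) by (apply Rmult_lt_0_compat; apply Rpower_pos).
  apply A_witness; [lra|]. intros e j He. destruct (small_pow g (e / C) ltac:(lra)) as (k1 & Hk1); [apply Rdiv_lt_0_compat; assumption|].
  destruct (liminf_lt _ _ Hrs (S (k0 + k1 + j))) as (k & Hk & Hroot). exists k. split; [lia|].
  apply root_lt in Hroot; [|lia|assumption]. apply Rbar_le_lt_trans with (Finite (C * g ^ k)).
  - eapply Rbar_le_trans; [apply (Hint k (s ^ k)); [lia|apply pow_lt; assumption|assumption]|]. simpl.
    rewrite !Rpower_pow_swap by lra. unfold g. rewrite Rpow_mult_distr. lra.
  - simpl. replace k with (k1 + (k - k1))%nat by lia. rewrite pow_add. assert (g ^ (k - k1) <= 1) by (apply pow_le1; lra).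
    assert (0 < g ^ k1) by (apply pow_lt; lra). apply (Rlt_div_r _ _ _ HC) in Hk1.
    apply Rle_lt_trans with (C * g ^ k1); [|lra]. apply Rmult_le_compat_l; [lra|nra].
Qed.

(** Every [q] strictly between the lower spectral dimension and [p] belongs to [A]. Hence [A] has an
    element below [p], and [A_decay] then gives decay along all generations, so the upper rate is
    below [1] too. *)
Lemma below_critical p : 0 < p -> Rbar_lt (root_inf p) (Finite 1) ->
  Rbar_le (Glb_Rbar A) (dS p (Finite n) (root_inf p)) /\
  Rbar_le (dS p (Finite n) (root_inf p)) (dS p (Finite n) (root_sup p)) /\
  Rbar_lt (dS p (Finite n) (root_sup p)) (Finite p) /\ Rbar_lt (root_sup p) (Finite 1).
Proof.
  intros Hp Hr. pose proof (dS_lt p n Hp n_gt1 _ Hr) as Hlt.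
  assert (H0 : Rbar_le (Finite 0) (dS p (Finite n) (root_inf p))) by (apply (dS_mono p n Hp n_gt1 m_infty); simpl; exact Logic.I).
  assert (H1 : Rbar_le (Glb_Rbar A) (dS p (Finite n) (root_inf p))).
  { destruct (dS p (Finite n) (root_inf p)) as [x| |] eqn:Ed; [|simpl in Hlt; tauto|simpl in H0; tauto]. simpl in Hlt, H0.
    apply (Rbar_le_above _ x p); [assumption|]. intros q Hq. apply glb_le. apply (low_energy_exponent p); [lra|assumption|]. rewrite Ed. simpl. lra. }
  assert (Hex : exists a, A a /\ a < p).
  { apply NNPP. intros Hno. apply (Rbar_lt_not_le _ _ (Rbar_le_lt_trans _ _ _ H1 Hlt)). apply (Glb_Rbar_correct A). intros a Ha. simpl.
    apply Rnot_lt_le. intros Hap. apply Hno. eauto. }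
  destruct Hex as (a & Ha & Hap). pose proof (decay_root a p Ha Hap) as Hs.
  split; [assumption|]. split; [apply dS_mono; [assumption|assumption|apply liminf_le_limsup]|]. split; [apply dS_lt; assumption|assumption].
Qed.

(** The [q]-energies are bounded because [q > a], and descendants number at most [n'^k]; Hoelder's
    inequality gives [p]-energies of order [n'^(k (1 - p/q))], and [n'] may be taken close to
    [n]. *)
Lemma root_bound a p q : A a -> 0 < p < q -> a < q -> Rbar_le (root_sup p) (Finite (Rpower n (1 - p / q))).
Proof.
  intros Ha Hpq Haq. set (b := 1 - p / q). assert (Hb : 0 < b < 1).
  { unfold b. assert (0 < p / q < 1); [|lra]. split; [apply Rdiv_lt_0_compat; lra|apply Rlt_div_l; lra]. }
  destruct (A_decay a q Ha Haq) as (C & lam & HC & Hlam & Hdec).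
  apply (Rbar_le_above _ _ (Rpower n b + 1)); [lra|]. intros s Hs. set (s' := (Rpower n b + s) / 2).
  pose proof (Rpower_pos n b) as Hnb. assert (Hs' : Rpower n b < s' < s) by (unfold s'; lra).
  set (n' := Rpower s' (/ b)).
  assert (En' : Rpower n' b = s') by (unfold n'; rewrite Rpower_mult, Rinv_l, Rpower_1 by lra; reflexivity).
  assert (Hn' : n < n').
  { apply Rnot_le_lt. intros Hle. assert (Rpower n' b <= Rpower n b); [|lra]. apply Rle_Rpower_l; [lra|]. split; [apply Rpower_pos|assumption]. }
  destruct (interpolate p q n' Hpq Hn') as (C' & k0 & HC' & Hint). set (C2 := C' * Rpower (C + 1) (p / q)).
  assert (HC2 : 0 < C2) by (apply Rmult_lt_0_compat; [assumption|apply Rpower_pos]).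
  destruct (pow_absorb C2 s' s HC2 ltac:(lra)) as (k1 & Hk1).
  apply (limsup_le _ _ (S (k0 + k1))). intros k Hk. apply root_le; [lia|lra|].
  eapply Rbar_le_trans; [apply (Hint k (C + 1)); [lia|lra|]|].
  - eapply Rbar_le_lt_trans; [apply Hdec|]. simpl. assert (lam ^ k <= 1) by (apply pow_le1; lra). nra.
  - simpl. fold b. rewrite Rpower_pow_swap by lra. rewrite En', <- Rmult_assoc. apply Hk1. lia.
Qed.

(** An element of [A] below [p] would push the upper rate below [1]; so [p <= a] for all of them,
    and [root_bound] applies with [q] decreasing to [a]. A lower rate below [1] is excluded by
    [below_critical]. *)
Lemma above_critical p : 0 < p -> Rbar_le (Finite 1) (root_sup p) ->
  Rbar_le (dS p (Finite n) (root_sup p)) (Glb_Rbar A) /\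
  Rbar_le (dS p (Finite n) (root_inf p)) (dS p (Finite n) (root_sup p)) /\
  Rbar_le (Finite p) (dS p (Finite n) (root_inf p)).
Proof.
  intros Hp Hr. split; [|split].
  - apply (Glb_Rbar_correct A). intros a Ha. apply (Rbar_le_above _ a (a + 1)); [lra|]. intros q Hq.
    assert (Hpa : p <= a) by (apply Rnot_lt_le; intros Hlt; exact (Rbar_lt_not_le _ _ (decay_root a p Ha Hlt) Hr)).
    apply dS_le_power; [assumption|assumption|lra|]. apply (root_bound a); [assumption|lra|lra].
  - apply dS_mono; [assumption|assumption|apply liminf_le_limsup].
  - apply dS_ge; [assumption|assumption|]. apply Rbar_not_lt_le. intros Hlt.
    destruct (below_critical p Hp Hlt) as (_ & _ & _ & H). exact (Rbar_lt_not_le _ _ H Hr).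
Qed.
End CriticalExponents.

(** With [x0, y0] fixed, [rho x0 y0 / rho x0 y <= th (d x0 y0 / d x0 y)], and the right side is
    arbitrarily small for distant [y]. *)
Lemma QS_unbounded {X : Type} (d rho : X -> X -> R) : is_metric d -> is_metric rho -> QS d rho -> diam d = p_infty -> diam rho = p_infty.
Proof.
  intros (D0 & D1 & Ds & Dt) (R0 & R1 & Rs & Rt) (th & Hth & Hqs) Hd.
  destruct (homeo_bounds th Hth) as (_ & _ & Hsmall).
  assert (Hbig : forall c, exists x y, c < d x y).
  { intros c. apply NNPP. intros Hno. assert (Rbar_le (diam d) (Finite c)) as H; [|rewrite Hd in H; exact H].
    apply rb_sup_lub. intros z (x & y & ->). simpl. apply Rnot_lt_le. intros Hlt. apply Hno. eauto. }
  destruct (Hbig 0) as (x0 & y0 & H0). assert (Hne : x0 <> y0) by (intros E; apply D1 in E; lra).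
  assert (Hr0 : 0 < rho x0 y0) by (destruct (R0 x0 y0) as [|E]; [assumption|exfalso; apply Hne, R1; congruence]).
  assert (Hall : forall c, 0 < c -> Rbar_le (Finite c) (diam rho)).
  { intros c Hc. destruct (Hsmall (rho x0 y0 / c)) as (a & Ha & Hth'); [apply Rdiv_lt_0_compat; assumption|].
    assert (Hy : exists y, d x0 y0 / a < d x0 y).
    { destruct (Hbig (2 * (d x0 y0 / a))) as (x & y & Hxy). pose proof (Dt x x0 y) as Ht. rewrite (Ds x x0) in Ht.
      destruct (Rlt_dec (d x0 y0 / a) (d x0 x)); [eauto|]. exists y. lra. }
    destruct Hy as (y & Hy). assert (0 < d x0 y0 / a) by (apply Rdiv_lt_0_compat; assumption).
    assert (Hney : x0 <> y) by (intros E; apply D1 in E; lra).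
    assert (Hry : 0 < rho x0 y) by (destruct (R0 x0 y) as [|E]; [assumption|exfalso; apply Hney, R1; congruence]).
    apply Rbar_le_trans with (Finite (rho x0 y)); [|apply rb_sup_ub; eauto]. simpl.
    assert (Hq : rho x0 y0 / rho x0 y <= rho x0 y0 / c).
    { eapply Rle_trans; [apply (Hqs x0 y0 y Hney)|]. apply Hth'. split; [apply Rdiv_le_0_compat; lra|].
      apply Rle_div_l; [lra|]. apply (Rlt_div_l _ _ _ Ha) in Hy. lra. }
    unfold Rdiv in Hq. apply Rmult_le_reg_l in Hq; [|assumption]. rewrite <- (Rinv_inv c), <- (Rinv_inv (rho x0 y)).
    apply Rinv_le_contravar; [apply Rinv_0_lt_compat; assumption|assumption]. }
  destruct (diam rho) as [t| |]; [|reflexivity|].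
  - specialize (Hall (Rabs t + 1)). pose proof (Rabs_pos t). pose proof (Rle_abs t). simpl in Hall. lra.
  - specialize (Hall 1 ltac:(lra)). simpl in Hall. tauto.
Qed.

(** * The partition *)

Section Tree.
Context {T : Type} (pi : T -> T) (phi : T).
Hypothesis tree : bi_infinite_tree pi.

Lemma iter_eq_level (a b : nat) w : Nat.iter a pi w = Nat.iter b pi w -> a = b.
Proof.
  destruct tree as (_ & T2). intros H.
  destruct (Nat.lt_trichotomy a b) as [Hab|[Hab|Hab]]; [|assumption|]; exfalso.
  - replace b with ((b - a) + a)%nat in H by lia. rewrite Nat.iter_add in H. symmetry in H. revert H. apply T2. lia.
  - replace a with ((a - b) + b)%nat in H by lia. rewrite Nat.iter_add in H. revert H. apply T2. lia.
Qed.

Lemma height_eq w (n m : nat) : Nat.iter n pi w = Nat.iter m pi phi -> height pi phi w = (Z.of_nat n - Z.of_nat m)%Z.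
Proof.
  intros H. unfold height.
  assert (Hs : exists h, exists n m : nat, Nat.iter n pi w = Nat.iter m pi phi /\ h = (Z.of_nat n - Z.of_nat m)%Z) by eauto.
  destruct (epsilon_spec (inhabits 0%Z) _ Hs) as (n' & m' & H' & ->).
  assert (E : Nat.iter (n' + m) pi phi = Nat.iter (n + m') pi phi).
  { rewrite !Nat.iter_add, <- H, <- H', <- !Nat.iter_add. f_equal. lia. }
  apply iter_eq_level in E. lia.
Qed.

Lemma height_pi w : height pi phi (pi w) = (height pi phi w - 1)%Z.
Proof.
  destruct tree as (T1 & _). destruct (T1 w phi) as (n & m & H).
  assert (H1 : Nat.iter (S n) pi w = Nat.iter (S m) pi phi) by (simpl; congruence).
  rewrite (height_eq w _ _ H1). rewrite Nat.iter_succ_r in H1. rewrite (height_eq (pi w) _ _ H1). lia.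
Qed.

Lemma height_iter w n : height pi phi (Nat.iter n pi w) = (height pi phi w - Z.of_nat n)%Z.
Proof. induction n as [|n IH]; simpl; [lia|]. rewrite height_pi, IH. lia. Qed.
End Tree.

Lemma card_le_list {A : Type} (P : A -> Prop) n : card_le P n -> exists l, NoDup l /\ (length l <= n)%nat /\ forall x, P x <-> In x l.
Proof.
  intros H.
  assert (forall k, (exists l, NoDup l /\ (forall x, In x l -> P x) /\ length l = k) \/
     exists l, NoDup l /\ (length l <= k)%nat /\ forall x, P x <-> In x l) as Hk.
  { induction k as [|k [IH|IH]].
    - left. exists []. split; [constructor|]. split; [intros ? []|reflexivity].
    - destruct IH as (l & H1 & H2 & H3). destruct (classic (exists x, P x /\ ~ In x l)) as [(x & Hx & Hn)|Hno].
      + left. exists (x :: l). split; [constructor; assumption|]. split; [intros y [<-|Hy]; auto|simpl; congruence].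
      + right. exists l. split; [assumption|]. split; [lia|]. intros x. split; [|auto]. intros Hx. apply NNPP. intros Hn. apply Hno. eauto.
    - right. destruct IH as (l & H1 & H2 & H3). exists l. split; [assumption|]. split; [lia|assumption]. }
  destruct (Hk (S n)) as [(l & H1 & H2 & H3)|(l & H1 & H2 & H3)].
  - specialize (H l H1 H2). lia.
  - exists l. split; [assumption|]. split; [|assumption]. apply H; [assumption|]. intros; apply H3; assumption.
Qed.

Section Graph.
Context {G T : Type} (E : G -> G -> Prop) (pi : T -> T) (phi : T) (K : T -> G -> Prop) (d : G -> G -> R) (r : R).
Context (f_enum : nat -> G).
Hypothesis G_inf : (forall i j, f_enum i = f_enum j -> i = j) /\ (forall x, exists i, f_enum i = x).
Hypothesis E_simple : simple_graph E.
Hypothesis E_conn : connected E.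
Hypothesis tree : bi_infinite_tree pi.
Hypothesis part : is_partition E pi phi K.
Hypothesis mini : minimal pi K.
Hypothesis d_metric : is_metric d.
Hypothesis thk : thick pi K d.
Hypothesis r_bd : 0 < r < 1.
Context (Cg CF : R).
Hypothesis Cg_ge : 1 <= Cg.
Hypothesis CF_pos : 0 < CF.
Hypothesis gd_bd : forall w, T_e pi K w -> / Cg * powerRZ r (height pi phi w) <= gd K d w <= Cg * powerRZ r (height pi phi w).
Hypothesis F1 : forall x y z, E x y -> x <> z -> d x y <= CF * d x z.

Notation ht := (height pi phi).
Notation Te := (T_e pi K).
Notation Le := (Lambda_e pi K).

Lemma K_pi w x : K w x -> K (pi w) x.
Proof. intros H. destruct part as (_ & P1 & _). apply P1. exists w. auto. Qed.

Lemma K_iter n w x : K w x -> K (Nat.iter n pi w) x.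
Proof. intros H. induction n; simpl; [assumption|]. apply K_pi. assumption. Qed.

Lemma Te_pi w : Te w -> Te (pi w).
Proof. intros (x & y & z & Hx & Hy & Hz & H). exists x, y, z. auto using K_pi. Qed.

Lemma Te_iter n w : Te w -> Te (Nat.iter n pi w).
Proof. intros H. induction n; simpl; [assumption|]. apply Te_pi. assumption. Qed.

(** The partition axioms alone allow an empty [K w]; thickness supplies a vertex. *)
Lemma Te_nonempty w : Te w -> exists x, K w x.
Proof. intros H. destruct thk as (al & _ & Ht). destruct (Ht w H) as (x & Hx & _). eauto. Qed.

(** The covering by children lets [x] be followed downwards forever. Completed by the ancestors of
    [w], this is an element of [Sigma*], and such sequences end in an edge. *)
Lemma ray w x : K w x -> exists g : nat -> T, g 0%nat = w /\ (forall k, pi (g (S k)) = g k) /\ (forall k, K (g k) x) /\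
  exists n0 a b, E a b /\ forall k, (n0 <= k)%nat -> forall z, K (g k) z <-> z = a \/ z = b.
Proof.
  intros Hx. destruct part as (_ & P1 & P2 & _).
  destruct (choice (fun w v => K w x -> pi v = w /\ K v x)) as (c & Hc).
  { intros v. destruct (classic (K v x)) as [Hv|Hv]; [|exists v; tauto]. apply P1 in Hv. destruct Hv as (u & Hu). exists u. auto. }
  set (g := fun k => Nat.iter k c w).
  assert (Hg : forall k, K (g k) x) by (induction k; [assumption|]; simpl; apply Hc; assumption).
  assert (Hpg : forall k, pi (g (S k)) = g k) by (intros k; apply Hc; apply Hg).
  assert (Hgh : forall k, ht (g k) = (ht w + Z.of_nat k)%Z).
  { induction k as [|k IH]; [simpl; lia|]. pose proof (height_pi pi phi tree (g (S k))) as H. rewrite Hpg in H. lia. }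
  set (om := fun n : Z => if Z_le_dec n (ht w) then Nat.iter (Z.to_nat (ht w - n)) pi w else g (Z.to_nat (n - ht w))).
  destruct (P2 om) as (n0 & a & b & Hab & H).
  { intros n. unfold om. destruct (Z_le_dec n (ht w)); destruct (Z_le_dec (n + 1) (ht w)); try lia.
    - split; [rewrite height_iter by assumption; lia|].
      replace (Z.to_nat (ht w - n)) with (S (Z.to_nat (ht w - (n + 1)))) by lia. reflexivity.
    - split; [rewrite height_iter by assumption; lia|]. replace n with (ht w) by lia.
      replace (Z.to_nat (ht w - ht w)) with 0%nat by lia. replace (Z.to_nat (ht w + 1 - ht w)) with 1%nat by lia. apply Hpg.
    - split; [rewrite Hgh; lia|]. replace (Z.to_nat (n + 1 - ht w)) with (S (Z.to_nat (n - ht w))) by lia. apply Hpg. }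
  exists g. split; [reflexivity|]. split; [assumption|]. split; [assumption|].
  exists (S (Z.to_nat (n0 - ht w))), a, b. split; [assumption|]. intros k Hk z.
  specialize (H (ht w + Z.of_nat k)%Z ltac:(lia) z). unfold om in H. destruct Z_le_dec; [lia|].
  replace (Z.to_nat (ht w + Z.of_nat k - ht w)) with k in H by lia. assumption.
Qed.

Lemma iter_ray (g : nat -> T) k : (forall k, pi (g (S k)) = g k) -> Nat.iter k pi (g k) = g 0%nat.
Proof.
  intros Hg. induction k as [|k IH]; [reflexivity|]. rewrite Nat.iter_succ_r, Hg. assumption.
Qed.

Lemma E_neq a b : E a b -> a <> b.
Proof. intros H ->. apply (proj2 E_simple) in H. assumption. Qed.

Lemma K_edge w x : K w x -> exists a b, E a b /\ K w a /\ K w b.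
Proof.
  intros Hx. destruct (ray w x Hx) as (g & G0 & Gp & _ & n0 & a & b & Hab & H). exists a, b. split; [assumption|].
  rewrite <- G0, <- (iter_ray g n0 Gp). split; apply K_iter; apply H; auto.
Qed.

Lemma Te_cases w : Te w -> Le w \/ more_than_two (K w).
Proof.
  intros H. destruct (Te_nonempty w H) as (x & Hx). destruct (K_edge w x Hx) as (a & b & Hab & Ha & Hb).
  destruct (classic (exists z, K w z /\ z <> a /\ z <> b)) as [(z & Hz & Hza & Hzb)|Hno].
  - right. exists a, b, z. repeat split; try assumption; auto using E_neq.
  - left. split; [|assumption]. exists a, b. split; [auto using E_neq|]. intros z. split.
    + intros Hz. destruct (classic (z = a)); [auto|]. destruct (classic (z = b)); [auto|]. exfalso. apply Hno. eauto.
    + intros [-> | ->]; assumption.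
Qed.

Lemma Le_Te w : Le w -> Te w.
Proof. intros H. apply H. Qed.

Lemma Le_edge w : Le w -> exists a b, E a b /\ forall z, K w z <-> z = a \/ z = b.
Proof.
  intros Hw. destruct (Te_nonempty w (Le_Te w Hw)) as (x & Hx). destruct (K_edge w x Hx) as (a & b & Hab & Ha & Hb).
  exists a, b. split; [assumption|]. destruct Hw as ((x1 & x2 & Hne & H) & _). pose proof (E_neq _ _ Hab).
  intros z. rewrite H. apply H in Ha. apply H in Hb. intuition congruence.
Qed.

Lemma two_not_more (A : G -> Prop) a b : (forall z, A z -> z = a \/ z = b) -> ~ more_than_two A.
Proof.
  intros H (x & y & z & Hx & Hy & Hz & H1 & H2 & H3). apply H in Hx. apply H in Hy. apply H in Hz. intuition congruence.
Qed.

Lemma Le_leaf w v n : Le w -> Te v -> Nat.iter (S n) pi v = w -> False.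
Proof.
  intros Hw Hv Ev. destruct (Le_edge w Hw) as (a & b & _ & H).
  apply (two_not_more (K (pi v)) a b); [|exact Hv]. intros z Hz. apply H. rewrite <- Ev, Nat.iter_succ_r. apply K_iter. assumption.
Qed.

Lemma Le_below w x : Te w -> K w x -> exists u n, Le u /\ K u x /\ Nat.iter n pi u = w.
Proof.
  intros Hw Hx. destruct (ray w x Hx) as (g & G0 & Gp & Gx & n0 & a & b & Hab & H).
  assert (Hn0 : ~ more_than_two (K (g n0))) by (apply (two_not_more _ a b); intros z Hz; apply (H n0 (Nat.le_refl _)); assumption).
  destruct (least_nat (fun k => ~ more_than_two (K (g k))) n0 Hn0) as (k & _ & Hk & Hl).
  assert (Hkw : Nat.iter k pi (g k) = w) by (rewrite <- G0; apply iter_ray; assumption).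
  assert (HT : Te (g k)).
  { destruct k as [|k]; [rewrite G0; assumption|]. unfold T_e. rewrite Gp. apply NNPP. apply Hl. lia. }
  exists (g k), k. split; [|auto]. destruct (Te_cases _ HT); [assumption|contradiction].
Qed.

Lemma G_third (a b : G) : exists z, z <> a /\ z <> b.
Proof.
  destruct G_inf as (Hi & _). apply NNPP. intros Hno.
  assert (H : forall i, f_enum i = a \/ f_enum i = b).
  { intros i. destruct (classic (f_enum i = a)); [auto|]. destruct (classic (f_enum i = b)); [auto|]. exfalso. apply Hno. eauto. }
  assert (f_enum 0%nat <> f_enum 1%nat) by (intros Ei; apply Hi in Ei; lia).
  assert (f_enum 1%nat <> f_enum 2%nat) by (intros Ei; apply Hi in Ei; lia).
  assert (f_enum 0%nat <> f_enum 2%nat) by (intros Ei; apply Hi in Ei; lia).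
  destruct (H 0%nat), (H 1%nat), (H 2%nat); congruence.
Qed.

Lemma neighbour x : exists y, E x y.
Proof.
  destruct (G_third x x) as (z & Hz & _). pose proof (E_conn x z) as H. apply clos_rt_rt1n in H.
  destruct H as [|y z' Hy _]; [congruence|eauto].
Qed.

(** From a node whose piece is the edge, one climbs to the last ancestor before a third vertex
    appears. A third vertex does appear, because there is a common ancestor with a node holding
    one. *)
Lemma edge_node a b : E a b -> exists u, Le u /\ forall z, K u z <-> z = a \/ z = b.
Proof.
  intros Hab. pose proof part as (_ & _ & _ & P3). destruct (P3 a b Hab) as (w & Hw).
  destruct (G_third a b) as (c & Hca & Hcb). destruct (neighbour c) as (c' & Hc). destruct (P3 c c' Hc) as (w' & Hw').
  destruct (proj1 tree w w') as (n & m & Enm).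
  assert (Hm : more_than_two (K (Nat.iter n pi w))).
  { exists a, b, c. repeat split; auto using E_neq.
    - apply K_iter. apply Hw. auto. - apply K_iter. apply Hw. auto. - rewrite Enm. apply K_iter. apply Hw'. auto. }
  destruct (least_nat (fun k => more_than_two (K (Nat.iter k pi w))) n Hm) as (k & _ & Hk & Hl).
  destruct k as [|k]; [exfalso; apply (two_not_more (K w) a b); [intros z Hz; apply Hw; assumption|assumption]|].
  set (u := Nat.iter k pi w). assert (HT : Te u) by exact Hk.
  destruct (Te_cases u HT) as [HL|HL]; [|exfalso; apply (Hl k); [lia|assumption]].
  exists u. split; [assumption|]. destruct (Le_edge u HL) as (a' & b' & _ & H).
  assert (Ha : K u a) by (apply K_iter; apply Hw; auto). assert (Hb : K u b) by (apply K_iter; apply Hw; auto).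
  pose proof (E_neq a b Hab). intros z. rewrite H. apply H in Ha. apply H in Hb. intuition congruence.
Qed.

Lemma Le_inj w v x y : Le w -> Le v -> x <> y -> K w x -> K w y -> K v x -> K v y -> w = v.
Proof.
  intros Hw Hv Hne H1 H2 H3 H4. apply NNPP. intros Hn. apply (mini w v Hw Hv Hn).
  destruct (Le_edge w Hw) as (a & b & _ & Ha). destruct (Le_edge v Hv) as (a' & b' & _ & Hb).
  apply Ha in H1. apply Ha in H2. apply Hb in H3. apply Hb in H4. intros z. rewrite Ha, Hb. intuition congruence.
Qed.

(** Stated for an arbitrary [D] since it serves both [d] and, later, [rho]. *)
Lemma gd_max (D : G -> G -> R) w : Te w ->
  (exists x y, K w x /\ K w y /\ D x y = gd K D w) /\ forall x y, K w x -> K w y -> D x y <= gd K D w.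
Proof.
  intros Hw. unfold gd. apply epsilon_spec. destruct (Te_nonempty w Hw) as (x0 & Hx0).
  destruct part as (Pf & _). destruct (Pf w) as (l & Hl).
  destruct (list_argmin (list_prod l l) (fun xy => - D (fst xy) (snd xy))) as ((x, y) & Hxy & Hm).
  - intros E0. assert (In (x0, x0) (list_prod l l)) as Hi by (apply in_prod; apply Hl; assumption). rewrite E0 in Hi. destruct Hi.
  - apply in_prod_iff in Hxy. exists (D x y). split.
    + exists x, y. rewrite !Hl. tauto.
    + intros x' y' Hx' Hy'. specialize (Hm (x', y')). simpl in Hm.
      assert (In (x', y') (list_prod l l)) as Hi by (apply in_prod; apply Hl; assumption). specialize (Hm Hi). lra.
Qed.

Lemma gd_spec w : Te w -> (exists x y, K w x /\ K w y /\ d x y = gd K d w) /\ forall x y, K w x -> K w y -> d x y <= gd K d w.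
Proof. apply gd_max. Qed.

Lemma gd_le w x y : Te w -> K w x -> K w y -> d x y <= gd K d w.
Proof. intros Hw. apply gd_spec. assumption. Qed.

Lemma rpow_pos j : 0 < powerRZ r j.
Proof. apply powerRZ_pos. lra. Qed.

Lemma Cg_inv : 0 < / Cg <= 1.
Proof. split; [apply Rinv_0_lt_compat; lra|]. rewrite <- Rinv_1. apply Rinv_le_contravar; lra. Qed.

Lemma gd_pos w : Te w -> 0 < gd K d w.
Proof.
  intros Hw. pose proof (gd_bd w Hw) as (H & _). pose proof (rpow_pos (ht w)). pose proof Cg_inv. nra.
Qed.

Definition nbr (x : G) : G := proj1_sig (constructive_indefinite_description _ (neighbour x)).
Lemma nbr_E x : E x (nbr x).
Proof. unfold nbr. destruct constructive_indefinite_description. assumption. Qed.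

(** The length of one edge at [x], divided by [CF] so that [F1] makes it a lower bound for every
    distance from [x]. *)
Definition nd (x : G) : R := d x (nbr x) / CF.

Lemma d_pos_neq x y : x <> y -> 0 < d x y.
Proof.
  destruct d_metric as (H1 & H2 & _). intros Hne. destruct (H1 x y) as [|H0]; [assumption|]. exfalso. apply Hne. apply H2. congruence.
Qed.

Lemma nd_pos x : 0 < nd x.
Proof. apply Rdiv_lt_0_compat; [|assumption]. apply d_pos_neq. apply E_neq. apply nbr_E. Qed.

Lemma nd_le x y : x <> y -> nd x <= d x y.
Proof. intros H. unfold nd. apply Rle_div_l; [assumption|]. rewrite Rmult_comm. apply F1; [apply nbr_E|assumption]. Qed.

Lemma nd_edge x y : E x y -> d x y <= CF * CF * nd x.
Proof.
  intros H. unfold nd. replace (CF * CF * (d x (nbr x) / CF)) with (CF * d x (nbr x)) by (field; lra).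
  apply F1; [assumption|]. apply E_neq. apply nbr_E.
Qed.

Lemma Le_gd w a b : Le w -> K w a -> K w b -> a <> b -> gd K d w = d a b.
Proof.
  intros Hw Ha Hb Hab. destruct (gd_spec w (Le_Te w Hw)) as ((x & y & Hx & Hy & E0) & Hm).
  destruct (Le_edge w Hw) as (a' & b' & _ & H). apply Rle_antisym; [|apply Hm; assumption].
  rewrite <- E0. apply H in Hx. apply H in Hy. apply H in Ha. apply H in Hb.
  destruct d_metric as (D0 & D1 & D2 & _). pose proof (D0 a b).
  assert (forall z, d z z = 0) as Dz by (intros; apply D1; reflexivity).
  destruct Hx as [-> | ->], Hy as [-> | ->], Ha as [-> | ->], Hb as [-> | ->]; try congruence; try rewrite Dz; try lra; rewrite D2; lra.
Qed.

Lemma Le_nd w x : Le w -> K w x -> gd K d w <= CF * CF * nd x.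
Proof.
  intros Hw Hx. destruct (Le_edge w Hw) as (a & b & Hab & H). pose proof (E_neq _ _ Hab).
  assert (K w a) by (apply H; auto). assert (K w b) by (apply H; auto).
  apply H in Hx. destruct Hx as [-> | ->].
  - rewrite (Le_gd w a b) by assumption. apply nd_edge. assumption.
  - rewrite (Le_gd w b a) by auto. apply nd_edge. apply (proj1 E_simple). assumption.
Qed.

Lemma Te_nd w x : Te w -> K w x -> nd x <= gd K d w.
Proof.
  intros Hw Hx. destruct (K_edge w x Hx) as (a & b & Hab & Ha & Hb). pose proof (E_neq _ _ Hab) as Hne.
  destruct (classic (x = a)) as [->|Hxa].
  - eapply Rle_trans; [apply nd_le; exact Hne|apply gd_le; assumption].
  - eapply Rle_trans; [apply nd_le; exact Hxa|apply gd_le; assumption].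
Qed.

(** At the common vertex the edge has length at most [CF^2 * nd x], and [nd x] is at most the
    diameter of [v]; so the edge cannot lie many levels above [v]. *)
Lemma edge_height c0 w v x : r ^ c0 * (Cg * Cg * (CF * CF)) < 1 -> Le w -> Te v -> K w x -> K v x -> (ht v - Z.of_nat c0 < ht w)%Z.
Proof.
  intros Hc Hw Hv Hxw Hxv. pose proof (Le_nd w x Hw Hxw) as H1. pose proof (Te_nd v x Hv Hxv) as H2.
  destruct (gd_bd w (Le_Te w Hw)) as (H3 & _). destruct (gd_bd v Hv) as (_ & H4).
  apply Z.nle_gt. intros Hle. pose proof (powerRZ_anti r (ht w) (ht v - Z.of_nat c0) r_bd Hle) as H5.
  replace (ht v) with (ht v - Z.of_nat c0 + Z.of_nat c0)%Z in H4 by lia. rewrite powerRZ_nat in H4 by lra.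
  set (X := powerRZ r (ht v - Z.of_nat c0)) in *. pose proof (rpow_pos (ht v - Z.of_nat c0)) as HX. fold X in HX.
  assert (HCF : 0 < CF * CF) by nra.
  assert (/ Cg * X <= CF * CF * (Cg * (r ^ c0 * X))).
  { eapply Rle_trans; [apply Rmult_le_compat_l; [apply Rlt_le, Cg_inv|exact H5]|]. eapply Rle_trans; [exact H3|].
    eapply Rle_trans; [exact H1|]. apply Rmult_le_compat_l; lra. }
  assert (X <= Cg * (CF * CF * (Cg * (r ^ c0 * X)))).
  { apply Rmult_le_reg_l with (/ Cg); [apply Cg_inv|]. rewrite <- (Rmult_assoc (/ Cg) Cg), Rinv_l, Rmult_1_l by lra. assumption. }
  replace (Cg * (CF * CF * (Cg * (r ^ c0 * X)))) with (r ^ c0 * (Cg * Cg * (CF * CF)) * X) in H0 by ring. nra.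
Qed.

Lemma gd_unbounded w s : Te w -> exists k, s < gd K d (Nat.iter k pi w).
Proof.
  intros Hw. destruct (Rle_dec s 0) as [Hs|Hs].
  { exists 0%nat. simpl. pose proof (gd_pos w Hw). lra. }
  pose proof (rpow_pos (ht w)) as Hp.
  assert (Hq : 0 < / Cg * powerRZ r (ht w) / s) by (apply Rdiv_lt_0_compat; [apply Rmult_lt_0_compat; [apply Cg_inv|assumption]|lra]).
  destruct (small_pow r _ r_bd Hq) as (k & Hk).
  exists k. destruct (gd_bd _ (Te_iter k w Hw)) as (H & _). eapply Rlt_le_trans; [|exact H].
  rewrite height_iter by assumption. assert (Hs' : 0 < s) by lra. apply (proj2 (Rlt_div_r _ _ _ Hs')) in Hk.
  replace (ht w) with (ht w - Z.of_nat k + Z.of_nat k)%Z in Hk by lia. rewrite powerRZ_nat in Hk by lra.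
  assert (0 < r ^ k) by (apply pow_lt; lra). apply Rmult_lt_reg_l with (r ^ k); [assumption|]. lra.
Qed.

Lemma scale_ancestor s w : 0 < s -> Te w -> gd K d w <= s -> exists k, Lambda_s pi K d s (Nat.iter k pi w).
Proof.
  intros Hs Hw Hg. destruct (gd_unbounded w s Hw) as (n & Hn).
  destruct (least_nat (fun k => s < gd K d (Nat.iter k pi w)) n Hn) as (k & _ & Hk & Hl).
  destruct k as [|k]; [simpl in Hk; lra|]. exists k. split; [apply Te_iter; assumption|]. split; [|exact Hk].
  apply Rnot_lt_le. apply Hl. lia.
Qed.

(** * The refined tree *)

Lemma nexp_spec m : / 2 ^ nexp r m <= r ^ m < 2 * / 2 ^ nexp r m.
Proof.
  unfold nexp. apply epsilon_spec. assert (Hm : 0 < r ^ m) by (apply pow_lt; lra).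
  destruct (small_pow (/ 2) (r ^ m)) as (n & Hn); [lra|assumption|].
  destruct (least_nat (fun n => (/ 2) ^ n <= r ^ m) n ltac:(lra)) as (k & _ & Hk & Hl).
  exists k. rewrite <- pow_inv. split; [assumption|]. destruct k as [|k].
  - simpl. assert (r ^ m <= 1) by (apply pow_le1; lra). lra.
  - specialize (Hl k ltac:(lia)). simpl. lra.
Qed.

Lemma pow2_pos n : 0 < 2 ^ n.
Proof. apply pow_lt. lra. Qed.

Lemma pow2_lt_inv a b : 2 ^ a < 2 ^ b -> (a < b)%nat.
Proof. intros H. apply Nat.nle_gt. intros Hle. pose proof (Rle_pow 2 b a ltac:(lra) Hle). lra. Qed.

Lemma pow2_nat n : 2 ^ n = INR (2 ^ n).
Proof. rewrite pow_INR. reflexivity. Qed.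

(** Both [r^m * 2^(nexp m)] and its analogue at [m + n] lie in [[1, 2)]; the bounded quantity is
    their quotient. *)
Lemma nexp_gap m n : (nexp r m <= nexp r (m + n))%nat /\ 1 < 2 * (r ^ n * 2 ^ (nexp r (m + n) - nexp r m)) /\
  r ^ n * 2 ^ (nexp r (m + n) - nexp r m) < 2.
Proof.
  destruct (nexp_spec m) as (A1 & A2). destruct (nexp_spec (m + n)) as (B1 & B2). rewrite pow_add in *.
  set (a := nexp r m) in *. set (b := nexp r (m + n)) in *.
  assert (Hm : 0 < r ^ m) by (apply pow_lt; lra). assert (Hn : 0 < r ^ n) by (apply pow_lt; lra).
  assert (Hn1 : r ^ n <= 1) by (apply pow_le1; lra).
  pose proof (pow2_pos a) as Pa. pose proof (pow2_pos b) as Pb.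
  assert (Ha : 1 <= r ^ m * 2 ^ a < 2).
  { split; [apply Rmult_le_reg_r with (/ 2 ^ a)|apply Rmult_lt_reg_r with (/ 2 ^ a)]; try (apply Rinv_0_lt_compat; assumption);
    rewrite Rmult_assoc, Rinv_r by lra; lra. }
  assert (Hb : 1 <= r ^ m * r ^ n * 2 ^ b < 2).
  { split; [apply Rmult_le_reg_r with (/ 2 ^ b)|apply Rmult_lt_reg_r with (/ 2 ^ b)]; try (apply Rinv_0_lt_compat; assumption);
    rewrite Rmult_assoc, Rinv_r by lra; lra. }
  assert (Hab : (a <= b)%nat).
  { apply Nat.lt_succ_r. apply pow2_lt_inv. simpl. apply Rmult_lt_reg_l with (r ^ m); [assumption|].
    assert (0 < r ^ m * 2 ^ b) by (apply Rmult_lt_0_compat; assumption). nra. }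
  split; [assumption|]. set (D := 2 ^ (b - a)).
  assert (HD : 2 ^ b = 2 ^ a * D) by (unfold D; rewrite <- pow_add; f_equal; lia).
  rewrite HD in Hb. assert (0 < D) by apply pow2_pos.
  assert (0 < r ^ n * D) by (apply Rmult_lt_0_compat; assumption). nra.
Qed.

Lemma nexp_0 : nexp r 0 = 0%nat.
Proof.
  destruct (nexp_spec 0) as (H1 & H2). simpl in *. destruct (nexp r 0) as [|n]; [reflexivity|]. exfalso.
  pose proof (pow2_pos n). simpl in H2. rewrite Rinv_mult in H2. assert (1 <= 2 ^ n) by (apply pow_R1_Rle; lra).
  assert (/ 2 ^ n <= 1) by (rewrite <- Rinv_1; apply Rinv_le_contravar; lra). lra.
Qed.

Lemma nexp_pos m : (1 <= m)%nat -> (1 <= nexp r m)%nat.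
Proof.
  intros Hm. destruct (nexp r m) as [|n] eqn:E0; [|lia]. exfalso. destruct (nexp_spec m) as (H & _). rewrite E0 in H. simpl in H.
  assert (r ^ m < 1) by (destruct m; [lia|]; simpl; assert (r ^ m <= 1) by (apply pow_le1; lra);
    assert (0 < r ^ m) by (apply pow_lt; lra); nra). lra.
Qed.

(** The number of intervals of step [m + n] in one of step [m], of the order of [r^-n] by
    [gap_bounds]; step [0] is the whole cable, since [nexp r 0 = 0]. *)
Definition gap (m n : nat) : nat := 2 ^ (nexp r (m + n) - nexp r m).

Lemma gap_pos m n : (1 <= gap m n)%nat.
Proof. unfold gap. pose proof (Nat.pow_nonzero 2 (nexp r (m + n) - nexp r m)). lia. Qed.

Lemma pow2_gap m n : (2 ^ nexp r (m + n) = 2 ^ nexp r m * gap m n)%nat.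
Proof. unfold gap. rewrite <- Nat.pow_add_r. f_equal. pose proof (proj1 (nexp_gap m n)). lia. Qed.

Lemma gap_add m n n' : (gap m (n + n') = gap m n * gap (m + n) n')%nat.
Proof.
  unfold gap. rewrite <- Nat.pow_add_r. f_equal. rewrite Nat.add_assoc.
  pose proof (proj1 (nexp_gap m n)). pose proof (proj1 (nexp_gap (m + n) n')). lia.
Qed.

Lemma gap_bounds m n : 1 < 2 * (r ^ n * INR (gap m n)) /\ r ^ n * INR (gap m n) < 2.
Proof. unfold gap. rewrite <- pow2_nat. apply nexp_gap. Qed.

Lemma lpar_eq m k : (1 <= m)%nat -> lpar r m k = (k / gap (m - 1) 1)%nat.
Proof.
  intros Hm. unfold lpar. set (g := gap (m - 1) 1).
  assert (Eg : (2 ^ nexp r m = 2 ^ nexp r (m - 1) * g)%nat).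
  { replace m with (m - 1 + 1)%nat at 1 by lia. apply pow2_gap. }
  assert (ER : 2 ^ nexp r m = 2 ^ nexp r (m - 1) * INR g) by (rewrite !pow2_nat, Eg, mult_INR; reflexivity).
  pose proof (gap_pos (m - 1) 1) as Hg. fold g in Hg. assert (HgR : 1 <= INR g) by (apply (le_INR 1); assumption).
  pose proof (pow2_pos (nexp r (m - 1))) as HN.
  assert (Hchar : forall l, (INR l * / 2 ^ nexp r (m - 1) <= INR k * / 2 ^ nexp r m /\
     (INR k + 1) * / 2 ^ nexp r m <= (INR l + 1) * / 2 ^ nexp r (m - 1)) <-> l = (k / g)%nat).
  { intros l. rewrite ER, Rinv_mult. set (e := / 2 ^ nexp r (m - 1)). assert (He : 0 < e) by (apply Rinv_0_lt_compat; assumption).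
    assert (C1 : INR l * e <= INR k * (e * / INR g) <-> (l * g <= k)%nat).
    { split.
      - intros H. apply INR_le. rewrite mult_INR. apply Rmult_le_reg_l with (e * / INR g); [apply Rmult_lt_0_compat; [assumption|apply Rinv_0_lt_compat; lra]|].
        replace (e * / INR g * (INR l * INR g)) with (INR l * e) by (field; lra). lra.
      - intros H. apply le_INR in H. rewrite mult_INR in H. replace (INR l * e) with (e * / INR g * (INR l * INR g)) by (field; lra).
        replace (INR k * (e * / INR g)) with (e * / INR g * INR k) by ring.
        apply Rmult_le_compat_l; [apply Rlt_le, Rmult_lt_0_compat; [assumption|apply Rinv_0_lt_compat; lra]|assumption]. }
    assert (C2 : (INR k + 1) * (e * / INR g) <= (INR l + 1) * e <-> (k + 1 <= (l + 1) * g)%nat).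
    { split.
      - intros H. apply INR_le. rewrite mult_INR, !plus_INR. simpl (INR 1).
        apply Rmult_le_reg_l with (e * / INR g); [apply Rmult_lt_0_compat; [assumption|apply Rinv_0_lt_compat; lra]|].
        replace (e * / INR g * ((INR l + 1) * INR g)) with ((INR l + 1) * e) by (field; lra). lra.
      - intros H. apply le_INR in H. rewrite mult_INR, !plus_INR in H. simpl (INR 1) in H.
        replace ((INR l + 1) * e) with (e * / INR g * ((INR l + 1) * INR g)) by (field; lra).
        replace ((INR k + 1) * (e * / INR g)) with (e * / INR g * (INR k + 1)) by ring.
        apply Rmult_le_compat_l; [apply Rlt_le, Rmult_lt_0_compat; [assumption|apply Rinv_0_lt_compat; lra]|assumption]. }
    rewrite C1, C2. pose proof (Nat.div_mod_eq k g). pose proof (Nat.mod_upper_bound k g ltac:(lia)).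
    split; [intros (H1 & H2)|intros ->].
    - apply (Nat.div_unique k g l (k - g * l)); nia.
    - split; nia. }
  apply Hchar. apply epsilon_spec. exists (k / g)%nat. apply Hchar. reflexivity.
Qed.

Context (wp : T -> G).
Hypothesis Hwp : forall w, Le w -> K w (wp w).

Notation V := (RNode T).
Notation par := (rpi pi r).
Notation rv := (rvalid pi K r).
Notation rht := (rheight pi phi).
Notation lev := (level pi phi K r).
Notation KC := (Kc pi K r wp).
Notation w_ := (wm K wp).

Definition inc (u : V) (x : G) : Prop := KC u (CV x).
(** Contact anywhere in the cable system, possibly inside a cable. A node touches itself, whereas
    [Jh] excludes equal nodes; [within_Jh] reconciles the two. *)
Definition tch (u v : V) : Prop := exists p, KC u p /\ KC v p.

Lemma wm_spec w : Le w -> K w (w_ w) /\ w_ w <> wp w.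
Proof.
  intros Hw. unfold wm. apply epsilon_spec. destruct (Le_edge w Hw) as (a & b & Hab & H). pose proof (E_neq _ _ Hab).
  pose proof (Hwp w Hw) as Hp. apply H in Hp. destruct Hp as [-> | ->].
  - exists b. rewrite H. auto.
  - exists a. rewrite H. auto.
Qed.

Lemma K_Le w x : Le w -> (K w x <-> x = wp w \/ x = w_ w).
Proof.
  intros Hw. destruct (Le_edge w Hw) as (a & b & Hab & H). destruct (wm_spec w Hw) as (H1 & H2). pose proof (Hwp w Hw) as H3.
  rewrite H in *. intuition congruence.
Qed.

Lemma iter_RBase i w : Nat.iter i par (RBase w) = RBase (Nat.iter i pi w).
Proof. induction i as [|i IH]; [reflexivity|]. simpl. rewrite IH. reflexivity. Qed.

Lemma iter_RSub i w m k : (i < m)%nat -> Nat.iter i par (RSub w m k) = RSub w (m - i) (k / gap (m - i) i).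
Proof.
  induction i as [|i IH]; intros Hi.
  - simpl. rewrite Nat.sub_0_r. f_equal. unfold gap. rewrite Nat.add_0_r, Nat.sub_diag. simpl. symmetry. apply Nat.div_1_r.
  - simpl. rewrite IH by lia. simpl. destruct (Nat.leb_spec (m - i) 1); [lia|]. f_equal; [lia|].
    rewrite lpar_eq by lia. rewrite Nat.Div0.div_div. f_equal. replace (S i) with (1 + i)%nat by lia. rewrite gap_add.
    replace (m - i - 1)%nat with (m - S i)%nat by lia. replace (m - S i + 1)%nat with (m - i)%nat by lia.
    replace (m - (1 + i))%nat with (m - S i)%nat by lia. replace (m - S i + 1)%nat with (m - i)%nat by lia. lia.
Qed.

Lemma iter_RSub_base i w m k : (1 <= m <= i)%nat -> Nat.iter i par (RSub w m k) = RBase (Nat.iter (i - m) pi w).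
Proof.
  intros Hi. transitivity (Nat.iter ((i - m) + S (m - 1)) par (RSub w m k)); [f_equal; lia|]. rewrite Nat.iter_add.
  change (Nat.iter (S (m - 1)) par (RSub w m k)) with (par (Nat.iter (m - 1) par (RSub w m k))).
  rewrite iter_RSub by lia. replace (m - (m - 1))%nat with 1%nat by lia. simpl. apply iter_RBase.
Qed.

Lemma rv_par u : rv u -> rv (par u).
Proof.
  destruct u as [w|w m k]; simpl; [apply Te_pi|]. intros (Hw & Hm & Hk). destruct (Nat.leb_spec m 1); simpl; [apply Le_Te; assumption|].
  split; [assumption|]. split; [lia|]. rewrite lpar_eq by lia. apply Nat.Div0.div_lt_upper_bound.
  rewrite Nat.mul_comm, <- pow2_gap. replace (m - 1 + 1)%nat with m by lia. assumption.
Qed.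

Lemma lev_par m u : lev (m + 1)%Z u -> lev m (par u).
Proof.
  intros (Hu & Hm). split; [apply rv_par; assumption|]. destruct u as [w|w i k]; simpl in *.
  - rewrite height_pi by assumption. lia.
  - destruct Hu as (_ & Hi & _). destruct (Nat.leb_spec i 1); simpl; lia.
Qed.

Lemma seg_CV_RSub w m k x : rv (RSub w m k) -> (inc (RSub w m k) x <-> (x = wp w /\ k = 0%nat) \/ (x = w_ w /\ S k = 2 ^ nexp r m)%nat).
Proof.
  intros (_ & _ & Hk). unfold inc. simpl. pose proof (pow2_pos (nexp r m)) as H2.
  assert (Hi : 0 < / 2 ^ nexp r m) by (apply Rinv_0_lt_compat; assumption).
  assert (H0 : INR k * / 2 ^ nexp r m = 0 <-> k = 0%nat).
  { split; [|intros ->; simpl; ring]. intros H. apply INR_eq. simpl. apply Rmult_integral in H. destruct H; lra. }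
  assert (H1 : (INR k + 1) * / 2 ^ nexp r m = 1 <-> S k = (2 ^ nexp r m)%nat).
  { rewrite pow2_nat. assert (HN : INR (2 ^ nexp r m) <> 0) by (rewrite <- pow2_nat; lra). split.
    - intros H. apply INR_eq. rewrite S_INR. apply Rmult_eq_reg_r with (/ INR (2 ^ nexp r m)); [|apply Rinv_neq_0_compat; assumption].
      rewrite H, Rinv_r by assumption. reflexivity.
    - intros H. rewrite <- S_INR, H. apply Rinv_r. assumption. }
  rewrite H0, H1. tauto.
Qed.

Lemma inc_RBase v x : Te v -> (inc (RBase v) x <-> K v x).
Proof.
  intros Hv. unfold inc. simpl. split.
  - intros (u & Hu & (n & <-) & [(-> & _)|(-> & _)]); apply K_iter; apply K_Le; auto.
  - intros Hx. destruct (Le_below v x Hv Hx) as (u & n & Hu & Hux & En). exists u. split; [assumption|]. split; [exists n; assumption|].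
    apply K_Le in Hux; [|assumption]. destruct Hux as [-> | ->]; auto.
Qed.

Lemma inc_K w i k x : rv (RSub w i k) -> inc (RSub w i k) x -> K w x.
Proof. intros Hv H. pose proof Hv as (Hw & _). apply seg_CV_RSub in H; [|assumption]. apply K_Le; tauto. Qed.

(** An interior point of a cable determines its edge, and minimality determines the node of
    [Lambda_e] from the edge. *)
Lemma cable_inj w w' x y t s1 s2 s1' s2' : Le w -> Le w' -> seg (wp w) (w_ w) s1 s2 (CE x y t) -> seg (wp w') (w_ w') s1' s2' (CE x y t) -> w = w'.
Proof.
  intros Hw Hw' (_ & H1) (_ & H2). destruct (wm_spec w Hw) as (A1 & A2). destruct (wm_spec w' Hw') as (B1 & B2).
  pose proof (Hwp w Hw). pose proof (Hwp w' Hw').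
  apply (Le_inj w w' (wp w) (w_ w)); auto; destruct H1 as [(E1 & E2 & _)|(E1 & E2 & _)], H2 as [(E3 & E4 & _)|(E3 & E4 & _)]; congruence.
Qed.

(** A common interior point fixes the cable. A base node containing the cable of [w] has height at
    most [ht w], while the intervals of that cable are strictly lower in the tree, so a mixed pair
    meets in a vertex; two base nodes with a common cable share its ends. *)
Lemma tch_cases m u v : lev m u -> lev m v -> tch u v ->
  (exists x, inc u x /\ inc v x) \/ (exists w i k k', u = RSub w i k /\ v = RSub w i k' /\ (k <= S k' /\ k' <= S k)%nat).
Proof.
  intros (Hu & Hum) (Hv & Hvm) ([x|x y t] & H1 & H2); [left; exists x; auto|].
  destruct u as [u|w i k], v as [v|w' i' k']; simpl in *.
  - destruct H1 as (a & Ha & Hsa & S1). destruct H2 as (b & Hb & Hsb & S2). assert (a = b) by (eapply cable_inj; eassumption). subst b.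
    left. exists (wp a). destruct Hsa as (n & <-). destruct Hsb as (n' & <-).
    split; apply inc_RBase; auto; apply K_iter; apply Hwp; assumption.
  - exfalso. destruct H1 as (a & Ha & (n & <-) & S1). destruct Hv as (Hw' & Hi' & _). assert (a = w') by (eapply cable_inj; eassumption). subst a.
    rewrite height_iter in Hum by assumption. lia.
  - exfalso. destruct H2 as (a & Ha & (n & <-) & S2). destruct Hu as (Hw & Hi & _). assert (w = a) by (eapply cable_inj; eassumption). subst a.
    rewrite height_iter in Hvm by assumption. lia.
  - destruct Hu as (Hw & Hi & Hk). destruct Hv as (Hw' & Hi' & Hk'). assert (w = w') by (eapply cable_inj; eassumption). subst w'.
    assert (i = i') by lia. subst i'. right. exists w, i, k, k'. split; [reflexivity|]. split; [reflexivity|].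
    destruct (wm_spec w Hw) as (_ & Hne). destruct H1 as (_ & H1). destruct H2 as (_ & H2).
    pose proof (pow2_pos (nexp r i)) as Hp. assert (Hi2 : 0 < / 2 ^ nexp r i) by (apply Rinv_0_lt_compat; assumption).
    assert (Ht : exists s, INR k * / 2 ^ nexp r i <= s <= (INR k + 1) * / 2 ^ nexp r i /\ INR k' * / 2 ^ nexp r i <= s <= (INR k' + 1) * / 2 ^ nexp r i).
    { destruct H1 as [(E1 & E2 & S1)|(E1 & E2 & S1)], H2 as [(E3 & E4 & S2)|(E3 & E4 & S2)]; try (exfalso; congruence).
      - exists t. split; assumption. - exists (1 - t). split; assumption. }
    destruct Ht as (s & (L1 & L2) & (L3 & L4)).
    split; apply INR_le; rewrite S_INR; apply Rmult_le_reg_r with (/ 2 ^ nexp r i); try assumption; lra.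
Qed.

Lemma tch_RSub w i k k' : rv (RSub w i k) -> rv (RSub w i k') -> (k <= S k' /\ k' <= S k)%nat -> tch (RSub w i k) (RSub w i k').
Proof.
  assert (Hgen : forall k k', rv (RSub w i k) -> rv (RSub w i k') -> (k' = k \/ k' = S k)%nat -> tch (RSub w i k) (RSub w i k')).
  { clear k k'. intros k k' (Hw & Hi & Hk) (_ & _ & Hk') Hkk. pose proof (pow2_pos (nexp r i)) as Hp.
    assert (Hi2 : 0 < / 2 ^ nexp r i) by (apply Rinv_0_lt_compat; assumption). pose proof (pos_INR k) as Hk0.
    pose proof (le_INR _ _ (proj1 (Nat.le_succ_l _ _) Hk)) as HkR. rewrite S_INR, <- pow2_nat in HkR.
    assert (Hone : forall s, s < 2 ^ nexp r i -> s * / 2 ^ nexp r i < 1).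
    { intros s Hs. apply Rmult_lt_reg_r with (2 ^ nexp r i); [assumption|]. rewrite Rmult_assoc, Rinv_l by lra. lra. }
    destruct Hkk as [-> | ->].
    - exists (CE (wp w) (w_ w) ((INR k + / 2) * / 2 ^ nexp r i)). assert (HH : KC (RSub w i k) (CE (wp w) (w_ w) ((INR k + / 2) * / 2 ^ nexp r i))); [|auto].
      simpl. split; [split; [apply Rmult_lt_0_compat; lra|apply Hone; lra]|]. left. repeat split; apply Rmult_le_compat_r; lra.
    - pose proof (le_INR _ _ (proj1 (Nat.le_succ_l _ _) Hk')) as HkR'. rewrite !S_INR, <- pow2_nat in HkR'.
      exists (CE (wp w) (w_ w) ((INR k + 1) * / 2 ^ nexp r i)). split; cbn [Kc seg].
      + split; [split; [apply Rmult_lt_0_compat; lra|apply Hone; lra]|]. left. repeat split; apply Rmult_le_compat_r; lra.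
      + split; [split; [apply Rmult_lt_0_compat; lra|apply Hone; lra]|]. left. rewrite S_INR. repeat split; apply Rmult_le_compat_r; lra. }
  intros H1 H2 Hkk. assert ((k' = k \/ k' = S k) \/ k = S k')%nat as [H|H] by lia; [apply Hgen; assumption|].
  destruct (Hgen k' k H2 H1) as (p & P1 & P2); [auto|]. exists p. auto.
Qed.

Lemma KC_par u p : rv u -> KC u p -> KC (par u) p.
Proof.
  destruct u as [w|w m k]; intros Hu.
  - simpl. intros (a & Ha & (n & <-) & H). exists a. split; [assumption|]. split; [exists (S n); reflexivity|assumption].
  - pose proof Hu as (Hw & Hm & Hk). pose proof (pow2_pos (nexp r m)) as Hp.
    assert (Hi2 : 0 < / 2 ^ nexp r m) by (apply Rinv_0_lt_compat; assumption).
    assert (Hmono : forall s1 s2 s1' s2', s1' <= s1 -> s2 <= s2' -> 0 <= s1' -> s2' <= 1 -> seg (wp w) (w_ w) s1 s2 p -> seg (wp w) (w_ w) s1' s2' p).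
    { intros s1 s2 s1' s2' A1 A2 A3 A4. assert (forall x, x = 0 -> s1 = x -> s1' = 0) by (intros; lra). destruct p as [x|x y t]; simpl.
      - intros [(-> & E0)|(-> & E0)]; [left|right]; split; try reflexivity; lra.
      - intros (A5 & [(-> & -> & A6)|(-> & -> & A6)]); (split; [assumption|]); [left|right]; repeat split; lra. }
    pose proof (pos_INR k) as Hk0. pose proof (le_INR _ _ (proj1 (Nat.le_succ_l _ _) Hk)) as HkR. rewrite S_INR, <- pow2_nat in HkR.
    assert (H01 : 0 <= INR k * / 2 ^ nexp r m /\ (INR k + 1) * / 2 ^ nexp r m <= 1).
    { split; [apply Rmult_le_pos; lra|]. apply Rmult_le_reg_r with (2 ^ nexp r m); [assumption|]. rewrite Rmult_assoc, Rinv_l by lra. lra. }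
    cbn [Kc]. intros H. cbn [rpi]. destruct (Nat.leb_spec m 1).
    + exists w. split; [assumption|]. split; [exists 0%nat; reflexivity|]. revert H. apply Hmono; lra.
    + cbn [Kc]. assert (Hl : INR (lpar r m k) * / 2 ^ nexp r (m - 1) <= INR k * / 2 ^ nexp r m /\
        (INR k + 1) * / 2 ^ nexp r m <= (INR (lpar r m k) + 1) * / 2 ^ nexp r (m - 1)).
      { assert (Hex : exists l, INR l * / 2 ^ nexp r (m - 1) <= INR k * / 2 ^ nexp r m /\
          (INR k + 1) * / 2 ^ nexp r m <= (INR l + 1) * / 2 ^ nexp r (m - 1)); [|exact (epsilon_spec (inhabits 0%nat) _ Hex)].
        set (g := gap (m - 1) 1). exists (k / g)%nat.
        assert (Eg : (2 ^ nexp r m = 2 ^ nexp r (m - 1) * g)%nat).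
        { replace m with (m - 1 + 1)%nat at 1 by lia. apply pow2_gap. }
        assert (ER : 2 ^ nexp r m = 2 ^ nexp r (m - 1) * INR g) by (rewrite !pow2_nat, Eg, mult_INR; reflexivity).
        pose proof (gap_pos (m - 1) 1) as Hg. fold g in Hg. assert (HgR : 1 <= INR g) by (apply (le_INR 1); assumption).
        pose proof (pow2_pos (nexp r (m - 1))) as HN.
        pose proof (Nat.div_mod_eq k g). pose proof (Nat.mod_upper_bound k g ltac:(lia)).
        assert (N1 : (k / g * g <= k)%nat) by nia. assert (N2' : (k + 1 <= (k / g + 1) * g)%nat) by nia.
        apply le_INR in N1. apply le_INR in N2'. rewrite mult_INR in N1. rewrite mult_INR, !plus_INR in N2'. simpl (INR 1) in N2'.
        rewrite ER, Rinv_mult. set (e := / 2 ^ nexp r (m - 1)). assert (He : 0 < e) by (apply Rinv_0_lt_compat; assumption).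
        assert (Heg : 0 < e * / INR g) by (apply Rmult_lt_0_compat; [assumption|apply Rinv_0_lt_compat; lra]).
        split.
        - replace (INR (k / g) * e) with (e * / INR g * (INR (k / g) * INR g)) by (field; lra). rewrite (Rmult_comm (INR k)).
          apply Rmult_le_compat_l; lra.
        - replace ((INR (k / g) + 1) * e) with (e * / INR g * ((INR (k / g) + 1) * INR g)) by (field; lra). rewrite (Rmult_comm (INR k + 1)).
          apply Rmult_le_compat_l; lra. }
      revert H. pose proof (rv_par _ Hu) as Hv. cbn [rpi] in Hv. destruct (Nat.leb_spec m 1); [lia|]. destruct Hv as (_ & _ & Hlv).
      pose proof (le_INR _ _ (proj1 (Nat.le_succ_l _ _) Hlv)) as HlR. rewrite S_INR, <- pow2_nat in HlR.
      pose proof (pow2_pos (nexp r (m - 1))) as HN. assert (0 < / 2 ^ nexp r (m - 1)) by (apply Rinv_0_lt_compat; assumption).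
      apply Hmono; try lra.
      * apply Rmult_le_pos; [apply pos_INR|lra].
      * apply Rmult_le_reg_r with (2 ^ nexp r (m - 1)); [assumption|]. rewrite Rmult_assoc, Rinv_l by lra. lra.
Qed.

Lemma lev_inj j j' u : lev j u -> lev j' u -> j = j'.
Proof. intros (_ & <-) (_ & <-). reflexivity. Qed.

Lemma tch_sym u v : tch u v -> tch v u.
Proof. intros (p & H1 & H2). exists p. auto. Qed.

Lemma tch_refl m u : lev m u -> tch u u.
Proof.
  intros (Hu & _). destruct u as [w|w i k].
  - destruct (Te_nonempty w Hu) as (x & Hx). exists (CV x). assert (inc (RBase w) x) by (apply inc_RBase; assumption). split; assumption.
  - apply tch_RSub; [assumption|assumption|lia].
Qed.

Lemma tch_par m u v : adj (lev (m + 1)%Z) tch u v -> tch (par u) (par v).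
Proof. intros ((Hu & _) & (Hv & _) & p & H1 & H2). exists p. split; apply KC_par; assumption. Qed.

Lemma inc_par m u x : lev (m + 1)%Z u -> inc u x -> inc (par u) x.
Proof. intros (Hu & _) H. apply KC_par; assumption. Qed.

Lemma inc_tch u v x : inc u x -> inc v x -> tch u v.
Proof. intros H1 H2. exists (CV x). auto. Qed.

Lemma inc_fin m u : lev m u -> exists l, forall x, inc u x -> In x l.
Proof.
  intros (Hu & _). destruct u as [w|w i k].
  - destruct (proj1 part w) as (l & Hl). exists l. intros x Hx. apply Hl. apply inc_RBase; assumption.
  - exists [wp w; w_ w]. intros x Hx. apply seg_CV_RSub in Hx; [|assumption]. simpl. intuition.
Qed.

Lemma cable_end w x i : Le w -> K w x -> (1 <= i)%nat -> exists k, rv (RSub w i k) /\ inc (RSub w i k) x.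
Proof.
  intros Hw Hx Hi. pose proof (Nat.pow_nonzero 2 (nexp r i) ltac:(lia)) as Hp. apply K_Le in Hx; [|assumption]. destruct Hx as [-> | ->].
  - exists 0%nat. assert (rv (RSub w i 0)) by (split; [assumption|split; lia]). split; [assumption|]. apply seg_CV_RSub; auto.
  - exists (2 ^ nexp r i - 1)%nat. assert (rv (RSub w i (2 ^ nexp r i - 1))) by (split; [assumption|split; lia]). split; [assumption|].
    apply seg_CV_RSub; [assumption|]. right. split; [reflexivity|lia].
Qed.

Lemma edge_level m w x : Le w -> K w x -> exists u, lev m u /\ inc u x /\
  (((m <= ht w)%Z /\ exists n, u = RBase (Nat.iter n pi w)) \/ ((ht w < m)%Z /\ exists k, u = RSub w (Z.to_nat (m - ht w)) k)).
Proof.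
  intros Hw Hx. destruct (Z_le_dec m (ht w)) as [Hm|Hm].
  - set (n := Z.to_nat (ht w - m)). exists (RBase (Nat.iter n pi w)).
    assert (HT : Te (Nat.iter n pi w)) by (apply Te_iter, Le_Te; assumption). split; [|split].
    + split; [exact HT|]. simpl. rewrite height_iter by assumption. unfold n. lia.
    + apply inc_RBase; [assumption|]. apply K_iter. assumption.
    + left. split; [assumption|]. exists n. reflexivity.
  - destruct (cable_end w x (Z.to_nat (m - ht w)) Hw Hx ltac:(lia)) as (k & H1 & H2).
    exists (RSub w (Z.to_nat (m - ht w)) k). split; [split; [assumption|simpl; lia]|]. split; [assumption|]. right. split; [lia|]. eauto.
Qed.

Lemma cover m x : exists u, lev m u /\ inc u x.
Proof.
  destruct (edge_node x (nbr x) (nbr_E x)) as (w & Hw & HK). destruct (edge_level m w x Hw) as (u & H1 & H2 & _); [apply HK; auto|]. eauto.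
Qed.

(** * Neighbours and distances in the refined tree *)

Context (Bc Cu Ma Dg : nat) (a1 : R).
Hypothesis ch_bd : forall w, Te w -> ~ Le w -> card_le (fun v => pi v = w) Bc.
Hypothesis uf : forall s w, 0 < s -> Lambda_s pi K d s w -> card_le (Lambda_sM pi K d s 1 w) Cu.
Hypothesis a1_pos : 0 < a1.
Hypothesis adp : forall x s y, 0 < s -> ball d x (a1 * s) y -> U_M pi K d Ma x s y.
Hypothesis deg : forall x, card_le (E x) Dg.

(** Nodes of [Lambda_e] are leaves of [T_e]; elsewhere there are at most [Bc] children. The
    successor keeps the powers at least [1]. *)
Lemma desc_list n : forall w, Te w -> exists l, (length l <= S Bc ^ n)%nat /\ forall v, Te v -> Nat.iter n pi v = w -> In v l.
Proof.
  induction n as [|n IH]; intros w Hw.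
  - exists [w]. split; [simpl; lia|]. intros v _ <-. left. reflexivity.
  - destruct (classic (Le w)) as [HL|HL].
    { exists []. split; [simpl; lia|]. intros v Hv Ev. exfalso. eapply Le_leaf; eassumption. }
    destruct (card_le_list _ _ (ch_bd w Hw HL)) as (l & _ & Hl & Hc).
    destruct (choice (fun c lc => Te c -> (length lc <= S Bc ^ n)%nat /\ forall v, Te v -> Nat.iter n pi v = c -> In v lc)) as (g & Hg).
    { intros c. destruct (classic (Te c)) as [Ht|Ht]; [|exists []; tauto]. destruct (IH c Ht) as (lc & H). exists lc. auto. }
    pose proof (length_keep Te l) as Hll. exists (flat_map g (keep Te l)). split.
    + eapply Nat.le_trans; [apply (length_flat_map_le _ _ (S Bc ^ n))|simpl; nia]. intros c Hc'. apply In_keep in Hc'. apply Hg; tauto.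
    + intros v Hv Ev. simpl in Ev. apply in_flat_map. exists (Nat.iter n pi v). pose proof (Te_iter n v Hv) as Ht. split.
      * apply In_keep. split; [apply Hc; assumption|assumption].
      * apply Hg; auto.
Qed.

(** Uniform finiteness counts pieces of equal scale, not of equal height. For [s] the largest
    diameter allowed at the height of [v], the ancestors of [v] and [v'] in [Lambda_s] share [x],
    and that of [v'] is fewer than [k0] generations up; so [v'] is among the descendants of
    boundedly many nodes. *)
Lemma base_nb : exists D0, forall v, Te v -> exists l, (length l <= D0)%nat /\
  forall v' x, Te v' -> ht v' = ht v -> K v x -> K v' x -> In v' l.
Proof.
  destruct (small_pow r (/ (Cg * Cg)) r_bd) as (k0 & Hk0); [apply Rinv_0_lt_compat; nra|].
  exists (Cu * S Bc ^ k0)%nat. intros v Hv. set (s := Cg * powerRZ r (ht v)). pose proof (rpow_pos (ht v)) as Hp.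
  assert (Hs : 0 < s) by (unfold s; nra).
  destruct (scale_ancestor s v Hs Hv) as (k & Hk); [apply gd_bd; assumption|].
  destruct (card_le_list _ _ (uf s _ Hs Hk)) as (la & _ & Hla & Hin).
  destruct (choice (fun a l => Te a -> (ht v - Z.of_nat k0 <= ht a)%Z -> (length l <= S Bc ^ k0)%nat /\
    forall v', Te v' -> Nat.iter (Z.to_nat (ht v - ht a)) pi v' = a -> In v' l)) as (g & Hg).
  { intros a. destruct (classic (Te a /\ (ht v - Z.of_nat k0 <= ht a)%Z)) as [(Ha & Hh)|Ha]; [|exists []; tauto].
    destruct (desc_list (Z.to_nat (ht v - ht a)) a Ha) as (l & H1 & H2). exists l. intros _ _. split; [|assumption].
    eapply Nat.le_trans; [exact H1|]. apply Nat.pow_le_mono_r; lia. }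
  set (la' := keep (fun a => Te a /\ (ht v - Z.of_nat k0 <= ht a)%Z) la).
  assert (Hla' : forall a, In a la' <-> In a la /\ Te a /\ (ht v - Z.of_nat k0 <= ht a)%Z) by (intros; exact (In_keep _ _ _)).
  assert (Hll : (length la' <= length la)%nat) by apply length_keep.
  exists (flat_map g la'). split.
  - eapply Nat.le_trans; [apply (length_flat_map_le _ _ (S Bc ^ k0))|apply Nat.mul_le_mono_r; lia].
    intros a Ha. apply Hla' in Ha. apply Hg; tauto.
  - intros v' x Hv' Eh Hx Hx'.
    destruct (scale_ancestor s v' Hs Hv') as (k' & Hk'); [unfold s; rewrite <- Eh; apply gd_bd; assumption|].
    assert (Hkk : (k' < k0)%nat).
    { apply Nat.nle_gt. intros Hle. destruct Hk' as (Ht & Hg1 & _). destruct (gd_bd _ Ht) as (Hlow & _).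
      rewrite height_iter in Hlow by assumption. rewrite Eh in Hlow. unfold s in Hg1.
      replace (ht v) with (ht v - Z.of_nat k' + Z.of_nat k')%Z in Hg1 at 1 by lia. rewrite powerRZ_nat in Hg1 by lra.
      set (X := powerRZ r (ht v - Z.of_nat k')) in *. pose proof (rpow_pos (ht v - Z.of_nat k')) as HX. fold X in HX.
      assert (Hrk : r ^ k' <= r ^ k0).
      { replace k' with (k0 + (k' - k0))%nat by lia. rewrite pow_add. assert (r ^ (k' - k0) <= 1) by (apply pow_le1; lra).
        assert (0 < r ^ k0) by (apply pow_lt; lra). nra. }
      assert (Hc : / Cg <= Cg * r ^ k').
      { apply Rmult_le_reg_r with X; [assumption|]. lra. }
      assert (Cg * r ^ k' < Cg * / (Cg * Cg)) by (apply Rmult_lt_compat_l; lra).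
      rewrite Rinv_mult in H. replace (Cg * (/ Cg * / Cg)) with (/ Cg) in H by (field; lra). lra. }
    assert (Ea : ht (Nat.iter k' pi v') = (ht v - Z.of_nat k')%Z) by (rewrite height_iter by assumption; lia).
    apply in_flat_map. exists (Nat.iter k' pi v'). pose proof (Te_iter k' v' Hv') as Ht. split.
    + apply Hla'. split; [|split; [assumption|lia]]. apply Hin. split; [assumption|].
      destruct (classic (Nat.iter k pi v = Nat.iter k' pi v')) as [->|Hne]; [apply within_refl|].
      apply within_step. split; [assumption|]. split; [assumption|]. split; [assumption|]. exists x. split; apply K_iter; assumption.
    + apply Hg; [assumption|lia|assumption|]. replace (Z.to_nat (ht v - ht (Nat.iter k' pi v'))) with k' by lia. reflexivity.
Qed.

Definition ends (w : T) (i : nat) : list V := [RSub w i 0; RSub w i (2 ^ nexp r i - 1)].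

Lemma ends_in w i k x : rv (RSub w i k) -> inc (RSub w i k) x -> In (RSub w i k) (ends w i).
Proof.
  intros Hv Hx. apply seg_CV_RSub in Hx; [|assumption]. unfold ends. destruct Hx as [(_ & ->)|(_ & Hk)]; [left; reflexivity|].
  right. left. f_equal. lia.
Qed.

Lemma vertex_nodes : exists D1, forall m x, exists l, (length l <= D1)%nat /\ forall u, lev m u -> inc u x -> In u l.
Proof.
  destruct base_nb as (D0 & HD0). exists (D0 + Dg * 2)%nat. intros m x.
  assert (Hbase : exists l, (length l <= D0)%nat /\ forall v, Te v -> ht v = m -> K v x -> In (RBase v) l).
  { destruct (classic (exists v, Te v /\ ht v = m /\ K v x)) as [(v & Hv & <- & Hx)|Hno].
    - destruct (HD0 v Hv) as (l & Hl & H). exists (map RBase l). split; [rewrite length_map; assumption|].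
      intros v' Hv' Eh Hx'. apply in_map. eapply H; eassumption.
    - exists []. split; [simpl; lia|]. intros v Hv Eh Hx. apply Hno. eauto. }
  destruct Hbase as (lb & Hlb & Hb). destruct (card_le_list _ _ (deg x)) as (le & _ & Hle & He).
  destruct (choice (fun y w => E x y -> Le w /\ forall z, K w z <-> z = x \/ z = y)) as (en & Hen).
  { intros y. destruct (classic (E x y)) as [H|H]; [|destruct (edge_node x (nbr x) (nbr_E x)) as (w & _); exists w; tauto].
    destruct (edge_node x y H) as (w & Hw). exists w. auto. }
  exists (lb ++ flat_map (fun y => ends (en y) (Z.to_nat (m - ht (en y)))) le). split.
  - rewrite length_app. pose proof (length_flat_map_le (fun y => ends (en y) (Z.to_nat (m - ht (en y)))) le 2) as H.
    assert (length (flat_map (fun y => ends (en y) (Z.to_nat (m - ht (en y)))) le) <= length le * 2)%nat by (apply H; intros; simpl; lia). nia.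
  - intros u (Hu & Hm) Hx. apply in_or_app. destruct u as [v|w i k].
    + left. apply Hb; [exact Hu|exact Hm|]. apply inc_RBase; assumption.
    + right. pose proof Hu as (Hw & Hi & _). pose proof (inc_K _ _ _ _ Hu Hx) as HKx. simpl in Hm.
      destruct (Le_edge w Hw) as (a & b & Hab & HK).
      assert (Hy : exists y, E x y /\ K w y).
      { apply HK in HKx. destruct HKx as [-> | ->]; [exists b|exists a]; split; try (apply HK; auto); auto. apply (proj1 E_simple); assumption. }
      destruct Hy as (y & Hy & Hwy). destruct (Hen y Hy) as (Hw' & HK').
      assert (en y = w).
      { apply (Le_inj (en y) w x y); auto using E_neq; apply HK'; auto. }
      apply in_flat_map. exists y. split; [apply He; assumption|]. rewrite H. replace (Z.to_nat (m - ht w)) with i by lia.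
      eapply ends_in; eassumption.
Qed.

(** The terms of the constant: three intervals of the same cable, the nodes at its two ends, the
    base neighbours, and the end intervals of cables touching a base node. By [edge_height] the
    latter have been subdivided for fewer than [c0] levels. *)
Lemma node_nb : exists D, (1 <= D)%nat /\ forall u, exists l, NoDup l /\ forall m, lev m u -> (length l <= D)%nat /\
  forall v, In v l <-> lev m v /\ tch u v.
Proof.
  destruct base_nb as (D0 & HD0). destruct vertex_nodes as (D1 & HD1).
  destruct (small_pow r (/ (Cg * Cg * (CF * CF))) r_bd) as (c0 & Hc0); [apply Rinv_0_lt_compat; repeat apply Rmult_lt_0_compat; lra|].
  assert (Hc0' : r ^ c0 * (Cg * Cg * (CF * CF)) < 1).
  { assert (HX : 0 < Cg * Cg * (CF * CF)) by (repeat apply Rmult_lt_0_compat; lra).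
    apply Rmult_lt_compat_r with (r := Cg * Cg * (CF * CF)) in Hc0; [|assumption]. rewrite Rinv_l in Hc0 by lra. assumption. }
  exists (3 + 2 * D1 + D0 + c0 * (D0 * 2))%nat. split; [lia|]. intros u.
  assert (Hcov : forall m, lev m u -> exists l, (length l <= 3 + 2 * D1 + D0 + c0 * (D0 * 2))%nat /\ forall v, lev m v -> tch u v -> In v l).
  { intros m Hu. destruct u as [v|w i k].
    - pose proof Hu as (HTv & Hvm). simpl in HTv, Hvm.
      destruct (choice (fun a l => Te a -> (length l <= D0)%nat /\ forall v' x, Te v' -> ht v' = ht a -> K a x -> K v' x -> In v' l)) as (bn & Hbn).
      { intros a. destruct (classic (Te a)) as [Ha|Ha]; [|exists []; tauto]. destruct (HD0 a Ha) as (l & H). exists l. auto. }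
      exists (map RBase (bn v) ++ flat_map (fun i => flat_map (fun w => ends w i) (bn (Nat.iter i pi v))) (seq 1 c0)). split.
      + rewrite length_app, length_map. pose proof (proj1 (Hbn v HTv)).
        assert (length (flat_map (fun i => flat_map (fun w => ends w i) (bn (Nat.iter i pi v))) (seq 1 c0)) <= c0 * (D0 * 2))%nat; [|lia].
        eapply Nat.le_trans; [apply (length_flat_map_le _ _ (D0 * 2))|rewrite length_seq; lia].
        intros i _. eapply Nat.le_trans; [apply (length_flat_map_le _ _ 2); intros; simpl; lia|].
        apply Nat.mul_le_mono_r. apply Hbn. apply Te_iter. assumption.
      + intros u' Hu' Ht. destruct (tch_cases m _ _ Hu Hu' Ht) as [(x & Hx & Hx')|(w & i & k & k' & E1 & _)]; [|discriminate].
        apply inc_RBase in Hx; [|assumption]. destruct Hu' as (Hv' & Hm'). apply in_or_app. destruct u' as [v'|w i k].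
        * left. apply in_map. apply (proj2 (Hbn v HTv) v' x); [exact Hv'|simpl in Hm'; lia|assumption|]. apply inc_RBase; assumption.
        * right. pose proof Hv' as (Hw & Hi & _). pose proof (inc_K _ _ _ _ Hv' Hx') as HKx. simpl in Hm'.
          pose proof (edge_height c0 w v x Hc0' Hw HTv HKx Hx) as Hh.
          apply in_flat_map. exists i. split; [apply in_seq; lia|]. apply in_flat_map. exists w. split; [|eapply ends_in; eassumption].
          apply (proj2 (Hbn (Nat.iter i pi v) (Te_iter i v HTv)) w x); [apply Le_Te; assumption| |apply K_iter; assumption|assumption].
          rewrite height_iter by assumption. lia.
    - pose proof Hu as (Hv & _). destruct (HD1 m (wp w)) as (l1 & Hl1 & H1). destruct (HD1 m (w_ w)) as (l2 & Hl2 & H2).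
      exists ([RSub w i (k - 1); RSub w i k; RSub w i (S k)] ++ l1 ++ l2). split; [rewrite !length_app; simpl; lia|].
      intros u' Hu' Ht. destruct (tch_cases m _ _ Hu Hu' Ht) as [(x & Hx & Hx')|(w' & i' & k1 & k2 & E1 & -> & Hk)].
      + apply in_or_app. right. apply in_or_app. apply seg_CV_RSub in Hx; [|assumption]. destruct Hx as [(-> & _)|(-> & _)]; auto.
      + apply in_or_app. left. inversion E1; subst. simpl.
        assert (k2 = k1 - 1 \/ k2 = k1 \/ k2 = S k1)%nat as [-> |[-> | ->]] by lia; auto. }
  destruct (classic (exists m, lev m u)) as [(m & Hm)|Hno].
  - destruct (Hcov m Hm) as (l & Hl & Hin).
    exists (ndup (keep (fun v => lev m v /\ tch u v) l)).
    split; [apply NoDup_ndup|]. intros m' Hm'. rewrite <- (lev_inj _ _ _ Hm Hm'). split.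
    + eapply Nat.le_trans; [|exact Hl]. apply NoDup_incl_length; [apply NoDup_ndup|]. intros v Hv. apply In_ndup, In_keep in Hv. tauto.
    + intros v. rewrite In_ndup, In_keep. split; [tauto|]. intros H. split; [apply Hin; tauto|assumption].
  - exists []. split; [constructor|]. intros m Hm. exfalso. eauto.
Qed.

Lemma node_ch : exists B, (1 <= B)%nat /\ forall m u, lev m u -> exists l, (length l <= B)%nat /\
  forall v, lev (m + 1)%Z v -> par v = u -> In v l.
Proof.
  destruct (INR_unbounded (2 / r)) as (Nr & HNr).
  assert (Hgap : forall i, (gap i 1 <= Nr)%nat).
  { intros i. destruct (gap_bounds i 1) as (_ & H). rewrite pow_1 in H. apply INR_le. apply Rlt_le. eapply Rlt_trans; [|exact HNr].
    apply Rlt_div_r; lra. }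
  assert (E0 : (2 ^ nexp r 1 = gap 0 1)%nat).
  { pose proof (pow2_gap 0 1) as H. rewrite nexp_0 in H. simpl in H. rewrite Nat.add_0_r in H. exact H. }
  exists (1 + Bc + Nr)%nat. split; [lia|]. intros m u (Hu & Hm). destruct u as [w|w i k].
  - destruct (classic (Le w)) as [HL|HL].
    + exists (map (RSub w 1) (seq 0 (2 ^ nexp r 1))). split; [rewrite length_map, length_seq, E0; specialize (Hgap 0%nat); lia|].
      intros v (Hv & _) Ep. destruct v as [v|w' i' k']; simpl in Ep.
      * exfalso. inversion Ep as [Ep']. apply (Le_leaf w v 0); assumption.
      * destruct (Nat.leb_spec i' 1); [|discriminate]. inversion Ep; subst. destruct Hv as (_ & Hi & Hk).
        assert (i' = 1%nat) by lia. subst i'. apply in_map. apply in_seq. lia.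
    + destruct (card_le_list _ _ (ch_bd w Hu HL)) as (l & _ & Hl & Hc). exists (map RBase l). split; [rewrite length_map; lia|].
      intros v (Hv & _) Ep. destruct v as [v|w' i' k']; simpl in Ep.
      * inversion Ep as [Ep']. apply in_map. apply Hc. assumption.
      * destruct (Nat.leb_spec i' 1); [|discriminate]. inversion Ep; subst. exfalso. apply HL. apply Hv.
  - exists (map (RSub w (S i)) (seq (k * gap i 1) (gap i 1))). split; [rewrite length_map, length_seq; specialize (Hgap i); lia|].
    intros v (Hv & _) Ep. destruct v as [v|w' i' k']; simpl in Ep; [discriminate|].
    destruct (Nat.leb_spec i' 1); [discriminate|]. inversion Ep as [[E1 E2 E3]]. subst w'. assert (i' = S i) by (destruct Hu as (_ & Hi & _); lia). subst i'.
    rewrite lpar_eq by lia. replace (S i - 1)%nat with i by lia. apply in_map. apply in_seq.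
    pose proof (gap_pos i 1). pose proof (Nat.div_mod_eq k' (gap i 1)). pose proof (Nat.mod_upper_bound k' (gap i 1) ltac:(lia)). nia.
Qed.

Lemma node_lev_iter j n v : lev (j + Z.of_nat n)%Z v -> lev j (Nat.iter n par v).
Proof. apply iter_lev. exact lev_par. Qed.

Lemma node_adj_iter j n v v' : adj (lev (j + Z.of_nat n)%Z) tch v v' -> adj (lev j) tch (Nat.iter n par v) (Nat.iter n par v').
Proof. apply iter_touch; [exact lev_par|exact tch_par]. Qed.

Lemma node_inc_iter j n v x : lev (j + Z.of_nat n)%Z v -> inc v x -> inc (Nat.iter n par v) x.
Proof. apply (iter_vertex lev); [exact lev_par|exact inc_par]. Qed.

(* Functions on [G], extended affinely along cables. *)
Definition hat (h : G -> R) (p : CPt G) : R :=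
  match p with
  | CV x => h x
  | CE x y t => (1 - t) * h x + t * h y
  end.

Lemma hat_seg h a b s1 s2 p : a <> b -> 0 <= s1 -> s2 <= 1 -> seg a b s1 s2 p -> s1 <= s2 -> exists t, s1 <= t <= s2 /\ hat h p = h a + t * (h b - h a).
Proof.
  intros Hab H1 H2 Hp H12. destruct p as [x|x y t]; simpl in *.
  - destruct Hp as [(-> & ->)|(-> & ->)]; [exists 0|exists 1]; split; try lra; ring.
  - destruct Hp as (Ht & [(-> & -> & Hs)|(-> & -> & Hs)]); [exists t|exists (1 - t)]; split; try lra; ring.
Qed.

Lemma hat_osc (D : G -> G -> R) (h : G -> R) gw u p q : rv u -> (forall x y, Rabs (h x - h y) <= D x y) -> 0 <= gw ->
  match u with
  | RBase w => forall x y, K w x -> K w y -> D x y <= gw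
  | RSub w i k => D (w_ w) (wp w) * / 2 ^ nexp r i <= gw
  end ->
  KC u p -> KC u q -> Rabs (hat h p - hat h q) <= 2 * gw.
Proof.
  intros Hu Hh Hg Hd Hp Hq. destruct u as [w|w i k].
  - destruct (Te_nonempty w Hu) as (z & Hz).
    assert (Hone : forall p, KC (RBase w) p -> Rabs (hat h p - h z) <= gw).
    { intros p' (u & HL & (n & <-) & Hs). destruct (wm_spec u HL) as (W1 & W2).
      destruct (hat_seg h (wp u) (w_ u) 0 1 p' (not_eq_sym W2) ltac:(lra) ltac:(lra) Hs ltac:(lra)) as (t & Ht & ->).
      pose proof (Hh (wp u) z) as B1. pose proof (Hh (w_ u) z) as B2.
      pose proof (Hd (wp u) z (K_iter _ _ _ (Hwp u HL)) Hz). pose proof (Hd (w_ u) z (K_iter _ _ _ W1) Hz).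
      replace (h (wp u) + t * (h (w_ u) - h (wp u)) - h z) with ((1 - t) * (h (wp u) - h z) + t * (h (w_ u) - h z)) by ring.
      apply Rcomplements.Rabs_le_between in B1. apply Rcomplements.Rabs_le_between in B2. apply Rabs_le. nra. }
    pose proof (Hone p Hp) as B1. pose proof (Hone q Hq) as B2. apply Rcomplements.Rabs_le_between in B1. apply Rcomplements.Rabs_le_between in B2.
    apply Rabs_le. lra.
  - pose proof Hu as (HL & Hi & Hk). destruct (wm_spec w HL) as (W1 & W2). pose proof (pow2_pos (nexp r i)) as HN.
    assert (He : 0 < / 2 ^ nexp r i) by (apply Rinv_0_lt_compat; assumption). pose proof (pos_INR k) as Hk0.
    pose proof (le_INR _ _ (proj1 (Nat.le_succ_l _ _) Hk)) as HkR. rewrite S_INR, <- pow2_nat in HkR.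
    assert (H0 : 0 <= INR k * / 2 ^ nexp r i) by (apply Rmult_le_pos; lra).
    assert (H1 : (INR k + 1) * / 2 ^ nexp r i <= 1).
    { apply Rmult_le_reg_r with (2 ^ nexp r i); [assumption|]. rewrite Rmult_assoc, Rinv_l by lra. lra. }
    cbn [Kc] in Hp, Hq.
    destruct (hat_seg h _ _ _ _ p (not_eq_sym W2) H0 H1 Hp ltac:(apply Rmult_le_compat_r; lra)) as (t & Ht & ->).
    destruct (hat_seg h _ _ _ _ q (not_eq_sym W2) H0 H1 Hq ltac:(apply Rmult_le_compat_r; lra)) as (t' & Ht' & ->).
    replace (h (wp w) + t * (h (w_ w) - h (wp w)) - (h (wp w) + t' * (h (w_ w) - h (wp w)))) with ((t - t') * (h (w_ w) - h (wp w))) by ring.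
    rewrite Rabs_mult. assert (Rabs (t - t') <= / 2 ^ nexp r i) by (apply Rabs_le; lra).
    pose proof (Hh (w_ w) (wp w)). pose proof (Rabs_pos (h (w_ w) - h (wp w))). pose proof (Rabs_pos (t - t')).
    apply Rle_trans with (/ 2 ^ nexp r i * D (w_ w) (wp w)); [apply Rmult_le_compat; assumption|lra].
Qed.

(** Both end nodes are paid for, so that the cost bounds the variation of a function between
    arbitrary points of the two ends ([wchain_osc]). *)
Inductive wchain (sg : V -> R) (m : Z) : V -> R -> V -> Prop :=
| wc_one v : lev m v -> wchain sg m v (sg v) v
| wc_step v u c v' : adj (lev m) tch v u -> wchain sg m u c v' -> wchain sg m v (sg v + c) v'.

Lemma wchain_lev sg m v c v' : wchain sg m v c v' -> lev m v /\ lev m v'.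
Proof. induction 1 as [v Hv|v u c v' (Hv & _) _ (_ & IH)]; auto. Qed.

Lemma wchain_ge sg m v c v' : (forall u, 0 <= sg u) -> wchain sg m v c v' -> sg v <= c.
Proof.
  intros Hs H. inversion H as [|? u c' ? Ha Hc]; subst; [lra|]. assert (0 <= c'); [|lra].
  clear - Hs Hc. induction Hc as [u Hu|u z c v' _ _ IH]; [apply Hs|]. pose proof (Hs u). lra.
Qed.

Lemma wchain_app sg m u c v v1 c1 w : wchain sg m u c v -> adj (lev m) tch v v1 -> wchain sg m v1 c1 w -> wchain sg m u (c + c1) w.
Proof.
  induction 1 as [v Hv|u z c v Ha Hc IH]; intros H1 H2; [econstructor; eassumption|].
  rewrite Rplus_assoc. econstructor; [eassumption|]. auto.
Qed.

Lemma wchain_rev sg m v c v' : wchain sg m v c v' -> wchain sg m v' c v.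
Proof.
  induction 1 as [v Hv|v u c v' Ha Hc IH]; [constructor; assumption|]. rewrite Rplus_comm.
  eapply wchain_app; [exact IH|apply adj_sym; [apply tch_sym|exact Ha]|]. constructor. apply Ha.
Qed.

Lemma wchain_osc sg m (F : CPt G -> R) v c v' : (forall u p q, lev m u -> KC u p -> KC u q -> Rabs (F p - F q) <= sg u) ->
  wchain sg m v c v' -> forall p q, KC v p -> KC v' q -> Rabs (F p - F q) <= c.
Proof.
  intros HF. induction 1 as [v Hv|v u c v' Ha Hc IH]; intros p q Hp Hq; [apply (HF v); assumption|].
  destruct Ha as (Hv & Hu & z & Hz & Hz'). pose proof (HF v p z Hv Hp Hz). pose proof (IH z q Hz' Hq).
  pose proof (Rabs_triang (F p - F z) (F z - F q)) as Ht. replace (F p - F z + (F z - F q)) with (F p - F q) in Ht by ring. lra.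
Qed.

Lemma within_wchain (s : R) m k v v' : 0 <= s -> lev m v -> within (adj (lev m) tch) k v v' -> exists c, c <= INR (S k) * s /\ wchain (fun _ => s) m v c v'.
Proof.
  intros Hs Hv. revert v'. induction k as [|k IH]; intros v' H.
  - simpl in H. subst v'. exists s. split; [simpl; lra|]. apply (wc_one (fun _ => s)). assumption.
  - rewrite S_INR. destruct H as [H|(u & Hu & Ha)].
    + destruct (IH _ H) as (c & Hc & Hw). exists c. split; [lra|assumption].
    + destruct (IH _ Hu) as (c & Hc & Hw). exists (c + s). split; [lra|].
      eapply wchain_app; [exact Hw|exact Ha|]. apply (wc_one (fun _ => s)). apply Ha.
Qed.

Lemma d_osc m x : forall u p q, lev m u -> KC u p -> KC u q ->
  Rabs (hat (fun y => d x y) p - hat (fun y => d x y) q) <= 2 * (Cg * powerRZ r m).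
Proof.
  intros u p q (Hu & Hm). destruct d_metric as (D0 & D1 & D2 & D3). pose proof (rpow_pos m) as Hp.
  apply (hat_osc d); [assumption| |nra|].
  - intros y z. apply Rabs_le. pose proof (D3 x y z). pose proof (D3 x z y). rewrite (D2 z y) in *. lra.
  - destruct u as [w|w i k]; simpl in Hm.
    + intros y z Hy Hz. eapply Rle_trans; [apply (gd_le w); assumption|]. rewrite <- Hm. apply gd_bd. assumption.
    + destruct Hu as (HL & Hi & _). destruct (wm_spec w HL) as (W1 & W2).
      pose proof (gd_le w _ _ (Le_Te w HL) W1 (Hwp w HL)) as B1. destruct (gd_bd w (Le_Te w HL)) as (_ & B2).
      destruct (nexp_spec i) as (B3 & _). rewrite <- Hm, powerRZ_nat by lra.
      assert (0 < / 2 ^ nexp r i) by (apply Rinv_0_lt_compat, pow2_pos). pose proof (D0 (w_ w) (wp w)). pose proof (rpow_pos (ht w)).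
      apply Rle_trans with (Cg * powerRZ r (ht w) * r ^ i); [apply Rmult_le_compat; lra|lra].
Qed.

(** Touching nodes may meet only inside a cable, where [d] has no meaning; the affine extension of
    the distance from [x] is followed along the chain instead. *)
Lemma d_far m c v v' x y : wchain (fun _ => 2 * (Cg * powerRZ r m)) m v c v' -> inc v x -> inc v' y -> d x y <= c.
Proof.
  intros Hc Hx Hy. pose proof (wchain_osc _ m (hat (fun y => d x y)) v c v' (d_osc m x) Hc (CV x) (CV y) Hx Hy) as H.
  destruct d_metric as (D0 & D1 & D2 & D3). simpl in H. replace (d x x) with 0 in H by (symmetry; apply D1; reflexivity).
  apply Rcomplements.Rabs_le_between in H. lra.
Qed.

(** The first term forces two distinct vertices this close, at level [m], onto base nodes
    ([near_base]); the second makes adaptedness applicable with [s = r^m / Cg]. *)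
Definition c8 : R := Rmin (/ Cg * / (CF * CF)) (a1 * / Cg).

Lemma c8_pos : 0 < c8.
Proof. pose proof Cg_inv. apply Rmin_glb_lt; apply Rmult_lt_0_compat; try lra. apply Rinv_0_lt_compat. nra. Qed.

Lemma near_base m v x y : lev m v -> inc v x -> x <> y -> d x y < c8 * powerRZ r m -> exists w, v = RBase w.
Proof.
  intros (Hv & Hm) Hx Hne Hd. destruct v as [w|w i k]; [eauto|]. exfalso. pose proof Hv as (HL & Hi & _). simpl in Hm.
  pose proof (Le_nd w x HL (inc_K _ _ _ _ Hv Hx)) as H1. pose proof (nd_le x y Hne) as H2. destruct (gd_bd w (Le_Te w HL)) as (H3 & _).
  pose proof (powerRZ_anti r (ht w) m r_bd ltac:(lia)) as H4. pose proof (rpow_pos m) as H5. pose proof Cg_inv.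
  assert (HCF : 0 < CF * CF) by nra.
  assert (c8 * powerRZ r m <= / Cg * / (CF * CF) * powerRZ r m) by (apply Rmult_le_compat_r; [lra|apply Rmin_l]).
  assert (/ Cg * powerRZ r m <= CF * CF * d x y).
  { eapply Rle_trans; [apply Rmult_le_compat_l; [lra|exact H4]|]. eapply Rle_trans; [exact H3|]. eapply Rle_trans; [exact H1|]. apply Rmult_le_compat_l; lra. }
  assert (CF * CF * d x y < CF * CF * (/ Cg * / (CF * CF) * powerRZ r m)) by (apply Rmult_lt_compat_l; lra).
  replace (CF * CF * (/ Cg * / (CF * CF) * powerRZ r m)) with (/ Cg * powerRZ r m) in H7 by (field; split; lra). lra.
Qed.

Notation vadj m := (fun a b => adj (lev m) tch a b /\ exists z, inc a z /\ inc b z).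

Lemma vadj_of m u v x : lev m u -> lev m v -> inc u x -> inc v x -> vadj m u v.
Proof. intros Hu Hv H1 H2. split; [|eauto]. split; [assumption|split; [assumption|]]. eapply inc_tch; eassumption. Qed.

(** For [s = r^m / Cg] the nodes of [Lambda_s] have height at least [m], so the chain of length at
    most [Ma] given by adaptedness projects to level [m]; one step is added at each end. *)
Lemma d_near m v v' x y : lev m v -> lev m v' -> inc v x -> inc v' y -> d x y < c8 * powerRZ r m -> within (vadj m) (Ma + 2) v v'.
Proof.
  intros Hv Hv' Hx Hy Hd. destruct (classic (x = y)) as [<-|Hne].
  { apply (within_mono _ 1); [lia|]. apply within_step. eapply vadj_of; eassumption. }
  destruct (near_base m v x y Hv Hx Hne Hd) as (t & ->).
  assert (Hd' : d y x < c8 * powerRZ r m) by (destruct d_metric as (_ & _ & Hs & _); rewrite Hs; assumption).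
  destruct (near_base m v' y x Hv' Hy (not_eq_sym Hne) Hd') as (t' & ->).
  set (s := / Cg * powerRZ r m). pose proof (rpow_pos m) as Hp. pose proof Cg_inv. assert (Hs : 0 < s) by (unfold s; nra).
  assert (Hb : ball d x (a1 * s) y).
  { unfold ball. eapply Rlt_le_trans; [exact Hd|]. unfold s. rewrite <- Rmult_assoc. apply Rmult_le_compat_r; [lra|apply Rmin_r]. }
  destruct (adp x s y Hs Hb) as [(_ & ->)|(u & (w0 & Hw0 & Hw0x & Hu & Hw) & Huy)]; [congruence|].
  assert (Hlev : forall w, Lambda_s pi K d s w -> (m <= ht w)%Z).
  { intros w (HT & Hg & _). apply Z.nlt_ge. intros Hlt. destruct (gd_bd w HT) as (Hl & _).
    assert (powerRZ r m < powerRZ r (ht w)).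
    { replace m with (ht w + Z.of_nat (Z.to_nat (m - ht w)))%Z at 1 by lia. rewrite powerRZ_nat by lra.
      pose proof (rpow_pos (ht w)). assert (r ^ Z.to_nat (m - ht w) < 1); [|nra].
      destruct (Z.to_nat (m - ht w)) as [|q] eqn:Eq; [lia|]. simpl. assert (r ^ q <= 1) by (apply pow_le1; lra). assert (0 < r ^ q) by (apply pow_lt; lra). nra. }
    unfold s in Hg. assert (/ Cg * powerRZ r m < / Cg * powerRZ r (ht w)) by (apply Rmult_lt_compat_l; lra). lra. }
  set (an := fun w => RBase (Nat.iter (Z.to_nat (ht w - m)) pi w)).
  assert (Han : forall w z, Lambda_s pi K d s w -> K w z -> lev m (an w) /\ inc (an w) z).
  { intros w z Hw1 Hz. pose proof (Hlev w Hw1). destruct Hw1 as (HT & _). pose proof (Te_iter (Z.to_nat (ht w - m)) w HT) as HT'. split.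
    - split; [exact HT'|]. simpl. rewrite height_iter by assumption. lia.
    - apply inc_RBase; [assumption|]. apply K_iter. assumption. }
  replace (Ma + 2)%nat with (1 + (Ma + 1))%nat by lia.
  destruct (Han w0 x Hw0 Hw0x) as (A1 & A2). destruct (Han u y Hu Huy) as (B1 & B2).
  apply within_trans with (an w0); [apply within_step; eapply vadj_of; eassumption|].
  apply within_trans with (an u); [|apply within_step; eapply vadj_of; eassumption].
  revert Hw. apply within_map. intros w w' (Hw & Hw' & _ & z & Hz & Hz').
  destruct (Han w z Hw Hz). destruct (Han w' z Hw' Hz'). eapply vadj_of; eassumption.
Qed.

(** * Contraction and interior nodes *)

(* [u] is [v], or both lie on one cable and a chain of cost [c] covers what is between them. *)
Definition link (sg : V -> R) (v u : V) (c : R) : Prop :=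
  v = u \/ exists w i k k', v = RSub w i k /\ u = RSub w i k' /\
    (INR k - INR k' + 1) * sg v <= c /\ (INR k' - INR k + 1) * sg v <= c.

Section Split.
Context (sg : V -> R) (m : Z).
Hypothesis sg_nonneg : forall u, 0 <= sg u.
Hypothesis sg_cable : forall w i k k', sg (RSub w i k) = sg (RSub w i k').

(** Before its first node with a vertex a chain cannot leave its cable, and it pays for every
    interval it crosses. *)
Lemma first_vertex v c v' : wchain sg m v c v' ->
  link sg v v' c \/ exists u x c2, inc u x /\ link sg v u c /\ wchain sg m u c2 v' /\ c2 <= c.
Proof.
  induction 1 as [v Hv|v z c v' Ha Hc IH]; [left; left; reflexivity|].
  destruct (classic (exists x, inc v x)) as [(x & Hx)|Hno].
  { right. exists v, x, (sg v + c). split; [assumption|]. split; [left; reflexivity|]. split; [econstructor; eassumption|lra]. }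
  pose proof Ha as (Hv & Hz & Ht). pose proof (sg_nonneg v) as Hs0. pose proof (wchain_ge sg m z c v' sg_nonneg Hc) as Hcz.
  destruct (tch_cases m v z Hv Hz Ht) as [(x & Hx & _)|(w & i & k & k2 & -> & -> & Hk1 & Hk2)]; [exfalso; eauto|].
  apply le_INR in Hk1. apply le_INR in Hk2. rewrite S_INR in Hk1, Hk2.
  assert (Hs : sg (RSub w i k2) = sg (RSub w i k)) by apply sg_cable.
  assert (Hlink : forall u, link sg (RSub w i k2) u c -> link sg (RSub w i k) u (sg (RSub w i k) + c)).
  { intros u [<-|(w' & i' & k3 & k4 & E1 & -> & L1 & L2)].
    - right. exists w, i, k, k2. repeat split; nra.
    - inversion E1; subst. right. exists w', i', k, k4. rewrite Hs in L1, L2. repeat split; nra. }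
  destruct IH as [IH|(u & x & c2 & Hx & Hl & Hw & Hc2)].
  - left. auto.
  - right. exists u, x, c2. split; [assumption|]. split; [auto|]. split; [assumption|lra].
Qed.

Lemma link_mono v u c c' : c <= c' -> link sg v u c -> link sg v u c'.
Proof. intros H [E0|(w & i & k & k' & E1 & E2 & L1 & L2)]; [left; assumption|]. right. exists w, i, k, k'. repeat split; try assumption; lra. Qed.

Lemma chain_split v c v' : wchain sg m v c v' -> link sg v v' c \/
  exists u u' x y c3, inc u x /\ inc u' y /\ link sg v u c /\ link sg v' u' c /\ wchain sg m u c3 u' /\ c3 <= c.
Proof.
  intros Hc. destruct (first_vertex v c v' Hc) as [H|(u & x & c2 & Hx & Hl & Hw & Hc2)]; [auto|].
  right. destruct (first_vertex v' c2 u (wchain_rev sg m _ _ _ Hw)) as [H|(u' & y & c3 & Hy & Hl' & Hw' & Hc3)].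
  - destruct (wchain_lev _ _ _ _ _ Hw) as (Hu & _). exists u, u, x, x, (sg u). repeat split; try assumption.
    + eapply link_mono; eassumption.
    + constructor. assumption.
    + pose proof (wchain_ge sg m _ _ _ sg_nonneg Hw). lra.
  - exists u, u', x, y, c3. repeat split; try assumption.
    + eapply link_mono; eassumption.
    + apply wchain_rev. assumption.
    + lra.
Qed.
End Split.

Lemma div_close k k' g i : (i <= g)%nat -> (k <= k' + i)%nat -> (k' <= k + i)%nat -> (k / g <= S (k' / g) /\ k' / g <= S (k / g))%nat.
Proof.
  intros Hg H1 H2. destruct (Nat.eq_dec g 0) as [->|Hg0]; [rewrite !Nat.div_0_r; lia|].
  pose proof (Nat.div_mod_eq k g). pose proof (Nat.mod_upper_bound k g Hg0).
  pose proof (Nat.div_mod_eq k' g). pose proof (Nat.mod_upper_bound k' g Hg0). nia.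
Qed.

Lemma gap_large q n : 0 < q -> r ^ n * (2 * q) <= 1 -> forall i, q < INR (gap i n).
Proof.
  intros Hq Hn i. destruct (gap_bounds i n) as (H & _). assert (0 < r ^ n) by (apply pow_lt; lra).
  apply Rmult_lt_reg_l with (r ^ n * 2); nra.
Qed.

Lemma link_par j n (i : nat) v u : lev (j + Z.of_nat n)%Z v -> lev (j + Z.of_nat n)%Z u -> (forall e, INR i <= INR (gap e n)) ->
  link (fun _ => 1) v u (INR i + 1) -> adj (lev j) tch (Nat.iter n par v) (Nat.iter n par u).
Proof.
  intros Hv Hu Hg Hl. pose proof (node_lev_iter _ _ _ Hv) as Hv'. pose proof (node_lev_iter _ _ _ Hu) as Hu'.
  split; [assumption|]. split; [assumption|]. destruct Hl as [<-|(w & e & k & k' & -> & -> & L1 & L2)]; [eapply tch_refl; eassumption|].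
  assert (K1 : (k <= k' + i)%nat) by (apply INR_le; rewrite plus_INR; lra).
  assert (K2 : (k' <= k + i)%nat) by (apply INR_le; rewrite plus_INR; lra).
  destruct Hv as ((HL & He & _) & _). destruct (Nat.lt_ge_cases n e) as [Hne|Hne].
  - rewrite !iter_RSub in * by lia. apply tch_RSub; [apply Hv'|apply Hu'|]. apply div_close with i; try assumption. apply INR_le. apply Hg.
  - rewrite !iter_RSub_base in * by lia. eapply tch_refl; eassumption.
Qed.

(** A chain along one cable projects to touching nodes once [gap] is at least its length. Any other
    chain is cut at the first and last vertices [x] and [y]: [r^n] outweighs its length, so
    [d x y < c8 * r^j], and [d_near] gives [Ma + 2] steps independently of [i]. *)
Lemma node_contract : exists n1, forall i n j v v', (i * n1 <= n)%nat -> lev (j + Z.of_nat n)%Z v ->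
    within (adj (lev (j + Z.of_nat n)%Z) tch) i v v' ->
    within (adj (lev j) tch) (Ma + 4) (Nat.iter n par v) (Nat.iter n par v').
Proof.
  pose proof c8_pos as Hc8.
  (* The bound [1 / 4] absorbs the number of nodes through [i + 2 <= 2 * 4^i]; the other bound
     brings the distance below the threshold of [d_near]. *)
  set (q := Rmin (1 / 4) (c8 / (8 * Cg))).
  assert (Hq : 0 < q) by (apply Rmin_glb_lt; [lra|apply Rdiv_lt_0_compat; lra]).
  assert (Hq4 : q <= 1 / 4) by apply Rmin_l.
  assert (Hqc : q * (8 * Cg) <= c8).
  { apply Rle_trans with (c8 / (8 * Cg) * (8 * Cg)); [apply Rmult_le_compat_r; [lra|apply Rmin_r]|]. right. field. lra. }
  destruct (small_pow r q r_bd Hq) as (n1 & Hn1). exists n1. intros i n j v v' Hin Hv Hw.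
  destruct i as [|i]; [simpl in Hw; subst v'; apply within_refl|].
  assert (Hr0 : 0 < r ^ n1) by (apply pow_lt; lra).
  assert (Hri : 0 < r ^ n /\ r ^ n * 4 ^ i <= q).
  { split; [apply pow_lt; lra|]. replace n with (n1 + (n1 * i + (n - S i * n1)))%nat by lia. rewrite !pow_add, pow_mult.
    assert (A1 : r ^ (n - S i * n1) <= 1) by (apply pow_le1; lra). assert (A0 : 0 < r ^ (n - S i * n1)) by (apply pow_lt; lra).
    assert (A2 : (r ^ n1) ^ i * 4 ^ i <= 1) by (rewrite <- Rpow_mult_distr; apply pow_le1; lra).
    assert (A3 : 0 < (r ^ n1) ^ i) by (apply pow_lt; assumption). assert (A4 : 0 < 4 ^ i) by (apply pow_lt; lra).
    assert (A5 : 0 < (r ^ n1) ^ i * 4 ^ i) by nra.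
    replace (r ^ n1 * ((r ^ n1) ^ i * r ^ (n - S i * n1)) * 4 ^ i) with (r ^ n1 * ((r ^ n1) ^ i * 4 ^ i) * r ^ (n - S i * n1)) by ring.
    assert (r ^ n1 * ((r ^ n1) ^ i * 4 ^ i) <= q) by nra. assert (0 < r ^ n1 * ((r ^ n1) ^ i * 4 ^ i)) by nra. nra. }
  destruct Hri as (Hr1 & Hri).
  assert (H4i : INR (S (S i)) <= 2 * 4 ^ i).
  { clear. induction i as [|i IH]; [simpl; lra|]. rewrite S_INR. simpl pow. assert (1 <= 4 ^ i) by (apply pow_R1_Rle; lra). lra. }
  assert (Hgap : forall e, INR (S i) <= INR (gap e n)).
  { intros e. apply Rlt_le. apply gap_large; [apply lt_0_INR; lia|]. rewrite S_INR in H4i. nra. }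
  destruct (within_wchain 1 _ (S i) v v' ltac:(lra) Hv Hw) as (c & Hc & Hch). rewrite Rmult_1_r, S_INR in Hc.
  assert (Hlk : forall a b, lev (j + Z.of_nat n)%Z a -> lev (j + Z.of_nat n)%Z b -> link (fun _ => 1) a b c -> adj (lev j) tch (Nat.iter n par a) (Nat.iter n par b)).
  { intros a b Ha Hb Hl. apply (link_par j n (S i)); try assumption. eapply link_mono; [exact Hc|exact Hl]. }
  pose proof (wchain_lev _ _ _ _ _ Hch) as (_ & Hv').
  destruct (chain_split (fun _ => 1) _ ltac:(intros; lra) ltac:(reflexivity) v c v' Hch) as [Hl|(u & u' & x & y & c3 & Hx & Hy & Hl & Hl' & Hc3 & Hcc)].
  - apply (within_mono _ 1); [lia|]. apply within_step. apply Hlk; assumption.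
  - pose proof (wchain_lev _ _ _ _ _ Hc3) as (Hu & Hu').
    replace (Ma + 4)%nat with (1 + (Ma + 2 + 1))%nat by lia.
    apply within_trans with (Nat.iter n par u); [apply within_step; apply Hlk; assumption|].
    apply within_trans with (Nat.iter n par u'); [|apply within_step; apply adj_sym; [apply tch_sym|]; apply Hlk; assumption].
    assert (Hd : d x y < c8 * powerRZ r j).
    { assert (Hsc : forall s a c b, wchain (fun _ => 1) (j + Z.of_nat n)%Z a c b -> wchain (fun _ => s) (j + Z.of_nat n)%Z a (s * c) b).
      { intros s a c' b H. induction H as [b Hb|b z c'' b' Hbz _ IH]; [rewrite Rmult_1_r; apply (wc_one (fun _ => s)); assumption|].
        rewrite Rmult_plus_distr_l, Rmult_1_r. apply (wc_step (fun _ => s)) with z; assumption. }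
      pose proof (d_far _ _ _ _ x y (Hsc (2 * (Cg * powerRZ r (j + Z.of_nat n))) _ _ _ Hc3) Hx Hy) as Hd.
      rewrite powerRZ_nat in Hd by lra. pose proof (rpow_pos j) as Hp. eapply Rle_lt_trans; [exact Hd|].
      rewrite S_INR in H4i.
      assert (Hc4 : c3 <= 2 * 4 ^ i) by lra.
      apply Rle_lt_trans with (2 * (Cg * (r ^ n * powerRZ r j)) * (2 * 4 ^ i)).
      - apply Rmult_le_compat_l; [|assumption]. assert (0 < r ^ n * powerRZ r j) by nra. nra.
      - replace (2 * (Cg * (r ^ n * powerRZ r j)) * (2 * 4 ^ i)) with (4 * Cg * (r ^ n * 4 ^ i) * powerRZ r j) by ring.
        apply Rmult_lt_compat_r; [assumption|]. nra. }
    eapply within_impl; [|apply (d_near j (Nat.iter n par u) (Nat.iter n par u') x y); try assumption].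
    + intros a b (Hab & _). exact Hab.
    + apply node_lev_iter; assumption.
    + apply node_lev_iter; assumption.
    + eapply node_inc_iter; eassumption.
    + eapply node_inc_iter; eassumption.
Qed.

(** Position [1] in a block of at least three intervals has both neighbours in the same block and is
    never an end of the cable. *)
Lemma mid_neighbours m w i k g v' : lev m (RSub w i (k * g + 1)) -> (3 <= g)%nat -> (exists N, 2 ^ nexp r i = N * g)%nat ->
  adj (lev m) tch (RSub w i (k * g + 1)) v' -> exists k', v' = RSub w i k' /\ (k' / g = k)%nat.
Proof.
  intros Hl Hg (N & HN) (_ & Hv' & Ht). pose proof Hl as (Hv & _).
  destruct (tch_cases m _ _ Hl Hv' Ht) as [(x & Hx & _)|(w' & i' & k1 & k2 & E1 & -> & Hk)].
  - exfalso. apply seg_CV_RSub in Hx; [|assumption]. rewrite HN in Hx. destruct Hx as [(_ & Hx)|(_ & Hx)]; [nia|].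
    destruct (Nat.le_gt_cases N k) as [HNk|HNk]; [pose proof (Nat.mul_le_mono_r _ _ g HNk); lia|].
    pose proof (Nat.mul_le_mono_r (S k) N g HNk). lia.
  - inversion E1; subst. exists k2. split; [reflexivity|]. symmetry. apply (Nat.div_unique k2 g k (k2 - k * g)); nia.
Qed.

Lemma cable_mid m w i n k : lev m (RSub w i k) -> (3 <= gap i n)%nat ->
  exists c, lev (m + Z.of_nat n)%Z c /\ Nat.iter n par c = RSub w i k /\
    forall v', adj (lev (m + Z.of_nat n)%Z) tch c v' -> Nat.iter n par v' = RSub w i k.
Proof.
  intros (Hv & Hm) Hg. pose proof Hv as (HL & Hi & Hk). simpl in Hm. set (g := gap i n) in *.
  assert (EN : (2 ^ nexp r (i + n) = 2 ^ nexp r i * g)%nat) by apply pow2_gap.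
  assert (Hit : forall k', Nat.iter n par (RSub w (i + n) k') = RSub w i (k' / g)).
  { intros k'. rewrite iter_RSub by lia. f_equal; [lia|]. f_equal. unfold g. f_equal. lia. }
  assert (HlC : lev (m + Z.of_nat n)%Z (RSub w (i + n) (k * g + 1))).
  { split; [|simpl; lia]. split; [assumption|]. split; [lia|]. rewrite EN. nia. }
  exists (RSub w (i + n) (k * g + 1)). split; [assumption|]. split.
  - rewrite Hit. f_equal. symmetry. apply (Nat.div_unique _ g k 1); lia.
  - intros v' Hv'. destruct (mid_neighbours _ w (i + n) k g v' HlC Hg (ex_intro _ _ EN) Hv') as (k' & -> & Ek). rewrite Hit, Ek. reflexivity.
Qed.

Lemma base_mid m w n : lev m (RBase w) -> Le w -> (1 <= n)%nat -> (3 <= gap 0 n)%nat ->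
  exists c, lev (m + Z.of_nat n)%Z c /\ Nat.iter n par c = RBase w /\
    forall v', adj (lev (m + Z.of_nat n)%Z) tch c v' -> Nat.iter n par v' = RBase w.
Proof.
  intros (Hv & Hm) HL Hn Hg. simpl in Hm.
  assert (EN : (2 ^ nexp r n = 1 * gap 0 n)%nat) by (pose proof (pow2_gap 0 n) as H; rewrite nexp_0 in H; exact H).
  assert (Hit : forall k', Nat.iter n par (RSub w n k') = RBase w).
  { intros k'. rewrite iter_RSub_base by lia. rewrite Nat.sub_diag. reflexivity. }
  assert (HlC : lev (m + Z.of_nat n)%Z (RSub w n (0 * gap 0 n + 1))).
  { split; [|simpl; lia]. split; [assumption|]. split; [lia|]. rewrite EN. lia. }
  exists (RSub w n (0 * gap 0 n + 1)). split; [assumption|]. split; [apply Hit|].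
  intros v' Hv'. destruct (mid_neighbours _ w n 0 (gap 0 n) v' HlC Hg (ex_intro _ _ EN) Hv') as (k' & -> & _). apply Hit.
Qed.

Lemma desc_exists n : forall m u x, lev m u -> inc u x -> exists c, lev (m + Z.of_nat n)%Z c /\ Nat.iter n par c = u /\ inc c x.
Proof.
  intros m u x Hu Hx. pose proof Hu as (Hv & Hm). destruct u as [w|w i k].
  - apply inc_RBase in Hx; [|assumption]. destruct (Le_below w x Hv Hx) as (e & b & HL & Hex & Eb).
    assert (Ehb : ht e = (m + Z.of_nat b)%Z) by (simpl in Hm; rewrite <- Hm, <- Eb, height_iter by assumption; lia).
    destruct (edge_level (m + Z.of_nat n)%Z e x HL Hex) as (c & Hc & Hcx & [(Hh & n' & ->)|(Hh & k & ->)]).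
    + exists (RBase (Nat.iter n' pi e)). split; [assumption|]. split; [|assumption].
      rewrite iter_RBase, <- Nat.iter_add. destruct Hc as (_ & Hc). simpl in Hc. rewrite height_iter in Hc by assumption.
      replace (n + n')%nat with b by lia. congruence.
    + eexists. split; [exact Hc|]. split; [|exact Hcx]. rewrite iter_RSub_base by lia.
      replace (n - Z.to_nat (m + Z.of_nat n - ht e))%nat with b by lia. congruence.
  - pose proof Hv as (HL & Hi & Hk). simpl in Hm.
    assert (Hx' := Hx). apply seg_CV_RSub in Hx'; [|assumption]. pose proof (gap_pos i n) as Hg. pose proof (pow2_gap i n) as EN.
    assert (Hit : forall k', Nat.iter n par (RSub w (i + n) k') = RSub w i (k' / gap i n)).
    { intros k'. rewrite iter_RSub by lia. f_equal; [lia|]. f_equal. f_equal. lia. }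
    destruct Hx' as [(-> & ->)|(-> & HkN)].
    + assert (Hr : rv (RSub w (i + n) 0)) by (split; [assumption|split; [lia|rewrite EN; nia]]).
      exists (RSub w (i + n) 0). split; [split; [assumption|simpl; lia]|]. split; [rewrite Hit; f_equal; apply Nat.Div0.div_0_l|].
      apply seg_CV_RSub; auto.
    + assert (Hr : rv (RSub w (i + n) (2 ^ nexp r (i + n) - 1))) by (split; [assumption|split; [lia|rewrite EN; nia]]).
      exists (RSub w (i + n) (2 ^ nexp r (i + n) - 1)). split; [split; [assumption|simpl; lia]|]. split.
      * rewrite Hit. f_equal. symmetry. apply (Nat.div_unique _ _ k (gap i n - 1)); [lia|]. rewrite EN, <- HkN. nia.
      * apply seg_CV_RSub; [assumption|]. right. split; [reflexivity|]. rewrite EN. nia.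
Qed.

(** Thickness gives a vertex [x] of [w] such that every node of [Lambda_s] within one step of those
    through [x] lies below [w]. For a base descendant through [x] much smaller than [s], the
    neighbours have their [Lambda_s]-ancestors among these. On cables the middle of a block is used
    instead. *)
Lemma node_interior : exists n0, (1 <= n0)%nat /\ forall n m w, (n0 <= n)%nat -> lev m w -> exists c, lev (m + Z.of_nat n)%Z c /\ Nat.iter n par c = w /\
  forall v', adj (lev (m + Z.of_nat n)%Z) tch c v' -> Nat.iter n par v' = w.
Proof.
  destruct thk as (al & Hal & Hthk).
  assert (HX : 0 < al / (CF * CF * (Cg * Cg) + Cg * Cg)) by (apply Rdiv_lt_0_compat; [assumption|nra]).
  destruct (small_pow r _ r_bd HX) as (nA & HnA). destruct (small_pow r (1 / 6) r_bd ltac:(lra)) as (nB & HnB).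
  assert (Hg3 : forall n i, (nB <= n)%nat -> (3 <= gap i n)%nat).
  { intros n i Hn. assert (3 < INR (gap i n)).
    - apply gap_large; [lra|]. replace n with (nB + (n - nB))%nat by lia. rewrite pow_add.
      assert (r ^ (n - nB) <= 1) by (apply pow_le1; lra). assert (0 < r ^ (n - nB)) by (apply pow_lt; lra). assert (0 < r ^ nB) by (apply pow_lt; lra). nra.
    - apply Nat.lt_le_incl. apply INR_lt. simpl (INR 3). lra. }
  assert (HA0 : 0 < CF * CF * (Cg * Cg) + Cg * Cg) by nra.
  apply (proj2 (Rlt_div_r _ _ _ HA0)) in HnA.
  exists (nA + nB + 1)%nat. split; [lia|]. intros n m w Hn Hw. pose proof Hw as (Hv & Hm). destruct w as [w|w i k].
  2:{ apply cable_mid; [assumption|apply Hg3; lia]. }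
  destruct (classic (Le w)) as [HL|HL]; [apply base_mid; [assumption|assumption|lia|apply Hg3; lia]|].
  simpl in Hm, Hv. destruct (Hthk w Hv) as (x & Hx & Hsub). set (s := al * gd K d (pi w)) in *.
  pose proof (gd_pos (pi w) (Te_pi w Hv)) as Hgp. assert (Hs : 0 < s) by (unfold s; nra).
  assert (Hinc : inc (RBase w) x) by (apply inc_RBase; assumption).
  destruct (desc_exists nA m (RBase w) x Hw Hinc) as (v1 & Hv1 & Ev1 & Hv1x).
  (* The term with [Cg] covers base neighbours; the term with [CF * CF] covers a touching edge,
     whose length is at most [CF^2 * nd z], hence at most [CF^2] times the diameter of [t1]. *)
  assert (Hsm : (CF * CF * Cg + Cg) * powerRZ r (m + Z.of_nat nA) <= s).
  { unfold s. destruct (gd_bd (pi w) (Te_pi w Hv)) as (Hlow & _). rewrite height_pi, Hm in Hlow by assumption.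
    rewrite powerRZ_nat by lra. pose proof (powerRZ_anti r (m - 1) m r_bd ltac:(lia)) as Hpa. pose proof (rpow_pos m) as Hp. pose proof Cg_inv.
    assert (/ Cg * powerRZ r m <= gd K d (pi w)) by nra.
    assert (powerRZ r m <= Cg * gd K d (pi w)).
    { apply Rmult_le_reg_l with (/ Cg); [lra|]. rewrite <- Rmult_assoc, Rinv_l, Rmult_1_l by lra. assumption. }
    assert (H7 : (CF * CF * Cg + Cg) * (r ^ nA * powerRZ r m) <= (CF * CF * Cg + Cg) * (r ^ nA * (Cg * gd K d (pi w)))).
    { assert (0 < r ^ nA) by (apply pow_lt; lra). apply Rmult_le_compat_l; [nra|]. apply Rmult_le_compat_l; lra. }
    eapply Rle_trans; [exact H7|].
    replace ((CF * CF * Cg + Cg) * (r ^ nA * (Cg * gd K d (pi w)))) with (r ^ nA * (CF * CF * (Cg * Cg) + Cg * Cg) * gd K d (pi w)) by ring.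
    apply Rmult_le_compat_r; lra. }
  assert (Hconv : forall c, lev (m + Z.of_nat nA + Z.of_nat (n - nA))%Z c -> lev (m + Z.of_nat n)%Z c).
  { intros c. replace (m + Z.of_nat nA + Z.of_nat (n - nA))%Z with (m + Z.of_nat n)%Z by lia. auto. }
  assert (Hsplit : forall c, Nat.iter n par c = Nat.iter nA par (Nat.iter (n - nA) par c)).
  { intros c. rewrite <- Nat.iter_add. f_equal. lia. }
  destruct v1 as [t1|u e k1].
  (* When the descendant through [x] already lies on a cable, the remaining [n - nA >= nB]
     generations reach the middle of a block there. *)
  2:{ destruct (cable_mid _ u e (n - nA) k1 Hv1 (Hg3 (n - nA)%nat e ltac:(lia))) as (c & Hc & Ec & Hnb).
      exists c. split; [auto|]. split; [rewrite Hsplit, Ec; assumption|]. intros v' Hv'. rewrite Hsplit, Hnb; [assumption|].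
      replace (m + Z.of_nat nA + Z.of_nat (n - nA))%Z with (m + Z.of_nat n)%Z by lia. assumption. }
  destruct (desc_exists (n - nA) _ _ x Hv1 Hv1x) as (c & Hc & Ec & _).
  exists c. split; [auto|]. split; [rewrite Hsplit, Ec; assumption|].
  pose proof Hv1 as (Ht1 & Hht1). simpl in Ht1, Hht1. apply inc_RBase in Hv1x; [|assumption].
  assert (Hgt1 : (CF * CF + 1) * gd K d t1 <= s).
  { destruct (gd_bd t1 Ht1) as (_ & Hup). rewrite Hht1 in Hup. eapply Rle_trans; [|exact Hsm].
    replace ((CF * CF * Cg + Cg) * powerRZ r (m + Z.of_nat nA)) with ((CF * CF + 1) * (Cg * powerRZ r (m + Z.of_nat nA))) by ring.
    apply Rmult_le_compat_l; nra. }
  pose proof (gd_pos t1 Ht1) as Hgt0.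
  destruct (scale_ancestor s t1 Hs Ht1 ltac:(nra)) as (ka & Hka).
  assert (Hkey : forall y z, Te y -> gd K d y <= s -> K y z -> K t1 z -> exists q, Nat.iter q pi y = w).
  { intros y z Hy Hgy Hyz Htz. destruct (scale_ancestor s y Hs Hy Hgy) as (k' & Hk').
    destruct (Hsub (Nat.iter k' pi y)) as (q & Hq).
    - exists (Nat.iter ka pi t1). split; [assumption|]. split; [apply K_iter; assumption|]. split; [assumption|].
      destruct (classic (Nat.iter ka pi t1 = Nat.iter k' pi y)) as [->|Hne]; [apply within_refl|].
      apply within_step. split; [assumption|]. split; [assumption|]. split; [assumption|]. exists z. split; apply K_iter; assumption.
    - exists (q + k')%nat. rewrite Nat.iter_add. assumption. }
  assert (Hnb1 : forall v', adj (lev (m + Z.of_nat nA)%Z) tch (RBase t1) v' -> Nat.iter nA par v' = RBase w).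
  { intros v' (_ & Hv' & Ht). destruct (tch_cases _ _ _ Hv1 Hv' Ht) as [(z & Hz & Hz')|(? & ? & ? & ? & E1 & _)]; [|discriminate].
    apply inc_RBase in Hz; [|assumption]. destruct Hv' as (Hr & Hh). destruct v' as [y|u e k']; simpl in Hh.
    - apply inc_RBase in Hz'; [|assumption]. destruct (Hkey y z) as (q & Hq); try assumption.
      { destruct (gd_bd y Hr) as (_ & Hup). rewrite Hh in Hup. eapply Rle_trans; [exact Hup|]. eapply Rle_trans; [|exact Hsm].
        pose proof (rpow_pos (m + Z.of_nat nA)). apply Rmult_le_compat_r; [lra|nra]. }
      assert (ht w = (ht y - Z.of_nat q)%Z) by (rewrite <- Hq; apply height_iter; assumption).
      rewrite iter_RBase. replace nA with q by lia. congruence.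
    - pose proof Hr as (HLu & He & _). pose proof (inc_K _ _ _ _ Hr Hz') as Huz.
      destruct (Hkey u z) as (q & Hq); try assumption; [apply Le_Te; assumption| |].
      { pose proof (Le_nd u z HLu Huz). pose proof (Te_nd t1 z Ht1 Hz). assert (0 < CF * CF) by nra. nra. }
      assert (ht w = (ht u - Z.of_nat q)%Z) by (rewrite <- Hq; apply height_iter; assumption).
      rewrite iter_RSub_base by lia. replace (nA - e)%nat with q by lia. congruence. }
  intros v' Hv'. rewrite Hsplit. apply Hnb1. rewrite <- Ec.
  replace (m + Z.of_nat n)%Z with (m + Z.of_nat nA + Z.of_nat (n - nA))%Z in Hv' by lia. apply node_adj_iter. assumption.
Qed.

Lemma common_node j j' v v' : lev j v -> lev j' v' -> exists k k', Nat.iter k par v = Nat.iter k' par v'.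
Proof.
  assert (Hb : forall j v, lev j v -> exists k w, Nat.iter k par v = RBase w).
  { intros i u (Hu & _). destruct u as [w|w e k]; [exists 0%nat, w; reflexivity|]. exists e, w. destruct Hu as (_ & He & _).
    rewrite iter_RSub_base by lia. rewrite Nat.sub_diag. reflexivity. }
  intros H H'. destruct (Hb _ _ H) as (k & w & E1). destruct (Hb _ _ H') as (k' & w' & E2).
  destruct (proj1 tree w w') as (n & n' & En). exists (n + k)%nat, (n' + k')%nat.
  rewrite !Nat.iter_add, E1, E2, !iter_RBase. congruence.
Qed.

(** [K w] is finite while the graph is infinite and connected, so some edge leaves [K w]; a node
    through that edge differs from [w]. On a cable the next interval serves. *)
Lemma node_neighbour m v : lev m v -> exists v', adj (lev m) tch v v' /\ v <> v'.
Proof.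
  intros Hl. pose proof Hl as (Hv & Hm). destruct v as [w|w i k].
  - destruct (Te_nonempty w Hv) as (x & Hx).
    assert (Hout : exists z, ~ K w z).
    { apply NNPP. intros Hno. destruct (proj1 part w) as (l & Hl'). destruct G_inf as (Hi & _).
      assert (Hn : NoDup (map f_enum (seq 0 (S (length l))))).
      { apply FinFun.Injective_map_NoDup; [exact Hi|apply seq_NoDup]. }
      assert (incl (map f_enum (seq 0 (S (length l)))) l).
      { intros z _. apply Hl'. apply NNPP. intros Hz. apply Hno. eauto. }
      pose proof (NoDup_incl_length Hn H) as Hle. rewrite length_map, length_seq in Hle. lia. }
    destruct Hout as (z & Hz).
    assert (Hcross : exists a b, E a b /\ K w a /\ ~ K w b).
    { pose proof (E_conn x z) as Hc. apply clos_rt_rt1n in Hc. revert Hx Hz. clear Hl Hv Hm. induction Hc as [a|a b c Hab _ IH]; intros Ha Hc'; [contradiction|].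
      destruct (classic (K w b)) as [Hb|Hb]; [auto|]. exists a, b. auto. }
    destruct Hcross as (a & b & Hab & Ha & Hb). destruct (edge_node a b Hab) as (u & HL & HK).
    destruct (edge_level m u a HL ltac:(apply HK; auto)) as (v' & Hv' & Hva & Hform). exists v'. split.
    + split; [assumption|split; [assumption|]]. eapply inc_tch; [|exact Hva]. apply inc_RBase; assumption.
    + intros <-. destruct Hform as [(_ & n & E1)|(_ & k & E1)]; [|discriminate]. inversion E1; subst. apply Hb. apply K_iter. apply HK. auto.
  - pose proof Hv as (HL & Hi & Hk). pose proof (nexp_pos i Hi) as Hp.
    assert (H2 : (2 <= 2 ^ nexp r i)%nat) by (change 2%nat with (2 ^ 1)%nat at 1; apply Nat.pow_le_mono_r; lia).
    set (k' := if Nat.eqb k 0 then 1%nat else (k - 1)%nat).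
    assert (Hk' : (k' < 2 ^ nexp r i)%nat /\ (k <= S k')%nat /\ (k' <= S k)%nat /\ k <> k') by (unfold k'; destruct (Nat.eqb_spec k 0); lia).
    assert (Hr : rv (RSub w i k')) by (split; [assumption|split; [assumption|apply Hk']]).
    exists (RSub w i k'). split; [|intros E1; inversion E1; lia]. split; [assumption|]. split; [split; [assumption|exact Hm]|].
    apply tch_RSub; [assumption|assumption|lia].
Qed.

(** With this [c9], no edge at a vertex of [u] is long enough for its node to have height [j + n] or
    less. So all descendants of [u] at level [j + n] are base nodes, which contain vertices. *)
Lemma node_coarse n : exists c9, 0 < c9 /\ forall j u c x, lev j u -> inc u x ->
    (forall y, inc u y -> nd y < c9 * powerRZ r j) ->
    lev (j + Z.of_nat n)%Z c -> Nat.iter n par c = u -> exists y, inc c y.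
Proof.
  assert (HCF : 0 < CF * CF) by nra. pose proof Cg_inv as HC.
  assert (Hrn : 0 < r ^ n) by (apply pow_lt; lra).
  exists (/ (CF * CF) * / Cg * r ^ n). split; [repeat apply Rmult_lt_0_compat; try lra; apply Rinv_0_lt_compat; lra|].
  intros j u c x Hu Hx Hfine Hc Ec.
  assert (Hbad : forall w y, Le w -> K w y -> (ht w <= j + Z.of_nat n)%Z -> inc u y -> False).
  { intros w y HL Hy Hh Hyu. specialize (Hfine y Hyu). pose proof (Le_nd w y HL Hy) as H1. destruct (gd_bd w (Le_Te w HL)) as (H2 & _).
    pose proof (powerRZ_anti r (ht w) (j + Z.of_nat n) r_bd Hh) as H3. rewrite powerRZ_nat in H3 by lra. pose proof (rpow_pos j) as Hp.
    assert (CF * CF * nd y < CF * CF * (/ (CF * CF) * / Cg * r ^ n * powerRZ r j)) by (apply Rmult_lt_compat_l; assumption).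
    replace (CF * CF * (/ (CF * CF) * / Cg * r ^ n * powerRZ r j)) with (/ Cg * (r ^ n * powerRZ r j)) in H by (field; split; lra).
    assert (/ Cg * (r ^ n * powerRZ r j) <= / Cg * powerRZ r (ht w)) by (apply Rmult_le_compat_l; lra). lra. }
  destruct u as [w|w i k].
  - destruct c as [v|w' i' k'].
    + destruct Hc as (Hv & _). destruct (Te_nonempty v Hv) as (y & Hy). exists y. apply inc_RBase; assumption.
    + exfalso. pose proof Hc as ((HL & Hi & _) & Hm). simpl in Hm. destruct (Nat.lt_ge_cases n i') as [Hlt|Hge].
      * rewrite iter_RSub in Ec by lia. discriminate.
      * rewrite iter_RSub_base in Ec by lia. inversion Ec as [Ew]. apply (Hbad w' (wp w') HL (Hwp w' HL)); [lia|].
        apply inc_RBase; [apply Hu|]. rewrite <- Ew. apply K_iter. apply Hwp. assumption.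
  - exfalso. pose proof Hu as (Hv & Hm). pose proof Hv as (HL & Hi & _). simpl in Hm.
    apply (Hbad w x HL (inc_K _ _ _ _ Hv Hx)); [lia|assumption].
Qed.

Theorem refined_filling : exists nb D B M n1 C7, (1 <= D)%nat /\ (1 <= B)%nat /\ (1 <= n1)%nat /\ 0 < C7 /\
  filling lev par tch inc d r nb D B M n1 C7 c8 nd.
Proof.
  destruct node_nb as (D & HD & Hnb). destruct node_ch as (B & HB & Hch). destruct node_contract as (n1 & Hcon).
  destruct node_interior as (n0 & Hn0 & Hint). destruct (choice _ Hnb) as (nb & Hnb').
  exists nb, D, B, (Ma + 4)%nat, (n0 + n1)%nat, (2 * Cg). split; [assumption|]. split; [assumption|]. split; [lia|]. split; [lra|]. constructor.
  - exact lev_inj.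
  - exact tch_sym.
  - exact tch_refl.
  - exact lev_par.
  - exact tch_par.
  - intros j v Hv. apply (Hnb' v). assumption.
  - intros v. apply Hnb'.
  - intros j v Hv. apply (proj2 (Hnb' v) j Hv).
  - exact Hch.
  - exact inc_par.
  - intros j v v' x _ _. apply inc_tch.
  - exact inc_fin.
  - exact cover.
  - intros i n j v v' Hi. apply Hcon. nia.
  - intros j w Hw. apply Hint; [lia|assumption].
  - exact node_neighbour.
  - intros j k v v' x y Hv Hv' Hx Hy Hw. pose proof (rpow_pos j).
    destruct (within_wchain (2 * (Cg * powerRZ r j)) j k v v' ltac:(nra) Hv Hw) as (c & Hc & Hch').
    eapply Rle_trans; [eapply d_far; eassumption|]. eapply Rle_trans; [exact Hc|]. right. ring.
  - intros j v v' x y Hv Hv' Hx Hy Hd. apply (within_mono _ (Ma + 2)); [lia|]. eapply d_near; eassumption.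
  - exact nd_pos.
  - exact nd_le.
  - intros j j' v v'. apply common_node.
  - exact node_coarse.
Qed.

(** * Growth and interpolation *)

Lemma node_adj_sym m a b : adj (lev m) tch a b -> adj (lev m) tch b a.
Proof. intros (H1 & H2 & H3). split; [|split]; try assumption. apply tch_sym. assumption. Qed.

Lemma within_Jh m n a b : lev m a -> (within (Jh pi phi K r wp m) n a b <-> within (adj (lev m) tch) n a b).
Proof.
  intros Ha. split.
  - apply within_impl. intros x y (H1 & H2 & _ & H3). split; [assumption|]. split; assumption.
  - revert b. induction n as [|n IH]; simpl; intros b H; [assumption|]. destruct H as [H|(u & Hu & H1 & H2 & H3)]; [left; auto|].
    destruct (classic (u = b)) as [<-|Hne]; [left; auto|]. right. exists u. split; [auto|]. split; [assumption|]. split; [assumption|]. auto.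
Qed.

Lemma rht_iter k v : rv v -> rht v = (rht (Nat.iter k par v) + Z.of_nat k)%Z.
Proof.
  intros Hv. destruct (node_lev_iter (rht v - Z.of_nat k) k v) as (_ & H); [split; [assumption|lia]|]. lia.
Qed.

Lemma descendants_bound : exists B, (1 <= B)%nat /\ forall k u l, rv u -> NoDup l ->
  (forall v, In v l -> rv v /\ Nat.iter k par v = u) -> (length l <= B ^ k)%nat.
Proof.
  destruct refined_filling as (nb & D & B & M & n1 & C7 & HD & HB & Hn1 & HC7 & Fl). exists B. split; [assumption|].
  intros k u l Hu Hl Hin. destruct (children_list _ _ _ _ _ _ _ _ _ _ _ _ _ _ Fl HD HB Hn1 r_bd k (rht u) u) as (l' & Hl' & H'); [split; [assumption|reflexivity]|].
  eapply Nat.le_trans; [apply NoDup_incl_length; [exact Hl|]|exact Hl']. intros v Hv. destruct (Hin v Hv) as (Hrv & Ev).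
  apply H'; [|assumption]. split; [assumption|]. rewrite <- Ev. apply rht_iter. assumption.
Qed.

Lemma cable_descendants : exists u, rv u /\ forall k, exists l, NoDup l /\ (forall v, In v l -> rv v /\ Nat.iter k par v = u) /\ length l = gap 1 k.
Proof.
  destruct (edge_node _ _ (nbr_E (f_enum 0%nat))) as (w & Hw & _). exists (RSub w 1 0).
  assert (Hp : forall i, (1 <= 2 ^ nexp r i)%nat) by (intros i; pose proof (Nat.pow_nonzero 2 (nexp r i) ltac:(lia)); lia).
  split; [split; [assumption|split; [lia|apply Hp]]|]. intros k. pose proof (gap_pos 1 k) as Hg.
  exists (map (RSub w (1 + k)) (seq 0 (gap 1 k))). split; [|split; [|rewrite length_map, length_seq; reflexivity]].
  - apply FinFun.Injective_map_NoDup; [intros x y Exy; injection Exy; auto|apply seq_NoDup].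
  - intros v Hv. apply in_map_iff in Hv. destruct Hv as (j & <- & Hj). apply in_seq in Hj. split.
    + split; [assumption|]. split; [lia|]. rewrite pow2_gap. specialize (Hp 1%nat). nia.
    + rewrite iter_RSub by lia. replace (1 + k - k)%nat with 1%nat by lia. rewrite Nat.div_small by lia. reflexivity.
Qed.

(** There are at most [B^k] descendants, and an interval of a cable has about [r^-k] of them, which
    exceeds [s^k] for a fixed [s] between [1] and [/ r]; hence [n > 1]. The last clause unfolds the
    upper limit. *)
Lemma Nstar_spec : exists n, Nstar pi K r = Finite n /\ 1 < n /\ forall n', n < n' -> exists k0, forall k, (k0 <= k)%nat ->
  forall u l, rv u -> NoDup l -> (forall v, In v l -> rv v /\ Nat.iter k par v = u) -> INR (length l) <= n' ^ k.
Proof.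
  set (cd := fun k w => card (Sk pi K r k (fun v => v = w))).
  set (a := fun k => rb_sup (fun z => exists w, rv w /\ z = rb_root k (cd k w))). assert (Ea : Nstar pi K r = rb_limsup a) by reflexivity.
  assert (Hcd : forall k u l, NoDup l -> (forall v, In v l -> rv v /\ Nat.iter k par v = u) -> Rbar_le (Finite (INR (length l))) (cd k u)).
  { intros k u l Hl Hin. apply rb_sup_ub. exists l. auto. }
  destruct descendants_bound as (B & HB & HBd). destruct cable_descendants as (u0 & Hu0 & Hdes).
  assert (Hup : Rbar_le (Nstar pi K r) (Finite (INR B))).
  { rewrite Ea. apply (limsup_le _ _ 1). intros k Hk. apply rb_sup_lub. intros z (w & Hw & ->). apply root_le; [assumption|apply pos_INR|].
    apply rb_sup_lub. intros z (l & Hl & Hin & ->). simpl. rewrite <- pow_INR. apply le_INR. apply (HBd k w); assumption. }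
  set (s := (1 + / r) / 2). assert (Hri : 1 < / r) by (rewrite <- Rinv_1; apply Rinv_lt_contravar; lra).
  assert (Hs : 1 < s) by (unfold s; lra).
  assert (Hrs : 0 < r * s < 1).
  { replace (r * s) with ((1 + r) / 2) by (unfold s; field; lra). lra. }
  assert (Hlow : Rbar_le (Finite s) (Nstar pi K r)).
  { rewrite Ea. apply limsup_ge. intros n. destruct (small_pow (r * s) (/ 2) Hrs ltac:(lra)) as (k0 & Hk0).
    exists (S (n + k0)). split; [lia|]. set (k := S (n + k0)).
    eapply Rbar_le_trans; [|apply rb_sup_ub; exists u0; split; [assumption|reflexivity]]. apply root_ge; [unfold k; lia|lra|].
    destruct (Hdes k) as (l & Hl & Hin & Hlen). eapply Rbar_le_trans; [|apply (Hcd k u0 l Hl Hin)]. rewrite Hlen. simpl.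
    destruct (gap_bounds 1 k) as (Hg & _). assert (Hrk : 0 < r ^ k) by (apply pow_lt; lra).
    assert (Hsk : (r * s) ^ k <= / 2).
    { unfold k. replace (S (n + k0)) with (S n + k0)%nat by lia. rewrite pow_add. assert ((r * s) ^ S n <= 1) by (apply pow_le1; lra).
      assert (0 < (r * s) ^ k0) by (apply pow_lt; lra). nra. }
    rewrite Rpow_mult_distr in Hsk. change (s ^ k <= INR (gap 1 k)). apply Rmult_le_reg_l with (r ^ k); [assumption|]. lra. }
  destruct (Nstar pi K r) as [n| |]; simpl in Hup, Hlow; try tauto. exists n. split; [reflexivity|]. split; [lra|].
  intros n' Hn'. destruct (limsup_lt a (Finite n')) as (k0 & Hk0); [rewrite <- Ea; exact Hn'|].
  exists (S k0). intros k Hk u l Hu Hl Hin.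
  assert (Hc : Rbar_lt (cd k u) (Finite (n' ^ k))).
  { apply root_lt; [lia|lra|]. eapply Rbar_le_lt_trans; [|apply (Hk0 k); lia]. apply rb_sup_ub. eauto. }
  apply Rlt_le. exact (Rbar_le_lt_trans (Finite _) _ _ (Hcd k u l Hl Hin) Hc).
Qed.

(** If every admissible function had energy at least [e], so would the infimum. The factor [2]
    undoes the [1/2] in the energy. *)
Lemma energy_witness p k N1 N2 N e w : rv w -> Rbar_lt (Epk pi phi K r wp p k N1 N2 N) (Finite e) -> exists f : V -> R,
  (forall x, lev (rht w + Z.of_nat k)%Z x -> within (adj (lev (rht w)) tch) N1 w (Nat.iter k par x) -> f x = 1) /\
  (forall x, lev (rht w + Z.of_nat k)%Z x -> ~ within (adj (lev (rht w)) tch) N2 w (Nat.iter k par x) -> f x = 0) /\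
  forall l, NoDup l -> (forall xy, In xy l -> JhN pi phi K r wp N (rht w + Z.of_nat k) xy) ->
    lsum l (fun xy => rpow (Rabs (f (fst xy) - f (snd xy))) p) <= 2 * e.
Proof.
  intros Hw He. assert (Hlw : lev (rht w) w) by (split; [assumption|reflexivity]).
  assert (Hlt : Rbar_lt (Epkw pi phi K r wp p k w N1 N2 N) (Finite e)).
  { eapply Rbar_le_lt_trans; [|exact He]. apply rb_sup_ub. eauto. }
  apply NNPP. intros Hno. apply Rbar_lt_not_le in Hlt. apply Hlt. apply rb_inf_glb. intros z (f & Hf1 & Hf0 & ->).
  apply Rbar_not_lt_le. intros Hz. apply Hno. exists f. split; [|split].
  - intros x Hx Hin. apply Hf1; [assumption|]. split; [apply Hx|]. split; [apply node_lev_iter; assumption|]. apply within_Jh; assumption.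
  - intros x Hx Hin. apply Hf0; [assumption|]. intros (_ & _ & H). apply Hin. apply within_Jh; assumption.
  - intros l Hl Hin. pose proof (nnsum_ge (JhN pi phi K r wp N (rht w + Z.of_nat k)) (fun xy => rpow (Rabs (f (fst xy) - f (snd xy))) p) l Hl Hin) as Hge.
    destruct (nnsum _ _) as [t| |]; simpl in Hge, Hz; try tauto; [lra|]. exfalso.
    destruct (Rle_dec 0 (/ 2)) as [H|]; [|lra]. destruct (Rle_lt_or_eq_dec 0 (/ 2) H); [exact Hz|lra].
Qed.

Lemma Epk_nonneg p k N1 N2 N : Rbar_le (Finite 0) (Epk pi phi K r wp p k N1 N2 N).
Proof.
  destruct cable_descendants as (u & Hu & _). eapply Rbar_le_trans; [|apply rb_sup_ub; exists u; split; [exact Hu|reflexivity]].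
  apply rb_inf_glb. intros z (f & _ & _ & ->). set (nn := nnsum _ _).
  assert (H0 : Rbar_le (Finite 0) nn) by (apply (nnsum_ge _ _ []); [constructor|intros ? []]).
  destruct nn as [t| |]; simpl in *; [lra| |contradiction].
  destruct (Rle_dec 0 (/ 2)) as [H|]; [|lra]. destruct (Rle_lt_or_eq_dec 0 (/ 2) H); [exact Logic.I|lra].
Qed.

Lemma node_balls : exists (nb : V -> list V) (D : nat), (1 <= D)%nat /\
  (forall j k v w, lev j w -> (In v (bl nb k w) <-> within (adj (lev j) tch) k w v)) /\
  forall j k w, lev j w -> (length (bl nb k w) <= D ^ k)%nat.
Proof.
  destruct refined_filling as (nb & D & B & M & n1 & C7 & HD & _ & _ & _ & Fl). exists nb, D. split; [assumption|]. split.
  - intros j k v w Hw. apply bl_spec; [destruct Fl; eauto|destruct Fl; eauto|assumption].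
  - intros j k w Hw. apply (bl_length (lev j) tch); [destruct Fl; eauto|destruct Fl; eauto|destruct Fl; eauto|assumption].
Qed.

(** Touching pairs are among the pairs at distance at most [N] because [N >= 1], and the cutoff
    equals [1] below [w] whatever [N1] is; so the energies dominate those required by
    [filling_dimension]. *)
Theorem dimension_witness (T_count : countable T) p N1 N2 N : 0 < p -> (1 <= N)%nat ->
  (forall e n0, 0 < e -> exists k, (n0 <= k)%nat /\ Rbar_lt (Epk pi phi K r wp p k N1 N2 N) (Finite e)) ->
  exists D, is_metric D /\ Ahlfors_regular D p /\ QS d D.
Proof.
  intros Hp HN Hen. destruct refined_filling as (nb & D & B & M & n1 & C7 & HD & HB & Hn1 & HC7 & Fl).
  apply (filling_dimension _ _ _ _ _ _ _ _ _ _ _ _ _ _ Fl HD HB Hn1 HC7 c8_pos r_bd d_metric p N2 Hp).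
  - destruct T_count as (en & Hsurj).
    exists (fun n => let (a, b) := Cantor.of_nat n in
      match a with
      | O => RBase (en b)
      | S _ => let (b1, b2) := Cantor.of_nat b in let (c1, c2) := Cantor.of_nat b2 in RSub (en b1) c1 c2
      end).
    intros [w|w i k]; destruct (Hsurj w) as (a & <-).
    + exists (Cantor.to_nat (0%nat, a)). rewrite Cantor.cancel_of_to. reflexivity.
    + exists (Cantor.to_nat (1%nat, Cantor.to_nat (a, Cantor.to_nat (i, k)))). rewrite !Cantor.cancel_of_to. reflexivity.
  - destruct (cover 0 (f_enum 0%nat)) as (v & Hv & _). eauto.
  - intros delta n0 Hdelta. destruct (Hen (delta / 2) n0) as (k & Hk & He); [lra|]. exists k. split; [assumption|].
    intros j u (Hu & <-). destruct (energy_witness p k N1 N2 N _ u Hu He) as (f & Hf1 & Hf0 & Hs). exists f. split; [|split].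
    + intros v Hv Ev. apply Hf1; [assumption|]. rewrite Ev. apply within_refl.
    + assumption.
    + intros l Hl Hin. replace delta with (2 * (delta / 2)) by field. apply Hs; [assumption|]. intros xy Hxy. destruct (Hin xy Hxy) as (Ha & Hne).
      split; [apply Ha|]. split; [apply Ha|]. split; [assumption|]. apply within_Jh; [apply Ha|]. apply (within_mono _ 1); [assumption|]. apply within_step. assumption.
Qed.

(* Hoelder's inequality; only the pairs near the support of the cutoff count. *)
Lemma energy_interpolate N1 N2 N p q : 0 < p < q -> exists C, 0 < C /\ forall k e s, 0 < e -> 0 < s ->
  Rbar_lt (Epk pi phi K r wp q k N1 N2 N) (Finite e) ->
  (forall u l, rv u -> NoDup l -> (forall v, In v l -> rv v /\ Nat.iter k par v = u) -> INR (length l) <= s) ->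
  Rbar_le (Epk pi phi K r wp p k N1 N2 N) (Finite (C * (Rpower e (p / q) * Rpower s (1 - p / q)))).
Proof.
  intros Hpq. destruct node_balls as (nb & D & HD & Hbl & Hbll).
  set (b := p / q). assert (Hb : 0 < b < 1) by (unfold b; split; [apply Rdiv_lt_0_compat; lra|apply Rlt_div_l; lra]).
  assert (HDp : forall i, 1 <= INR (D ^ i)) by (intros i; apply (le_INR 1); pose proof (Nat.pow_nonzero D i ltac:(lia)); lia).
  (* Times [s], this counts the relevant pairs: at most [D^N2] nodes near [w] with at most [s]
     descendants each, [D^N] partners for each descendant, and a factor [2] for the position in the
     pair. *)
  set (X := 2 * INR (D ^ N) * INR (D ^ N2)). assert (HX : 0 < X) by (unfold X; pose proof (HDp N); pose proof (HDp N2); nra).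
  pose proof (Rpower_pos 2 b) as H2b. pose proof (Rpower_pos X (1 - b)) as HXb.
  exists (Rpower 2 b * Rpower X (1 - b)). split; [apply Rmult_lt_0_compat; assumption|]. intros k e s He Hs HE Hcount.
  apply rb_sup_lub. intros z (w & Hw & ->). set (m := rht w). set (L := (m + Z.of_nat k)%Z). assert (Hlw : lev m w) by (split; [assumption|reflexivity]).
  destruct (energy_witness q k N1 N2 N e w Hw HE) as (f & Hf1 & Hf0 & Hsum). fold m L in Hf1, Hf0, Hsum.
  set (cst := Rpower 2 b * Rpower X (1 - b) * (Rpower e b * Rpower s (1 - b))).
  assert (Hcst : cst = Rpower (2 * e) b * Rpower (X * s) (1 - b)) by (unfold cst; rewrite <- !Rpower_mult_distr by lra; ring).
  eapply Rbar_le_trans; [apply rb_inf_lb; exists f; split; [|split; [|reflexivity]]|].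
  - intros x Hx (_ & _ & Hin). apply Hf1; [assumption|]. apply within_Jh; assumption.
  - intros x Hx Hno. apply Hf0; [assumption|]. intros Hin. apply Hno. split; [apply Hx|]. split; [apply node_lev_iter; assumption|]. apply within_Jh; assumption.
  - fold m L. set (nn := nnsum _ _).
    assert (Hnn : Rbar_le nn (Finite cst)).
    { apply nnsum_le. intros l Hl Hin. set (near := fun x => within (adj (lev m) tch) N2 w (Nat.iter k par x)).
      set (tst := fun xy : V * V => near (fst xy) \/ near (snd xy)). set (l' := keep tst l).
      assert (Hl' : forall xy, In xy l' -> In xy l /\ tst xy) by (intros xy; apply In_keep).
      set (Y := ndup (keep near (map fst l ++ map snd l))).
      assert (HY : forall x, In x Y <-> (In x (map fst l) \/ In x (map snd l)) /\ near x).
      { intros x. unfold Y. rewrite In_ndup, In_keep, in_app_iff. reflexivity. }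
      assert (HYl : forall x, In x Y -> lev L x).
      { intros x Hx. apply HY in Hx. destruct Hx as ([Hx|Hx] & _); apply in_map_iff in Hx; destruct Hx as (xy & <- & Hxy); apply (Hin xy Hxy). }
      assert (Hone : forall (A : Type) (l : list A), lsum l (fun _ => 1) = INR (length l)).
      { intros A l0. induction l0 as [|x l0 IH]; [reflexivity|]. rewrite lsum_cons, IH. simpl length. rewrite S_INR. ring. }
      assert (HYlen : INR (length Y) <= INR (D ^ N2) * s).
      { rewrite <- Hone. apply Rle_trans with (lsum (bl nb N2 w) (fun u => lsum (keep (fun x => Nat.iter k par x = u) Y) (fun _ => 1))).
        - apply lsum_fibers; [apply NoDup_ndup| |intros; lra]. intros x Hx. apply (Hbl m); [assumption|]. apply HY. assumption.
        - eapply Rle_trans; [apply (lsum_const_le _ _ s)|].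
          + intros u Hu. apply (Hbl m) in Hu; [|assumption]. assert (Hul : lev m u) by (eapply within_adj_X; eassumption).
            rewrite Hone. apply (Hcount u); [apply Hul|apply NoDup_keep, NoDup_ndup|]. intros v Hv. apply In_keep in Hv.
            split; [apply HYl; tauto|tauto].
          + apply Rmult_le_compat_r; [lra|]. apply le_INR. apply (Hbll m). assumption. }
      assert (Hlen : INR (length l') <= X * s).
      { rewrite <- Hone. apply Rle_trans with (lsum (flat_map (fun x => map (pair x) (bl nb N x) ++ map (fun y => (y, x)) (bl nb N x)) Y) (fun _ => 1)).
        - apply lsum_incl; [apply NoDup_keep; assumption| |intros; lra]. intros (x, y) Hxy. apply Hl' in Hxy. destruct Hxy as (Hxy & Hnear).
          destruct (Hin _ Hxy) as (J1 & J2 & _ & J3). simpl in *. apply within_Jh in J3; [|assumption]. apply in_flat_map. destruct Hnear as [Hn|Hn].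
          + exists x. split; [apply HY; split; [left; exact (in_map fst _ _ Hxy)|assumption]|]. apply in_or_app. left. apply in_map. apply (Hbl L); assumption.
          + exists y. split; [apply HY; split; [right; exact (in_map snd _ _ Hxy)|assumption]|]. apply in_or_app. right. apply in_map_iff. exists x. split; [reflexivity|].
            apply (Hbl L); [assumption|]. apply within_sym; [apply node_adj_sym|assumption].
        - rewrite lsum_flat_map. eapply Rle_trans; [apply (lsum_const_le _ _ (2 * INR (D ^ N)))|].
          + intros x Hx. rewrite Hone, length_app, !length_map, plus_INR. pose proof (le_INR _ _ (Hbll L N x (HYl x Hx))). lra.
          + unfold X. pose proof (HDp N). replace (2 * INR (D ^ N) * INR (D ^ N2) * s) with (INR (D ^ N2) * s * (2 * INR (D ^ N))) by ring.
            apply Rmult_le_compat_r; [lra|assumption]. }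
      change (lsum l (fun xy => rpow (Rabs (f (fst xy) - f (snd xy))) p) <= cst).
      rewrite (lsum_keep tst); fold l'.
      2:{ intros (x, y) Hxy Hnn. destruct (Hin _ Hxy) as (J1 & J2 & _). simpl in *.
        rewrite (Hf0 x), (Hf0 y); [rewrite Rminus_diag, Rabs_R0; apply rpow_0; lra|assumption| |assumption|]; intros Hx; apply Hnn; unfold tst; auto. }
      assert (Hmain : lsum l' (fun xy => rpow (rpow (Rabs (f (fst xy) - f (snd xy))) q) b) <= Rpower (2 * e) b * Rpower (X * s) (1 - b)).
      { apply power_sum; [assumption|lra|apply Rmult_lt_0_compat; assumption|assumption|intros; apply rpow_nonneg|].
        apply Hsum; [apply NoDup_keep; assumption|]. intros xy Hxy. apply Hin. apply Hl'. assumption. }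
      rewrite <- Hcst in Hmain.
      rewrite (lsum_ext l' _ (fun xy => rpow (Rabs (f (fst xy) - f (snd xy))) p)) in Hmain.
      - lra.
      - intros xy _. rewrite rpow_rpow. f_equal. unfold b. field. lra. }
    assert (H0 : Rbar_le (Finite 0) nn) by (apply (nnsum_ge _ _ []); [constructor|intros ? []]).
    fold cst. destruct nn as [t| |]; simpl in *; try contradiction. lra.
Qed.

(** * Weights from a quasisymmetric metric *)

Context (rho : G -> G -> R) (th : R -> R) (alpha Ca : R) (mu : G -> R).
Hypothesis rho_met : is_metric rho.
Hypothesis th_homeo : homeo_halfline th.
Hypothesis rho_qs : theta_QS th d rho.
Hypothesis Ca_pos : 0 < Ca.
Hypothesis mu_nonneg : forall x, 0 <= mu x.
Hypothesis unbounded : diam rho = p_infty.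
Hypothesis AR : forall x s, 0 < s -> Rbar_le (rx rho x) (Finite s) -> Rbar_le (Finite s) (diam rho) ->
      Rbar_le (Finite (/ Ca * Rpower s alpha)) (nnsum (ball rho x s) mu) /\
      Rbar_le (nnsum (ball rho x s) mu) (Finite (Ca * Rpower s alpha)).

Lemma rho_nn x y : 0 <= rho x y.
Proof. apply rho_met. Qed.
Lemma rho_0 x : rho x x = 0.
Proof. apply rho_met. reflexivity. Qed.
Lemma rho_sym x y : rho x y = rho y x.
Proof. apply rho_met. Qed.
Lemma rho_tri x y z : rho x z <= rho x y + rho y z.
Proof. apply rho_met. Qed.
Lemma rho_pos x y : x <> y -> 0 < rho x y.
Proof. intros H. destruct (rho_nn x y) as [|E0]; [assumption|]. exfalso. apply H. apply (proj1 (proj2 rho_met)). congruence. Qed.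

Lemma qs_bounded L : 0 <= L -> exists C, 0 < C /\ forall x y z, x <> z -> d x y <= L * d x z -> rho x y <= C * rho x z.
Proof.
  intros HL. destruct (homeo_bounds th th_homeo) as (_ & Hb & _). destruct (Hb L HL) as (C & HC & H).
  exists C. split; [assumption|]. intros x y z Hne Hd. pose proof (d_pos_neq x z Hne) as Hp. pose proof (rho_pos x z Hne) as Hr.
  apply Rle_div_l; [assumption|]. eapply Rle_trans; [apply rho_qs; assumption|]. apply H. split.
  - apply Rdiv_le_0_compat; [apply d_metric|assumption].
  - apply Rle_div_l; assumption.
Qed.

Lemma qs_small e : 0 < e -> exists a, 0 < a /\ forall x y z, x <> z -> d x y <= a * d x z -> rho x y <= e * rho x z.
Proof.
  intros He. destruct (homeo_bounds th th_homeo) as (_ & _ & Hb). destruct (Hb e He) as (a & Ha & H).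
  exists a. split; [assumption|]. intros x y z Hne Hd. pose proof (d_pos_neq x z Hne) as Hp. pose proof (rho_pos x z Hne) as Hr.
  apply Rle_div_l; [assumption|]. eapply Rle_trans; [apply rho_qs; assumption|]. apply H. split.
  - apply Rdiv_le_0_compat; [apply d_metric|assumption].
  - apply Rle_div_l; assumption.
Qed.

(* The [rho]-diameter of a piece, dividing the length of an edge evenly along its cable. *)
Definition wt (u : V) : R :=
  match u with
  | RBase w => Rmax 0 (gd K rho w)
  | RSub w i _ => rho (w_ w) (wp w) * / 2 ^ nexp r i
  end.

Lemma wt_nn u : 0 <= wt u.
Proof.
  destruct u as [w|w i k]; simpl; [apply Rmax_l|]. apply Rmult_le_pos; [apply rho_nn|]. apply Rlt_le, Rinv_0_lt_compat, pow2_pos.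
Qed.

Lemma wt_cable w i k k' : wt (RSub w i k) = wt (RSub w i k').
Proof. reflexivity. Qed.

Lemma wt_base w : Te w -> (exists x y, K w x /\ K w y /\ x <> y /\ rho x y = wt (RBase w)) /\
  (forall x y, K w x -> K w y -> rho x y <= wt (RBase w)) /\ 0 < wt (RBase w).
Proof.
  intros Hw. destruct (gd_max rho w Hw) as ((x & y & Hx & Hy & Exy) & Hm).
  destruct (Te_nonempty w Hw) as (z & Hz). destruct (K_edge w z Hz) as (a & b & Hab & Ha & Hb).
  pose proof (rho_pos a b (E_neq a b Hab)) as Hp. pose proof (Hm a b Ha Hb) as Hg. simpl. rewrite Rmax_right by lra.
  split; [|split; [assumption|lra]]. exists x, y. repeat split; try assumption. intros <-. rewrite rho_0 in Exy. lra.
Qed.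

Lemma wt_pos u : rv u -> 0 < wt u.
Proof.
  destruct u as [w|w i k]; intros Hu; [apply wt_base; assumption|]. destruct Hu as (Hw & _). simpl.
  apply Rmult_lt_0_compat; [apply rho_pos, wm_spec; assumption|apply Rinv_0_lt_compat, pow2_pos].
Qed.

Lemma wt_base_far w x : Te w -> K w x -> exists y, K w y /\ x <> y /\ wt (RBase w) <= 2 * rho x y.
Proof.
  intros Hw Hx. destruct (wt_base w Hw) as ((a & b & Ha & Hb & _ & Eab) & _ & Hp). pose proof (rho_tri a x b) as Ht. rewrite (rho_sym a x) in Ht.
  destruct (Rle_dec (rho x a) (rho x b)).
  - exists b. split; [assumption|]. split; [intros <-; rewrite rho_0 in *; lra|lra].
  - exists a. split; [assumption|]. split; [intros <-; rewrite rho_0 in *; lra|lra].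
Qed.

Lemma gd_far m w x : lev m (RBase w) -> K w x -> exists z, K w z /\ x <> z /\ powerRZ r m <= 2 * Cg * d x z.
Proof.
  intros (Hw & Hm) Hx. simpl in Hm. destruct (gd_spec w Hw) as ((a & b & Ha & Hb & Eab) & _).
  destruct (gd_bd w Hw) as (H & _). rewrite Hm in H. pose proof (rpow_pos m). pose proof (gd_pos w Hw).
  assert (H2 : powerRZ r m <= Cg * gd K d w).
  { apply Rmult_le_reg_l with (/ Cg); [apply Cg_inv|]. rewrite <- Rmult_assoc, Rinv_l by lra. lra. }
  destruct d_metric as (_ & D0 & Ds & Dt). pose proof (Dt a x b) as Ht. rewrite (Ds a x) in Ht.
  assert (Dx : d x x = 0) by (apply D0; reflexivity).
  destruct (Rle_dec (d x a) (d x b)).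
  - exists b. split; [assumption|]. split; [intros <-; lra|nra].
  - exists a. split; [assumption|]. split; [intros <-; lra|nra].
Qed.

Lemma gd_near m w x y : lev m (RBase w) -> K w x -> K w y -> d x y <= Cg * powerRZ r m.
Proof.
  intros (Hw & Hm) Hx Hy. simpl in Hm. eapply Rle_trans; [apply (gd_le w); assumption|]. rewrite <- Hm. apply gd_bd. assumption.
Qed.

Lemma cable_E w : Le w -> E (w_ w) (wp w).
Proof.
  intros Hw. destruct (Le_edge w Hw) as (a & b & Hab & HKe). destruct (wm_spec w Hw) as (M1 & M2). pose proof (Hwp w Hw) as M3.
  apply HKe in M1. apply HKe in M3. destruct M1 as [E1 | E1], M3 as [E3 | E3].
  - congruence.
  - rewrite E1, E3. assumption.
  - rewrite E1, E3. apply (proj1 E_simple). assumption.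
  - congruence.
Qed.

(** On a base node all vertices lie within [Cg * r^m] of [x], so quasisymmetry compares them with
    [y]; on a cable [F1] bounds the length of the edge by [CF * d x y]. *)
Lemma wt_le_far c : 0 < c -> exists C, 0 < C /\ forall m u x y, lev m u -> inc u x -> x <> y -> c * powerRZ r m <= d x y -> wt u <= C * rho x y.
Proof.
  intros Hc. destruct (qs_bounded (Cg / c)) as (C1 & HC1 & H1); [apply Rdiv_le_0_compat; lra|].
  destruct (qs_bounded CF ltac:(lra)) as (C2 & HC2 & H2).
  exists (2 * C1 + C2). split; [lra|]. intros m u x y Hu Hx Hne Hd. pose proof (rho_pos x y Hne) as Hp.
  destruct u as [w|w i k].
  - pose proof Hu as (Hw & _). apply inc_RBase in Hx; [|assumption]. destruct (wt_base_far w x Hw Hx) as (z & Hz & _ & Hwz).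
    assert (rho x z <= C1 * rho x y); [|nra]. apply H1; [assumption|]. eapply Rle_trans; [apply (gd_near m w); assumption|].
    apply Rmult_le_reg_l with (c / Cg); [apply Rdiv_lt_0_compat; lra|].
    replace (c / Cg * (Cg * powerRZ r m)) with (c * powerRZ r m) by (field; lra). replace (c / Cg * (Cg / c * d x y)) with (d x y) by (field; lra). assumption.
  - destruct Hu as (Hv & _). pose proof Hv as (Hw & _). pose proof (inc_K w i k x Hv Hx) as HK. simpl.
    assert (Hone : / 2 ^ nexp r i <= 1) by (rewrite <- Rinv_1; apply Rinv_le_contravar; [lra|apply pow_R1_Rle; lra]).
    assert (0 < / 2 ^ nexp r i) by apply Rinv_0_lt_compat, pow2_pos. pose proof (rho_nn (w_ w) (wp w)).
    assert (rho (w_ w) (wp w) <= C2 * rho x y); [|nra].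
    pose proof (cable_E w Hw) as HE.
    apply K_Le in HK; [|assumption]. destruct HK as [-> | ->].
    + rewrite rho_sym. apply H2; [assumption|]. apply F1; [apply (proj1 E_simple); assumption|assumption].
    + apply H2; [assumption|]. apply F1; [assumption|assumption].
Qed.

Lemma shallow_exists : exists c0, forall w v x, Le w -> Te v -> K w x -> K v x -> (ht v - Z.of_nat c0 < ht w)%Z.
Proof.
  assert (HCC : 0 < Cg * Cg * (CF * CF)) by (repeat apply Rmult_lt_0_compat; lra).
  destruct (small_pow r (/ (Cg * Cg * (CF * CF))) r_bd) as (c0 & Hc0); [apply Rinv_0_lt_compat; assumption|].
  exists c0. intros w v x. apply edge_height. apply Rmult_lt_compat_r with (r := Cg * Cg * (CF * CF)) in Hc0; [|assumption]. rewrite Rinv_l in Hc0; lra.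
Qed.

Lemma pow2_nexp_ratio c0 i i' : (i' <= i + c0)%nat -> / 2 ^ nexp r i <= 2 * / r ^ c0 * / 2 ^ nexp r i'.
Proof.
  intros Hi. assert (Hr : 0 < r ^ c0) by (apply pow_lt; lra). pose proof (pow2_pos (nexp r i)). pose proof (pow2_pos (nexp r i')).
  assert (Hmon : (nexp r i' <= nexp r (i + c0))%nat).
  { replace (i + c0)%nat with (i' + (i + c0 - i'))%nat by lia. apply nexp_gap. }
  assert (H1 : 2 ^ nexp r i' <= 2 ^ nexp r i * INR (gap i c0)).
  { eapply Rle_trans; [apply Rle_pow; [lra|exact Hmon]|]. rewrite !pow2_nat, (pow2_gap i c0), mult_INR. lra. }
  destruct (gap_bounds i c0) as (_ & H2).
  assert (H3 : INR (gap i c0) <= 2 * / r ^ c0).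
  { apply Rmult_le_reg_l with (r ^ c0); [assumption|]. replace (r ^ c0 * (2 * / r ^ c0)) with 2 by (field; lra). lra. }
  apply Rmult_le_reg_l with (2 ^ nexp r i * 2 ^ nexp r i'); [apply Rmult_lt_0_compat; assumption|].
  replace (2 ^ nexp r i * 2 ^ nexp r i' * / 2 ^ nexp r i) with (2 ^ nexp r i') by (field; lra).
  replace (2 ^ nexp r i * 2 ^ nexp r i' * (2 * / r ^ c0 * / 2 ^ nexp r i')) with (2 ^ nexp r i * (2 * / r ^ c0)) by (field; lra).
  eapply Rle_trans; [exact H1|]. apply Rmult_le_compat_l; lra.
Qed.

Lemma cable_other w x : Le w -> K w x -> exists y, K w y /\ E x y /\ x <> y /\ rho (w_ w) (wp w) = rho x y /\ gd K d w = d x y.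
Proof.
  intros Hw Hx. pose proof (cable_E w Hw) as HE. destruct (wm_spec w Hw) as (M1 & M2). pose proof (Hwp w Hw) as M3.
  apply K_Le in Hx; [|assumption]. destruct Hx as [-> | ->].
  - exists (w_ w). split; [assumption|]. split; [apply (proj1 E_simple); assumption|]. split; [congruence|]. split; [apply rho_sym|]. apply Le_gd; auto.
  - exists (wp w). split; [assumption|]. split; [assumption|]. split; [congruence|]. split; [reflexivity|]. apply Le_gd; auto.
Qed.

(** At a common vertex [x] both weights are compared with [rho x z] for another vertex [z] of the
    first piece or its edge. By [shallow_exists] cables that meet have ages differing by at most
    [c0], so their subdivisions differ by a bounded factor. *)
Lemma wt_adj : exists A, 1 <= A /\ forall m u v, adj (lev m) tch u v -> wt v <= A * wt u.
Proof.
  destruct shallow_exists as (c0 & Hc0).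
  assert (Hr0 : 0 < r ^ c0) by (apply pow_lt; lra). assert (Hr1 : 1 <= / r ^ c0).
  { rewrite <- Rinv_1. apply Rinv_le_contravar; [assumption|apply pow_le1; lra]. }
  destruct (wt_le_far (/ (2 * Cg)) ltac:(apply Rinv_0_lt_compat; lra)) as (C1 & HC1 & H1).
  destruct (qs_bounded CF ltac:(lra)) as (C2 & HC2 & H2).
  destruct (wt_le_far (/ Cg * / 1) ltac:(rewrite Rinv_1, Rmult_1_r; apply Cg_inv)) as (C3 & HC3 & H3).
  set (A := 1 + C1 + C3 * (2 * / r ^ c0) + C2 * (2 * / r ^ c0)).
  assert (HA1 : 0 < C3 * (2 * / r ^ c0)) by (apply Rmult_lt_0_compat; lra).
  assert (HA2 : 0 < C2 * (2 * / r ^ c0)) by (apply Rmult_lt_0_compat; lra).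
  exists A. split; [unfold A; lra|]. intros m u v (Hu & Hv & Ht). pose proof (wt_nn u) as Hnn.
  destruct (tch_cases m u v Hu Hv Ht) as [(x & Hxu & Hxv)|(w & i & k & k' & -> & -> & _)].
  2:{ rewrite (wt_cable w i k' k). unfold A. nra. }
  destruct u as [w|w i k].
  - pose proof Hu as (Hw & _). apply inc_RBase in Hxu; [|assumption]. destruct (gd_far m w x Hu Hxu) as (z & Hz & Hne & Hd).
    assert (wt v <= C1 * rho x z) as Hv1.
    { apply (H1 m); [assumption|assumption|assumption|]. apply Rmult_le_reg_l with (2 * Cg); [lra|]. rewrite <- Rmult_assoc, Rinv_r by lra. lra. }
    destruct (wt_base w Hw) as (_ & Hm & _). specialize (Hm x z Hxu Hz). pose proof (rho_nn x z). unfold A. nra.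
  - pose proof Hu as (Hru & Hmu). pose proof Hru as (Hw & Hi & _). pose proof (inc_K w i k x Hru Hxu) as HKx.
    destruct (cable_other w x Hw HKx) as (y & HKy & Hxy & Hne & Er & Ed). pose proof (rho_pos x y Hne) as Hrp. cbn [wt] in *. rewrite Er in *.
    set (e := / 2 ^ nexp r i) in *. assert (He : 0 < e) by apply Rinv_0_lt_compat, pow2_pos.
    destruct v as [v|w' i' k'].
    + pose proof Hv as (Hv' & Hmv). apply inc_RBase in Hxv; [|assumption]. specialize (Hc0 w v x Hw Hv' HKx Hxv). simpl in Hmu, Hmv.
      assert (wt (RBase v) <= C3 * rho x y) as Hv3.
      { apply (H3 m); [assumption|apply inc_RBase; assumption|assumption|]. rewrite Rinv_1, Rmult_1_r, <- Ed.
        destruct (gd_bd w (Le_Te w Hw)) as (Hl & _). eapply Rle_trans; [|exact Hl]. apply Rmult_le_compat_l; [apply Rlt_le, Cg_inv|].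
        apply powerRZ_anti; [assumption|lia]. }
      assert (Hone : 1 <= 2 * / r ^ c0 * e).
      { pose proof (pow2_nexp_ratio c0 0 i ltac:(lia)) as Hp. rewrite nexp_0 in Hp. simpl in Hp. rewrite Rinv_1 in Hp. exact Hp. }
      eapply Rle_trans; [exact Hv3|]. apply Rle_trans with (C3 * (2 * / r ^ c0) * (rho x y * e)).
      * replace (C3 * (2 * / r ^ c0) * (rho x y * e)) with (C3 * rho x y * (2 * / r ^ c0 * e)) by ring.
        assert (0 < C3 * rho x y) by (apply Rmult_lt_0_compat; assumption). nra.
      * apply Rmult_le_compat_r; [assumption|]. unfold A. lra.
    + pose proof Hv as (Hrv & Hmv). pose proof Hrv as (Hw' & Hi' & _). pose proof (inc_K w' i' k' x Hrv Hxv) as HKx'.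
      destruct (cable_other w' x Hw' HKx') as (y' & HKy' & Hxy' & Hne' & Er' & Ed'). cbn [wt]. rewrite Er'.
      pose proof (Hc0 w w' x Hw (Le_Te w' Hw') HKx HKx') as Hh. simpl in Hmu, Hmv.
      assert (rho x y' <= C2 * rho x y) as Hrr by (apply H2; [assumption|]; apply F1; assumption).
      pose proof (pow2_nexp_ratio c0 i' i) as Hp. specialize (Hp ltac:(lia)). fold e in Hp.
      assert (0 < / 2 ^ nexp r i') by apply Rinv_0_lt_compat, pow2_pos. pose proof (rho_nn x y').
      apply Rle_trans with (C2 * rho x y * (2 * / r ^ c0 * e)).
      * apply Rmult_le_compat; lra.
      * replace (C2 * rho x y * (2 * / r ^ c0 * e)) with (C2 * (2 * / r ^ c0) * (rho x y * e)) by ring.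
        apply Rmult_le_compat_r; [assumption|]. unfold A. lra.
Qed.

Lemma wt_par m v : lev (m + 1)%Z v -> wt v <= wt (par v).
Proof.
  intros (Hv & Hm). destruct v as [w|w i k].
  - simpl par. destruct (wt_base w Hv) as ((x & y & Hx & Hy & _ & <-) & _). apply wt_base; [apply Te_pi; assumption|apply K_pi; assumption|apply K_pi; assumption].
  - destruct Hv as (Hw & Hi & Hk). destruct (wm_spec w Hw) as (M1 & _). pose proof (Hwp w Hw). pose proof (rho_nn (w_ w) (wp w)).
    simpl par. destruct (Nat.leb_spec i 1).
    + destruct (wt_base w (Le_Te w Hw)) as (_ & Hmx & _). specialize (Hmx _ _ M1 H). cbn [wt] in *.
      assert (/ 2 ^ nexp r i <= 1) by (rewrite <- Rinv_1; apply Rinv_le_contravar; [lra|apply pow_R1_Rle; lra]).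
      eapply Rle_trans; [|exact Hmx]. rewrite <- (Rmult_1_r (rho (w_ w) (wp w))) at 2. apply Rmult_le_compat_l; assumption.
    + cbn [wt]. apply Rmult_le_compat_l; [assumption|]. apply Rinv_le_contravar; [apply pow2_pos|]. apply Rle_pow; [lra|].
      replace i with (i - 1 + 1)%nat at 2 by lia. apply nexp_gap.
Qed.

Lemma wt_iter k : forall m v, lev (m + Z.of_nat k)%Z v -> wt v <= wt (Nat.iter k par v).
Proof.
  induction k as [|k IH]; intros m v Hv; simpl; [lra|].
  assert (Hv' : lev (m + 1 + Z.of_nat k)%Z v) by (replace (m + 1 + Z.of_nat k)%Z with (m + Z.of_nat (S k))%Z by lia; assumption).
  eapply Rle_trans; [apply (IH (m + 1)%Z); assumption|]. apply (wt_par m). apply node_lev_iter. assumption.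
Qed.

(** The ancestor contains a vertex at [d]-distance of order [r^m] from [x], much more than the size
    of the piece, and [qs_small] turns this into a definite factor for [rho]. On cables the number
    of intervals does it. *)
Lemma wt_half : exists K1, (1 <= K1)%nat /\ forall m v, lev (m + Z.of_nat K1)%Z v -> wt v <= / 2 * wt (Nat.iter K1 par v).
Proof.
  destruct (qs_small (/ 2) ltac:(lra)) as (a & Ha & Hq).
  destruct (small_pow r (Rmin (/ 4) (a / (2 * Cg * Cg))) r_bd) as (K1 & HK1).
  { apply Rmin_glb_lt; [lra|]. apply Rdiv_lt_0_compat; [assumption|nra]. }
  pose proof (Rmin_l (/ 4) (a / (2 * Cg * Cg))). pose proof (Rmin_r (/ 4) (a / (2 * Cg * Cg))).
  assert (HK0 : (1 <= K1)%nat) by (destruct K1; [simpl in HK1; lra|lia]).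
  exists K1. split; [assumption|]. intros m v Hv. pose proof (node_lev_iter m K1 v Hv) as Hp. pose proof Hv as (Hrv & Hhv).
  assert (HrK : 0 < r ^ K1) by (apply pow_lt; lra).
  destruct v as [w|w i k].
  - rewrite iter_RBase in *. pose proof Hp as (Hw' & _). destruct (wt_base w Hrv) as ((x & y & Hx & Hy & Hne & Exy) & _). rewrite <- Exy.
    pose proof (K_iter K1 w x Hx) as Hx'. destruct (gd_far m _ x Hp Hx') as (z & Hz & Hxz & Hd).
    pose proof (gd_near _ w x y Hv Hx Hy) as Hn. rewrite powerRZ_nat in Hn by lra.
    destruct (wt_base _ Hw') as (_ & Hmx & _). specialize (Hmx x z Hx' Hz).
    assert (rho x y <= / 2 * rho x z); [|lra]. apply Hq; [assumption|].
    eapply Rle_trans; [exact Hn|]. pose proof (rpow_pos m).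
    assert (HC0 : 0 < 2 * Cg * Cg) by nra. assert (Hc : r ^ K1 * (2 * Cg * Cg) <= a) by (apply Rlt_le; apply (proj2 (Rlt_div_r _ _ _ HC0)); lra).
    assert (0 < d x z) by (apply d_pos_neq; assumption).
    apply Rle_trans with (Cg * (r ^ K1 * (2 * Cg * d x z))).
    + apply Rmult_le_compat_l; [lra|]. apply Rmult_le_compat_l; lra.
    + replace (Cg * (r ^ K1 * (2 * Cg * d x z))) with (r ^ K1 * (2 * Cg * Cg) * d x z) by ring. apply Rmult_le_compat_r; lra.
  - destruct Hrv as (Hw & Hi & Hk). destruct (wm_spec w Hw) as (M1 & _). pose proof (Hwp w Hw) as Mp. pose proof (rho_nn (w_ w) (wp w)) as Hnn.
    destruct (Nat.lt_ge_cases K1 i) as [Hlt|Hge].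
    + rewrite iter_RSub by assumption. cbn [wt]. rewrite (Rmult_comm (/ 2)), Rmult_assoc. apply Rmult_le_compat_l; [assumption|].
      assert (Hg : 2 < INR (gap (i - K1) K1)) by (apply gap_large; lra).
      pose proof (pow2_gap (i - K1) K1) as Eg. replace (i - K1 + K1)%nat with i in Eg by lia.
      rewrite !pow2_nat, Eg, mult_INR, <- Rinv_mult, <- pow2_nat. apply Rinv_le_contravar; [|apply Rmult_le_compat_l; [apply Rlt_le, pow2_pos|lra]].
      apply Rmult_lt_0_compat; [apply pow2_pos|lra].
    + rewrite iter_RSub_base in * by lia. pose proof Hp as (Hw' & _). destruct (wt_base _ Hw') as (_ & Hmx & _).
      specialize (Hmx _ _ (K_iter (K1 - i) w _ M1) (K_iter (K1 - i) w _ Mp)). cbn [wt] in *.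
      pose proof (nexp_pos i Hi) as Hn1. assert (/ 2 ^ nexp r i <= / 2).
      { apply Rinv_le_contravar; [lra|]. apply Rle_trans with (2 ^ 1); [lra|]. apply Rle_pow; [lra|assumption]. }
      rewrite Rmult_comm. apply Rmult_le_compat; try assumption. apply Rlt_le, Rinv_0_lt_compat, pow2_pos.
Qed.

Lemma wt_decay K1 : (forall m v, lev (m + Z.of_nat K1)%Z v -> wt v <= / 2 * wt (Nat.iter K1 par v)) ->
  forall q k m v, (q * K1 <= k)%nat -> lev (m + Z.of_nat k)%Z v -> wt v <= (/ 2) ^ q * wt (Nat.iter k par v).
Proof.
  intros HK q. induction q as [|q IH]; intros k m v Hk Hv.
  - simpl. rewrite Rmult_1_l. apply (wt_iter k m). assumption.
  - simpl in Hk. replace k with ((k - K1) + K1)%nat by lia. rewrite Nat.iter_add.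
    assert (Hv' : lev (m + Z.of_nat (k - K1) + Z.of_nat K1)%Z v) by (replace (m + Z.of_nat (k - K1) + Z.of_nat K1)%Z with (m + Z.of_nat k)%Z by lia; assumption).
    specialize (HK _ _ Hv'). pose proof (node_lev_iter _ _ _ Hv') as Hp. specialize (IH (k - K1)%nat m _ ltac:(lia) Hp). simpl. lra.
Qed.

Hypothesis F2 : forall eps, 0 < eps -> exists s, 0 < s /\ exists (n : nat) (xs : nat -> G),
      (1 <= n)%nat /\
      (forall i, (i < n)%nat -> ball d (xs O) s (xs i)) /\
      ~ ball d (xs O) s (xs n) /\
      (forall i, (1 <= i <= n)%nat -> E (xs i) (xs (i - 1)%nat) /\
                                      d (xs i) (xs (i - 1)%nat) <= eps * s).

(** The chain of (F2) has short steps for [d]. Each of its points is at distance at least [s / 2]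
    from one of the two ends, and [qs_small] with that end as third point makes the steps short for
    [rho]. *)
Lemma exponent_ge1 : 1 <= alpha.
Proof.
  apply (AR_exponent_ge1 rho alpha Ca mu rho_met Ca_pos mu_nonneg unbounded AR). intros e He.
  destruct (qs_bounded 2 ltac:(lra)) as (C & HC & HQ1).
  destruct (qs_small (e / C)) as (a & Ha & HQ2); [apply Rdiv_lt_0_compat; assumption|].
  destruct (F2 (a / 2)) as (s & Hs & n & xs & Hn & Hin & Hout & Hst); [lra|].
  destruct d_metric as (D0 & D1 & Ds & Dt). unfold ball in *. apply Rnot_lt_le in Hout.
  assert (Hne : xs 0%nat <> xs n) by (intros E0; assert (d (xs 0%nat) (xs n) = 0) by (apply D1; assumption); lra).
  pose proof (rho_pos _ _ Hne) as Hp. exists n, xs. split; [assumption|]. split; [assumption|].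
  intros i Hi. destruct (Hst i Hi) as (HE & Hd). split; [apply E_neq; assumption|].
  assert (Hdi : d (xs 0%nat) (xs i) <= d (xs 0%nat) (xs n)).
  { destruct (Nat.eq_dec i n) as [->|]; [lra|]. specialize (Hin i ltac:(lia)). lra. }
  assert (Hz : exists z, xs i <> z /\ s / 2 <= d (xs i) z /\ rho (xs i) z <= C * rho (xs 0%nat) (xs n)).
  { pose proof (Dt (xs 0%nat) (xs i) (xs n)) as Ht. destruct (Rle_dec (s / 2) (d (xs i) (xs 0%nat))) as [H|H].
    - exists (xs 0%nat). split; [intros E0; apply D1 in E0; lra|]. split; [assumption|]. rewrite rho_sym. apply HQ1; [assumption|lra].
    - rewrite (Ds (xs i) (xs 0%nat)) in H. exists (xs n). split; [intros E0; apply D1 in E0; lra|]. split; [lra|].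
      rewrite (rho_sym (xs i)), (rho_sym (xs 0%nat)). apply HQ1; [congruence|].
      pose proof (Dt (xs n) (xs 0%nat) (xs i)). rewrite (Ds (xs n) (xs 0%nat)) in *. lra. }
  destruct Hz as (z & Hxz & Hdz & Hrz).
  apply Rle_trans with (e / C * rho (xs i) z).
  - apply HQ2; [assumption|]. nra.
  - replace (e * rho (xs 0%nat) (xs n)) with (e / C * (C * rho (xs 0%nat) (xs n))) by (field; lra).
    apply Rmult_le_compat_l; [apply Rlt_le, Rdiv_lt_0_compat; assumption|assumption].
Qed.

(** Going up [t] generations brings the distance [Cc * r^m] below the threshold of [fl_near], so the
    ancestors lie within [M] of one node through [z]. *)
Lemma node_count Cc : 0 < Cc -> exists Dn : nat, forall m z, exists l, (length l <= Dn)%nat /\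
  forall v x, lev m v -> inc v x -> d x z <= Cc * powerRZ r m -> In v l.
Proof.
  intros HC. destruct refined_filling as (nb & D & B & M & n1 & C7 & HD & HB & Hn1 & HC7 & Fl).
  pose proof c8_pos as Hc8. destruct (small_pow r (c8 / Cc) r_bd) as (t & Ht); [apply Rdiv_lt_0_compat; assumption|].
  exists (D ^ M * B ^ t)%nat. intros m z. destruct (cover (m - Z.of_nat t) z) as (u0 & Hu0 & Hz).
  destruct (choice (fun u lc => lev (m - Z.of_nat t)%Z u -> (length lc <= B ^ t)%nat /\
      forall v, lev (m - Z.of_nat t + Z.of_nat t)%Z v -> Nat.iter t par v = u -> In v lc)) as (g & Hg).
  { intros u. destruct (classic (lev (m - Z.of_nat t)%Z u)) as [Hu|Hu]; [|exists []; tauto].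
    destruct (children_list _ _ _ _ _ _ _ _ _ _ _ _ _ _ Fl HD HB Hn1 r_bd t _ u Hu) as (l & H). exists l. auto. }
  assert (Hbl : forall v, In v (bl nb M u0) <-> within (adj (lev (m - Z.of_nat t)%Z) tch) M u0 v).
  { intros v. apply bl_spec; [destruct Fl; eauto|destruct Fl; eauto|assumption]. }
  exists (flat_map g (bl nb M u0)). split.
  - eapply Nat.le_trans; [apply (length_flat_map_le _ _ (B ^ t))|].
    + intros u Hu. apply Hg. apply Hbl in Hu. eapply within_adj_X; eassumption.
    + apply Nat.mul_le_mono_r. apply (bl_length (lev (m - Z.of_nat t)%Z) tch); [destruct Fl; eauto|destruct Fl; eauto|destruct Fl; eauto|assumption].
  - intros v x Hv Hx Hd. replace m with (m - Z.of_nat t + Z.of_nat t)%Z in Hv by lia.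
    pose proof (node_lev_iter _ _ _ Hv) as Hp. pose proof (node_inc_iter _ _ _ _ Hv Hx) as Hpx.
    apply in_flat_map. exists (Nat.iter t par v). split; [|apply Hg; auto].
    apply Hbl. apply within_sym; [intros a b (A1 & A2 & A3); split; [|split]; try assumption; apply tch_sym; assumption|].
    apply (within_impl (fun a b => adj (lev (m - Z.of_nat t)%Z) tch a b /\ exists z, inc a z /\ inc b z)); [tauto|].
    apply (fl_near _ _ _ _ _ _ _ _ _ _ _ _ _ _ Fl _ _ _ x z Hp Hu0 Hpx Hz).
    eapply Rle_lt_trans; [exact Hd|]. replace m with (m - Z.of_nat t + Z.of_nat t)%Z at 1 by lia. rewrite powerRZ_nat by lra.
    rewrite <- Rmult_assoc. apply Rmult_lt_compat_r; [apply rpow_pos|]. rewrite Rmult_comm. apply (proj2 (Rlt_div_r _ _ _ HC)). assumption.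
Qed.

(** Dividing a length into equal parts does not increase the sum of [alpha]-th powers, because
    [alpha >= 1]. *)
Lemma split_power t g : 0 < t -> (1 <= g)%nat -> INR g * Rpower (t * / INR g) alpha <= Rpower t alpha.
Proof.
  intros Ht Hg. assert (HgR : 1 <= INR g) by (apply (le_INR 1); assumption). pose proof exponent_ge1 as Hal.
  assert (Hi : 0 < / INR g) by (apply Rinv_0_lt_compat; lra).
  rewrite <- Rpower_mult_distr, Rpower_inv by lra.
  assert (INR g <= Rpower (INR g) alpha). { rewrite <- (Rpower_1 (INR g)) at 1 by lra. apply Rle_Rpower; lra. }
  pose proof (Rpower_pos (INR g) alpha). pose proof (Rpower_pos t alpha).
  replace (INR g * (Rpower t alpha * / Rpower (INR g) alpha)) with (Rpower t alpha * (INR g * / Rpower (INR g) alpha)) by ring.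
  rewrite <- (Rmult_1_r (Rpower t alpha)) at 2. apply Rmult_le_compat_l; [lra|].
  apply Rmult_le_reg_r with (Rpower (INR g) alpha); [assumption|]. rewrite Rmult_assoc, Rinv_l by lra. lra.
Qed.

(** By [F1] every other point is at [rho]-distance at least [e / C] from the end of the edge, so
    [AR_point] bounds its point mass from below. *)
Lemma cable_mass : exists C, 0 < C /\ forall w, Le w -> Rpower (rho (w_ w) (wp w)) alpha <= C * mu (wp w).
Proof.
  destruct (qs_bounded CF ltac:(lra)) as (C & HC & HQ). pose proof (Rpower_pos C alpha) as HCp.
  exists (Rpower C alpha * Ca). split; [apply Rmult_lt_0_compat; assumption|]. intros w Hw.
  destruct (wm_spec w Hw) as (_ & Hne). pose proof (rho_pos _ _ Hne) as Hp. pose proof exponent_ge1 as Hal.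
  set (e := rho (w_ w) (wp w)) in *.
  replace e with (C * (e / C)) by (field; lra). rewrite <- Rpower_mult_distr; [|assumption|apply Rdiv_lt_0_compat; assumption].
  rewrite Rmult_assoc. apply Rmult_le_compat_l; [lra|].
  apply (AR_point rho alpha Ca mu Ca_pos mu_nonneg unbounded AR); [apply Rdiv_lt_0_compat; assumption| |eauto|lra].
  intros y Hy. apply Rle_div_l; [assumption|]. rewrite Rmult_comm. unfold e. rewrite rho_sym. apply HQ; [congruence|].
  apply F1; [|congruence]. apply (proj1 E_simple), cable_E. assumption.
Qed.

(** * Sums of powers of weights *)

Notation wta := (fun v => Rpower (wt v) alpha).

Lemma cable_sum w i a g t l : 0 < t -> (1 <= g)%nat -> NoDup l -> wt (RSub w i 0) = t * / INR g ->
  (forall v, In v l -> exists k, v = RSub w i k /\ (a <= k < a + g)%nat) -> lsum l wta <= Rpower t alpha.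
Proof.
  intros Ht Hg Hl Hw Hin. eapply Rle_trans; [|apply (split_power t g); assumption].
  assert (Hlen : (length l <= g)%nat).
  { rewrite <- (length_seq g a), <- (length_map (RSub w i)). apply NoDup_incl_length; [assumption|].
    intros v Hv. destruct (Hin v Hv) as (k & -> & Hk). apply in_map, in_seq. lia. }
  eapply Rle_trans; [apply (lsum_const_le l wta (Rpower (t * / INR g) alpha))|].
  - intros v Hv. destruct (Hin v Hv) as (k & -> & _). rewrite (wt_cable w i k 0), Hw. lra.
  - apply Rmult_le_compat_r; [apply Rlt_le, Rpower_pos|]. apply le_INR. assumption.
Qed.

Lemma piece_ball_mass m w Z : lev m (RBase w) -> NoDup Z ->
  (forall z, In z Z -> exists x, K w x /\ rho x z <= wt (RBase w)) -> lsum Z mu <= Ca * Rpower 3 alpha * wta (RBase w).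
Proof.
  intros (Hw & _) HZ Hb. destruct (wt_base w Hw) as (_ & Hm & Hp). destruct (Te_nonempty w Hw) as (x0 & Hx0).
  destruct (wt_base_far w x0 Hw Hx0) as (y & Hy & Hne & _).
  rewrite Rmult_assoc, Rpower_mult_distr by lra.
  apply (AR_upper rho alpha Ca mu unbounded AR x0); [lra| |assumption|].
  - exists y. split; [congruence|]. specialize (Hm x0 y Hx0 Hy). lra.
  - intros z Hz. destruct (Hb z Hz) as (x & Hx & Hxz). specialize (Hm x0 x Hx0 Hx). pose proof (rho_tri x0 x z). lra.
Qed.

(** Each piece pays for its weight with the measure of a ball of radius [wt v] about one of its
    vertices. Overlap is bounded: if [d x z] were large against [r^(m+k)], quasisymmetry would make
    [rho x z] exceed [wt v]. All these balls lie in one ball of radius [3 * wt w]. *)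
Lemma base_mass : exists C, 0 < C /\ forall m k w Y, lev m (RBase w) -> NoDup Y ->
  (forall v, In v Y -> (exists w', v = RBase w') /\ lev (m + Z.of_nat k)%Z v /\ Nat.iter k par v = RBase w) ->
  lsum Y wta <= C * wta (RBase w).
Proof.
  destruct (qs_small (/ 4) ltac:(lra)) as (a & Ha & HQ).
  destruct (node_count (Cg / a)) as (Dn & HDn); [apply Rdiv_lt_0_compat; lra|].
  set (C := 2 * Ca * (INR Dn * (Ca * Rpower 3 alpha))).
  assert (HC : 0 <= C).
  { unfold C. pose proof (Rpower_pos 3 alpha). pose proof (pos_INR Dn). repeat apply Rmult_le_pos; lra. }
  exists (C + 1). split; [lra|]. intros m k w Y Hw HY Hin.
  destruct (choice (fun v (xl : G * list G) => In v Y -> inc v (fst xl) /\ NoDup (snd xl) /\ (forall z, In z (snd xl) -> rho (fst xl) z < wt v) /\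
    Rpower (wt v) alpha <= 2 * Ca * lsum (snd xl) mu)) as (g & Hg).
  { intros v. destruct (classic (In v Y)) as [Hv|Hv]; [|exists (f_enum 0%nat, []); tauto].
    destruct (Hin v Hv) as ((w' & ->) & (Hw' & _) & _). destruct (Te_nonempty w' Hw') as (x & Hx).
    destruct (wt_base w' Hw') as (_ & Hm & Hp). destruct (wt_base_far w' x Hw' Hx) as (y & Hy & Hne & _).
    destruct (AR_lower rho alpha Ca mu Ca_pos unbounded AR x (wt (RBase w')) Hp) as (l & L1 & L2 & L3).
    { exists y. split; [congruence|apply Hm; assumption]. }
    exists (x, l). intros _. split; [apply inc_RBase; assumption|]. auto. }
  destruct (choice (fun z l => (length l <= Dn)%nat /\ forall v x, lev (m + Z.of_nat k)%Z v -> inc v x -> d x z <= Cg / a * powerRZ r (m + Z.of_nat k) -> In v l)) as (gi & Hgi).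
  { intros z. apply HDn. }
  set (Z := ndup (flat_map (fun v => snd (g v)) Y)).
  assert (H1 : lsum Y wta <= 2 * Ca * lsum Y (fun v => lsum (snd (g v)) mu)).
  { rewrite <- lsum_scal. apply lsum_le. intros v Hv. apply Hg. assumption. }
  assert (H2 : lsum Y (fun v => lsum (snd (g v)) mu) <= INR Dn * lsum Z mu).
  { apply (lsum_double_count Y Z (fun v => snd (g v)) gi Dn mu HY).
    - intros v Hv. apply Hg. assumption.
    - intros v Hv z Hz. apply In_ndup, in_flat_map. eauto.
    - intros v z Hv Hz. destruct (Hg v Hv) as (G1 & _ & G3 & _). specialize (G3 z Hz).
      destruct (Hin v Hv) as ((w' & ->) & Hlev & _). apply (proj2 (Hgi z) _ (fst (g (RBase w')))); [assumption|assumption|].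
      set (x := fst (g (RBase w'))) in *. apply Rnot_lt_le. intros Hlt.
      pose proof Hlev as (Hw' & _). apply inc_RBase in G1; [|assumption].
      destruct (wt_base_far w' x Hw' G1) as (y & Hy & Hne & Hwt). destruct (wt_base w' Hw') as (_ & _ & Hp).
      pose proof (gd_near _ w' x y Hlev G1 Hy) as Hd.
      assert (Hxz : x <> z).
      { intros <-. assert (d x x = 0) as Dx by (apply d_metric; reflexivity). rewrite Dx in Hlt.
        assert (0 < Cg / a * powerRZ r (m + Z.of_nat k)); [|lra]. apply Rmult_lt_0_compat; [apply Rdiv_lt_0_compat; lra|apply rpow_pos]. }
      assert (rho x y <= / 4 * rho x z); [|lra]. apply HQ; [assumption|].
      eapply Rle_trans; [exact Hd|]. apply Rmult_le_reg_l with (/ a); [apply Rinv_0_lt_compat; assumption|].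
      rewrite <- (Rmult_assoc (/ a) a), Rinv_l, Rmult_1_l by lra. unfold Rdiv in Hlt. lra.
    - intros z _. apply Hgi.
    - intros z _. apply mu_nonneg. }
  assert (H3 : lsum Z mu <= Ca * Rpower 3 alpha * wta (RBase w)).
  { apply (piece_ball_mass m); [assumption|apply NoDup_ndup|]. intros z Hz. apply In_ndup, in_flat_map in Hz. destruct Hz as (v & Hv & Hz).
    destruct (Hg v Hv) as (G1 & _ & G3 & _). destruct (Hin v Hv) as (_ & Hlev & Ev). exists (fst (g v)). split.
    - pose proof Hw as (HT & _). apply inc_RBase; [assumption|]. rewrite <- Ev. eapply node_inc_iter; eassumption.
    - apply Rlt_le. eapply Rlt_le_trans; [apply G3; assumption|]. rewrite <- Ev. apply (wt_iter k m). assumption. }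
  pose proof (Rpower_pos (wt (RBase w)) alpha) as Hpos. pose proof (pos_INR Dn) as HDn0.
  apply Rle_trans with (C * wta (RBase w)); [|nra].
  eapply Rle_trans; [exact H1|]. replace (C * wta (RBase w)) with (2 * Ca * (INR Dn * (Ca * Rpower 3 alpha * wta (RBase w)))) by (unfold C; ring).
  apply Rmult_le_compat_l; [lra|]. eapply Rle_trans; [exact H2|]. apply Rmult_le_compat_l; assumption.
Qed.

(** Intervals are summed cable by cable, and each cable is charged to the point mass at its end
    [wp u]. A vertex receives at most [Dg] charges, because the other ends are distinct neighbours
    of it. *)
Lemma cables_mass : exists C, 0 < C /\ forall m k w Y, lev m (RBase w) -> NoDup Y ->
  (forall v, In v Y -> (exists u i j, v = RSub u i j) /\ lev (m + Z.of_nat k)%Z v /\ Nat.iter k par v = RBase w) ->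
  lsum Y wta <= C * wta (RBase w).
Proof.
  destruct cable_mass as (Cm & HCm & Hcm). set (C := Cm * (INR Dg * (Ca * Rpower 3 alpha))).
  assert (HC : 0 <= C).
  { unfold C. pose proof (Rpower_pos 3 alpha). pose proof (pos_INR Dg). repeat apply Rmult_le_pos; lra. }
  exists (C + 1). split; [lra|]. intros m k w Y Hw HY Hin.
  set (edge := fun v : V => match v with RBase u => u | RSub u _ _ => u end).
  set (U := ndup (map edge Y)). set (dp := fun u => Z.to_nat (m + Z.of_nat k - ht u)).
  set (L := fun u => map (RSub u (dp u)) (seq 0 (2 ^ nexp r (dp u)))).
  assert (HU : forall u, In u U -> Le u /\ K w (wp u)).
  { intros u Hu. apply In_ndup, in_map_iff in Hu. destruct Hu as (v & <- & Hv).
    destruct (Hin v Hv) as ((u & i & j & ->) & ((Hu & Hi & Hj) & Hm) & Ev). simpl. split; [assumption|].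
    assert (i <= k)%nat by (apply Nat.nlt_ge; intros Hlt; rewrite iter_RSub in Ev by assumption; discriminate).
    rewrite iter_RSub_base in Ev by lia. injection Ev as <-. apply K_iter. apply Hwp. assumption. }
  assert (H1 : lsum Y wta <= lsum U (fun u => lsum (L u) wta)).
  { rewrite <- lsum_flat_map. apply lsum_incl; [assumption| |intros; apply Rlt_le, Rpower_pos].
    intros v Hv. apply in_flat_map. exists (edge v). split; [apply In_ndup, in_map; assumption|].
    destruct (Hin v Hv) as ((u & i & j & ->) & ((Hu & Hi & Hj) & Hm) & _). simpl in *. unfold L.
    assert (dp u = i) as -> by (unfold dp; lia). apply in_map, in_seq. lia. }
  assert (H2 : lsum U (fun u => lsum (L u) wta) <= Cm * lsum U (fun u => lsum [wp u] mu)).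
  { rewrite <- lsum_scal. apply lsum_le. intros u Hu. destruct (HU u Hu) as (HL & _).
    replace (lsum [wp u] mu) with (mu (wp u)) by (unfold lsum; simpl; ring).
    eapply Rle_trans; [|apply Hcm; assumption].
    apply (cable_sum u (dp u) 0 (2 ^ nexp r (dp u))).
    - apply rho_pos, wm_spec. assumption.
    - pose proof (Nat.pow_nonzero 2 (nexp r (dp u)) ltac:(lia)). lia.
    - apply FinFun.Injective_map_NoDup; [intros x y Exy; injection Exy; auto|apply seq_NoDup].
    - cbn [wt]. rewrite pow2_nat. reflexivity.
    - intros v Hv. apply in_map_iff in Hv. destruct Hv as (j & <- & Hj). apply in_seq in Hj. exists j. split; [reflexivity|lia]. }
  set (Z := ndup (map wp U)).
  assert (H3 : lsum U (fun u => lsum [wp u] mu) <= INR Dg * lsum Z mu).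
  { apply (lsum_double_count U Z (fun u => [wp u]) (fun z => keep (fun u => wp u = z) U) Dg mu).
    - apply NoDup_ndup.
    - intros; constructor; [intros []|constructor].
    - intros u Hu z [<-|[]]. apply In_ndup, in_map. assumption.
    - intros u z Hu [<-|[]]. apply In_keep. auto.
    - intros z _. set (lf := keep _ _).
      assert (Hlf : forall u, In u lf -> Le u /\ wp u = z).
      { intros u Hu. apply In_keep in Hu. split; [apply HU; tauto|tauto]. }
      rewrite <- (length_map w_). apply (deg z).
      + apply NoDup_map_NoDup_ForallPairs; [|apply NoDup_keep, NoDup_ndup].
        intros u u' Hu Hu' Ew. destruct (Hlf u Hu) as (L1 & L2). destruct (Hlf u' Hu') as (L3 & L4).
        destruct (wm_spec u L1) as (W1 & W2). destruct (wm_spec u' L3) as (W3 & W4).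
        apply (Le_inj u u' (wp u) (w_ u)); [assumption|assumption|congruence|apply Hwp; assumption|assumption| |congruence].
        rewrite L2, <- L4. apply Hwp. assumption.
      + intros y Hy. apply in_map_iff in Hy. destruct Hy as (u & <- & Hu). destruct (Hlf u Hu) as (L1 & <-).
        apply (proj1 E_simple), cable_E. assumption.
    - intros; apply mu_nonneg. }
  assert (H4 : lsum Z mu <= Ca * Rpower 3 alpha * wta (RBase w)).
  { apply (piece_ball_mass m); [assumption|apply NoDup_ndup|]. intros z Hz. apply In_ndup, in_map_iff in Hz. destruct Hz as (u & <- & Hu).
    exists (wp u). split; [apply HU; assumption|]. rewrite rho_0. apply wt_nn. }
  pose proof (Rpower_pos (wt (RBase w)) alpha) as Hpos. pose proof (pos_INR Dg) as HDn0.
  apply Rle_trans with (C * wta (RBase w)); [|nra].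
  eapply Rle_trans; [exact H1|]. eapply Rle_trans; [exact H2|].
  replace (C * wta (RBase w)) with (Cm * (INR Dg * (Ca * Rpower 3 alpha * wta (RBase w)))) by (unfold C; ring).
  apply Rmult_le_compat_l; [lra|]. eapply Rle_trans; [exact H3|]. apply Rmult_le_compat_l; assumption.
Qed.

Lemma lsum_filter {A : Type} (p : A -> bool) (l : list A) F :
  lsum l F = lsum (filter p l) F + lsum (filter (fun x => negb (p x)) l) F.
Proof.
  induction l as [|x l IH]; [unfold lsum; simpl; ring|]. rewrite lsum_cons, IH. simpl. destruct (p x); simpl; rewrite lsum_cons; ring.
Qed.

Lemma node_mass : exists C, 0 < C /\ forall m k u Y, lev m u -> NoDup Y ->
  (forall v, In v Y -> lev (m + Z.of_nat k)%Z v /\ Nat.iter k par v = u) -> lsum Y wta <= C * wta u.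
Proof.
  destruct base_mass as (C1 & HC1 & H1). destruct cables_mass as (C2 & HC2 & H2).
  exists (1 + C1 + C2). split; [lra|]. intros m k u Y Hu HY Hin. pose proof (Rpower_pos (wt u) alpha) as Hp.
  destruct u as [w|w i k0].
  - set (isb := fun v : V => match v with RBase _ => true | RSub _ _ _ => false end).
    rewrite (lsum_filter isb).
    assert (A1 : lsum (filter isb Y) wta <= C1 * wta (RBase w)).
    { apply (H1 m k); [assumption|apply NoDup_filter; assumption|]. intros v Hv. apply filter_In in Hv. destruct Hv as (Hv & Hb).
      destruct (Hin v Hv). split; [destruct v; [eauto|discriminate]|auto]. }
    assert (A2 : lsum (filter (fun v => negb (isb v)) Y) wta <= C2 * wta (RBase w)).
    { apply (H2 m k); [assumption|apply NoDup_filter; assumption|]. intros v Hv. apply filter_In in Hv. destruct Hv as (Hv & Hb).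
      destruct (Hin v Hv). split; [destruct v; [discriminate|eauto]|auto]. }
    nra.
  - apply Rle_trans with (wta (RSub w i k0)); [|nra].
    pose proof (wt_pos _ (proj1 Hu)) as Hwp0. pose proof Hu as ((Hw & Hi & _) & Hm).
    assert (Hg : (1 <= gap i k)%nat) by apply gap_pos. apply (cable_sum w (i + k) (k0 * gap i k) (gap i k)); [assumption|assumption|assumption| |].
    + cbn [wt]. rewrite !pow2_nat, pow2_gap, mult_INR, Rinv_mult. ring.
    + intros v Hv. destruct (Hin v Hv) as ((Hrv & Hmv) & Ev). destruct v as [w'|w' i' k']; [rewrite iter_RBase in Ev; discriminate|].
      destruct Hrv as (_ & Hi' & _). destruct (Nat.lt_ge_cases k i') as [Hlt|Hge]; [|rewrite iter_RSub_base in Ev by lia; discriminate].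
      rewrite iter_RSub in Ev by assumption. injection Ev as -> Ei Ek. exists k'. rewrite Ei in Ek. split; [f_equal; lia|].
      pose proof (Nat.div_mod_eq k' (gap i k)). pose proof (Nat.mod_upper_bound k' (gap i k) ltac:(lia)). nia.
Qed.

(** * Cutoff functions *)

Lemma wchain_scal sg a m v c v' : wchain sg m v c v' -> wchain (fun u => a * sg u) m v (a * c) v'.
Proof.
  induction 1 as [v Hv|v u c v' Ha _ IH]; [exact (wc_one (fun u => a * sg u) m v Hv)|].
  rewrite Rmult_plus_distr_l. apply (wc_step (fun u => a * sg u) m v u (a * c) v'); assumption.
Qed.

(** Stopping at the first exit keeps the last node within [M0 + 1] steps of [u0], so its weight is
    still comparable. *)
Lemma chain_prefix M0 m k u0 v c v' : wchain wt (m + Z.of_nat k) v c v' ->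
  within (adj (lev m) tch) (S M0) u0 (Nat.iter k par v) -> ~ within (adj (lev m) tch) M0 u0 (Nat.iter k par v') ->
  exists v2 c2, wchain wt (m + Z.of_nat k) v c2 v2 /\ c2 <= c /\ within (adj (lev m) tch) (S M0) u0 (Nat.iter k par v2) /\
    ~ within (adj (lev m) tch) M0 u0 (Nat.iter k par v2).
Proof.
  induction 1 as [v Hv|v u c v' Ha Hc IH]; intros H1 H2.
  - exists v, (wt v). split; [constructor; assumption|]. split; [lra|auto].
  - destruct (classic (within (adj (lev m) tch) M0 u0 (Nat.iter k par v))) as [Hin|Hin].
    + destruct IH as (v2 & c2 & C1 & C2 & C3); [|assumption|].
      { right. exists (Nat.iter k par v). split; [assumption|]. apply node_adj_iter. assumption. }
      exists v2, (wt v + c2). split; [econstructor; eassumption|]. split; [lra|assumption].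
    + exists v, (wt v). split; [constructor; apply Ha|]. split; [|auto].
      pose proof (wchain_ge wt _ _ _ _ wt_nn Hc). pose proof (wt_nn u). lra.
Qed.

(** Intervals of one cable whose ancestors do not touch are more than [gap] apart, and [gap]
    intervals make up the weight of an ancestor. *)
Lemma link_separated m k v u c : link wt v u c -> lev (m + Z.of_nat k)%Z v -> lev (m + Z.of_nat k)%Z u ->
  ~ within (adj (lev m) tch) 1 (Nat.iter k par v) (Nat.iter k par u) -> wt (Nat.iter k par v) <= c.
Proof.
  intros Hl Hv Hu Hsep. pose proof (node_lev_iter _ _ _ Hv) as Hpv. pose proof (node_lev_iter _ _ _ Hu) as Hpu.
  destruct Hl as [->|(w & i & k1 & k2 & -> & -> & L1 & L2)]; [exfalso; apply Hsep; apply within_refl|].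
  pose proof Hv as ((Hw & Hi & _) & _). destruct (Nat.lt_ge_cases k i) as [Hlt|Hge].
  2:{ exfalso. apply Hsep. rewrite !iter_RSub_base by lia. apply within_refl. }
  rewrite !iter_RSub in * by assumption. set (g := gap (i - k) k) in *.
  assert (Hg : (1 <= g)%nat) by apply gap_pos.
  assert (Eg : wt (RSub w (i - k) (k1 / g)) = INR g * wt (RSub w i k1)).
  { cbn [wt]. replace i with (i - k + k)%nat at 2 by lia. rewrite !pow2_nat, pow2_gap, mult_INR. fold g.
    assert (1 <= INR g) by (apply (le_INR 1); assumption). assert (0 < INR (2 ^ nexp r (i - k))) by (rewrite <- pow2_nat; apply pow2_pos).
    field. lra. }
  pose proof (wt_nn (RSub w i k1)) as Hnn. rewrite Eg.
  destruct (Nat.le_gt_cases k1 (k2 + g)) as [H1|H1]; [destruct (Nat.le_gt_cases k2 (k1 + g)) as [H2|H2]|].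
  - exfalso. apply Hsep. apply within_step. split; [assumption|]. split; [assumption|]. apply tch_RSub; [apply Hpv|apply Hpu|].
    apply (div_close k1 k2 g g); lia.
  - eapply Rle_trans; [|exact L2]. apply Rmult_le_compat_r; [assumption|]. apply le_INR in H2. rewrite S_INR, plus_INR in H2. lra.
  - eapply Rle_trans; [|exact L1]. apply Rmult_le_compat_r; [assumption|]. apply le_INR in H1. rewrite S_INR, plus_INR in H1. lra.
Qed.

Lemma wt_osc x m u p q : lev m u -> KC u p -> KC u q -> Rabs (hat (rho x) p - hat (rho x) q) <= 2 * wt u.
Proof.
  intros (Hu & _). apply (hat_osc rho (rho x) (wt u) u p q Hu).
  - intros y z. pose proof (rho_tri x y z). pose proof (rho_tri x z y). rewrite (rho_sym z y) in *. unfold Rabs. destruct Rcase_abs; lra.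
  - apply wt_nn.
  - destruct u as [w|w i k]; [apply wt_base; exact Hu|simpl; lra].
Qed.

(* A long chain either runs along a cable or joins two vertices, whose [rho]-distance is at most twice its cost. *)
Lemma chain_separated : exists c, 0 < c /\ forall m k v cost v', wchain wt (m + Z.of_nat k) v cost v' ->
  ~ within (adj (lev m) tch) (Ma + 4) (Nat.iter k par v) (Nat.iter k par v') -> c * wt (Nat.iter k par v) <= cost.
Proof.
  destruct wt_adj as (A & HA & HAd). pose proof c8_pos as Hc8. destruct (wt_le_far c8 Hc8) as (C & HC & Hfar).
  set (X := A ^ (Ma + 5)). assert (HX : 1 <= X) by (apply pow_R1_Rle; assumption).
  set (c := / (X * (1 + 2 * C))). assert (HXC : 0 < X * (1 + 2 * C)) by nra. assert (Hc : 0 < c) by (apply Rinv_0_lt_compat; assumption).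
  exists c. split; [assumption|]. intros m k v cost0 v0 Hch0 Hsep0.
  destruct (chain_prefix (Ma + 4) m k (Nat.iter k par v) v cost0 v0 Hch0) as (v' & cost & Hch & Hcost & Hnear & Hsep); [apply within_refl|assumption|].
  destruct (wchain_lev _ _ _ _ _ Hch) as (Hv & Hv'). pose proof (wt_nn (Nat.iter k par v)) as Hnn.
  assert (Hgoal : wt (Nat.iter k par v) <= X * (1 + 2 * C) * cost).
  2:{ apply Rle_trans with cost; [|assumption]. apply Rmult_le_reg_l with (X * (1 + 2 * C)); [assumption|].
      rewrite <- Rmult_assoc. unfold c. rewrite Rinv_r, Rmult_1_l by lra. assumption. }
  assert (Hcost0 : 0 <= cost) by (eapply Rle_trans; [apply (wt_nn v)|eapply wchain_ge; [apply wt_nn|eassumption]]).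
  assert (Hdir : forall t, wt (Nat.iter k par v) <= X * t -> t <= (1 + 2 * C) * cost -> wt (Nat.iter k par v) <= X * (1 + 2 * C) * cost).
  { intros t T1 T2. eapply Rle_trans; [exact T1|]. rewrite Rmult_assoc. apply Rmult_le_compat_l; lra. }
  assert (Hself : wt (Nat.iter k par v) <= X * wt (Nat.iter k par v)) by nra.
  assert (HC1 : cost <= (1 + 2 * C) * cost) by nra.
  destruct (chain_split wt (m + Z.of_nat k) wt_nn wt_cable v cost v' Hch) as [Hl|(u & u' & x & y & c3 & Hx & Hy & L1 & L2 & Hch3 & Hc3)].
  - apply (Hdir _ Hself). eapply Rle_trans; [|exact HC1]. apply (link_separated m k v v' cost Hl Hv Hv').
    intros Hw. apply Hsep. revert Hw. apply within_mono. lia.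
  - destruct (wchain_lev _ _ _ _ _ Hch3) as (Hu & Hu').
    destruct (classic (within (adj (lev m) tch) 1 (Nat.iter k par v) (Nat.iter k par u))) as [Hvu|Hvu].
    2:{ apply (Hdir _ Hself). eapply Rle_trans; [|exact HC1]. apply (link_separated m k v u cost L1 Hv Hu Hvu). }
    destruct (classic (within (adj (lev m) tch) 1 (Nat.iter k par v') (Nat.iter k par u'))) as [Hvu'|Hvu'].
    2:{ apply (Hdir (wt (Nat.iter k par v'))).
        - unfold X. replace (Ma + 5)%nat with (S (Ma + 4)) by lia. apply (within_ratio (adj (lev m) tch)); [assumption|apply HAd|apply wt_nn|].
          apply within_sym; [apply node_adj_sym|assumption].
        - eapply Rle_trans; [|exact HC1]. apply (link_separated m k v' u' cost L2 Hv' Hu' Hvu'). }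
    pose proof (node_lev_iter _ _ _ Hu) as Hpu. pose proof (node_lev_iter _ _ _ Hu') as Hpu'.
    pose proof (node_inc_iter _ _ _ _ Hu Hx) as Hpx. pose proof (node_inc_iter _ _ _ _ Hu' Hy) as Hpy.
    (* Otherwise [d_near] would join the projections of [v] and [v'] in [1 + (Ma + 2) + 1] steps. *)
    assert (Hd : c8 * powerRZ r m <= d x y).
    { apply Rnot_lt_le. intros Hlt. apply Hsep. replace (Ma + 4)%nat with (1 + ((Ma + 2) + 1))%nat by lia.
      apply within_trans with (Nat.iter k par u); [assumption|]. apply within_trans with (Nat.iter k par u').
      - apply (within_impl (fun a b => adj (lev m) tch a b /\ exists z, inc a z /\ inc b z)); [tauto|]. apply (d_near m _ _ x y); assumption.
      - apply within_sym; [apply node_adj_sym|assumption]. }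
    assert (Hxy : x <> y).
    { intros <-. assert (d x x = 0) as Dx by (apply d_metric; reflexivity). rewrite Dx in Hd.
      assert (0 < c8 * powerRZ r m); [|lra]. apply Rmult_lt_0_compat; [assumption|apply rpow_pos]. }
    pose proof (Hfar m _ x y Hpu Hpx Hxy Hd) as Hf.
    assert (Hr : rho x y <= 2 * c3).
    { pose proof (wchain_osc (fun u => 2 * wt u) _ (hat (rho x)) _ _ _ (fun u p q => wt_osc x _ u p q) (wchain_scal wt 2 _ _ _ _ Hch3) (CV x) (CV y) Hx Hy) as Ho.
      simpl in Ho. rewrite rho_0, Rminus_0_l, Rabs_Ropp in Ho. rewrite Rabs_pos_eq in Ho by apply rho_nn. assumption. }
    apply (Hdir (wt (Nat.iter k par u))).
    + assert (wt (Nat.iter k par v) <= A ^ 1 * wt (Nat.iter k par u)) as H1.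
      { apply (within_ratio (adj (lev m) tch)); [assumption|apply HAd|apply wt_nn|]. apply within_sym; [apply node_adj_sym|assumption]. }
      assert (A ^ 1 <= X) by (apply Rle_pow; [assumption|lia]). pose proof (wt_nn (Nat.iter k par u)). nra.
    + assert (C * rho x y <= C * (2 * cost)) by (apply Rmult_le_compat_l; lra). lra.
Qed.

Lemma inf_exists (S : R -> Prop) a s0 : S s0 -> (forall c, S c -> a <= c) ->
  exists g, (forall c, S c -> g <= c) /\ forall b, (forall c, S c -> b <= c) -> b <= g.
Proof.
  intros Hs Ha. destruct (completeness (fun b => forall c, S c -> b <= c)) as (g & G1 & G2).
  - exists s0. intros b Hb. apply Hb. assumption.
  - exists a. assumption.
  - exists g. split; [|intros b Hb; apply G1; assumption]. intros c Hc. apply G2. intros b Hb. apply Hb. assumption.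
Qed.

(* The cutoff is [1] minus the truncated, normalised least cost of a chain from the [N1]-neighbourhood. *)
Lemma cutoff N1 : exists C, 0 < C /\ forall m k u, lev m u -> exists f : V -> R,
  (forall v, lev (m + Z.of_nat k)%Z v -> within (adj (lev m) tch) N1 u (Nat.iter k par v) -> f v = 1) /\
  (forall v, lev (m + Z.of_nat k)%Z v -> ~ within (adj (lev m) tch) (N1 + (Ma + 4)) u (Nat.iter k par v) -> f v = 0) /\
  forall v v', adj (lev (m + Z.of_nat k)%Z) tch v v' -> Rabs (f v - f v') <= C * wt v / wt u.
Proof.
  destruct wt_adj as (A & HA & HAd). destruct chain_separated as (c & Hc & Hcs).
  assert (HAN : 1 <= A ^ N1) by (apply pow_R1_Rle; assumption).
  exists ((1 + A) * A ^ N1 / c). split; [apply Rdiv_lt_0_compat; nra|]. intros m k u Hu.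
  pose proof (wt_pos u (proj1 Hu)) as Hup. set (L := adj (lev (m + Z.of_nat k)%Z) tch).
  set (P := fun v => within (adj (lev m) tch) N1 u (Nat.iter k par v)).
  (* No chain leaving the neighbourhood is cheaper: [c] comes from [chain_separated], and [A ^ N1]
     compares [wt u] with the weight of the ancestor where the chain starts. *)
  set (s0 := c * (wt u / A ^ N1)). assert (Hs0 : 0 < s0) by (apply Rmult_lt_0_compat; [assumption|apply Rdiv_lt_0_compat; lra]).
  set (S0 := fun v t => t = s0 \/ exists v1, P v1 /\ wchain wt (m + Z.of_nat k) v1 t v).
  destruct (choice (fun v g => (forall t, S0 v t -> g <= t) /\ forall b, (forall t, S0 v t -> b <= t) -> b <= g)) as (dst & Hd).
  { intros v. apply (inf_exists (S0 v) 0 s0); [left; reflexivity|]. intros t [->|(v1 & _ & Hw)]; [lra|].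
    eapply Rle_trans; [apply (wt_nn v1)|]. eapply wchain_ge; [apply wt_nn|eassumption]. }
  assert (Hd1 : forall v, dst v <= s0) by (intros v; apply (proj1 (Hd v)); left; reflexivity).
  assert (Hd0 : forall v, 0 <= dst v).
  { intros v. apply (proj2 (Hd v)). intros t [->|(v1 & _ & Hw)]; [lra|].
    eapply Rle_trans; [apply (wt_nn v1)|]. eapply wchain_ge; [apply wt_nn|eassumption]. }
  (* The value [1] is imposed on the inner neighbourhood because [dst] need not vanish there: a
     chain pays for its end nodes. *)
  set (f := fun v => if excluded_middle_informative (P v) then 1 else 1 - dst v / s0).
  assert (Hf1 : forall v, f v <= 1).
  { intros v. unfold f. destruct excluded_middle_informative; [lra|]. assert (0 <= dst v / s0) by (apply Rdiv_le_0_compat; auto). lra. }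
  assert (Hdiff : forall v v', L v v' -> f v - f v' <= (wt v + wt v') / s0).
  { intros v v' Hvv. pose proof (wt_nn v). pose proof (wt_nn v'). assert (Hq : 0 <= (wt v + wt v') / s0) by (apply Rdiv_le_0_compat; lra).
    pose proof (Hf1 v) as Hfv. unfold f in *. destruct (excluded_middle_informative (P v')) as [Hv'|Hv']; [lra|].
    destruct (excluded_middle_informative (P v)) as [Hv|Hv].
    - assert (dst v' <= wt v + wt v').
      { apply (proj1 (Hd v')). right. exists v. split; [assumption|]. apply wc_step with v'; [assumption|]. constructor. apply Hvv. }
      assert (dst v' / s0 <= (wt v + wt v') / s0) by (apply Rmult_le_compat_r; [apply Rlt_le, Rinv_0_lt_compat; assumption|assumption]). lra.
    - assert (dst v' - wt v' <= dst v).
      { apply (proj2 (Hd v)). intros t [->|(v1 & Hv1 & Hw)]; [specialize (Hd1 v'); lra|].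
        assert (dst v' <= t + wt v'); [|lra]. apply (proj1 (Hd v')). right. exists v1. split; [assumption|].
        apply (wchain_app wt _ v1 t v v'); [assumption|assumption|constructor; apply Hvv]. }
      assert (dst v' / s0 <= (dst v + wt v') / s0) by (apply Rmult_le_compat_r; [apply Rlt_le, Rinv_0_lt_compat; assumption|lra]).
      assert (0 <= wt v / s0) by (apply Rdiv_le_0_compat; lra). unfold Rdiv in *. lra. }
  exists f. split; [|split].
  - intros v _ Hv. unfold f. destruct excluded_middle_informative; [reflexivity|contradiction].
  - intros v Hv Hno. unfold f. destruct excluded_middle_informative as [HP|HP].
    + exfalso. apply Hno. revert HP. apply within_mono. lia.
    + assert (dst v = s0); [|replace (dst v) with s0; field; lra].
      apply Rle_antisym; [apply Hd1|]. apply (proj2 (Hd v)). intros t [->|(v1 & Hv1 & Hw)]; [lra|].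
      assert (Hsep : c * wt (Nat.iter k par v1) <= t).
      { apply (Hcs m k v1 t v Hw). intros Hin. apply Hno. eapply within_trans; eassumption. }
      eapply Rle_trans; [|exact Hsep]. apply Rmult_le_compat_l; [lra|].
      apply Rle_div_l; [lra|]. rewrite Rmult_comm. apply (within_ratio (adj (lev m) tch)); [assumption|apply HAd|apply wt_nn|].
      apply within_sym; [apply node_adj_sym|assumption].
  - intros v v' Hvv. assert (Hsum : (wt v + wt v') / s0 <= (1 + A) * A ^ N1 / c * wt v / wt u).
    { specialize (HAd _ _ _ Hvv). pose proof (wt_nn v).
      replace ((1 + A) * A ^ N1 / c * wt v / wt u) with ((1 + A) * wt v / s0) by (unfold s0; field; lra).
      apply Rmult_le_compat_r; [apply Rlt_le, Rinv_0_lt_compat; assumption|lra]. }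
    pose proof (Hdiff v v' Hvv). pose proof (Hdiff v' v (node_adj_sym _ _ _ Hvv)). rewrite (Rplus_comm (wt v')) in *.
    unfold Rabs. destruct Rcase_abs; lra.
Qed.

Lemma within_osc m (f : V -> R) C A : 1 <= A -> 0 <= C -> (forall v v', adj (lev m) tch v v' -> wt v' <= A * wt v) ->
  (forall v v', adj (lev m) tch v v' -> Rabs (f v - f v') <= C * wt v) ->
  forall n v v', within (adj (lev m) tch) n v v' -> Rabs (f v - f v') <= INR n * (C * A ^ n) * wt v.
Proof.
  intros HA HC Hw Hf n v. pose proof (wt_nn v) as Hnn. induction n as [|n IH]; intros v' H.
  - simpl in H. subst. rewrite Rminus_diag, Rabs_R0. simpl. lra.
  - assert (HAn : 0 <= A ^ n) by (apply pow_le; lra). assert (Hle : INR n * (C * A ^ n) * wt v <= INR n * (C * A ^ S n) * wt v).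
    { apply Rmult_le_compat_r; [assumption|]. apply Rmult_le_compat_l; [apply pos_INR|]. apply Rmult_le_compat_l; [assumption|]. simpl. nra. }
    assert (H0 : 0 <= C * A ^ S n * wt v) by (apply Rmult_le_pos; [apply Rmult_le_pos; [assumption|apply pow_le; lra]|assumption]).
    rewrite S_INR. destruct H as [H|(u & H & Ha)].
    + specialize (IH _ H). lra.
    + specialize (IH _ H). specialize (Hf _ _ Ha).
      pose proof (within_ratio (adj (lev m) tch) wt A n v u HA Hw Hnn H) as Hu.
      assert (C * wt u <= C * A ^ S n * wt v).
      { rewrite Rmult_assoc. apply Rmult_le_compat_l; [assumption|]. simpl. assert (0 <= A ^ n * wt v) by (apply Rmult_le_pos; assumption). nra. }
      replace (f v - f v') with ((f v - f u) + (f u - f v')) by ring. eapply Rle_trans; [apply Rabs_triang|]. lra.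
Qed.

(** An increment at [x] is at most [B0 * wt x / wt u]. In [wt x ^ p = wt x ^ (p - alpha) * wt x ^
    alpha] the first factor decays geometrically by [wt_decay], and the second sums to a constant by
    [node_mass], over boundedly many ancestors near [u]. *)
Lemma energy_list p N N1 N2 : (N1 + (Ma + 4) <= N2)%nat -> alpha < p ->
  exists C b (K1 : nat), 0 < C /\ 0 < b < 1 /\ (1 <= K1)%nat /\ forall m k u, lev m u -> exists f : V -> R,
  (forall v, lev (m + Z.of_nat k)%Z v -> within (adj (lev m) tch) N1 u (Nat.iter k par v) -> f v = 1) /\
  (forall v, lev (m + Z.of_nat k)%Z v -> ~ within (adj (lev m) tch) N2 u (Nat.iter k par v) -> f v = 0) /\
  forall l, NoDup l -> (forall xy, In xy l -> lev (m + Z.of_nat k)%Z (fst xy) /\ within (adj (lev (m + Z.of_nat k)%Z) tch) N (fst xy) (snd xy)) ->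
    lsum l (fun xy => rpow (Rabs (f (fst xy) - f (snd xy))) p) <= C * b ^ (k / K1).
Proof.
  intros HN Hp. pose proof exponent_ge1 as Hal. destruct (cutoff N1) as (C0 & HC0 & Hcut). destruct wt_adj as (A & HA & HAd).
  destruct wt_half as (K1 & HK1 & Hhalf). pose proof (wt_decay K1 Hhalf) as Hdec. destruct node_mass as (Cm & HCm & Hmass).
  destruct node_balls as (nb & D & HD & Hbl & Hbll).
  (* A pair contributes only if one member projects within [N2] of [u]; the first member then
     projects within [N2 + N]. *)
  set (Q := (N2 + N)%nat). set (B0 := INR N * (C0 * A ^ N) + 1).
  assert (HB0 : 0 < B0).
  { assert (0 <= INR N * (C0 * A ^ N)); [|unfold B0; lra]. apply Rmult_le_pos; [apply pos_INR|]. apply Rmult_le_pos; [lra|]. apply pow_le. lra. }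
  set (b := Rpower (/ 2) (p - alpha)). assert (Hb : 0 < b < 1) by (apply Rpower_lt1; lra).
  set (AQ := A ^ Q). assert (HAQ : 1 <= AQ) by (apply pow_R1_Rle; assumption).
  set (C := (INR (D ^ Q) + 1) * ((INR (D ^ N) + 1) * (Rpower B0 p * Cm * Rpower AQ p))).
  assert (HB0p : 0 < Rpower B0 p * Cm * Rpower AQ p).
  { pose proof (Rpower_pos B0 p). pose proof (Rpower_pos AQ p). repeat apply Rmult_lt_0_compat; assumption. }
  assert (HC : 0 < C).
  { unfold C. pose proof (pos_INR (D ^ Q)). pose proof (pos_INR (D ^ N)). apply Rmult_lt_0_compat; [lra|]. apply Rmult_lt_0_compat; [lra|assumption]. }
  exists C, b, K1. split; [assumption|]. split; [assumption|]. split; [assumption|]. intros m k u Hu.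
  destruct (Hcut m k u Hu) as (f & Hf1 & Hf0 & Hfd). exists f. split; [assumption|].
  assert (Hf0' : forall v, lev (m + Z.of_nat k)%Z v -> ~ within (adj (lev m) tch) N2 u (Nat.iter k par v) -> f v = 0).
  { intros v Hv Hno. apply Hf0; [assumption|]. intros Hin. apply Hno. revert Hin. apply within_mono. assumption. }
  split; [assumption|]. intros l Hl Hin. set (L := (m + Z.of_nat k)%Z) in *.
  pose proof (wt_pos u (proj1 Hu)) as Hup. set (q := (k / K1)%nat).
  set (Gx := fun x => Rpower (B0 * (wt x / wt u)) p).
  set (Fx := fun xy : V * V => rpow (Rabs (f (fst xy) - f (snd xy))) p).
  assert (HFG : forall xy, In xy l -> Fx xy <= Gx (fst xy)).
  { intros (x, y) Hxy. destruct (Hin _ Hxy) as (H1 & H2). simpl in *. unfold Fx, Gx. simpl.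
    assert (Hwx : 0 < wt x) by (apply wt_pos; apply H1). assert (0 < wt x / wt u) by (apply Rdiv_lt_0_compat; assumption).
    rewrite <- rpow_pos_eq by (apply Rmult_lt_0_compat; assumption). apply rpow_le; [lra|].
    pose proof (within_osc L f (C0 / wt u) A HA ltac:(apply Rdiv_le_0_compat; lra) (HAd L)) as Ho.
    assert (Hfd' : forall v v', adj (lev L) tch v v' -> Rabs (f v - f v') <= C0 / wt u * wt v).
    { intros v v' Hvv. replace (C0 / wt u * wt v) with (C0 * wt v / wt u) by (unfold Rdiv; ring). apply Hfd. assumption. }
    eapply Rle_trans; [apply (Ho Hfd' N x y H2)|].
    replace (INR N * (C0 / wt u * A ^ N) * wt x) with (INR N * (C0 * A ^ N) * (wt x / wt u)) by (field; lra).
    apply Rmult_le_compat_r; [lra|]. unfold B0. lra. }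
  set (near := fun x => within (adj (lev m) tch) Q u (Nat.iter k par x)).
  set (l' := keep (fun xy => near (fst xy)) l).
  assert (Hl' : forall xy, In xy l' <-> In xy l /\ near (fst xy)) by (intros; exact (In_keep _ _ _)).
  assert (S1 : lsum l Fx <= lsum l' (fun xy => Gx (fst xy))).
  { rewrite (lsum_keep (fun xy => near (fst xy))); [apply lsum_le; intros xy Hxy; apply HFG, Hl'; assumption|].
    intros (x, y) Hxy Hnn. destruct (Hin _ Hxy) as (H1 & H2). simpl in *.
    assert (Hy : lev L y) by (eapply within_adj_X; eassumption).
    assert (Hxyp : within (adj (lev m) tch) N (Nat.iter k par y) (Nat.iter k par x)).
    { apply within_sym; [apply node_adj_sym|]. revert H2. apply within_map. intros a c. apply node_adj_iter. }
    unfold Fx. simpl. rewrite (Hf0' x), (Hf0' y); [rewrite Rminus_diag, Rabs_R0; apply rpow_0; lra|assumption| |assumption|].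
    - intros Hw. apply Hnn. unfold near, Q. eapply within_trans; eassumption.
    - intros Hw. apply Hnn. unfold near, Q. revert Hw. apply within_mono. lia. }
  set (Y := ndup (map fst l')).
  assert (HY : forall x, In x Y -> lev L x /\ near x).
  { intros x Hx. apply In_ndup, in_map_iff in Hx. destruct Hx as (xy & <- & Hxy). apply Hl' in Hxy. split; [apply Hin; tauto|tauto]. }
  assert (HGpos : forall x, 0 <= Gx x) by (intros; apply Rlt_le, Rpower_pos).
  assert (S2 : lsum l' (fun xy => Gx (fst xy)) <= (INR (D ^ N) + 1) * lsum Y Gx).
  { apply Rle_trans with (lsum (flat_map (fun x => map (pair x) (bl nb N x)) Y) (fun xy => Gx (fst xy))).
    - apply lsum_incl; [apply NoDup_keep; assumption| |intros; apply HGpos]. intros (x, y) Hxy.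
      apply in_flat_map. exists x. split; [apply In_ndup; exact (in_map fst _ _ Hxy)|]. apply in_map. apply Hl' in Hxy. destruct Hxy as (Hxy & _).
      destruct (Hin _ Hxy) as (H1 & H2). simpl in *. apply (Hbl L); assumption.
    - rewrite lsum_flat_map, <- lsum_scal. apply lsum_le. intros x Hx. rewrite lsum_map. simpl.
      eapply Rle_trans; [apply (lsum_const_le _ _ (Gx x)); intros; lra|]. apply Rmult_le_compat_r; [apply HGpos|].
      pose proof (le_INR _ _ (Hbll L N x (proj1 (HY x Hx)))). lra. }
  assert (S3 : lsum Y Gx <= lsum (bl nb Q u) (fun w => lsum (keep (fun x => Nat.iter k par x = w) Y) Gx)).
  { apply lsum_fibers; [apply NoDup_ndup| |assumption]. intros x Hx. apply (Hbl m); [assumption|]. apply HY. assumption. }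
  assert (S4 : forall w, In w (bl nb Q u) -> lsum (keep (fun x => Nat.iter k par x = w) Y) Gx <=
     Rpower B0 p * Cm * Rpower AQ p * b ^ q).
  { intros w Hw. apply (Hbl m) in Hw; [|assumption]. assert (Hwl : lev m w) by (eapply within_adj_X; eassumption).
    pose proof (wt_pos w (proj1 Hwl)) as Hwp0. set (Yw := keep _ Y).
    assert (HYw : forall x, In x Yw -> lev L x /\ Nat.iter k par x = w).
    { intros x Hx. apply In_keep in Hx. split; [apply HY; tauto|tauto]. }
    assert (HwA : wt w <= AQ * wt u) by (apply (within_ratio (adj (lev m) tch)); [assumption|apply HAd|apply wt_nn|assumption]).
    pose proof (Hmass m k w Yw Hwl (NoDup_keep _ _ (NoDup_ndup _)) HYw) as Hms.
    set (cst := Rpower B0 p * (b ^ q * Rpower (wt w) (p - alpha)) * / Rpower (wt u) p).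
    assert (Hcst : 0 <= cst).
    { unfold cst. pose proof (Rpower_pos B0 p). pose proof (Rpower_pos (wt w) (p - alpha)). pose proof (Rinv_0_lt_compat _ (Rpower_pos (wt u) p)).
      assert (0 < b ^ q) by (apply pow_lt; lra). repeat apply Rmult_le_pos; lra. }
    apply Rle_trans with (lsum Yw (fun x => cst * Rpower (wt x) alpha)).
    - apply lsum_le. intros x Hx. destruct (HYw x Hx) as (Hxl & Ex). pose proof (wt_pos x (proj1 Hxl)) as Hxp.
      unfold Gx, cst. rewrite <- Rpower_mult_distr; [|assumption|apply Rdiv_lt_0_compat; assumption].
      unfold Rdiv. rewrite <- Rpower_mult_distr, Rpower_inv; [|assumption|assumption|apply Rinv_0_lt_compat; assumption].
      replace (Rpower (wt x) p) with (Rpower (wt x) (p - alpha) * Rpower (wt x) alpha) by (rewrite <- Rpower_plus; f_equal; ring).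
      assert (Hx2 : Rpower (wt x) (p - alpha) <= b ^ q * Rpower (wt w) (p - alpha)).
      { unfold b. rewrite <- Rpower_pow_swap by lra. assert (0 < (/ 2) ^ q) by (apply pow_lt; lra). rewrite Rpower_mult_distr by assumption.
        apply Rle_Rpower_l; [lra|]. split; [assumption|]. rewrite <- Ex. apply (Hdec q k m); [|assumption].
        rewrite Nat.mul_comm. apply Nat.Div0.mul_div_le. }
      pose proof (Rpower_pos B0 p). pose proof (Rpower_pos (wt x) alpha). pose proof (Rinv_0_lt_compat _ (Rpower_pos (wt u) p)).
      replace (Rpower B0 p * (Rpower (wt x) (p - alpha) * Rpower (wt x) alpha * / Rpower (wt u) p)) with
        (Rpower (wt x) (p - alpha) * (Rpower B0 p * Rpower (wt x) alpha * / Rpower (wt u) p)) by ring.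
      replace (Rpower B0 p * (b ^ q * Rpower (wt w) (p - alpha)) * / Rpower (wt u) p * Rpower (wt x) alpha) with
        (b ^ q * Rpower (wt w) (p - alpha) * (Rpower B0 p * Rpower (wt x) alpha * / Rpower (wt u) p)) by ring.
      apply Rmult_le_compat_r; [|assumption]. repeat apply Rmult_le_pos; lra.
    - rewrite lsum_scal. eapply Rle_trans; [apply Rmult_le_compat_l; [exact Hcst|exact Hms]|]. unfold cst.
      assert (E1 : Rpower (wt w) (p - alpha) * Rpower (wt w) alpha = Rpower (wt w) p) by (rewrite <- Rpower_plus; f_equal; ring).
      replace (Rpower B0 p * (b ^ q * Rpower (wt w) (p - alpha)) * / Rpower (wt u) p * (Cm * Rpower (wt w) alpha)) with
        (Rpower B0 p * Cm * b ^ q * / Rpower (wt u) p * (Rpower (wt w) (p - alpha) * Rpower (wt w) alpha)) by ring. rewrite E1.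
      assert (E2 : Rpower (wt w) p <= Rpower AQ p * Rpower (wt u) p).
      { rewrite Rpower_mult_distr by lra. apply Rle_Rpower_l; lra. }
      pose proof (Rpower_pos (wt u) p). pose proof (Rpower_pos B0 p). assert (0 < b ^ q) by (apply pow_lt; lra).
      pose proof (Rinv_0_lt_compat _ (Rpower_pos (wt u) p)).
      replace (Rpower B0 p * Cm * Rpower AQ p * b ^ q) with (Rpower B0 p * Cm * b ^ q * / Rpower (wt u) p * (Rpower AQ p * Rpower (wt u) p)) by (field; lra).
      apply Rmult_le_compat_l; [|assumption]. repeat apply Rmult_le_pos; lra. }
  assert (S5 : lsum Y Gx <= (INR (D ^ Q) + 1) * (Rpower B0 p * Cm * Rpower AQ p * b ^ q)).
  { eapply Rle_trans; [exact S3|]. eapply Rle_trans; [apply lsum_const_le; exact S4|].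
    assert (0 < b ^ q) by (apply pow_lt; lra). apply Rmult_le_compat_r; [apply Rlt_le, Rmult_lt_0_compat; assumption|].
    pose proof (le_INR _ _ (Hbll m Q u Hu)). lra. }
  pose proof (pos_INR (D ^ N)). fold q. eapply Rle_trans; [exact S1|]. eapply Rle_trans; [exact S2|].
  replace (C * b ^ q) with ((INR (D ^ N) + 1) * ((INR (D ^ Q) + 1) * (Rpower B0 p * Cm * Rpower AQ p * b ^ q))) by (unfold C; ring).
  apply Rmult_le_compat_l; lra.
Qed.

(** Rounding [k / K1] down costs at most one factor [b], hence the constant [C / b]. *)
Theorem energy_decay p N N1 N2 : (N1 + (Ma + 4) <= N2)%nat -> alpha < p ->
  exists C lam, 0 < C /\ 0 < lam < 1 /\ forall k, Rbar_le (Epk pi phi K r wp p k N1 N2 N) (Finite (C * lam ^ k)).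
Proof.
  intros HN Hp. destruct (energy_list p N N1 N2 HN Hp) as (C & b & K1 & HC & Hb & HK1 & H).
  assert (HKR : 1 <= INR K1) by (apply (le_INR 1); assumption).
  set (lam := Rpower b (/ INR K1)). assert (Hlam : 0 < lam < 1) by (apply Rpower_lt1; [assumption|apply Rinv_0_lt_compat; lra]).
  assert (ElK : lam ^ K1 = b).
  { unfold lam. rewrite <- Rpower_pow by apply Rpower_pos. rewrite Rpower_mult, Rinv_l, Rpower_1 by lra. reflexivity. }
  exists (C / b), lam. split; [apply Rdiv_lt_0_compat; lra|]. split; [assumption|]. intros k.
  assert (Hbk : C * b ^ (k / K1) <= C / b * lam ^ k).
  { unfold Rdiv. rewrite Rmult_assoc. apply Rmult_le_compat_l; [lra|]. apply Rmult_le_reg_l with b; [lra|].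
    rewrite <- Rmult_assoc, Rinv_r, Rmult_1_l by lra. change (b * b ^ (k / K1)) with (b ^ S (k / K1)). rewrite <- ElK at 1. rewrite <- pow_mult.
    assert (Hk : (k <= K1 * S (k / K1))%nat).
    { pose proof (Nat.div_mod_eq k K1). pose proof (Nat.mod_upper_bound k K1 ltac:(lia)). lia. }
    replace (K1 * S (k / K1))%nat with (k + (K1 * S (k / K1) - k))%nat by lia. rewrite pow_add.
    assert (lam ^ (K1 * S (k / K1) - k) <= 1) by (apply pow_le1; lra). assert (0 < lam ^ k) by (apply pow_lt; lra). nra. }
  apply rb_sup_lub. intros z (w & Hw & ->). set (m := rht w). assert (Hl : lev m w) by (split; [assumption|reflexivity]).
  destruct (H m k w Hl) as (f & Hf1 & Hf0 & Hs).
  eapply Rbar_le_trans; [apply rb_inf_lb; exists f; split; [|split; [|reflexivity]]|].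
  - intros x Hx (_ & _ & Hin). apply Hf1; [assumption|]. apply within_Jh; assumption.
  - intros x Hx Hno. apply Hf0; [assumption|]. intros Hin. apply Hno. split; [apply Hx|]. split; [apply node_lev_iter; assumption|]. apply within_Jh; assumption.
  - set (nn := nnsum _ _). assert (Hnn : Rbar_le nn (Finite (C * b ^ (k / K1)))).
    { apply nnsum_le. intros l Hl0 Hin. apply Hs; [assumption|]. intros xy Hxy. destruct (Hin xy Hxy) as (J1 & J2 & _ & J3).
      split; [assumption|]. apply within_Jh; assumption. }
    assert (H0 : Rbar_le (Finite 0) nn) by (apply (nnsum_ge _ _ []); [constructor|intros ? []]).
    destruct nn as [t| |]; simpl in *; try contradiction. lra.
Qed.

End Graph.

(** * Energies, regular metrics and spectral dimensions compared *)

Theorem theorem4p1 (G T : Type) (E : G -> G -> Prop) (pi : T -> T) (phi : T)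
  (K : T -> G -> Prop) (d : G -> G -> R) (r : R) (wp : T -> G) :
  countably_infinite G -> simple_graph E -> connected E -> bounded_degree E ->
  countable T -> bi_infinite_tree pi ->
  is_partition E pi phi K -> minimal pi K ->
  is_metric d -> diam d = p_infty -> fits d E ->
  basic_framework pi phi K d r ->
  (* the labelling K_w = {w^+, w^-} for w in Lambda_e used to build T_r *)
  (forall w, Lambda_e pi K w -> K w (wp w)) ->
  exists M0 : nat, forall (N N1 N2 : nat) (p : R),
    (1 <= N)%nat -> (N1 + M0 <= N2)%nat -> 0 < p ->
    (Iund pi phi K r wp N1 N2 N = dimAR d /\ Ibar pi phi K r wp N1 N2 N = dimAR d) /\
    (Rbar_lt (Rund_p pi phi K r wp p N1 N2 N) (Finite 1) ->
       Rbar_le (dimAR d) (dSund pi phi K r wp p N1 N2 N) /\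
       Rbar_le (dSund pi phi K r wp p N1 N2 N) (dSbar pi phi K r wp p N1 N2 N) /\
       Rbar_lt (dSbar pi phi K r wp p N1 N2 N) (Finite p)) /\
    (Rbar_le (Finite 1) (Rbar_p pi phi K r wp p N1 N2 N) ->
       Rbar_le (dSbar pi phi K r wp p N1 N2 N) (dimAR d) /\
       Rbar_le (dSund pi phi K r wp p N1 N2 N) (dSbar pi phi K r wp p N1 N2 N) /\
       Rbar_le (Finite p) (dSund pi phi K r wp p N1 N2 N)).
Proof.
  intros (f_enum & G_inf) E_simple E_conn (Dg & deg) T_count tree part mini d_metric d_unb ((CF & CF_pos & F1) & F2)
    ((Bc & ch_bd) & (Cu & uf) & thk & (Ma & a1 & a2 & a1_pos & _ & adp) & r_bd & Cg & Cg_ge & gd_bd) Hwp.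
  assert (adp' : forall x s y, 0 < s -> ball d x (a1 * s) y -> U_M pi K d Ma x s y) by (intros x s y Hs; apply adp; assumption).
  pose proof (Nstar_spec E pi phi K d r f_enum G_inf E_simple E_conn tree part mini d_metric thk r_bd Cg CF Cg_ge CF_pos gd_bd F1 wp Hwp
    Bc Cu Ma Dg a1 ch_bd uf a1_pos adp' deg) as (n & En & n_gt1 & Hn).
  set (A := fun alpha => exists rho, is_metric rho /\ Ahlfors_regular rho alpha /\ QS d rho).
  (* The radius beyond which [chain_separated] gives a definite cost; it depends on adaptedness
     only. *)
  exists (Ma + 4)%nat. intros N N1 N2 p HN HN12 Hp. set (Ep := fun p k => Epk pi phi K r wp p k N1 N2 N).
  assert (Ep_nonneg : forall p k, Rbar_le (Finite 0) (Ep p k)).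
  { intros q k. exact (Epk_nonneg E pi phi K d r f_enum G_inf E_simple E_conn tree part thk r_bd wp q k N1 N2 N). }
  assert (A_witness : forall q, 0 < q -> (forall e k0, 0 < e -> exists k, (k0 <= k)%nat /\ Rbar_lt (Ep q k) (Finite e)) -> A q).
  { intros q Hq H. exact (dimension_witness E pi phi K d r f_enum G_inf E_simple E_conn tree part mini d_metric thk r_bd Cg CF Cg_ge CF_pos gd_bd F1 wp Hwp
      Bc Cu Ma Dg a1 ch_bd uf a1_pos adp' deg T_count q N1 N2 N Hq HN H). }
  assert (A_decay : forall a q, A a -> a < q -> exists C lam, 0 < C /\ 0 < lam < 1 /\ forall k, Rbar_le (Ep q k) (Finite (C * lam ^ k))).
  { intros a q (rho & rho_met & (mu & mu_nn & Ca & Ca_pos & AR) & qs) Haq. pose proof (QS_unbounded d rho d_metric rho_met qs d_unb) as unb.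
    destruct qs as (th & Hth & qs).
    exact (energy_decay E pi phi K d r f_enum G_inf E_simple E_conn tree part mini d_metric thk r_bd Cg CF Cg_ge CF_pos gd_bd F1 wp Hwp
      Bc Cu Ma Dg a1 ch_bd uf a1_pos adp' deg rho th a Ca mu rho_met Hth qs Ca_pos mu_nn unb AR F2 q N N1 N2 HN12 Haq). }
  (* The critical exponents are infima over [p > 0], whereas [dimAR] puts no sign on its exponents;
     since these are at least [1], nothing is lost. *)
  assert (A_pos : forall a, A a -> 0 < a).
  { intros a (rho & rho_met & (mu & mu_nn & Ca & Ca_pos & AR) & qs). pose proof (QS_unbounded d rho d_metric rho_met qs d_unb) as unb.
    destruct qs as (th & Hth & qs).
    pose proof (exponent_ge1 E d E_simple d_metric rho th a Ca mu rho_met Hth qs Ca_pos mu_nn unb AR F2). lra. }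
  assert (interp : forall p q n', 0 < p < q -> n < n' -> exists C k0, 0 < C /\ forall k e, (k0 <= k)%nat -> 0 < e ->
    Rbar_lt (Ep q k) (Finite e) -> Rbar_le (Ep p k) (Finite (C * (Rpower e (p / q) * Rpower (n' ^ k) (1 - p / q))))).
  { intros p1 q n' Hpq Hn'.
    destruct (energy_interpolate E pi phi K d r f_enum G_inf E_simple E_conn tree part mini d_metric thk r_bd Cg CF Cg_ge CF_pos gd_bd F1 wp Hwp
      Bc Cu Ma Dg a1 ch_bd uf a1_pos adp' deg N1 N2 N p1 q Hpq) as (C & HC & H).
    destruct (Hn n' Hn') as (k0 & Hk0). exists C, k0. split; [assumption|]. intros k e Hk He Hlt.
    apply H; [assumption|apply pow_lt; lra|assumption|apply Hk0; assumption]. }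
  split; [exact (critical_infimum Ep A Ep_nonneg A_witness A_decay A_pos)|].
  unfold dSund, dSbar. rewrite En. split; intros H.
  - destruct (below_critical Ep A n A_witness A_decay n_gt1 interp p Hp H) as (H1 & H2 & H3 & _). auto.
  - exact (above_critical Ep A n A_witness A_decay n_gt1 interp p Hp H).
Qed.
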